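(* Let $X=\mathbb{R}^n\times G$, where $G$ is a countable discrete torsion-free Abelian group. Let $\alpha_j,\beta_j$, $j=1,2,\dots$, be topological automorphisms of $X$, and let $A_j=\alpha_j|_{\mathbb{R}^n}$ and $B_j=\beta_j|_{\mathbb{R}^n}$ be the corresponding invertible real $n\times n$ matrices. Assume that (a) at least one of the sequences $\{A_jB_j^{-1}\}_{j\ge 1}$ or $\{B_jA_j^{-1}\}_{j\ge 1}$ is bounded (in norm); (b) the sequence $\{\|A_jB_j^{-1}\|\cdot\|B_jA_j^{-1}\|\}_{j\ge1}$ is bounded. Let $\xi_j$, $j=1,2,\dots$, be independent random variables taking values in $X$ with distributions $\mu_j$. Assume that: (i) the series $L_1=\sum_{j=1}^\infty\alpha_j\xi_j$ and $L_2=\sum_{j=1}^\infty\beta_j\xi_j$ converge in distribution; (ii) the linear forms $L_1$ and $L_2$ are independent. Then all $\mu_j$ are shifts of Gaussian distributions in $\mathbb{R}^n$, i.e., for each $j$ there are a Gaussian distribution $\gamma_j$ on $\mathbb{R}^n$ (regarded as a distribution on $X$ supported in $\mathbb{R}^n\times\{0\}$) and an element $x_j\in X$ such that $\mu_j=\gamma_j*E_{x_j}$.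
   Context: A topological automorphism of a topological group is a group automorphism that is also a homeomorphism. A distribution is a Borel probability measure. $E_x$ denotes the Dirac mass at $x$, and $*$ denotes convolution. Here $n$ is a nonnegative integer, and $\mathbb{R}^n$ is identified with the subgroup $\mathbb{R}^n\times\{0\}$ of $X$. It is the connected component of zero of $X$, so every topological automorphism $\alpha$ of $X$ maps $\mathbb{R}^n$ onto itself, and $\alpha|_{\mathbb{R}^n}$ is identified with an invertible real $n\times n$ matrix. $\|\cdot\|$ is a norm on the space of real $n\times n$ matrices. Gaussian distributions on $\mathbb{R}^n$ are those with characteristic function $t\mapsto\exp\{i\langle m,t\rangle-\tfrac12\langle Ct,t\rangle\}$, with $m\in\mathbb{R}^n$ and $C$ symmetric positive semidefinite (degenerate ones are included). Convergence: for independent $X$-valued random variables $\eta_j$, the series $\sum_{j=1}^\infty\eta_j$ converges in distribution if there is an $X$-valued random variable $L$ such that the distributions of the partial sums $\sum_{j=1}^N\eta_j$ converge weakly to the distribution of $L$ as $N\to\infty$; one then writes $L=\sum_{j=1}^\infty\eta_j$. For the pair of linear forms, the joint distribution of $(L_1,L_2)$ on $X^2$ is understood to be the weak limit, as $N\to\infty$, of the distributions of the pairs of partial sums $\big(\sum_{j=1}^N\alpha_j\xi_j,\ \sum_{j=1}^N\beta_j\xi_j\big)$; in particular this limit is assumed to exist. Independence of $L_1$ and $L_2$ means that this joint distribution is the product of its marginals. *)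

(* Defs.v *)
From HB Require Import structures.
From mathcomp Require Import all_boot all_order all_algebra.
From mathcomp Require Import complex.
From mathcomp Require Import all_classical all_reals all_analysis.

Set Warnings "-redundant-canonical-projection".
Set Implicit Arguments.
Unset Strict Implicit.
Unset Printing Implicit Defensive.

Import Order.TTheory GRing.Theory Num.Theory.
Import numFieldNormedType.Exports.

Local Open Scope classical_set_scope.
Local Open Scope ring_scope.

(* The group G with its discrete topology. Measurable types of the library are
   pointed, whence the choice of 0, which plays no other role. *)
Definition discrete_group (G : zmodType) : Type := G.

HB.instance Definition _ (G : zmodType) := GRing.Zmodule.on (discrete_group G).
HB.instance Definition _ (G : zmodType) := isPointed.Build (discrete_group G) 0.
HB.instance Definition _ (G : zmodType) :=
  hasNbhs.Build (discrete_group G) principal_filter.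
HB.instance Definition _ (G : zmodType) :=
  Discrete_ofNbhs.Build (discrete_group G) erefl.

(* Joins that the library leaves undeclared for products. *)
HB.instance Definition _ (T U : pnbhsType) := Pointed.on (T * U)%type.
HB.instance Definition _ (T U : ptopologicalType) := Pointed.on (T * U)%type.

Definition torsion_free (G : zmodType) : Prop :=
  forall (g : G) (k : nat), (0 < k)%N -> g *+ k = 0 -> g = 0.

Notation borel T := (g_sigma_algebraType (@open T)).

(* Column vectors, so that a matrix acts on the left. *)
Notation RnG R n G := ('cV[R]_n * discrete_group G)%type.

Section Topological_automorphisms.
Context {R : realType} {n : nat} {G : zmodType}.

Definition top_automorphism (a : RnG R n G -> RnG R n G) : Prop :=
  [/\ {morph a : x y / x + y}, continuous a
    & exists b, [/\ cancel a b, cancel b a & continuous b]].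

(* Column j is the image of the j-th vector of the standard basis: this is the
   matrix of the restriction to R^n * {0}, which a topological automorphism
   maps linearly onto itself. *)
Definition restr_mx (a : RnG R n G -> RnG R n G) : 'M[R]_n :=
  \matrix_(i, j) (a (delta_mx j 0, 0)).1 i 0.

End Topological_automorphisms.

(* Nonnegativity follows from the three conditions. *)
Definition is_mx_norm {R : realType} {n : nat} (N : 'M[R]_n -> R) : Prop :=
  [/\ forall A B, N (A + B) <= N A + N B,
      forall c A, N (c *: A) = `|c| * N A
    & forall A, N A = 0 -> A = 0].

Definition bounded_seq {R : realType} (u : nat -> R) : Prop :=
  exists M : R, forall j, `|u j| <= M.

Section Random_variables.
Context {R : realType}.

(* The measures are plain set functions, so that laws of maps need not come
   with a proof of measurability; only Borel sets matter. *)
Definition weak_cvg {T : ptopologicalType}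
    (mu_ : nat -> set (borel T) -> \bar R) (mu : set (borel T) -> \bar R) : Prop :=
  forall f : T -> R, continuous f -> (exists M : R, forall x, `|f x| <= M) ->
    (\int[mu_ N]_x (f x)%:E @[N --> \oo] --> \int[mu]_x (f x)%:E)%E.

Context {d : measure_display} {Omega : measurableType d} (P : probability Omega R).

Definition cvg_in_law {T : ptopologicalType} (S : nat -> Omega -> T) : Prop :=
  exists (d' : measure_display) (Omega' : measurableType d')
    (P' : probability Omega' R) (L : {RV P' >-> borel T}),
    weak_cvg (fun N => pushforward P (S N : Omega -> borel T)) (distribution P' L).

(* The joint law lam of the limits of S1 and S2 is the weak limit of the laws of
   the pairs, and it is the product of its marginals. *)
Definition independent_limits {T : ptopologicalType}
    (S1 S2 : nat -> Omega -> T) : Prop :=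
  exists lam : probability (borel (T * T)%type) R,
    weak_cvg (fun N => pushforward P
      ((fun w => (S1 N w, S2 N w)) : Omega -> borel (T * T)%type)) lam /\
    forall A B : set (borel T), measurable A -> measurable B ->
      lam (A `*` B) =
        (pushforward lam (fst : borel (T * T)%type -> borel T) A *
         pushforward lam (snd : borel (T * T)%type -> borel T) B)%E.

Definition mutually_independent {d' : measure_display} {T : measurableType d'}
    (xi : nat -> {RV P >-> T}) : Prop :=
  forall (s : seq nat) (B : nat -> set T), uniq s ->
    (forall j, measurable (B j)) ->
    P (\bigcap_(j in [set` s]) (xi j @^-1` B j)) =
      (\prod_(j <- s) P (xi j @^-1` B j))%E.

End Random_variables.

Section Gaussian.
Context {R : realType} {n : nat}.
Local Open Scope complex_scope.

Definition dotmul (x y : 'cV[R]_n) : R := \sum_i x i 0 * y i 0.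

Definition cexp (z : R[i]) : R[i] :=
  (expR (complex.Re z))%:C * (cos (complex.Im z) +i* sin (complex.Im z)).

(* The integral of exp(i<t, x>), taken on real and imaginary parts. *)
Definition char_fun (mu : probability (borel 'cV[R]_n) R) (t : 'cV[R]_n) : R[i] :=
  Rintegral mu setT (fun x => cos (dotmul t x)) +i*
  Rintegral mu setT (fun x => sin (dotmul t x)).

Definition is_gaussian (mu : probability (borel 'cV[R]_n) R) : Prop :=
  exists (m : 'cV[R]_n) (C : 'M[R]_n),
    [/\ C^T = C, forall t, 0 <= dotmul (C *m t) t
      & forall t, char_fun mu t =
          cexp ('i * (dotmul m t)%:C - (2^-1 * dotmul (C *m t) t)%:C)].

End Gaussian.

Section Convolution.
Context {R : realType} {n : nat} {G : zmodType}.
Local Notation X := (RnG R n G).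

Definition convolution (mu nu : set (borel X) -> \bar R) :
    set (borel X) -> \bar R :=
  pushforward (mu \x nu)%E
    ((fun p => (p.1 : X) + (p.2 : X)) : borel X * borel X -> borel X).

Definition embed_Rn (gamma : set (borel 'cV[R]_n) -> \bar R) :
    set (borel X) -> \bar R :=
  pushforward gamma
    ((fun v => (v : 'cV[R]_n, 0 : discrete_group G)) : borel 'cV[R]_n -> borel X).

End Convolution.

(* Main.v *)
(** For a density [w] and a real random variable [p], let [coherence w p] be the
    squared modulus of the characteristic function of [p] at 1 under [w]. As L1
    and L2 are independent limits, the coherences of the summands satisfy
    prod_j f_j (u a_j + v b_j) = F u * K v for additive functionals u and v.

    In the G-component, u and v range over the additive maps G -> R, which separate
    the points as G is torsion-free. The tails of the products are uniformly close
    to 1. Shifting (u, v) along a direction leaving f_j unchanged, successively for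
    the finitely many remaining j, bounds K away from 0; averaging the logarithm of
    the identity over translates of v then gives F = 1. So all these components are
    almost surely constant, and the R^n-component of beta_j xi_j is, up to a
    constant, the image of that of alpha_j xi_j by B_j A_j^-1.

    In the R^n-component, the identity persists, with the same F, after tilting by
    exp (t y), y being a coordinate of L2. When the B_j A_j^-1 are bounded,
    averaging over u bounds the differences of K in v by factorials, uniformly in
    t. Hence E exp ((t + h) y) * E exp ((t - h) y) <= M * (E exp (t y)) ^ 2, so that
    y, and each of its summands, has a moment generating function of growth at most
    exp (C t ^ 2). The elimination argument, for each tilt, shows that the Laplace
    transform of a summand has no zero; by the growth bound its logarithm is then a
    quadratic polynomial, as in the theorems of Marcinkiewicz and Cramer. *)

Require Import Defs.
From HB Require Import structures.
From mathcomp Require Import all_boot all_order all_algebra.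
From mathcomp Require Import complex.
From mathcomp Require Import all_classical all_reals all_analysis.
From mathcomp Require Import measurable_realfun.
From mathcomp Require Import ring lra.

Set Implicit Arguments.
Unset Strict Implicit.
Unset Printing Implicit Defensive.

Import Order.TTheory GRing.Theory Num.Theory.
Import numFieldNormedType.Exports.

Local Open Scope classical_set_scope.
Local Open Scope ring_scope.

(** * Limits and primitives *)

(** Only convergence in law is given: there are no moments and no regularity, and characteristic
    functions may vanish away from 0. Squared moduli are real, at most 1 and blind to additive
    constants, so that logarithms have no branches and the constants left by the G-components
    disappear. Differences in v of the logarithm of the identity do not involve F u, so they may be
    averaged over small u; this supplies the smoothness in v that K is not known to have, and is why
    finite differences stand in for derivatives. A squared modulus is the characteristic function of
    a symmetrised variable y - y', and under the tilt t one has E exp (h (y - y')) = E exp ((t + h)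
    y) * E exp ((t - h) y) / (E exp (t y)) ^ 2, whence the shape of the bound on exponential
    moments. The tilt is a function of L2 and leaves the law of L1 alone, so that all constants come
    from one neighbourhood of 0 on which F >= 1/2, the same for all t. This uniformity carries
    exponential moments from t = 0 to every t by steps of fixed length. *)

Lemma cvgn_norm_le (R : realType) (u : nat -> R) (l B : R) :
  u n @[n --> \oo] --> l -> (forall n, `|u n| <= B) -> `|l| <= B.
Proof.
move=> ul uB; have un : `|u n| @[n --> \oo] --> `|l| by apply: cvg_norm.
rewrite -(cvg_lim (@Rhausdorff R) un); apply: limr_le; last exact: nearW.
by apply/cvg_ex; eexists; exact: un.
Qed.

Lemma cvgn_norm_le_from (R : realType) (u : nat -> R) (l B : R) (N : nat) :
  u n @[n --> \oo] --> l -> (forall n, (N <= n)%N -> `|u n| <= B) -> `|l| <= B.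
Proof.
move=> ul uB; have un : `|u n| @[n --> \oo] --> `|l| by apply: cvg_norm.
rewrite -(cvg_lim (@Rhausdorff R) un); apply: limr_le.
  by apply/cvg_ex; eexists; exact: un.
by exists N => // m /= Nm; exact: uB.
Qed.

Lemma cvgn_le (R : realType) (u : nat -> R) (l b : R) :
  u n @[n --> \oo] --> l -> (forall n, u n <= b) -> l <= b.
Proof.
move=> ul ub; rewrite -(cvg_lim (@Rhausdorff R) ul).
by apply: limr_le; [apply/cvg_ex; eexists; exact: ul|exact: nearW].
Qed.

Lemma cvgn_ge (R : realType) (u : nat -> R) (l b : R) :
  u n @[n --> \oo] --> l -> (forall n, b <= u n) -> b <= l.
Proof.
move=> ul ub; rewrite -(cvg_lim (@Rhausdorff R) ul).
by apply: limr_ge; [apply/cvg_ex; eexists; exact: ul|exact: nearW].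
Qed.

Lemma nonincreasing_cvgn_lim_le (R : realType) (u : nat -> R) (l : R) :
  (forall n, u n.+1 <= u n) -> u n @[n --> \oo] --> l -> forall n, l <= u n.
Proof.
move=> /nonincreasing_seqP nu ul n; rewrite -(cvg_lim (@Rhausdorff R) ul).
by apply: nonincreasing_cvgn_ge => //; apply/cvg_ex; eexists; exact: ul.
Qed.

Lemma nondecreasing_cvgn_lim_ge (R : realType) (u : nat -> R) (l : R) :
  (forall n, u n <= u n.+1) -> u n @[n --> \oo] --> l -> forall n, u n <= l.
Proof.
move=> /nondecreasing_seqP nu ul n; rewrite -(cvg_lim (@Rhausdorff R) ul).
by apply: nondecreasing_cvgn_le => //; apply/cvg_ex; eexists; exact: ul.
Qed.

Lemma bounded_sum_tail (R : realType) (s : nat -> R) (B : R) :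
  (forall j, 0 <= s j) -> (forall N, \sum_(0 <= j < N) s j <= B) ->
  forall e, 0 < e -> exists J, forall N, \sum_(J <= j < N) s j <= e.
Proof.
move=> s0 sB e e0.
have nd : nondecreasing_seq (fun N => \sum_(0 <= j < N) s j).
  by apply/nondecreasing_seqP => N; rewrite big_nat_recr //= lerDl.
have /cvg_ex[l sl] : cvgn (fun N => \sum_(0 <= j < N) s j).
  by apply: (nondecreasing_is_cvgn nd); exists B => _ [N _ <-].
have /cvgrPdist_le/(_ e e0) [J _ hJ] := sl.
exists J => N; have [NJ|JN] := leqP N J; first by rewrite big_geq // ltW.
have := hJ J (leqnn J); rewrite /= => h.
have sN : \sum_(0 <= j < N) s j <= l.
  by apply: (nondecreasing_cvgn_lim_ge _ sl) => m; rewrite big_nat_recr //= lerDl.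
move: h sN; rewrite (big_cat_nat (n := J) _ (ltnW JN)) //= ler_norml => /andP[_]; lra.
Qed.

Lemma is_derive_mvt (R : realType) (f df : R -> R) (a b : R) :
  (forall x : R, is_derive x (1 : R) f (df x)) ->
  exists2 c, Num.min a b <= c <= Num.max a b & f b - f a = df c * (b - a).
Proof.
move=> dfE.
have cf : continuous f.
  by move=> x; apply/differentiable_continuous/derivable1_diffP; case: (dfE x).
have key x y : x <= y -> exists2 c, x <= c <= y & f y - f x = df c * (y - x).
  move=> xy; have [|c] := MVT_segment xy (fun z _ => dfE z).
    exact/continuous_subspaceT.
  by rewrite in_itv /=; exists c.
have [ab|/ltW ba] := leP a b; first exact: key.
have [c cab e] := key b a ba; exists c => //.
by rewrite -opprB e -mulrN opprB.
Qed.

Lemma is_derive_cst0 (R : realType) (f g df : R -> R) (a b : R) :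
  (forall x : R, is_derive x (1 : R) f (df x)) -> (forall x : R, is_derive x (1 : R) g (df x)) ->
  f b - f a = g b - g a.
Proof.
move=> fE gE.
have h x : is_derive x (1 : R) (f \- g) 0.
  by have := is_deriveB (fE x) (gE x); rewrite subrr.
have := is_derive_0_is_cst a b h; rewrite /= => e.
apply/eqP; rewrite -subr_eq0; apply/eqP.
by rewrite (_ : _ - _ = f b - g b - (f a - g a)); [rewrite -e subrr|ring].
Qed.

(** The fundamental theorem needs a left endpoint, so the integrals over [[- n, x]] are used for all
    [n]; normalised to vanish at 0, they agree where several are defined and glue to a primitive on
    the whole line. *)
Lemma primitive_exists (R : realType) (g : R -> R) :
  continuous g -> exists G, forall x : R, is_derive x (1 : R) G (g x).
Proof.
move=> cg.
pose I (n : nat) x := Rintegral lebesgue_measure `[- n%:R, x] g.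
pose H n x := I n x - I n 0.
have dH (n : nat) x : `|x| < n%:R -> is_derive x (1 : R) (H n) (g x).
  rewrite ltr_norml => /andP[nx xn].
  have [] := @continuous_FTC1_closed R g (- n%:R) x n%:R xn _ nx (cg x).
    apply: continuous_compact_integrable; first exact: segment_compact.
    exact: continuous_subspaceT.
  rewrite -/(I n) => d1 d2.
  have dI : is_derive x (1 : R) (I n) (g x).
    by apply: (DeriveDef d1); rewrite -derive1E d2.
  have := is_deriveB dI (is_derive_cst (I n 0) x (1 : R)).
  by rewrite subr0.
have HE m n x : `|x| < m%:R -> `|x| < n%:R -> H m x = H n x.
  move=> xm xn.
  have H0 k : H k 0 = 0 by rewrite /H subrr.
  have key : forall a b : R, a <= b -> (forall y, y \in `[a, b] -> `|y| <= `|x|) ->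
     H m a - H n a = H m b - H n b.
    move=> a b ab abx.
    have dD y : y \in `[a, b] -> is_derive y (1 : R) (H m \- H n) 0.
      move=> /abx yx.
      have := is_deriveB (dH m y (le_lt_trans yx xm)) (dH n y (le_lt_trans yx xn)).
      by rewrite subrr.
    have dDo y : y \in `]a, b[ -> is_derive y (1 : R) (H m \- H n) 0.
      by move=> yab; apply: dD; apply: subset_itv_oo_cc.
    have [|c _] := MVT_segment ab dDo.
      apply: derivable_within_continuous => y yab.
      by have [] := dD y yab.
    by move=> /eqP; rewrite mul0r subr_eq0 => /eqP /= ->.
  have [x0|x0] := leP 0 x.
    have := key 0 x x0; rewrite !H0 subrr => h.
    apply/eqP; rewrite -subr_eq0; apply/eqP; symmetry; apply: h.
    by move=> y; rewrite in_itv /= => /andP[y0 yx]; rewrite !ger0_norm.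
  have := key x 0 (ltW x0); rewrite !H0 subrr => h.
  apply/eqP; rewrite -subr_eq0; apply/eqP; apply: h.
  move=> y; rewrite in_itv /= => /andP[xy y0].
  by rewrite !ler0_norm ?lerN2 // ltW.
pose N (x : R) := (Num.truncn `|x|).+1.
have NP (x : R) : `|x| < (N x)%:R by rewrite truncnS_gt.
exists (fun x => H (N x) x) => x.
apply: (@near_eq_is_derive R R^o R^o (H (N x)) _ x 1); last exact/dH/NP.
have : \forall y \near x, `|y| < (N x)%:R.
  exact: (@cvgr_norm_lt _ R^o _ _ _ id x cvg_id _ (NP x)).
by apply: filterS => y yN; exact: HE.
Qed.

(** Integrals over segments are taken below as increments of this primitive: linearity, changes of
    variable and bounds then follow from the derivative and the mean value theorem. *)
Definition primitive (R : realType) (g : R -> R) : R -> R :=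
  xget 0 [set G | forall x : R, is_derive x (1 : R) G (g x)].

Lemma primitiveP (R : realType) (g : R -> R) :
  continuous g -> forall x : R, is_derive x (1 : R) (primitive g) (g x).
Proof.
move=> /primitive_exists[G GP]; rewrite /primitive.
by case: xgetP => [H -> //|/(_ G)/(_ GP)].
Qed.

Lemma exp_partial_sum_le (R : realType) (m : R) (N : nat) : 0 <= m ->
  \sum_(0 <= k < N) m ^+ k / k`!%:R <= expR m.
Proof.
move=> m0; have nd : nondecreasing_seq (series (exp_coeff m)).
  by apply: nondecreasing_series => k _ _; exact: exp_coeff_ge0.
exact: (nondecreasing_cvgn_le nd (@is_cvg_series_exp_coeff _ m) N).
Qed.

(** * Finite differences and averages *)

Section ForwardDifferences.
Context {R : realType}.
Implicit Types (f g : nat -> R) (a b : nat -> R).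

Definition fdiff f : nat -> R := fun i => f i.+1 - f i.

Definition fdiffn l f : nat -> R := iter l fdiff f.

Lemma fdiffnS l f i : fdiffn l.+1 f i = fdiffn l f i.+1 - fdiffn l f i.
Proof. by []. Qed.

Lemma eq_fdiffn l f g : f =1 g -> fdiffn l f =1 fdiffn l g.
Proof. by move=> /funext ->. Qed.

Lemma fdiffnD l f g i : fdiffn l (f \+ g) i = fdiffn l f i + fdiffn l g i.
Proof. by elim: l i => // l IH i; rewrite !fdiffnS !IH; ring. Qed.

Lemma fdiffnZ l c f i : fdiffn l (fun i => c * f i) i = c * fdiffn l f i.
Proof. by elim: l i => // l IH i; rewrite !fdiffnS !IH; ring. Qed.

Lemma fdiffn_cst l c i : fdiffn l.+1 (fun=> c) i = 0.
Proof. by elim: l i => [|l IH] i; rewrite fdiffnS ?IH /= subrr. Qed.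

Lemma fdiffn_sum l (I : Type) (r : seq I) (P : pred I) (F : I -> nat -> R) i :
  fdiffn l (fun i => \sum_(k <- r | P k) F k i) i =
  \sum_(k <- r | P k) fdiffn l (F k) i.
Proof.
elim: l i => // l IH i.
by rewrite !fdiffnS !IH -sumrB.
Qed.

Lemma fdiffn_cvg l (F : nat -> nat -> R) f i :
  (forall j, (i <= j <= i + l)%N -> F N j @[N --> \oo] --> f j) ->
  fdiffn l (F N) i @[N --> \oo] --> fdiffn l f i.
Proof.
elim: l i => [|l IH] i Ff; first by apply: Ff; rewrite addn0 leqnn.
have -> : (fun N => fdiffn l.+1 (F N) i) =
          (fun N => fdiffn l (F N) i.+1 - fdiffn l (F N) i) by [].
apply: cvgB; apply: IH => j jl; apply: Ff.
  by move: jl; rewrite addSnnS => /andP[/ltnW -> ->].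
by move: jl => /andP[-> /leq_trans]; apply; rewrite leq_add2l.
Qed.

(** Leibniz rule. One factor is shifted by [j], as [f i.+1 * g i.+1 - f i * g i] equals [f i * (g
    i.+1 - g i) + (f i.+1 - f i) * g i.+1]. *)
Lemma fdiffnM l f g i : fdiffn l (f \* g) i =
  \sum_(j < l.+1) 'C(l, j)%:R * (fdiffn j f i * fdiffn (l - j) g (i + j)%N).
Proof.
elim: l i => [|l IH] i.
  by rewrite big_ord_recl big_ord0 /= addr0 bin0 mul1r addn0.
rewrite fdiffnS !IH -sumrB.
pose A j := fdiffn j f i * fdiffn (l.+1 - j) g (i + j)%N.
transitivity (\sum_(j < l.+1) ('C(l, j)%:R * A j + 'C(l, j)%:R * A j.+1)).
  apply: eq_bigr => -[j /= jl] _; rewrite /A subSS subSn // !fdiffnS.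
  by rewrite addSn addnS; ring.
rewrite big_split /=.
transitivity (\sum_(j < l.+2) 'C(l.+1, j)%:R * A j); last by [].
rewrite [in RHS]big_ord_recl /= bin0.
under [in RHS]eq_bigr do rewrite /bump /= add1n binS natrD mulrDl.
rewrite [in RHS]big_split /= addrA; congr (_ + _).
rewrite big_ord_recl /= bin0 [in RHS]big_ord_recr /= bin_small // mul0r addr0.
by congr (_ + _); apply: eq_bigr => j _; rewrite /bump /= add1n.
Qed.

(* The weighted masses of these bounds are submultiplicative under products of
   functions, which gives factorial bounds on the differences of [expR \o f]. *)
Definition diff_bounded M f a :=
  forall l i, (l + i <= M)%N -> `|fdiffn l f i| <= l`!%:R * a l.

Definition cauchy_prod a b : nat -> R :=
  fun l => \sum_(j < l.+1) a j * b (l - j)%N.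

Definition diff_mass M (rho : R) a := \sum_(l < M.+1) rho ^+ l * a l.

(** The binomial coefficients of the Leibniz rule are absorbed by ['C(l, j) * j! * (l - j)! = l!],
    so that the bounds multiply like power series. *)
Lemma diff_boundedM M f g a b :
  diff_bounded M f a -> diff_bounded M g b -> diff_bounded M (f \* g) (cauchy_prod a b).
Proof.
move=> fa gb l i li; rewrite fdiffnM.
apply: (le_trans (ler_norm_sum _ _ _)); rewrite mulr_sumr.
apply: ler_sum => -[j /= jl] _.
have jl' : (j <= l)%N by [].
rewrite normrM normr_nat normrM -(bin_fact jl') !natrM.
have -> : 'C(l, j)%:R * (j`!%:R * (l - j)`!%:R) * (a j * b (l - j)%N) =
   'C(l, j)%:R * (j`!%:R * a j * ((l - j)`!%:R * b (l - j)%N)) by ring.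
apply: ler_wpM2l => //; apply: ler_pM => //.
  by apply: fa; apply: leq_trans li; rewrite leq_add2r.
by apply: gb; rewrite addnC -addnA subnKC // addnC.
Qed.

Lemma cauchy_prod_ge0 a b : (forall l, 0 <= a l) -> (forall l, 0 <= b l) ->
  forall l, 0 <= cauchy_prod a b l.
Proof. by move=> a0 b0 l; apply: sumr_ge0 => j _; apply: mulr_ge0. Qed.

(** [diff_mass] is the l1 norm, truncated at degree [M], of a power series at radius [rho];
    truncation only drops nonnegative terms of the product. *)
Lemma diff_massM M rho a b : 0 <= rho -> (forall l, 0 <= a l) ->
  (forall l, 0 <= b l) ->
  diff_mass M rho (cauchy_prod a b) <= diff_mass M rho a * diff_mass M rho b.
Proof.
move=> rho0 a0 b0; rewrite /diff_mass mulr_suml.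
pose F (j k : nat) := rho ^+ j * a j * (rho ^+ k * b k).
have F0 j k : 0 <= F j k by rewrite !mulr_ge0 ?exprn_ge0.
rewrite [X in _ <= X](_ : _ = \sum_(j < M.+1) \sum_(k < M.+1) F j k); last first.
  by apply: eq_bigr => j _; rewrite mulr_sumr.
have -> : \sum_(l < M.+1) rho ^+ l * cauchy_prod a b l =
  \sum_(l < M.+1) \sum_(j < M.+1 | (j <= l)%N) F j (l - j)%N.
  apply: eq_bigr => -[l /= lM] _; rewrite mulr_sumr.
  rewrite (big_ord_widen _ (fun j => rho ^+ l * (a j * b (l - j)%N)) lM).
  apply: eq_big => [j|j jl]; first by rewrite ltnS.
  by rewrite /F -{1}(subnKC (jl : (j <= l)%N)) exprD; ring.
rewrite (exchange_big_dep xpredT) //=; apply: ler_sum => j _.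
rewrite -(big_mkord (fun l => (j <= l)%N) (fun l => F j (l - j)%N)).
rewrite -(big_mkord xpredT (fun k => F j k)).
rewrite (big_cat_nat _ (n := j)) //=; last by rewrite ltnW.
rewrite big_nat_cond big_pred0 ?add0r; last first.
  by move=> l; apply/negbTE/negP => /andP[/andP[_ lj]]; rewrite leqNgt lj.
rewrite -{1}(add0n (j : nat)) big_addn.
rewrite [X in X <= _]big_mkcond /=.
rewrite [X in _ <= X](big_cat_nat _ (n := (M.+1 - j)%N)) //=; last exact: leq_subr.
rewrite -[X in X <= _]addr0; apply: lerD; last by apply: sumr_ge0.
by apply: ler_sum => k _; rewrite leq_addl addnK.
Qed.

(** In the exponential series the power [f ^ k] has mass at most [m ^ k], where [m] is the mass of
    [f]; a single coefficient of it is at most [rho ^- l * m ^ k], as in Cauchy's estimate, and the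
    sum over [k] is an exponential again. *)
Lemma diff_bounded_exp M (rho : R) f a : 0 < rho -> (forall l, 0 <= a l) ->
  diff_bounded M f a ->
  forall l i, (l + i <= M)%N ->
  `|fdiffn l (fun i => expR (f i)) i| <= l`!%:R * (rho ^- l * expR (diff_mass M rho a)).
Proof.
move=> rho0 a0 fa.
set m := diff_mass M rho a.
have m0 : 0 <= m by apply: sumr_ge0 => l _; rewrite mulr_ge0 // exprn_ge0 // ltW.
have pw k : exists b, [/\ forall l, 0 <= b l, diff_bounded M (fun i => f i ^+ k) b
    & diff_mass M rho b <= m ^+ k].
  elim: k => [|k [b [b0 fb bm]]].
    exists (fun l => (l == 0%N)%:R); split=> //.
    - case=> [|l] i _; first by rewrite /= expr0 normr1 mulr1.
      by rewrite (@eq_fdiffn _ _ (fun=> 1)) ?fdiffn_cst ?normr0 ?mulr0 // => ?; rewrite expr0.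
    - rewrite /diff_mass big_ord_recl /= expr0 mul1r big1 ?addr0 ?expr0 //.
      by move=> j _; rewrite mulr0.
  exists (cauchy_prod a b); split; first exact: cauchy_prod_ge0.
    rewrite (_ : (fun i => _) = f \* (fun i => f i ^+ k)); last first.
      by apply/funext => i; rewrite exprS.
    exact: diff_boundedM.
  rewrite exprS; apply: le_trans (diff_massM _ _ a0 b0) _; first exact: ltW.
  exact: ler_wpM2l.
have pw1 k l i : (l + i <= M)%N ->
    `|fdiffn l (fun i => f i ^+ k) i| <= l`!%:R * (rho ^- l * m ^+ k).
  move=> li; have [b [b0 fb bm]] := pw k.
  apply: le_trans (fb l i li) _; apply: ler_wpM2l => //.
  rewrite mulrC ler_pdivlMr ?exprn_gt0 // mulrC; apply: le_trans bm.
  have lM : (l < M.+1)%N by rewrite ltnS (leq_trans _ li) ?leq_addr.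
  rewrite /diff_mass (bigD1 (Ordinal lM)) //= lerDl.
  by apply: sumr_ge0 => j _; rewrite mulr_ge0 // exprn_ge0 // ltW.
move=> l i li.
have c1 : fdiffn l (fun i => series (exp_coeff (f i)) N) i @[N --> \oo] -->
    fdiffn l (fun i => expR (f i)) i.
  by apply: fdiffn_cvg => j _; exact: (is_cvg_series_exp_coeff (f j)).
apply: (cvgn_norm_le c1) => N.
rewrite [X in fdiffn _ X](_ : _ = (fun i => \sum_(0 <= k < N) (k`!%:R^-1 * f i ^+ k))); last first.
  apply/funext => j; rewrite /series /=; apply: eq_bigr => k _.
  by rewrite /exp_coeff /= mulrC.
rewrite fdiffn_sum; apply: (le_trans (ler_norm_sum _ _ _)).
apply: (@le_trans _ _ (\sum_(0 <= k < N) l`!%:R * (rho ^- l * (m ^+ k / k`!%:R)))).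
  apply: ler_sum => k _; rewrite fdiffnZ normrM ger0_norm ?invr_ge0 //.
  rewrite (_ : l`!%:R * _ = k`!%:R^-1 * (l`!%:R * (rho ^- l * m ^+ k))); last by ring.
  by apply: ler_wpM2l; rewrite ?invr_ge0 //; exact: pw1.
rewrite -mulr_sumr -mulr_sumr; apply: ler_wpM2l => //; apply: ler_wpM2l.
  by rewrite invr_ge0 exprn_ge0 // ltW.
exact: exp_partial_sum_le.
Qed.

End ForwardDifferences.

(** * Averages along segments *)

Section Averages.
Context {R : realType} {V : lmodType R}.
Variable small : R -> V -> Prop.
Hypothesis smallZ : forall (v : V) (e : R), 0 < e ->
  exists2 d : R, 0 < d & forall r : R, `|r| <= d -> small e (r *: v).
Hypothesis small_le : forall (d d' : R) y, d <= d' -> small d y -> small d' y.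
Implicit Types (phi psi : V -> R) (v w x y : V).

(** No topology on [V] is assumed: [small d] stands for the neighbourhoods of 0, and is later
    [box d]. *)
Definition unif_cont phi := forall e : R, 0 < e ->
  exists2 d : R, 0 < d & forall x y, small d y -> `|phi (x + y) - phi x| <= e.

Definition shift_diff y phi : V -> R := fun x => phi (x + y) - phi x.

Definition ray phi x v : R -> R := fun r => phi (x + r *: v).

(** The mean of [phi] over the segment from [x] to [x + v]. *)
Definition avg v phi : V -> R :=
  fun x => primitive (ray phi x v) 1 - primitive (ray phi x v) 0.

Lemma unif_cont_ray phi x v : unif_cont phi -> continuous (ray phi x v).
Proof.
move=> uc r; apply/cvgrPdist_le => e e0.
have [d d0 hd] := uc e e0; have [d' d'0 hd'] := smallZ v d0.
apply/nbhs_ballP; exists d' => //= t /ltW rt; rewrite distrC /ray.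
have -> : x + t *: v = x + r *: v + (t - r) *: v.
  by rewrite -addrA -scalerDl (addrC r) subrK.
by apply: hd; apply: hd'; rewrite distrC.
Qed.

Lemma avgE v phi x G : unif_cont phi ->
  (forall r : R, is_derive r (1 : R) G (ray phi x v r)) -> avg v phi x = G 1 - G 0.
Proof.
move=> uc GP; apply: (is_derive_cst0 0 1 (df := ray phi x v)) => //.
exact/primitiveP/unif_cont_ray.
Qed.

Lemma avg_close v phi x (q tau : R) : unif_cont phi ->
  (forall r, 0 <= r <= 1 -> `|phi (x + r *: v) - q| <= tau) ->
  `|avg v phi x - q| <= tau.
Proof.
move=> uc h.
have [c] := is_derive_mvt 0 1 (primitiveP (unif_cont_ray (x := x) (v := v) uc)).
rewrite min_l // max_r // subr0 mulr1 -/(avg v phi x) => c01 ->.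
exact: h.
Qed.

Lemma avg_bound v phi b x : unif_cont phi -> (forall x, `|phi x| <= b) ->
  `|avg v phi x| <= b.
Proof.
move=> uc pb; rewrite -[avg _ _ _]subr0; apply: avg_close => // r _.
by rewrite subr0.
Qed.

Lemma unif_contD phi psi : unif_cont phi -> unif_cont psi ->
  unif_cont (phi \+ psi).
Proof.
move=> u1 u2 e e0.
have e20 : 0 < e / 2 by rewrite divr_gt0.
have [d d0 hd] := u1 _ e20; have [d' d'0 hd'] := u2 _ e20.
exists (Num.min d d'); first by rewrite lt_min d0.
move=> x y sy /=; have -> : phi (x + y) + psi (x + y) - (phi x + psi x) =
   (phi (x + y) - phi x) + (psi (x + y) - psi x) by ring.
apply: (le_trans (ler_normD _ _)); rewrite [e]splitr; apply: lerD.
  by apply: hd; apply: small_le sy; rewrite ge_min lexx.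
by apply: hd'; apply: small_le sy; rewrite ge_min lexx orbT.
Qed.
Lemma unif_contZ c phi : unif_cont phi -> unif_cont (fun x => c * phi x).
Proof.
move=> u e e0; have c0 : 0 < `|c| + 1 by rewrite ltr_pwDr.
have [d d0 hd] := u (e / (`|c| + 1)) (divr_gt0 e0 c0); exists d => // x y /hd h.
rewrite -mulrBr normrM; apply: (@le_trans _ _ ((`|c| + 1) * (e / (`|c| + 1)))).
  by apply: ler_pM => //; rewrite lerDl.
by rewrite mulrC divfK // gt_eqF.
Qed.

Lemma unif_cont0 : unif_cont (fun=> 0).
Proof. by move=> e e0; exists 1 => // x y _; rewrite subrr normr0 ltW. Qed.

Lemma unif_cont_sum (I : Type) (r : seq I) (F : I -> V -> R) :
  (forall k, unif_cont (F k)) -> unif_cont (fun x => \sum_(k <- r) F k x).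
Proof.
move=> uF; elim: r => [|k r IH].
  by rewrite (_ : (fun x => _) = fun=> 0); [exact: unif_cont0|apply/funext => x; rewrite big_nil].
rewrite (_ : (fun x => _) = F k \+ (fun x => \sum_(k <- r) F k x)); first exact: unif_contD.
by apply/funext => x; rewrite big_cons.
Qed.

Lemma avgD v phi psi x : unif_cont phi -> unif_cont psi ->
  avg v (phi \+ psi) x = avg v phi x + avg v psi x.
Proof.
move=> u1 u2; have u3 := unif_contD u1 u2.
have h (r : R) : is_derive r (1 : R) (primitive (ray phi x v) \+ primitive (ray psi x v))
    (ray (phi \+ psi) x v r).
  by apply: is_deriveD; apply: primitiveP; exact: unif_cont_ray.
by rewrite (avgE u3 h) /avg /=; ring.
Qed.

Lemma avgZ v phi c x : unif_cont phi ->
  avg v (fun x => c * phi x) x = c * avg v phi x.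
Proof.
move=> u1; have u2 := unif_contZ c u1.
have h (r : R) : is_derive r (1 : R) (fun r => c * primitive (ray phi x v) r)
    (ray (fun x => c * phi x) x v r).
  exact: (is_deriveZ c (primitiveP (unif_cont_ray (x := x) (v := v) u1) r)).
by rewrite (avgE u2 h) /avg mulrBr.
Qed.

Lemma unif_cont_avg v phi : unif_cont phi -> unif_cont (avg v phi).
Proof.
move=> uc e e0; have [d d0 hd] := uc e e0; exists d => // x y sy.
have uct : unif_cont (fun z => phi (z + y)).
  move=> e' e'0; have [d' d'0 hd'] := uc e' e'0; exists d' => // z t st.
  by rewrite addrAC; exact: hd'.
have -> : avg v phi (x + y) = avg v (fun z => phi (z + y)) x.
  rewrite /avg (_ : ray phi (x + y) v = ray (fun z => phi (z + y)) x v) //.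
  by apply/funext => r; rewrite /ray addrAC.
have uc' : unif_cont (fun x => -1 * phi x) by exact: unif_contZ.
rewrite -mulN1r -avgZ // -avgD //.
rewrite -[avg _ _ _]subr0; apply: avg_close; first exact: unif_contD.
by move=> r _; rewrite subr0 /= mulN1r; exact: hd.
Qed.

Lemma unif_cont_shift_diff y phi : unif_cont phi -> unif_cont (shift_diff y phi).
Proof.
move=> uc; rewrite (_ : shift_diff y phi = (fun z => phi (z + y)) \+ (fun z => -1 * phi z)).
  apply: unif_contD; last exact: unif_contZ.
  move=> e' e'0; have [d' d'0 hd'] := uc e' e'0; exists d' => // z t st.
  by rewrite addrAC; exact: hd'.
by apply/funext => z; rewrite /shift_diff /= mulN1r.
Qed.

Lemma avg_shift_diff v y phi : unif_cont phi ->
  avg v (shift_diff y phi) = shift_diff y (avg v phi).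
Proof.
move=> uc; apply/funext => x.
have uct : unif_cont (fun z => phi (z + y)).
  move=> e' e'0; have [d' d'0 hd'] := uc e' e'0; exists d' => // z t st.
  by rewrite addrAC; exact: hd'.
have -> : shift_diff y (avg v phi) x = avg v (fun z => phi (z + y)) x + -1 * avg v phi x.
  rewrite /shift_diff mulN1r; congr (_ - _).
  rewrite /avg (_ : ray phi (x + y) v = ray (fun z => phi (z + y)) x v) //.
  by apply/funext => r; rewrite /ray addrAC.
rewrite -avgZ // -avgD //; last exact: unif_contZ.
by congr avg; apply/funext => z; rewrite /shift_diff /= mulN1r.
Qed.

(** Averaging replaces differentiability: shifting a segment along itself changes the integral only
    through its two ends, each a piece of length [|s|]. Only the bound [b] on [phi] enters the
    estimate, not its modulus of continuity. *)
Lemma shift_diff_avg_bound v s b phi x : unif_cont phi -> (forall x, `|phi x| <= b) ->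
  `|shift_diff (s *: v) (avg v phi) x| <= 2 * `|s| * b.
Proof.
move=> uc pb; set g := ray phi x v.
have Gg := primitiveP (unif_cont_ray (x := x) (v := v) uc).
set G := primitive _ in Gg.
have h (r : R) : is_derive r (1 : R) (fun r => G (s + r)) (ray phi (x + s *: v) v r).
  rewrite (_ : ray _ _ _ _ = ray phi x v (s + r)); last first.
    by rewrite /ray scalerDl addrA.
  have h1 : is_derive r (1 : R) (fun r : R => s + r) 1.
    by rewrite -[X in is_derive _ _ _ X]add0r; apply: is_deriveD.
  have := @is_derive1_comp _ G (fun r : R => s + r) r _ _ (Gg (s + r)) h1.
  by rewrite mulr1.
rewrite /shift_diff (avgE uc h) /avg -/G.
have -> : G (s + 1) - G (s + 0) - (G 1 - G 0) = (G (s + 1) - G 1) - (G (s + 0) - G 0) by ring.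
have key a c : `|G a - G c| <= b * `|a - c|.
  have [z _ ->] := is_derive_mvt c a Gg; rewrite normrM ler_wpM2r //; exact: pb.
apply: (le_trans (ler_normB _ _)).
apply: (le_trans (lerD (key _ _) (key _ _))).
by rewrite addrK addr0 subr0 le_eqVlt; apply/orP; left; apply/eqP; ring.
Qed.

Definition avgs (vs : seq V) phi : V -> R := foldr avg phi vs.

Lemma unif_cont_avgs vs phi : unif_cont phi -> unif_cont (avgs vs phi).
Proof. by move=> uc; elim: vs => //= v vs; exact: unif_cont_avg. Qed.

Lemma avgs_bound vs phi b x : unif_cont phi -> (forall x, `|phi x| <= b) ->
  `|avgs vs phi x| <= b.
Proof.
move=> uc pb; elim: vs x => //= v vs IH x.
by apply: avg_bound => //; exact: unif_cont_avgs.
Qed.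

Lemma avgs_translate vs phi x y :
  avgs vs (fun z => phi (z + y)) x = avgs vs phi (x + y).
Proof.
elim: vs x => //= v vs IH x; rewrite /avg.
rewrite (_ : ray (avgs vs _) x v = ray (avgs vs phi) (x + y) v) //.
by apply/funext => r; rewrite /ray IH addrAC.
Qed.

Lemma avgs_cat vs ws phi : avgs (vs ++ ws) phi = avgs vs (avgs ws phi).
Proof. by rewrite /avgs foldr_cat. Qed.

(** The set of shifts [u] over which [avgs vs phi x] averages [phi (x + u)]. *)
Fixpoint zonotope (vs : seq V) (u : V) : Prop :=
  if vs is v :: ws then
    exists r u', [/\ 0 <= r <= 1, u = r *: v + u' & zonotope ws u']
  else u = 0.

Lemma avgs_close vs phi x (q tau : R) : unif_cont phi ->
  (forall u, zonotope vs u -> `|phi (x + u) - q| <= tau) ->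
  `|avgs vs phi x - q| <= tau.
Proof.
move=> uc; elim: vs x => [|v vs IH] x h /=; first by rewrite -[x]addr0; exact: h.
apply: avg_close; first exact: unif_cont_avgs.
move=> r r01; apply: IH => u zu; rewrite -addrA; apply: h.
by exists r, u.
Qed.

Lemma avgs_shift_diff vs y phi : unif_cont phi ->
  avgs vs (shift_diff y phi) = shift_diff y (avgs vs phi).
Proof.
move=> uc; elim: vs => //= v vs ->.
by rewrite avg_shift_diff //; exact: unif_cont_avgs.
Qed.

Lemma avgs_sum vs (I : Type) (r : seq I) (F : I -> V -> R) x :
  (forall k, unif_cont (F k)) ->
  avgs vs (fun x => \sum_(k <- r) F k x) x = \sum_(k <- r) avgs vs (F k) x.
Proof.
move=> uF; elim: vs x => //= v vs IH x.
rewrite (_ : avgs vs _ = (fun x => \sum_(k <- r) avgs vs (F k) x)); last exact/funext.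
have uA k : unif_cont (avgs vs (F k)) by exact: unif_cont_avgs.
elim: r {IH} => [|k r IHr].
  rewrite big_nil (_ : (fun x => _) = fun x => 0 * 0); last first.
    by apply/funext => z; rewrite big_nil mulr0.
  by rewrite (avgZ v 0 x unif_cont0) mul0r.
rewrite big_cons -IHr -avgD //; last exact: unif_cont_sum.
by congr avg; apply/funext => z; rewrite big_cons.
Qed.

Lemma unif_cont_shift_diffn m y phi :
  unif_cont phi -> unif_cont (iter m (shift_diff y) phi).
Proof. by move=> uc; elim: m => //= m; exact: unif_cont_shift_diff. Qed.

Lemma shift_diff_avgs_bound vs v s b phi x : v \in vs -> unif_cont phi ->
  (forall x, `|phi x| <= b) ->
  `|shift_diff (s *: v) (avgs vs phi) x| <= 2 * `|s| * b.
Proof.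
move=> + uc pb; elim: vs x => //= w vs IH x; rewrite in_cons.
case: eqP => [-> _|_ /= vvs].
  apply: shift_diff_avg_bound; first exact: unif_cont_avgs.
  by move=> z; exact: avgs_bound.
have uA := unif_cont_avgs vs uc.
rewrite -avg_shift_diff //; apply: avg_bound; first exact: unif_cont_shift_diff.
by move=> z; exact: IH.
Qed.

Lemma shift_diff_sum_avgs_bound (I : Type) (r : seq I) vs (w : I -> V) (s : I -> R) b phi x :
  (forall k, w k \in vs) -> unif_cont phi -> (forall x, `|phi x| <= b) ->
  `|shift_diff (\sum_(k <- r) s k *: w k) (avgs vs phi) x| <=
    (2 * \sum_(k <- r) `|s k|) * b.
Proof.
move=> wvs uc pb; elim: r x => [|k r IH] x.
  by rewrite !big_nil /shift_diff addr0 subrr normr0 mulr0 mul0r.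
rewrite !big_cons.
have -> : shift_diff (s k *: w k + \sum_(j <- r) s j *: w j) (avgs vs phi) x =
  shift_diff (s k *: w k) (avgs vs phi) (x + \sum_(j <- r) s j *: w j) +
  shift_diff (\sum_(j <- r) s j *: w j) (avgs vs phi) x.
  by rewrite /shift_diff -!addrA [in RHS](addrC (\sum_(_ <- _) _)) addrA; ring.
rewrite mulrDr mulrDl; apply: (le_trans (ler_normD _ _)); apply: lerD => //.
exact: shift_diff_avgs_bound.
Qed.

(** Each of the [m] differences is charged to its own copy of [vs], since differences commute with
    averages. In return the support of the average grows with [m], so that a support of fixed size
    forces vectors of length of order [1 / m]. *)
Lemma shift_diffn_avgs_bound vs y kap m b phi x : 0 <= kap ->
  (forall phi b x, unif_cont phi -> (forall x, `|phi x| <= b) ->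
    `|shift_diff y (avgs vs phi) x| <= kap * b) ->
  unif_cont phi -> (forall x, `|phi x| <= b) ->
  `|iter m (shift_diff y) (avgs (flatten (nseq m vs)) phi) x| <= kap ^+ m * b.
Proof.
move=> kap0 hk uc pb; elim: m x => [|m IH] x; first by rewrite /= expr0 mul1r.
have uA := unif_cont_avgs (flatten (nseq m vs)) uc.
rewrite /= avgs_cat.
have -> : iter m (shift_diff y) (avgs vs (avgs (flatten (nseq m vs)) phi)) =
  avgs vs (iter m (shift_diff y) (avgs (flatten (nseq m vs)) phi)).
  elim: {IH} m (avgs _ _) uA => //= k IHk psi up.
  by rewrite IHk // avgs_shift_diff //; exact: unif_cont_shift_diffn.
by rewrite exprS -mulrA; apply: hk => //; exact: unif_cont_shift_diffn.
Qed.

Lemma shift_diffn_bound m y b phi x : (forall x, `|phi x| <= b) ->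
  `|iter m (shift_diff y) phi x| <= 2 ^+ m * b.
Proof.
move=> pb; elim: m x => [|m IH] x; first by rewrite expr0 mul1r.
rewrite /= {1}/shift_diff; apply: (le_trans (ler_normB _ _)).
by rewrite exprS -mulrA mulrDl mul1r; apply: lerD.
Qed.

Lemma avgs_iter_shift_diff m vs y phi : unif_cont phi ->
  avgs vs (iter m (shift_diff y) phi) = iter m (shift_diff y) (avgs vs phi).
Proof.
move=> uc; elim: m => //= m <-.
by rewrite avgs_shift_diff //; exact: unif_cont_shift_diffn.
Qed.

Lemma zonotope_coord (f : V -> R) vs u : (forall x y, f (x + y) = f x + f y) ->
  (forall r x, f (r *: x) = r * f x) -> zonotope vs u ->
  `|f u| <= \sum_(v <- vs) `|f v|.
Proof.
move=> fD fZ; elim: vs u => [|v vs IH] u /=.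
  by move=> ->; rewrite big_nil -(scale0r 0) fZ mul0r normr0.
move=> [r [u' [/andP[r0 r1] -> /IH h]]]; rewrite big_cons fD fZ.
apply: (le_trans (ler_normD _ _)); apply: lerD => //.
by rewrite normrM ger0_norm // ler_piMl.
Qed.

Lemma iter_shift_diff m y phi x i :
  fdiffn m (fun i => phi (x + i%:R *: y)) i = iter m (shift_diff y) phi (x + i%:R *: y).
Proof.
elim: m i => // m IH i; rewrite fdiffnS !IH /= /shift_diff; congr (_ - _).
by rewrite -natr1 scalerDl scale1r addrA.
Qed.
End Averages.

Definition box {R : realType} {n : nat} (d : R) (x : 'cV[R]_n) : Prop :=
  forall i, `|x i 0| <= d.

Lemma box_le {R : realType} {n : nat} (d d' : R) (x : 'cV[R]_n) :
  d <= d' -> box d x -> box d' x.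
Proof. by move=> dd' bx i; apply: le_trans dd'; exact: bx. Qed.

Lemma boxD {R : realType} {n : nat} (d d' : R) (x y : 'cV[R]_n) :
  box d x -> box d' y -> box (d + d') (x + y).
Proof.
by move=> bx by' i; rewrite mxE; apply: (le_trans (ler_normD _ _)); exact: lerD.
Qed.

Lemma boxZ {R : realType} {n : nat} (d r : R) (x : 'cV[R]_n) :
  box d x -> box (`|r| * d) (r *: x).
Proof. by move=> bx i; rewrite mxE normrM; apply: ler_wpM2l. Qed.

Lemma boxZ_small {R : realType} {n : nat} (v : 'cV[R]_n) (e : R) : 0 < e ->
  exists2 d : R, 0 < d & forall r : R, `|r| <= d -> box e (r *: v).
Proof.
move=> e0; pose B := \sum_i `|v i 0| + 1.
have B0 : 0 < B by rewrite ltr_pwDr // sumr_ge0.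
exists (e / B); first by rewrite divr_gt0.
move=> r re i; rewrite mxE normrM -[leRHS](@divfK _ B _ e) ?gt_eqF //.
apply: ler_pM => //; rewrite /B (bigD1 i) //= -addrA lerDl.
by rewrite addr_ge0 // sumr_ge0.
Qed.

(** * Products of defect functions *)

Section DefectFunctions.
Context {R : realType} {n : nat}.
Local Notation V := 'cV[R]_n.
Implicit Types (phi : V -> R).

(* The properties of [1 - |f|^2] for a characteristic function [f]. *)
Record defect phi : Prop := Defect {
  defect0 : phi 0 = 0;
  defect_ge0 : forall x, 0 <= phi x;
  defect_le1 : forall x, phi x <= 1;
  defectN : forall x, phi (- x) = phi x;
  defectD : forall x y, phi (x + y) <= 2 * phi x + 2 * phi y;
  defect_diff : forall x y e, 0 < e -> `|phi (x + y) - phi x| <= e + phi y / e;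
  defect_cont : forall e : R, 0 < e ->
    exists2 d : R, 0 < d & forall y, box d y -> phi y <= e }.

Lemma defect_unif_cont phi : defect phi -> unif_cont box phi.
Proof.
move=> dp e e0; have e20 : 0 < e / 2 by rewrite divr_gt0.
have [d d0 hd] := defect_cont dp (mulr_gt0 e20 e20); exists d => // x y /hd py.
apply: (le_trans (defect_diff dp x y e20)); rewrite [leRHS]splitr lerD2l.
by rewrite ler_pdivrMr.
Qed.

Lemma defect_sum phi (I : Type) (r : seq I) (F : I -> V) : defect phi ->
  phi (\sum_(k <- r) F k) <= 2 ^+ size r * \sum_(k <- r) phi (F k).
Proof.
move=> dp; elim: r => [|k r IH]; first by rewrite !big_nil (defect0 dp) mulr0.
rewrite !big_cons /= exprS mulrDr; apply: (le_trans (defectD dp _ _)).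
have p1 : 1 <= 2 ^+ size r :> R by rewrite exprn_ege1 // ler1n.
have q0 := defect_ge0 dp (F k).
rewrite -mulrA lerD //; last by rewrite -mulrA ler_pM2l.
by rewrite ler_pM2l // ler_peMl.
Qed.

Lemma defect_double phi l x : defect phi -> phi (2 ^+ l *: x) <= 4 ^+ l * phi x.
Proof.
move=> dp; elim: l => [|l IH]; first by rewrite !expr0 scale1r mul1r.
have -> : 2 ^+ l.+1 *: x = 2 ^+ l *: x + 2 ^+ l *: x.
  by rewrite -scalerDl exprS mulrDl mul1r.
apply: (le_trans (defectD dp _ _)); rewrite exprS -mulrA; move: IH; lra.
Qed.

(** Integrate [phi (r v) <= 2 phi (s v) + 2 phi ((r - s) v)] over [s] in [0, 1]. The first integral
    is the average; in the second, [r - s] stays in [-1, 1], where evenness gives at most twice the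
    average. A supremum is thus bounded by an average, and averages can be summed over a family. *)
Lemma defect_ray_avg phi v r : defect phi -> 0 <= r <= 1 ->
  phi (r *: v) <= 6 * avg v phi 0.
Proof.
move=> dp /andP[r0 r1].
have uc := defect_unif_cont dp.
have cr := unif_cont_ray boxZ_small (x := 0) (v := v) uc.
have Gg := primitiveP cr; rewrite /avg; set G := primitive _ in Gg *.
have rayE s : ray phi 0 v s = phi (s *: v) by rewrite /ray add0r.
have mono a b : a <= b -> G a <= G b.
  move=> ab; rewrite -subr_ge0; have [c _ ->] := is_derive_mvt a b Gg.
  by rewrite mulr_ge0 ?subr_ge0 // rayE defect_ge0.
have odd : G 0 - G (- 1) = G 1 - G 0.
  have h (s : R) : is_derive s (1 : R) (fun s => - G (- s)) (ray phi 0 v s).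
    have h1 : is_derive s (1 : R) (fun s : R => - s) (- 1) by apply: is_deriveN.
    have h2 := @is_derive1_comp _ G (fun r : R => - r) s _ _ (Gg (- s)) h1.
    have := is_deriveN h2; rewrite mulrN1 opprK !rayE scaleNr defectN //.
  have := is_derive_cst0 0 1 h Gg; rewrite oppr0; lra.
(* The derivative of [H] is the slack of that inequality, so that [H] is nondecreasing. *)
pose H (s : R) := 2 * (G s - G 0) - 2 * (G (r - s) - G r) - s * phi (r *: v).
have dH (s : R) : is_derive s (1 : R) H
    (2 * phi (s *: v) + 2 * phi ((r - s) *: v) - phi (r *: v)).
  have h1 : is_derive s (1 : R) (fun s : R => r - s) (- 1).
    by rewrite -[X in is_derive _ _ _ X]add0r; apply: is_deriveB.
  have h2 := @is_derive1_comp _ G (fun s : R => r - s) s _ _ (Gg (r - s)) h1.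
  have h3 := is_deriveZ 2 (is_deriveB (Gg s) (is_derive_cst (G 0) s (1 : R))).
  have h4 := is_deriveZ 2 (is_deriveB h2 (is_derive_cst (G r) s (1 : R))).
  have h5 := is_deriveM (is_derive_id s (1 : R)) (is_derive_cst (phi (r *: v)) s (1 : R)).
  have h6 := is_deriveB (is_deriveB h3 h4) h5.
  apply: is_derive_eq h6 _.
  rewrite !rayE scaler0 add0r scaler1 !subr0 /GRing.scale /= mulrN1; ring.
have [c _] := is_derive_mvt 0 1 dH.
rewrite subr0 mulr1 => e.
have : 0 <= H 1 - H 0.
  rewrite e subr_ge0; have {1}-> : r *: v = c *: v + (r - c) *: v.
    by rewrite -scalerDl addrC subrK.
  exact: defectD.
have := mono _ _ r1; have : G (- 1) <= G (r - 1) by apply: mono; lra.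
rewrite /H subr0; lra.
Qed.

End DefectFunctions.

Lemma minr_lipschitz (R : realType) (a b q e : R) :
  `|a - b| <= e -> `|Num.min a q - Num.min b q| <= e.
Proof.
rewrite !ler_norml => /andP[h1 h2].
by case: (leP a q) => ?; case: (leP b q) => ?; apply/andP; split; lra.
Qed.

Lemma sum_flatten_nseq (R : realType) (T : Type) (f : T -> R) l vs :
  \sum_(v <- flatten (nseq l vs)) f v = l%:R * \sum_(v <- vs) f v.
Proof.
elim: l => [|l IH]; first by rewrite big_nil mul0r.
by rewrite /= big_cat /= IH -natr1 mulrDl mul1r addrC.
Qed.

(** * Factorial bounds on the differences of the factor k *)

Section Smoothing.
Context {R : realType} {n : nat}.
Local Notation V := 'cV[R]_n.
Variables (phi : nat -> V -> R) (c : nat -> V) (F : V -> R) (k : R -> R).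
Variables K delta : R.
Hypothesis dphi : forall j, defect (phi j).
Hypotheses (K0 : 0 < K) (delta0 : 0 < delta).
Hypothesis c_le : forall j, box K (c j).
Hypothesis F_ge : forall u, box delta u -> 1 / 2 <= F u.
Hypothesis k0 : k 0 = 1.
Hypothesis prod_cvg : forall u s,
  \prod_(j < N) (1 - phi j (u + s *: c j)) @[N --> \oo] --> F u * k s.

Let prod_dec u s N : F u * k s <= \prod_(j < N) (1 - phi j (u + s *: c j)).
Proof.
pose p N := \prod_(j < N) (1 - phi j (u + s *: c j)).
have dp m : p m.+1 <= p m.
  rewrite /p big_ord_recr /= ler_piMr //.
    by apply: prodr_ge0 => j _; rewrite subr_ge0 (defect_le1 (dphi j)).
  by rewrite gerBl (defect_ge0 (dphi m)).
exact: (nonincreasing_cvgn_lim_le dp (@prod_cvg u s) N).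
Qed.

(** From [1 - x <= exp (- x)]: the partial products at [s = 0] stay above [F u >= 1 / 2], and
    [exp S <= 2] excludes [S > 1]. *)
Let sum_box u N : box delta u -> \sum_(0 <= j < N) phi j u <= 1.
Proof.
move=> bu; have := prod_dec u 0 N; rewrite k0 mulr1.
under eq_bigr do rewrite scale0r addr0.
move=> h; have {h} : 1 / 2 <= expR (- \sum_(j < N) phi j u).
  apply: le_trans (F_ge bu) (le_trans h _); rewrite -sumrN expR_sum.
  apply: ler_prod => j _; rewrite subr_ge0 (defect_le1 (dphi j)) /=.
  exact: expR_ge1Dx.
rewrite big_mkord; set S := \sum_(j < N) _ => h.
rewrite leNgt; apply/negP => S1.
have := expR_ge1Dx S; have : expR S <= 2.
  rewrite -[S]opprK expRN -[2]invrK lef_pV2 ?posrE ?expR_gt0 ?invr_gt0 //; lra.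
lra.
Qed.

Let e_ (i : 'I_n) : V := delta *: delta_mx i 0.

(** A bound for [phi j] on the box of size [delta] that remains summable over [j]: suprema need not
    add up, but averages do. *)
Let sj j := 2 ^+ n * \sum_i 6 * avg (e_ i) (phi j) 0.

Let uphi j : unif_cont box (phi j).
Proof. exact: defect_unif_cont. Qed.

Let le_sj j x : box delta x -> phi j x <= sj j.
Proof.
move=> bx.
have -> : x = \sum_i (x i 0 / delta) *: e_ i.
  apply/matrixP => i u; rewrite ord1 summxE (bigD1 i) //= big1 ?addr0.
    by rewrite /e_ !mxE !eqxx /= mulr1 divfK // gt_eqF.
  by move=> l li; rewrite /e_ !mxE eq_sym (negbTE li) /= !mulr0.
have := @defect_sum _ _ (phi j) _ (index_enum 'I_n) (fun i => (x i 0 / delta) *: e_ i) (dphi j).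
have -> : size (index_enum 'I_n) = n by rewrite -[RHS](size_enum_ord n) enumT; congr size; rewrite unlock.
move=> h; apply: (le_trans h); rewrite /sj ler_pM2l ?exprn_gt0 //.
apply: ler_sum => i _.
have r01 : 0 <= `|x i 0| / delta <= 1.
  apply/andP; split; first exact: divr_ge0 (normr_ge0 _) (ltW delta0).
  by rewrite ler_pdivrMr // mul1r; exact: bx.
apply: le_trans (defect_ray_avg (e_ i) (dphi j) r01).
have [p|p] := leP 0 (x i 0); first by rewrite ger0_norm.
by rewrite ltr0_norm // mulNr scaleNr (defectN (dphi j)).
Qed.

Let sj_ge0 j : 0 <= sj j.
Proof.
apply: le_trans (le_sj j (x := 0) _); first by rewrite (defect0 (dphi j)).
by move=> i; rewrite mxE normr0 ltW.
Qed.

Let S0 : R := 2 ^+ n * (6 * n%:R).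

Let sum_sj N : \sum_(0 <= j < N) sj j <= S0.
Proof.
rewrite /sj /S0 -mulr_sumr ler_pM2l ?exprn_gt0 // exchange_big /=.
apply: (@le_trans _ _ (\sum_(i < n) 6)); last first.
  by rewrite sumr_const card_ord mulr_natr.
apply: ler_sum => i _; rewrite -mulr_sumr -[leRHS]mulr1 ler_pM2l //.
rewrite -(@avgs_sum R V box boxZ_small (@box_le R n) [:: e_ i] nat (index_iota 0 N) phi 0 uphi) /=.
set T := fun x => _.
have uT : unif_cont box T by apply: unif_cont_sum uphi; exact: box_le.
(* Being within 1/2 of 1/2 encodes lying between 0 and 1. *)
have := @avg_close _ _ _ boxZ_small (e_ i) T 0 (1 / 2) (1 / 2) uT.
have h r : 0 <= r <= 1 -> `|T (0 + r *: e_ i) - 1 / 2| <= 1 / 2.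
  move=> /andP[r0 r1]; rewrite add0r ler_norml /T.
  have : \sum_(0 <= j < N) phi j (r *: e_ i) <= 1.
    apply: sum_box => l; rewrite /e_ !mxE normrM normrM ger0_norm // (ger0_norm (ltW delta0)).
    apply: (@le_trans _ _ (1 * (delta * 1))); last by rewrite mul1r mulr1.
    have d1 := ltW delta0; apply: ler_pM => //; first by rewrite mulr_ge0.
    by apply: ler_pM => //; case: (_ && _); rewrite ?normr1 ?normr0.
  have : 0 <= \sum_(0 <= j < N) phi j (r *: e_ i).
    by apply: sumr_ge0 => j _; exact: (defect_ge0 (dphi j)).
  by move=> a b; apply/andP; split; lra.
by move=> /(_ h); rewrite ler_norml => /andP[_]; lra.
Qed.

(** The truncation makes [Psi j] bounded and uniformly continuous on the whole space, as averaging
    requires, without changing [- ln (1 - phi j)] on the box of size [delta]; the level [sj j] makes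
    the bounds summable. *)
Let tj j x := Num.min (phi j x) (Num.min (1 / 2) (sj j)).
Let Psi j x := - ln (1 - tj j x).

Let tj_ge0 j x : 0 <= tj j x.
Proof. by rewrite !le_min (defect_ge0 (dphi j)) sj_ge0 /= andbT divr_ge0. Qed.

Let tj_half j x : tj j x <= 1 / 2.
Proof. by rewrite !ge_min lexx /= orbT. Qed.

Let ln_inv_le (a : R) : 0 < a -> - ln a <= (1 - a) / a.
Proof.
move=> a0; have := @le_ln1Dx R ((1 - a) / a).
have -> : 1 + (1 - a) / a = a^-1 by field; rewrite gt_eqF.
rewrite lnV ?posrE //; apply.
rewrite ltr_pdivlMr // ; lra.
Qed.

Let Psi_bound j x : 0 <= Psi j x <= 2 * sj j.
Proof.
have t0 := tj_ge0 j x; have t1 := tj_half j x.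
have ts : tj j x <= sj j by rewrite !ge_min lexx /= !orbT.
have p : 0 < 1 - tj j x by lra.
apply/andP; split.
  by rewrite /Psi oppr_ge0 ln_le0 //; lra.
apply: (le_trans (ln_inv_le p)); rewrite ler_pdivrMr //.
have : 0 <= sj j * (1 - 2 * tj j x) by rewrite mulr_ge0 ?sj_ge0 //; lra.
nra.
Qed.

Let Psi_le j x : `|Psi j x| <= 2 * sj j.
Proof. by have /andP[p ?] := Psi_bound j x; rewrite ger0_norm. Qed.

Let uPsi j : unif_cont box (Psi j).
Proof.
move=> e e0; have e20 : 0 < e / 2 by rewrite divr_gt0.
have [d d0 hd] := uphi j e20; exists d => // x y /(hd x) h.
have key (a b : R) : 0 <= a <= 1 / 2 -> 0 <= b <= 1 / 2 ->
    - ln (1 - a) - (- ln (1 - b)) <= 2 * `|a - b|.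
  move=> /andP[a0 a1] /andP[b0 b1].
  have pa : 0 < 1 - a by lra.
  have pb : 0 < 1 - b by lra.
  have -> : - ln (1 - a) - - ln (1 - b) = - ln ((1 - a) / (1 - b)).
    by rewrite ln_div ?posrE //; ring.
  apply: (le_trans (ln_inv_le (divr_gt0 pa pb))).
  have -> : (1 - (1 - a) / (1 - b)) / ((1 - a) / (1 - b)) = (a - b) / (1 - a).
    by field; rewrite !gt_eqF.
  rewrite ler_pdivrMr //; have := ler_norm (a - b).
  have : 0 <= `|a - b| by []. nra.
have tt : `|tj j (x + y) - tj j x| <= e / 2.
  exact: minr_lipschitz.
have b1 : 0 <= tj j (x + y) <= 1 / 2 by rewrite tj_ge0 tj_half.
have b2 : 0 <= tj j x <= 1 / 2 by rewrite tj_ge0 tj_half.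
have := key _ _ b1 b2; have := key _ _ b2 b1; rewrite distrC => k1 k2.
by rewrite ler_norml /Psi; apply/andP; split; lra.
Qed.

Let Psi_box j x : box delta x -> phi j x <= 1 / 2 -> Psi j x = - ln (1 - phi j x).
Proof. by move=> bx h; rewrite /Psi /tj min_l // le_min h le_sj. Qed.

Let phi_half j x : box delta x -> phi j x <= 1 / 2.
Proof.
move=> bx; have := prod_dec x 0 j.+1; rewrite k0 mulr1 big_ord_recr /= scale0r addr0.
have := F_ge bx => Fh h.
have : (\prod_(i < j) (1 - phi i (x + 0 *: c i))) * (1 - phi j x) <= 1 - phi j x.
  apply: ler_piMl; first by rewrite subr_ge0 (defect_le1 (dphi j)).
  apply: prodr_ile1 => i _.
  by rewrite subr_ge0 (defect_le1 (dphi i)) gerBl (defect_ge0 (dphi i)).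
lra.
Qed.

Let box_sum u s j : box (delta / 2) u -> `|s| * K <= delta / 2 -> box delta (u + s *: c j).
Proof.
move=> bu sK; rewrite (splitr delta); apply: boxD => //.
by apply: box_le sK _; exact: boxZ.
Qed.

Let Psi_prod u s N : box (delta / 2) u -> `|s| * K <= delta / 2 ->
  \prod_(j < N) (1 - phi j (u + s *: c j)) = expR (- \sum_(0 <= j < N) Psi j (u + s *: c j)).
Proof.
move=> bu sK; rewrite -sumrN expR_sum big_mkord; apply: eq_bigr => j _.
have b := box_sum j bu sK; have h := phi_half j b.
by rewrite Psi_box // opprK lnK // posrE; lra.
Qed.

Let L := 2 * S0.

Let sum_Psi_le N (x : nat -> V) : \sum_(0 <= j < N) Psi j (x j) <= L.
Proof.
apply: (@le_trans _ _ (\sum_(0 <= j < N) 2 * sj j)).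
  by apply: ler_sum => j _; case/andP: (Psi_bound j (x j)).
by rewrite -mulr_sumr ler_pM2l.
Qed.

Let Fk_ge u s : box (delta / 2) u -> `|s| * K <= delta / 2 -> expR (- L) <= F u * k s.
Proof.
move=> bu sK; apply: (cvgn_ge (@prod_cvg u s)) => N.
by rewrite Psi_prod // ler_expR lerN2 sum_Psi_le.
Qed.

Lemma F01 : F 0 = 1.
Proof.
have := @prod_cvg 0 0; rewrite k0 mulr1.
under eq_fun do under eq_bigr do rewrite scale0r addr0 (defect0 (dphi _)) subr0.
under eq_fun do rewrite big1_eq.
by move/(cvg_lim (@Rhausdorff R)) => <-; rewrite lim_cst.
Qed.

Let box0 : box (delta / 2) (0 : V).
Proof. by move=> i; rewrite mxE normr0 divr_ge0 // ltW. Qed.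

Lemma k_bounds s : `|s| * K <= delta / 2 -> expR (- L) <= k s <= 1.
Proof.
move=> sK; have := Fk_ge box0 sK; rewrite F01 mul1r => -> /=.
have := @prod_cvg 0 s; rewrite F01 mul1r => h.
apply: (cvgn_le h) => N; apply: prodr_ile1 => i _.
by rewrite subr_ge0 (defect_le1 (dphi i)) gerBl (defect_ge0 (dphi i)).
Qed.

Let Psi_cvg u s : box (delta / 2) u -> `|s| * K <= delta / 2 ->
  \sum_(0 <= j < N) Psi j (u + s *: c j) @[N --> \oo] --> - ln (F u * k s).
Proof.
move=> bu sK.
have P0 : 0 < F u * k s by apply: lt_le_trans (Fk_ge bu sK); exact: expR_gt0.
have -> : (fun N => \sum_(0 <= j < N) Psi j (u + s *: c j)) =
   (fun N => - ln (\prod_(j < N) (1 - phi j (u + s *: c j)))).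
  by apply/funext => N; rewrite Psi_prod // expRK opprK.
apply: cvgN; apply: continuous_cvg; first exact: continuous_ln.
exact: prod_cvg.
Qed.

(** Summability on the box of size [delta] passes to any larger box by doubling, at the cost of a
    factor [4 ^ l]. *)
Lemma defect_tail l (e : R) : 0 < e -> exists J, forall N (x : nat -> V),
  (forall j, box (2 ^+ l * delta) (x j)) -> \sum_(J <= j < N) phi j (x j) <= e.
Proof.
move=> e0; have p4 : 0 < 4 ^+ l :> R by rewrite exprn_gt0.
have p2 : 0 < 2 ^+ l :> R by rewrite exprn_gt0.
have [J hJ] := bounded_sum_tail sj_ge0 sum_sj (divr_gt0 e0 p4).
exists J => N x bx; apply: (@le_trans _ _ (\sum_(J <= j < N) 4 ^+ l * sj j)); last first.
  by rewrite -mulr_sumr mulrC -ler_pdivlMr.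
apply: ler_sum => j _.
have -> : x j = 2 ^+ l *: ((2 ^+ l)^-1 *: x j).
  by rewrite scalerA divff ?scale1r // gt_eqF.
apply: (le_trans (defect_double _ _ (dphi j))); rewrite ler_pM2l //; apply: le_sj => i.
rewrite mxE normrM gtr0_norm ?invr_gt0 // mulrC ler_pdivrMr // mulrC; exact: bx.
Qed.

Section FixedStep.
Variables (h : R) (m0 : nat).
Hypotheses (h0 : 0 < h) (m0h : m0%:R * h * K <= delta / 2).

(** The nodes are centred at 0, so that the difference of order [m0.*2] at index 0 is a central
    difference at [s = 0]. *)
Let s_ (i : nat) : R := (i%:R - m0%:R) * h.

Let s_le i : (i <= m0.*2)%N -> `|s_ i| * K <= delta / 2.
Proof.
move=> im; apply: le_trans m0h; rewrite ler_pM2r // normrM (gtr0_norm h0) ler_pM2r //.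
have : i%:R <= m0.*2%:R :> R by rewrite ler_nat.
rewrite -addnn natrD => i2; have : 0 <= i%:R :> R by [].
by rewrite ler_norml => i1; apply/andP; split; lra.
Qed.

Let T l i N (u : V) :=
  \sum_(0 <= j < N) iter l (shift_diff (h *: c j)) (Psi j) (u + s_ i *: c j).

Let TE l i N u : T l i N u =
  fdiffn l (fun i => \sum_(0 <= j < N) Psi j (u + s_ i *: c j)) i.
Proof.
rewrite fdiffn_sum; apply: eq_bigr => j _.
have sE i' : u + s_ i' *: c j = (u - (m0%:R * h) *: c j) + i'%:R *: (h *: c j).
  by rewrite /s_ mulrBl scalerBl scalerA addrA addrAC.
rewrite (@eq_fdiffn _ _ _ (fun i => Psi j ((u - (m0%:R * h) *: c j) + i%:R *: (h *: c j)))).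
  by rewrite iter_shift_diff sE.
by move=> i' /=; rewrite sE.
Qed.

Let Q i := - ln (k (s_ i)).

(** For [l > 0] the difference in [s] kills [- ln (F u)]: the limit does not depend on [u], whereas
    its approximations do and can be averaged over [u]. *)
Let T_cvg l i u : (0 < l)%N -> (l + i <= m0.*2)%N -> box (delta / 2) u ->
  T l i N u @[N --> \oo] --> fdiffn l Q i.
Proof.
move=> l0 li bu; have Fu : 0 < F u.
  apply: (@lt_le_trans _ _ (1 / 2)); first by lra.
  by apply/F_ge/(box_le _ bu); have := delta0; lra.
under eq_fun do rewrite TE.
have -> : fdiffn l Q i = fdiffn l ((fun=> - ln (F u)) \+ Q) i.
  by case: l l0 {li} => // l _; rewrite fdiffnD fdiffn_cst add0r.
apply: fdiffn_cvg => j /andP[_ jl] /=.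
have sj2 : `|s_ j| * K <= delta / 2 by apply: s_le; apply: leq_trans li; rewrite addnC.
have /andP[kj _] := k_bounds sj2.
rewrite /Q -opprD -lnM ?posrE //; first exact: Psi_cvg.
by apply: lt_le_trans kj; exact: expR_gt0.
Qed.

Let T_tail l (e : R) : 0 < e -> exists N0, forall i u, (0 < l)%N ->
  (l + i <= m0.*2)%N -> box (delta / 2) u -> `|T l i N0 u - fdiffn l Q i| <= e.
Proof.
move=> e0; have p0 : 0 < 2 ^+ l * 2 :> R by rewrite mulr_gt0 ?exprn_gt0.
have [N0 hN0] := bounded_sum_tail sj_ge0 sum_sj (divr_gt0 e0 p0).
exists N0 => i u l0 li bu; rewrite distrC.
have c1 : (T l i N u - T l i N0 u) @[N --> \oo] --> fdiffn l Q i - T l i N0 u.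
  by apply: cvgB; [exact: T_cvg|exact: cvg_cst].
apply: (cvgn_norm_le_from (N := N0) c1) => N N0N.
rewrite /T (big_cat_nat (n := N0) _ N0N) //= addrAC subrr add0r.
apply: (le_trans (ler_norm_sum _ _ _)).
apply: (@le_trans _ _ (\sum_(N0 <= j < N) (2 ^+ l * 2) * sj j)).
  by apply: ler_sum => j _; rewrite -mulrA; exact: shift_diffn_bound.
by rewrite -mulr_sumr mulrC -ler_pdivlMr.
Qed.

(** The limit is close to the average over [u] of a finite sum [T]. There, each difference in the
    direction [h *: c j] gains a factor from one copy of the vectors of length [eta], and the bounds
    [2 * sj j] add up to at most [L]. *)
Let fdiff_Q_le l i : (0 < l)%N -> (l + i <= m0.*2)%N ->
  `|fdiffn l Q i| <= (2 * (n%:R * (h * K / (delta / (2 * l%:R))))) ^+ l * L.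
Proof.
(* With [l] copies of the vectors, the shifts reach [l * eta = delta / 2] in each coordinate. *)
move=> l0 li; set eta := delta / (2 * l%:R).
have l0' : 0 < l%:R :> R by rewrite ltr0n.
have eta0 : 0 < eta by rewrite divr_gt0 // mulr_gt0.
set kap := 2 * _.
have kap0 : 0 <= kap by rewrite /kap !mulr_ge0 // ?invr_ge0 ?ltW.
pose vs : seq V := [seq eta *: delta_mx a 0 | a <- enum 'I_n].
pose ws := flatten (nseq l vs).
apply/ler_addgt0Pr => e e0; have [N0 hN0] := T_tail l e0.
have uT : unif_cont box (T l i N0).
  apply: unif_cont_sum; first exact: box_le.
  move=> j e' e'0; have [d d0 hd] := unif_cont_shift_diffn (@box_le R n) l (h *: c j) (uPsi j) e'0.
  by exists d => // x y /hd; rewrite (addrAC x y); exact.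
have zb u : zonotope ws u -> box (delta / 2) u.
  move=> zu a.
  have fD (x y : V) : (x + y) a 0 = x a 0 + y a 0 by rewrite mxE.
  have fZ r (x : V) : (r *: x) a 0 = r * x a 0 by rewrite mxE.
  have := zonotope_coord (f := fun x : V => x a 0) fD fZ zu; move=> /le_trans; apply.
  have -> : \sum_(v <- ws) `|v a 0| = l%:R * \sum_(v <- vs) `|v a 0|.
    exact: sum_flatten_nseq.
  rewrite big_map big_enum /= (bigD1 a) //= big1 ?addr0.
    rewrite !mxE !eqxx /= mulr1 gtr0_norm // /eta le_eqVlt; apply/orP; left; apply/eqP.
    by field; rewrite gt_eqF.
  by move=> b ba; rewrite !mxE eq_sym (negbTE ba) /= mulr0 normr0.
have cl : `|avgs ws (T l i N0) 0 - fdiffn l Q i| <= e.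
  apply: (avgs_close boxZ_small) => //; first exact: box_le.
  by move=> u zu; rewrite add0r; apply: hN0 => //; exact: zb.
have bd : `|avgs ws (T l i N0) 0| <= kap ^+ l * L.
  rewrite /T (avgs_sum boxZ_small); last 2 first.
  - exact: box_le.
  - move=> j e' e'0; have [d d0 hd] := unif_cont_shift_diffn (@box_le R n) l (h *: c j) (uPsi j) e'0.
    by exists d => // x y /hd; rewrite (addrAC x y); exact.
  apply: (le_trans (ler_norm_sum _ _ _)).
  apply: (@le_trans _ _ (\sum_(0 <= j < N0) (kap ^+ l * (2 * sj j)))); last first.
    rewrite -mulr_sumr ler_wpM2l ?exprn_ge0 // -mulr_sumr.
    by rewrite ler_pM2l.
  apply: ler_sum => j _.
  rewrite avgs_translate (avgs_iter_shift_diff boxZ_small (@box_le R n)) //.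
  apply: (shift_diffn_avgs_bound boxZ_small (@box_le R n)) => //.
  move=> f b x uf fb.
  have -> : h *: c j = \sum_(a <- enum 'I_n) (h * c j a 0 / eta) *: (eta *: delta_mx a 0).
    apply/matrixP => a z; rewrite ord1 summxE big_enum /= (bigD1 a) //= big1 ?addr0.
      by rewrite !mxE !eqxx /= mulr1 divfK // gt_eqF.
    by move=> b' ba; rewrite !mxE eq_sym (negbTE ba) /= !mulr0.
  have b0 : 0 <= b by apply: le_trans (fb 0).
  have mem (a : 'I_n) : eta *: delta_mx a 0 \in vs.
    by apply/mapP; exists a => //; rewrite mem_enum.
  apply: le_trans (@shift_diff_sum_avgs_bound R V box boxZ_small (@box_le R n) _
    (enum 'I_n) vs _ (fun a => h * c j a 0 / eta) b f x mem uf fb) _.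
  apply: ler_wpM2r => //; rewrite ler_pM2l // big_enum /=.
  apply: (@le_trans _ _ (\sum_(a < n) h * K / eta)).
    apply: ler_sum => a _; rewrite normrM normrM (gtr0_norm h0) (@gtr0_norm _ eta^-1) ?invr_gt0 //.
    by rewrite ler_pM2r ?invr_gt0 // ler_pM2l //; exact: c_le.
  by rewrite sumr_const card_ord -[leLHS]mulr_natl.
rewrite -[fdiffn l Q i](subKr (avgs ws (T l i N0) 0)); apply: (le_trans (ler_normB _ _)).
exact: lerD.
Qed.

(** The factor [l ^ l] due to the length [eta] is at most [l! * e ^ l], whence [expR 1]. The factor
    [n.+1] keeps [A] positive for [n = 0]. *)
Let A : R := 4 * n.+1%:R * K * expR 1 * h / delta.

Let A_gt0 : 0 < A.
Proof. by rewrite /A divr_gt0 // !mulr_gt0 // expR_gt0. Qed.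

Let diff_bounded_Q : diff_bounded m0.*2 (fun i => ln (k (s_ i))) (fun l => (L + 1) * A ^+ l).
Proof.
move=> l i li.
have -> : fdiffn l (fun i => ln (k (s_ i))) i = - fdiffn l Q i.
  rewrite -mulN1r -fdiffnZ; apply: eq_fdiffn => j.
  by rewrite /Q mulN1r opprK.
rewrite normrN; have [l0|l0] := posnP l.
  rewrite l0 /= fact0 mul1r expr0 mulr1.
  have /k_bounds/andP[k1 k2] : `|s_ i| * K <= delta / 2.
    by apply: s_le; move: li; rewrite l0 add0n.
  have kp : 0 < k (s_ i) by apply: lt_le_trans k1; exact: expR_gt0.
  apply: (@le_trans _ _ L); last by rewrite lerDl.
  rewrite ger0_norm /Q ?oppr_ge0 ?ln_le0 //.
  by rewrite lerNl -[X in X <= _]expRK ler_ln // posrE // expR_gt0.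
apply: (le_trans (fdiff_Q_le l0 li)).
have l0' : 0 < l%:R :> R by rewrite ltr0n.
have -> : 2 * (n%:R * (h * K / (delta / (2 * l%:R)))) = l%:R * (4 * n%:R * K * h / delta).
  by field; rewrite !gt_eqF.
have L0 : 0 <= L by rewrite /L /S0 !mulr_ge0.
have K0' := ltW K0; have h0' := ltW h0; have d0' := ltW delta0.
rewrite exprMn (_ : _ * ((L + 1) * _) = l`!%:R * A ^+ l * (L + 1)); last by ring.
apply: (ler_pM _ L0).
- by rewrite mulr_ge0 // exprn_ge0 // divr_ge0 // !mulr_ge0.
- have -> : A ^+ l = expR 1 ^+ l * (4 * n.+1%:R * K * h / delta) ^+ l.
    by rewrite -exprMn; congr (_ ^+ _); rewrite /A; field; rewrite gt_eqF.
  set Y := 4 * n%:R * K * h / delta; rewrite mulrA; apply: ler_pM; rewrite ?exprn_ge0 //.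
  + by rewrite divr_ge0 // !mulr_ge0.
  + rewrite -expRM_natl mulr1 mulrC -ler_pdivrMr ?ltr0n ?fact_gt0 //.
    apply: le_trans (exp_partial_sum_le l.+1 (ltW l0')).
    by rewrite big_nat_recr //= lerDr sumr_ge0 // => a _; rewrite divr_ge0 // exprn_ge0.
  + apply: lerXn2r; rewrite ?nnegrE ?divr_ge0 // ?mulr_ge0 //.
    rewrite ler_pM2r ?invr_gt0 // ler_pM2r // ler_pM2r // ler_pM2l // ler_nat.
    exact: leqnSn.
- by rewrite lerDl.
Qed.

(** The bounds for [ln (k s)] pass to [k] by the exponential estimate at radius [1 / (2 A)], where
    the mass is a geometric series of ratio 1/2. *)
Lemma fdiffn_k_le : `|fdiffn m0.*2 (fun i => k ((i%:R - m0%:R) * h)) 0| <=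
  (m0.*2)`!%:R * ((2 * A) ^+ m0.*2 * expR (2 * (L + 1))).
Proof.
have L0 : 0 <= L by rewrite /L /S0 !mulr_ge0.
have rho0 : 0 < (2 * A)^-1 by rewrite invr_gt0 mulr_gt0.
have a0 l : 0 <= (L + 1) * A ^+ l by rewrite mulr_ge0 ?exprn_ge0 ?addr_ge0 // ltW.
have E := diff_bounded_exp rho0 a0 diff_bounded_Q.
have EE l i : (l + i <= m0.*2)%N ->
    fdiffn l (fun i => expR (ln (k (s_ i)))) i = fdiffn l (fun i => k (s_ i)) i.
  elim: l i => [|l IH] i li.
    have /k_bounds/andP[k1 k2] : `|s_ i| * K <= delta / 2 by apply: s_le.
    rewrite /= lnK // posrE; apply: lt_le_trans k1; exact: expR_gt0.
  by rewrite !fdiffnS !IH ?addnS //; exact: ltnW.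
have := E m0.*2 0%N; rewrite EE addn0 // => /(_ (leqnn _)) /le_trans; apply.
apply: ler_wpM2l => //; rewrite exprVn invrK; apply: ler_wpM2l.
  by rewrite exprn_ge0 // mulr_ge0 // ltW.
rewrite ler_expR /diff_mass.
rewrite (eq_bigr (fun l : 'I_m0.*2.+1 => (L + 1) * (1 / 2) ^+ l)); last first.
  move=> l _; rewrite mulrCA -exprMn; congr (_ * _ ^+ _).
  by field; rewrite gt_eqF.
rewrite -mulr_sumr mulrC; apply: ler_wpM2r; first by rewrite addr_ge0.
have -> : \sum_(i < m0.*2.+1) (1 / 2) ^+ i = 2 - 2 * (1 / 2) ^+ m0.*2.+1 :> R.
  elim: (m0.*2.+1) => [|p IH]; first by rewrite big_ord0 expr0; ring.
  by rewrite big_ord_recr /= IH exprS; field.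
by rewrite lerBlDr lerDl mulr_ge0 // exprn_ge0 // divr_ge0.
Qed.

End FixedStep.
End Smoothing.

(** * Elimination of factors *)

Section Elimination.
Context {R : realType} {W : zmodType}.
Implicit Types (E : W -> R) (w u : W) (ds : seq W).

(* The product of [E] over [w] plus the subset sums of [ds], split by parity of
   the cardinality of the subset. *)
Fixpoint parity_prods ds E w : R * R :=
  if ds is d :: ds' then
    ((parity_prods ds' E w).1 * (parity_prods ds' E (w + d)).2,
     (parity_prods ds' E w).2 * (parity_prods ds' E (w + d)).1)
  else (E w, 1).

(** [k] counts the terms: it records how far a shift moves along the arithmetic progressions used
    below. *)
Fixpoint subset_sum ds (k : nat) u : Prop :=
  if ds is d :: ds' then subset_sum ds' k u \/
    (exists k' u', [/\ k = k'.+1, u = d + u' & subset_sum ds' k' u'])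
  else k = 0%N /\ u = 0.

Lemma parity_prodsM ds (I : Type) (r : seq I) (e : I -> W -> R) w :
  parity_prods ds (fun w => \prod_(j <- r) e j w) w =
  (\prod_(j <- r) (parity_prods ds (e j) w).1, \prod_(j <- r) (parity_prods ds (e j) w).2).
Proof.
elim: ds w => [|d ds IH] w /=; first by rewrite big1_eq.
by rewrite !IH /= -!big_split.
Qed.

Lemma parity_prods_period ds E d w : (forall w, E (w + d) = E w) ->
  parity_prods ds E (w + d) = parity_prods ds E w.
Proof.
move=> Ed; elim: ds w => [|d' ds IH] w /=; first by rewrite Ed.
by rewrite IH addrAC IH.
Qed.

(** Adding or removing [d] matches the subsets of even cardinality with those of odd cardinality and
    preserves the value of [E]. *)
Lemma parity_prods_eq ds E d w : d \in ds -> (forall w, E (w + d) = E w) ->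
  (parity_prods ds E w).1 = (parity_prods ds E w).2.
Proof.
move=> + Ed; elim: ds w => //= d' ds IH w; rewrite in_cons => /orP[/eqP <-|dds].
  by rewrite parity_prods_period // mulrC.
by rewrite !IH //.
Qed.

(** The empty subset is even, so the first product has [E w] among its factors. *)
Lemma parity_prods_bounds ds E w : (forall w, 0 <= E w <= 1) ->
  (0 <= (parity_prods ds E w).1 <= E w) && (0 <= (parity_prods ds E w).2 <= 1).
Proof.
move=> E01; elim: ds w => [|d ds IH] w /=.
  by have /andP[-> _] := E01 w; rewrite !lexx ler01.
have /andP[/andP[a1 a2] /andP[a3 a4]] := IH w.
have /andP[/andP[b1 b2] /andP[b3 b4]] := IH (w + d).
have /andP[e1 e2] := E01 (w + d).
rewrite !mulr_ge0 //=; apply/andP; split.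
  by apply: le_trans a2; rewrite ler_piMr.
by rewrite mulr_ile1 // (le_trans b2).
Qed.

Lemma parity_prods_ge ds E w (a : R) : 0 <= a <= 1 ->
  (forall k u, subset_sum ds k u -> a <= E (w + u)) ->
  a ^+ (2 ^ size ds) <= (parity_prods ds E w).1 /\
  a ^+ (2 ^ size ds) <= (parity_prods ds E w).2.
Proof.
move=> a01; have /andP[a0 a1] := a01.
elim: ds w => [|d ds IH] w h /=.
  by split; [rewrite expn0 expr1 -[w]addr0; exact: (h 0%N)|rewrite expn0 expr1].
have [|h1 h2] := IH w _; first by move=> k u s; apply: (h k); left.
have [|h3 h4] := IH (w + d) _.
  by move=> k u s; rewrite -addrA; apply: (h k.+1); right; exists k, u.
by rewrite expnS mul2n -addnn exprD; split; apply: ler_pM; rewrite ?exprn_ge0.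
Qed.

(** Odd subsets are nonempty: the value of [E] at [w] itself does not enter. There are at most
    [2 ^ size ds] factors. *)
Lemma parity_prods_odd_ge ds E w (a : R) : 0 <= a <= 1 ->
  (forall k u, subset_sum ds k.+1 u -> a <= E (w + u)) ->
  a ^+ (2 ^ size ds) <= (parity_prods ds E w).2.
Proof.
move=> a01; have /andP[a0 a1] := a01.
elim: ds w => [|d ds IH] w h /=; first by rewrite expn0 expr1.
have h1 := IH w (fun k u s => h k u (or_introl s)).
have [|h3 _] := @parity_prods_ge ds E (w + d) a a01.
  by move=> k u s; rewrite -addrA; apply: (h k); right; exists k, u.
by rewrite expnS mul2n -addnn exprD; apply: ler_pM; rewrite ?exprn_ge0.
Qed.

(* The factor [e j] contributes equally to both parities as [d j] is a period
   of it, so that both products of [E] agree, although [E] itself has no period. *)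
Lemma prod_lower_bound (J : nat) (e : nat -> W -> R) (d : nat -> W) w (a : R) :
  (forall j w, 0 <= e j w <= 1) -> (forall j w, e j (w + d j) = e j w) ->
  0 <= a <= 1 ->
  (forall k u, subset_sum [seq d j | j <- iota 0 J] k.+1 u ->
     a <= \prod_(0 <= j < J) e j (w + u)) ->
  a ^+ (2 ^ J) <= \prod_(0 <= j < J) e j w.
Proof.
move=> e01 ed a01 h; set ds := [seq d j | j <- iota 0 J] in h *.
pose E w := \prod_(j <- index_iota 0 J) e j w.
have E01 w' : 0 <= E w' <= 1.
  rewrite prodr_ge0 /=; last by move=> j _; case/andP: (e01 j w').
  by apply: prodr_ile1 => j _.
have := @parity_prods_odd_ge ds E w a a01 h; rewrite size_map size_iota => /le_trans; apply.
have := @parity_prodsM ds nat (index_iota 0 J) e w; rewrite -/E => PM.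
have -> : (parity_prods ds E w).2 = (parity_prods ds E w).1.
  rewrite PM /= big_seq [RHS]big_seq; apply: eq_bigr => j; rewrite mem_index_iota => /andP[_ jJ].
  by rewrite (@parity_prods_eq _ _ (d j)) //; apply/mapP; exists j; rewrite ?mem_iota.
by have /andP[/andP[]] := parity_prods_bounds ds w E01.
Qed.

End Elimination.

Lemma subset_sum_ind {W : zmodType} (ds : seq W) (Q : nat -> W -> Prop) :
  Q 0%N 0 -> (forall d k u, d \in ds -> Q k u -> Q k.+1 (d + u)) ->
  forall k u, subset_sum ds k u -> (k <= size ds)%N /\ Q k u.
Proof.
move=> Q0; elim: ds => [|d ds IH] QS k u /=; first by case=> -> ->.
have IH' := IH (fun d' k u h => QS d' k u (mem_behead (s := d :: ds) h)).
case=> [/IH' [kd q]|[k' [u' [-> -> /IH' [kd q]]]]]; first by split => //; exact: leqW.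
by split => //; apply: QS => //; exact: mem_head.
Qed.

(** Weierstrass's product inequality. *)
Lemma prod_one_minus_ge {R : realType} (J N : nat) (a : nat -> R) :
  (forall j, 0 <= a j <= 1) -> 1 - \sum_(J <= j < N) a j <= \prod_(J <= j < N) (1 - a j).
Proof.
move=> a01; have [NJ|JN] := leqP N J; first by rewrite !big_geq // subr0.
elim: N JN => // N IH; rewrite ltnS leq_eqVlt => /orP[/eqP ->|JN].
  by rewrite !big_nat1.
have JN' := ltnW JN; rewrite (big_nat_recr _ _ _ JN') (big_nat_recr _ _ (fun j => 1 - a j) JN') /=.
have /andP[a0 a1] := a01 N.
set P := \prod_(_ <= _ < _) _ in IH *; set S := \sum_(_ <= _ < _) _ in IH *.
have S0 : 0 <= S by apply: sumr_ge0 => j _; case/andP: (a01 j).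
have P1 : P <= 1 by apply: prodr_ile1 => j _; case/andP: (a01 j) => *; lra.
have := IH JN; nra.
Qed.

(** * Positivity of the factor k on the whole line *)

Section Positivity.
Context {R : realType} {n : nat}.
Local Notation V := 'cV[R]_n.
Variables (phi : nat -> V -> R) (c : nat -> V) (F : V -> R) (k : R -> R).
Variables K delta : R.
Hypothesis dphi : forall j, defect (phi j).
Hypotheses (K0 : 0 < K) (delta0 : 0 < delta).
Hypothesis c_le : forall j, box K (c j).
Hypothesis F_ge : forall u, box delta u -> 1 / 2 <= F u.
Hypothesis k0 : k 0 = 1.
Hypothesis kN : forall s, k (- s) = k s.
Hypothesis prod_cvg : forall u s,
  \prod_(j < N) (1 - phi j (u + s *: c j)) @[N --> \oo] --> F u * k s.

Let phi01 j x : 0 <= phi j x <= 1.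
Proof. by rewrite (defect_ge0 (dphi j)) (defect_le1 (dphi j)). Qed.

Let k_near s : `|s| * K <= delta / 2 -> 0 < k s.
Proof.
move=> h; have := k_bounds dphi delta0 c_le F_ge k0 prod_cvg h => /andP[+ _].
by apply: lt_le_trans; exact: expR_gt0.
Qed.

Let E J u s := \prod_(0 <= j < J) (1 - phi j (u + s *: c j)).

Let E_ge J u s : F u * k s <= E J u s.
Proof.
have h := @prod_cvg u s; rewrite -(cvg_lim (@Rhausdorff R) h).
apply: limr_le; first by apply/cvg_ex; exists (F u * k s).
exists J => // N /= JN; rewrite -(big_mkord xpredT (fun j => 1 - phi j (u + s *: c j))).
rewrite (big_cat_nat (n := J)) //=; apply: ler_piMr.
  by apply: prodr_ge0 => j _; have /andP[? ?] := phi01 j (u + s *: c j); lra.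
by apply: prodr_ile1 => j _; have /andP[? ?] := phi01 j (u + s *: c j); apply/andP; split; lra.
Qed.

(** Beyond finitely many factors the product is at least 1/2 on the range concerned, so that only
    the first [J] factors have to be bounded from below. Elimination does this at [s'] in terms of
    [k] at the [J] points [s' + i kappa]; from the points near 0, where [k] is known to be positive,
    one moves left in steps of [kappa]. *)
Lemma k_gt0 s : 0 < k s.
Proof.
wlog s0 : s / s <= 0.
  by move=> h; case: (leP s 0) => [/h//|/ltW s0]; rewrite -kN h // oppr_le0.
have [l hl] : exists l, `|s| * K + delta <= 2 ^+ l * delta.
  have [l _ /(_ l (leqnn l)) hl] := nbhs_infty_ger ((`|s| * K + delta) / delta).
  exists l; rewrite -ler_pdivrMr //; apply: (le_trans hl).
  by rewrite -natrX ler_nat ltnW // ltn_expl.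
have [J hJ] := defect_tail dphi delta0 F_ge k0 prod_cvg l (divr_gt0 ltr01 (ltr0n R 2) : 0 < 1 / 2).
have F0 := F01 dphi k0 prod_cvg.
have k_le1 s' : k s' <= 1.
  by have := E_ge 0 0 s'; rewrite F0 mul1r /E big_geq.
have E_le s' : `|s'| <= `|s| -> E J 0 s' <= 2 * k s'.
  move=> ss; rewrite mulrC -ler_pdivrMr //.
  have -> : k s' = F 0 * k s' by rewrite F0 mul1r.
  have h := @prod_cvg 0 s'; rewrite -(cvg_lim (@Rhausdorff R) h).
  apply: limr_ge; first by apply/cvg_ex; exists (F 0 * k s').
  exists J => // N /= JN; rewrite -(big_mkord xpredT (fun j => 1 - phi j (0 + s' *: c j))).
  rewrite (big_cat_nat (n := J)) //=; apply: ler_wpM2l.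
    by apply: prodr_ge0 => j _; have /andP[? ?] := phi01 j (0 + s' *: c j); lra.
  apply: le_trans (prod_one_minus_ge J N (fun j => phi01 j (0 + s' *: c j))).
  have : \sum_(J <= j < N) phi j (0 + s' *: c j) <= 1 / 2.
    apply: hJ => j; rewrite add0r; apply: (@box_le _ _ (`|s'| * K)); last exact: boxZ.
    apply: (le_trans _ hl); apply: (@le_trans _ _ (`|s| * K)); first by rewrite ler_pM2r.
    by rewrite lerDl ltW.
  by lra.
(* Small enough that [J] shifts by [kappa *: c j] stay in the box where [F] is at least 1/2, and
   that [k] is positive on the initial stretch up to [J * kappa]; [J.+1] also covers [J = 0]. *)
pose kappa := delta / (2 * K * J.+1%:R).
have J0 : 0 < J.+1%:R :> R by rewrite ltr0n.
have kap0 : 0 < kappa by rewrite divr_gt0 // !mulr_gt0.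
have kapJ (i : nat) : (i <= J.+1)%N -> i%:R * kappa * K <= delta / 2.
  move=> iJ; have -> : delta / 2 = J.+1%:R * kappa * K.
    by rewrite /kappa; field; rewrite !gt_eqF.
  by rewrite ler_pM2r // ler_pM2r // ler_nat.
have start s' : 0 <= s' -> s' <= J%:R * kappa -> 0 < k s'.
  move=> s'0 s'J; apply: k_near; rewrite ger0_norm //.
  apply: le_trans (kapJ J (leqnSn J)); by rewrite ler_pM2r.
suff claim (m : nat) s' : s <= s' -> s' <= J%:R * kappa -> - (m%:R * kappa) <= s' -> 0 < k s'.
  have [m _ /(_ m (leqnn m)) hm] := nbhs_infty_ger (`|s| / kappa).
  apply: (claim m) => //; first by apply: (le_trans s0); rewrite mulr_ge0 // ltW.
  by rewrite lerNl -ler0_norm // -ler_pdivrMr.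
elim: m s' => [|m IH] s' ss' s'J ms'; first by apply: start => //; rewrite mul0r oppr0 in ms'.
have [s'0|s'0] := leP 0 s'; first exact: start.
have kpos (i : nat) : (i < J)%N -> 0 < k (s' + i.+1%:R * kappa).
  move=> iJ; have i0 : 0 <= i%:R * kappa by rewrite mulr_ge0 // ltW.
  have i1 : i.+1%:R * kappa = i%:R * kappa + kappa by rewrite -natr1 mulrDl mul1r.
  apply: IH.
  - by rewrite i1; lra.
  - apply: (@le_trans _ _ (i.+1%:R * kappa)); first by lra.
    by rewrite ler_pM2r // ler_nat.
  - by move: ms'; rewrite i1 -natr1 mulrDl mul1r; lra.
(* All factors being at most 1, the product lies below each of them and serves as a common lower
   bound. *)
pose a := \prod_(i < J) (1 / 2 * k (s' + i.+1%:R * kappa)).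
have b01 (i : 'I_J) : 0 <= 1 / 2 * k (s' + i.+1%:R * kappa) <= 1.
  by have := kpos i (ltn_ord i); have := k_le1 (s' + i.+1%:R * kappa) => *; apply/andP; split; lra.
have a0 : 0 < a.
  by apply: prodr_gt0 => i _; have := kpos i (ltn_ord i); lra.
have a1 : a <= 1 by apply: prodr_ile1 => i _; exact: b01.
(* The direction [(- kappa *: c j, kappa)] leaves [u + s *: c j] unchanged. *)
have low := @prod_lower_bound R (V * R)%type J (fun j w => 1 - phi j (w.1 + w.2 *: c j))
  (fun j => (- kappa *: c j, kappa)) (0, s') a.
have : a ^+ (2 ^ J) <= E J 0 s'.
  apply: low.
  - by move=> j w; have /andP[? ?] := phi01 j (w.1 + w.2 *: c j); apply/andP; split; lra.
  - move=> j [u r] /=; congr (1 - phi j _).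
    by rewrite scalerDl scaleNr addrACA addNr addr0.
  - by rewrite (ltW a0) a1.
  move=> i u su.
  have [iJ [bu u2]] : (i.+1 <= J)%N /\ (box (i.+1%:R * kappa * K) u.1 /\ u.2 = i.+1%:R * kappa).
    have := @subset_sum_ind (V * R)%type [seq (- kappa *: c j, kappa) | j <- iota 0 J]
      (fun k u => box (k%:R * kappa * K) u.1 /\ u.2 = k%:R * kappa).
    rewrite size_map size_iota; apply => //.
      by split; [move=> a'; rewrite mxE normr0 !mul0r|rewrite mul0r].
    move=> _ k' u' /mapP[j _ ->] [b' e']; split => /=.
      rewrite -natr1 2!mulrDl mul1r addrC; apply: boxD => //.
      by have := boxZ (- kappa) (c_le j); rewrite normrN gtr0_norm.
    by rewrite e' -natr1 mulrDl mul1r addrC.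
  rewrite /= u2 add0r; apply: le_trans (E_ge J u.1 (s' + i.+1%:R * kappa)).
  apply: (@le_trans _ _ (1 / 2 * k (s' + i.+1%:R * kappa))).
    rewrite /a (bigD1 (Ordinal iJ)) //=; apply: ler_piMr; first by case/andP: (b01 (Ordinal iJ)).
    by apply: prodr_ile1 => i' _; exact: b01.
  rewrite ler_pM2r ?kpos //; apply: F_ge; apply: box_le bu.
  apply: (le_trans (kapJ i.+1 (leqW iJ))).
  by rewrite ler_pdivrMr // mulr_natr mulr2n lerDl ltW.
have : 0 < a ^+ (2 ^ J) by rewrite exprn_gt0.
have : `|s'| <= `|s| by rewrite !ler0_norm ?lerN2 // ltW.
by move=> /E_le; lra.
Qed.

End Positivity.

(** * Coherence *)

Notation Rintegrable mu f := (mu.-integrable setT (EFin \o f)).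

Section RealIntegrals.
Context {d} {T : measurableType d} {R : realType} (mu : {measure set T -> \bar R}).
Implicit Types f g : T -> R.

Lemma RintegrableD f g : Rintegrable mu f -> Rintegrable mu g ->
  Rintegrable mu (fun x => f x + g x).
Proof. by move=> fi gi; exact: (integrableD measurableT fi gi). Qed.

Lemma RintegrableB f g : Rintegrable mu f -> Rintegrable mu g ->
  Rintegrable mu (fun x => f x - g x).
Proof. by move=> fi gi; exact: (integrableB measurableT fi gi). Qed.

Lemma RintegrableZ (c : R) f : Rintegrable mu f -> Rintegrable mu (fun x => c * f x).
Proof. by move=> fi; exact: (integrableZl measurableT c fi). Qed.

Lemma Rintegrable_sum (I : Type) (r : seq I) (f : I -> T -> R) :
  (forall i, Rintegrable mu (f i)) -> Rintegrable mu (fun x => \sum_(i <- r) f i x).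
Proof.
move=> fi; elim: r => [|i r IH].
  by under eq_fun do rewrite big_nil; exact: integrable0.
by under eq_fun do rewrite big_cons; exact: RintegrableD.
Qed.

Lemma Rintegral_sum (I : Type) (r : seq I) (f : I -> T -> R) :
  (forall i, Rintegrable mu (f i)) ->
  \int[mu]_x (\sum_(i <- r) f i x) = \sum_(i <- r) \int[mu]_x f i x.
Proof.
move=> fi; elim: r => [|i r IH].
  under eq_Rintegral do rewrite big_nil; rewrite big_nil.
  by rewrite /Rintegral integral0.
under eq_Rintegral do rewrite big_cons; rewrite big_cons -IH RintegralD //.
exact: Rintegrable_sum.
Qed.

Lemma Rintegrable_measurable f : Rintegrable mu f -> measurable_fun setT f.
Proof. by case/integrableP => /measurable_EFinP. Qed.

Lemma Rintegrable_le f g : measurable_fun setT f -> (forall x, `|f x| <= g x) ->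
  Rintegrable mu g -> Rintegrable mu f.
Proof.
move=> mf fg; apply: le_integrable => //; first exact/measurable_EFinP.
by move=> x _ /=; rewrite lee_fin (le_trans (fg x)) // ler_norm.
Qed.

End RealIntegrals.

Lemma one_minus_cos {R : realType} (b : R) : 1 - cos b = 2 * sin (b / 2) ^+ 2.
Proof.
rewrite [in cos b](splitr b) cosD -!expr2; have := cos2Dsin2 (b / 2); lra.
Qed.

Section Coherence.
Context {d} {T : measurableType d} {R : realType} (mu : {measure set T -> \bar R}).
Implicit Types (w p q : T -> R).

Record weight w : Prop := Weight {
  weight_ge0 : forall x, 0 <= w x;
  weight_int : Rintegrable mu w;
  weight_mass : 0 < \int[mu]_x w x }.

Lemma weighted_integrable w p (M : R) : weight w -> measurable_fun setT p ->
  (forall x, `|p x| <= M) -> Rintegrable mu (fun x => w x * p x).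
Proof.
move=> [w0 wi _] mp pM; apply: (@Rintegrable_le _ _ _ _ _ (fun x => M * w x)).
- by apply: measurable_funM => //; exact: Rintegrable_measurable wi.
- by move=> x; rewrite normrM mulrC (ger0_norm (w0 x)) ler_wpM2r.
- exact: RintegrableZ.
Qed.

Lemma weighted_integrable_cos w p : weight w -> measurable_fun setT p ->
  Rintegrable mu (fun x => w x * cos (p x)).
Proof.
move=> ww mp; apply: (@weighted_integrable _ _ 1) => //; last by move=> x; exact: cos_max.
exact: (measurableT_comp (continuous_measurable_fun (@continuous_cos R)) mp).
Qed.

Lemma weighted_integrable_sin w p : weight w -> measurable_fun setT p ->
  Rintegrable mu (fun x => w x * sin (p x)).
Proof.
move=> ww mp; apply: (@weighted_integrable _ _ 1) => //; last by move=> x; exact: sin_max.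
exact: (measurableT_comp (continuous_measurable_fun (@continuous_sin R)) mp).
Qed.

Definition wcos w p := \int[mu]_x (w x * cos (p x)).
Definition wsin w p := \int[mu]_x (w x * sin (p x)).

(* The squared modulus of the characteristic function of [p], at 1, under the
   probability measure with density proportional to [w]. *)
Definition coherence w p := (wcos w p ^+ 2 + wsin w p ^+ 2) / (\int[mu]_x w x) ^+ 2.

(* wcos^2 + wsin^2 is the double integral of w(x) w(y) cos (p x - p y). *)
Lemma gram_ge w (I : Type) (r : seq I) (a : I -> R) (p : I -> T -> R) (f g : T -> R) (M : R) :
  weight w -> (forall i, measurable_fun setT (p i)) ->
  measurable_fun setT f -> measurable_fun setT g ->
  (forall x, `|f x| <= M) -> (forall x, `|g x| <= M) ->
  (forall x y, f x * g y <= \sum_(i <- r) a i * cos (p i x - p i y)) ->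
  (\int[mu]_x (w x * f x)) * (\int[mu]_x (w x * g x)) <=
    \sum_(i <- r) a i * (wcos w (p i) ^+ 2 + wsin w (p i) ^+ 2).
Proof.
move=> ww mp mf mg fM gM h.
have ic i := weighted_integrable_cos ww (mp i).
have isn i := weighted_integrable_sin ww (mp i).
have iF := weighted_integrable ww mf fM; have iG := weighted_integrable ww mg gM.
have inner y : g y * (\int[mu]_x (w x * f x)) <=
    \sum_(i <- r) a i * (wcos w (p i) * cos (p i y) + wsin w (p i) * sin (p i y)).
  have iS (i : I) : Rintegrable mu (fun x => a i * (cos (p i y) * (w x * cos (p i x)) + sin (p i y) * (w x * sin (p i x)))).
    by apply/RintegrableZ/RintegrableD; exact: RintegrableZ.
  have -> : \sum_(i <- r) a i * (wcos w (p i) * cos (p i y) + wsin w (p i) * sin (p i y))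
     = \int[mu]_x (\sum_(i <- r) a i * (cos (p i y) * (w x * cos (p i x)) + sin (p i y) * (w x * sin (p i x)))).
    rewrite Rintegral_sum //.
    apply: eq_bigr => i _; rewrite RintegralZl //; last by apply/RintegrableD; exact: RintegrableZ.
    congr (_ * _); rewrite RintegralD //; try exact: RintegrableZ.
    by rewrite !RintegralZl // mulrC [X in _ + X]mulrC.
  rewrite -RintegralZl //; apply: le_Rintegral => //; first exact: RintegrableZ.
    exact: Rintegrable_sum.
  move=> x _; rewrite (_ : \sum_(i <- r) _ = w x * \sum_(i <- r) a i * cos (p i x - p i y)).
    by rewrite mulrCA [g y * _]mulrC ler_wpM2l // (weight_ge0 ww).
  by rewrite mulr_sumr; apply: eq_bigr => i _; rewrite cosB; ring.
have iS (i : I) : Rintegrable mu (fun y => a i * (wcos w (p i) * (w y * cos (p i y)) + wsin w (p i) * (w y * sin (p i y)))).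
  by apply/RintegrableZ/RintegrableD; exact: RintegrableZ.
have -> : \sum_(i <- r) a i * (wcos w (p i) ^+ 2 + wsin w (p i) ^+ 2) =
    \int[mu]_y (\sum_(i <- r) a i * (wcos w (p i) * (w y * cos (p i y)) + wsin w (p i) * (w y * sin (p i y)))).
  rewrite Rintegral_sum //.
  apply: eq_bigr => i _; rewrite RintegralZl //; last by apply/RintegrableD; exact: RintegrableZ.
  by rewrite RintegralD //; try exact: RintegrableZ; rewrite !RintegralZl // !expr2.
rewrite -RintegralZl //; apply: le_Rintegral => //; first exact: RintegrableZ.
  exact: Rintegrable_sum.
move=> y _; rewrite (_ : \sum_(i <- r) _ =
   w y * \sum_(i <- r) a i * (wcos w (p i) * cos (p i y) + wsin w (p i) * sin (p i y))).
  by rewrite mulrCA [_ * g y]mulrC ler_wpM2l // (weight_ge0 ww).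
by rewrite mulr_sumr; apply: eq_bigr => i _; ring.
Qed.

Lemma gram_ge0 w (I : Type) (r : seq I) (a : I -> R) (p : I -> T -> R) :
  weight w -> (forall i, measurable_fun setT (p i)) ->
  (forall x y, 0 <= \sum_(i <- r) a i * cos (p i x - p i y)) ->
  0 <= \sum_(i <- r) a i * (wcos w (p i) ^+ 2 + wsin w (p i) ^+ 2).
Proof.
move=> ww mp h.
have z0 : \int[mu]_x (w x * 0) = 0.
  by under eq_Rintegral do rewrite mulr0; rewrite /Rintegral integral0.
have := @gram_ge w I r a p (fun=> 0) (fun=> 0) 0 ww mp.
by rewrite z0 mulr0; apply => // *; rewrite ?normr0 ?mulr0.
Qed.

Lemma coherence_cst w (c : R) : weight w -> coherence w (fun=> c) = 1.
Proof.
move=> ww; have m0 := weight_mass ww; have iw := weight_int ww.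
rewrite /coherence /wcos /wsin.
under eq_Rintegral do rewrite mulrC; under [X in _ + X ^+ 2]eq_Rintegral do rewrite mulrC.
rewrite !RintegralZl // !exprMn -mulrDl cos2Dsin2 mul1r divff //.
by rewrite expf_neq0 // gt_eqF.
Qed.

(** A pointwise inequality between cosines of phase differences integrates to one between
    coherences. The inequalities for coherences below come from trigonometric ones in this way. *)
Lemma gram_coherence w (I : Type) (r : seq I) (a : I -> R) (p : I -> T -> R) :
  weight w -> (forall i, measurable_fun setT (p i)) ->
  (forall x y, 0 <= \sum_(i <- r) a i * cos (p i x - p i y)) ->
  0 <= \sum_(i <- r) a i * coherence w (p i).
Proof.
move=> ww mp h; rewrite /coherence; under eq_bigr do rewrite mulrA.
by rewrite -mulr_suml mulr_ge0 ?gram_ge0 // invr_ge0 exprn_ge0 // ltW // weight_mass.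
Qed.

Lemma coherence_ge0 w p : 0 <= coherence w p.
Proof. by rewrite /coherence divr_ge0 ?addr_ge0 ?sqr_ge0. Qed.

Lemma coherence_le1 w p : weight w -> measurable_fun setT p -> coherence w p <= 1.
Proof.
move=> ww mp.
have := @gram_coherence w bool [:: true; false] (fun b => if b then 1 else -1)
  (fun b => if b then fun=> 0 else p) ww.
rewrite !big_cons big_nil /= coherence_cst // addr0 mul1r mulN1r subr_ge0; apply.
  by case.
by move=> x y; rewrite !big_cons big_nil subrr cos0 addr0 mul1r mulN1r subr_ge0 cos_le1.
Qed.

Lemma coherence_le w p q : weight w -> measurable_fun setT p -> measurable_fun setT q ->
  (forall x y, cos (p x - p y) <= cos (q x - q y)) -> coherence w p <= coherence w q.
Proof.
move=> ww mp mq h.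
have := @gram_coherence w bool [:: true; false] (fun b => if b then 1 else -1)
  (fun b => if b then q else p) ww.
rewrite !big_cons big_nil /= addr0 mul1r mulN1r subr_ge0; apply.
  by case.
by move=> x y; rewrite !big_cons big_nil addr0 mul1r mulN1r subr_ge0.
Qed.

Lemma coherenceN w p : weight w -> measurable_fun setT p ->
  coherence w (fun x => - p x) = coherence w p.
Proof.
move=> ww mp; have mN : measurable_fun setT (fun x => - p x) by exact: measurableT_comp.
have E x y : cos (- p x - - p y) = cos (p x - p y) by rewrite -opprD cosN.
by apply/eqP; rewrite eq_le !coherence_le // => x y; rewrite E.
Qed.

(** The difference is at most [2 |sin (b / 2)|]; completing squares makes this linear in
    [1 - cos b], as the transfer to coherences requires. *)
Let cos_diff_le (a b e : R) : 0 < e -> `|cos (a + b) - cos a| <= e + (1 - cos b) / e.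
Proof.
move=> e0.
have h1 := one_minus_cos b.
have -> : cos (a + b) - cos a = - 2 * sin (b / 2) * sin (a + b / 2).
  rewrite {1}(_ : a + b = (a + b / 2) + b / 2); last by field.
  rewrite {2}(_ : a = (a + b / 2) - b / 2); last by field.
  by rewrite cosD cosB; ring.
apply: (@le_trans _ _ (2 * `|sin (b / 2)|)).
  rewrite normrM [X in X * _]normrM normrN (_ : `|2| = 2); last by rewrite ger0_norm.
  by apply: ler_piMr; [rewrite mulr_ge0|exact: sin_max].
rewrite h1 -real_normK ?num_real //; set s := `|_|.
rewrite -subr_ge0 (_ : _ - _ = ((e - s) ^+ 2 + s ^+ 2) / e); last by field; rewrite gt_eqF.
by rewrite divr_ge0 ?addr_ge0 ?sqr_ge0 // ltW.
Qed.

(** The transferred inequality is [sin (x + y) ^ 2 <= 2 sin x ^ 2 + 2 sin y ^ 2] at half phases;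
    constants are carried by the phase 0, whose coherence is 1, with coefficient 3. *)
Lemma incoherenceD w p q : weight w -> measurable_fun setT p -> measurable_fun setT q ->
  1 - coherence w (fun x => p x + q x) <= 2 * (1 - coherence w p) + 2 * (1 - coherence w q).
Proof.
move=> ww mp mq.
pose P (i : nat) := nth (fun=> 0) [:: fun=> 0; p; q; fun x => p x + q x] i.
pose a (i : nat) : R := nth 0 [:: 3; -2; -2; 1] i.
have := @gram_coherence w nat (iota 0 4) a P ww.
rewrite /= !big_cons big_nil /a /P /= coherence_cst // => h.
suff: 0 <= 3 * 1 + (-2 * coherence w p + (-2 * coherence w q + (1 * coherence w (fun x => p x + q x) + 0))) by lra.
apply: h.
  by case=> [|[|[|[|i]]]] //=; [exact: measurable_funD|rewrite nth_nil].
move=> x y; rewrite !big_cons big_nil /= subrr cos0.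
rewrite (_ : p x + q x - _ = (p x - p y) + (q x - q y)); last by ring.
set A := p x - p y; set B := q x - q y.
have h1 := @one_minus_cos R.
have H : sin ((A + B) / 2) ^+ 2 <= 2 * sin (A / 2) ^+ 2 + 2 * sin (B / 2) ^+ 2.
  rewrite mulrDl sinD; set s := sin _; set c := cos (B / 2); set c' := cos _; set s' := sin _.
  have cs : c ^+ 2 + s' ^+ 2 = 1 by rewrite /c /s' cos2Dsin2.
  have cs' : c' ^+ 2 + s ^+ 2 = 1 by rewrite /c' /s cos2Dsin2.
  have := sqr_ge0 (s * c - c' * s'); nra.
have := h1 A; have := h1 B; have := h1 (A + B); lra.
Qed.

Lemma coherence_diff w p q (e : R) : weight w -> measurable_fun setT p ->
  measurable_fun setT q -> 0 < e ->
  `|coherence w (fun x => p x + q x) - coherence w p| <= e + (1 - coherence w q) / e.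
Proof.
move=> ww mp mq e0.
pose P (i : nat) := nth (fun=> 0) [:: fun=> 0; p; q; fun x => p x + q x] i.
have mP i : measurable_fun setT (P i).
  by case: i => [|[|[|[|i]]]]; rewrite /P /= ?nth_nil //; exact: measurable_funD.
have key (b : R) : `|b| = 1 ->
    b * (coherence w (fun x => p x + q x) - coherence w p) <= e + (1 - coherence w q) / e.
  move=> b1; pose a (i : nat) : R := nth 0 [:: e + e^-1; b; - e^-1; - b] i.
  have := @gram_coherence w nat (iota 0 4) a P ww mP.
  rewrite /= !big_cons big_nil /a /P /= coherence_cst // => h.
  rewrite -subr_ge0.
  have H := cos_diff_le.
  set Y := (X in 0 <= X); suff -> : Y = (e + e^-1) * 1 + (b * coherence w p + (- e^-1 * coherence w q + (- b * coherence w (fun x => p x + q x) + 0))).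
    apply: h => x y; rewrite !big_cons big_nil /= subrr cos0.
    rewrite (_ : p x + q x - _ = (p x - p y) + (q x - q y)); last by ring.
    have := H (p x - p y) (q x - q y) e e0.
    set A := p x - p y; set B := q x - q y => H'.
    have : b * (cos (A + B) - cos A) <= e + (1 - cos B) / e.
      by apply: (le_trans (ler_norm _)); rewrite normrM b1 mul1r.
    rewrite -subr_ge0 => /le_trans; apply; rewrite le_eqVlt; apply/orP; left; apply/eqP; ring.
  by rewrite /Y; ring.
have := key 1 (normr1 _); have := key (-1) (normrN1 _).
rewrite mul1r mulN1r => h1 h2; rewrite ler_norml h2 andbT; lra.
Qed.

(** A constant has coherence 1, so the difference is at most every positive [e]. *)
Lemma coherence_shift w p (c : R) : weight w -> measurable_fun setT p ->
  coherence w (fun x => p x + c) = coherence w p.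
Proof.
move=> ww mp; apply/eqP; rewrite -subr_eq0 -normr_le0; apply/ler_addgt0Pr => e e0.
have := @coherence_diff w p (fun=> c) e ww mp (measurable_cst _) e0.
by rewrite coherence_cst // subrr mul0r addr0 add0r.
Qed.

End Coherence.

(** * Independence *)

Lemma rect_measure_unique {d1 d2} {T1 : measurableType d1} {T2 : measurableType d2}
    {R : realType} (m1 m2 : {measure set (T1 * T2) -> \bar R}) :
  (m1 setT < +oo)%E ->
  (forall A B, measurable A -> measurable B -> m1 (A `*` B) = m2 (A `*` B)) ->
  forall X, measurable X -> m1 X = m2 X.
Proof.
move=> m1oo m12 X mX.
pose C : set (set (T1 * T2)) :=
  [set C | exists A, measurable A /\ exists B, measurable B /\ C = A `*` B].
apply: (measure_unique C (fun=> setT)) => //.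
- rewrite measurable_prod_measurableType //; congr (<<s _ >>).
  rewrite predeqE; split => [[A mA [B mB <-]]|[A [mA [B [mB ->]]]]].
    by exists A; split => //; exists B.
  by exists A => //; exists B.
- move=> /= _ _ [X1 [mX1 [X2 [mX2 ->]]]] [Y1 [mY1 [Y2 [mY2 ->]]]].
  rewrite -setXI; exists (X1 `&` Y1); split; first exact: measurableI.
  by exists (X2 `&` Y2); split => //; exact: measurableI.
- by move=> _; exists setT; split => //; exists setT; split => //; rewrite setXTT.
- by rewrite bigcup_const //; exists 0%N.
- by move=> A [A1 [mA1 [A2 [mA2 ->]]]]; exact: m12.
Qed.

Definition independent2 {d d1 d2} {Omega : measurableType d} {T1 : measurableType d1}
    {T2 : measurableType d2} {R : realType} (P : set Omega -> \bar R)
    (X : Omega -> T1) (Y : Omega -> T2) : Prop :=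
  forall A B, measurable A -> measurable B ->
    P (X @^-1` A `&` Y @^-1` B) = (P (X @^-1` A) * P (Y @^-1` B))%E.

Lemma independent2_comp {d d1 d2 d1' d2'} {Omega : measurableType d} {T1 : measurableType d1}
    {T2 : measurableType d2} {S1 : measurableType d1'} {S2 : measurableType d2'}
    {R : realType} (P : set Omega -> \bar R) (X : Omega -> T1) (Y : Omega -> T2)
    (f : T1 -> S1) (g : T2 -> S2) : measurable_fun setT f -> measurable_fun setT g ->
  independent2 P X Y -> independent2 P (f \o X) (g \o Y).
Proof.
move=> mf mg XY A B mA mB; apply: (XY (f @^-1` A) (g @^-1` B)).
  by have := mf measurableT A mA; rewrite setTI.
by have := mg measurableT B mB; rewrite setTI.
Qed.

Section ProductExpectation.
Context {d} {Omega : measurableType d} {R : realType} (P : probability Omega R).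

Lemma independent2_Rintegral (U V : Omega -> R) :
  independent2 P U V -> Rintegrable P U -> Rintegrable P V ->
  Rintegrable P (fun w => U w * V w) /\
  \int[P]_w (U w * V w) = (\int[P]_w U w) * (\int[P]_w V w).
Proof.
move=> UV iU iV.
have mU := Rintegrable_measurable iU; have mV := Rintegrable_measurable iV.
pose fU : {mfun Omega >-> R} := HB.pack U (isMeasurableFun.Build _ _ _ _ U mU).
pose fV : {mfun Omega >-> R} := HB.pack V (isMeasurableFun.Build _ _ _ _ V mV).
have mUV : measurable_fun setT (fun w => (U w, V w)) by exact: measurable_fun_pair.
pose m1 := distribution P fU; pose m2 := distribution P fV.
pose m := pushforward P (fun w => (U w, V w)).
have mE X : measurable X -> (m1 \x m2)%E X = m X.
  by apply: product_measure_unique => A B mA mB; rewrite -UV.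
pose f (z : R * R) := (z.1 * z.2)%:E.
have mf : measurable_fun setT f.
  by apply/measurable_EFinP; apply: measurable_funM.
have mabs : measurable_fun setT (fun x : R => `|x|%:E).
  by apply/measurable_EFinP; exact: normr_measurable.
have i12 : (m1 \x m2)%E.-integrable setT f.
  apply/(integrable12ltyP _ _ mf).
  have -> : (\int[m1]_x \int[m2]_y `|f (x, y)| = \int[m1]_x (`|x|%:E * \int[m2]_y `|y|%:E))%E.
    apply: eq_integral => x _; rewrite -ge0_integralZl_EFin //.
    by apply: eq_integral => y _; rewrite /f /= normrM EFinM.
  rewrite ge0_integralZr //; last by apply: integral_ge0 => y _; rewrite lee_fin.
  have e1 : (\int[m1]_x `|x|%:E = \int[P]_w `|(U w)%:E|)%E.
    by rewrite ge0_integral_distribution.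
  have e2 : (\int[m2]_x `|x|%:E = \int[P]_w `|(V w)%:E|)%E.
    by rewrite ge0_integral_distribution.
  rewrite e1 e2; case/integrableP: iU => _ U1; case/integrableP: iV => _ V1.
  by apply: lte_mul_pinfty; rewrite ?integral_ge0 // ge0_fin_numE // integral_ge0.
have mUV2 : measurable_fun setT (fun w => U w * V w) by exact: measurable_funM.
have iUV : Rintegrable P (fun w => U w * V w).
  apply/integrableP; split; first exact/measurable_EFinP.
  case/integrableP: i12 => _; rewrite (eq_measure_integral m) => [|A mA _]; last exact: mE.
  by rewrite ge0_integral_pushforward //; exact: measurableT_comp.
split => //; rewrite /Rintegral.
have -> : (\int[P]_w (U w * V w)%:E = \int[m1 \x m2]_z f z)%E.
  rewrite [RHS](eq_measure_integral m) => [|A mA _]; last exact: mE.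
  by rewrite integral_pushforward.
rewrite -integral12_prod_meas1 //= /fubini_F /=.
have eV : (\int[m2]_y y%:E = \int[P]_w (V w)%:E)%E by rewrite integral_distribution //; exact/measurable_EFinP.
have eU : (\int[m1]_y y%:E = \int[P]_w (U w)%:E)%E by rewrite integral_distribution //; exact/measurable_EFinP.
have finV : (\int[P]_w (V w)%:E)%E \is a fin_num by apply: integrable_fin_num.
have finU : (\int[P]_w (U w)%:E)%E \is a fin_num by apply: integrable_fin_num.
have im2 : m2.-integrable setT EFin.
  by apply: integrable_pushforward => //; exact/measurable_EFinP.
have im1 : m1.-integrable setT EFin.
  by apply: integrable_pushforward => //; exact/measurable_EFinP.
rewrite (eq_integral (fun x => (fine (\int[P]_w (V w)%:E))%:E * x%:E)%E); last first.
  by move=> x _; rewrite fineK // -eV muleC -integralZl //; apply: eq_integral => y _; rewrite /f EFinM.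
rewrite integralZl // eU fineM //= mulrC //.
Qed.

End ProductExpectation.

Lemma big_nat_shift (T : Type) (idx : T) (op : T -> T -> T) (k m : nat) (F : nat -> T) :
  \big[op/idx]_(k <= j < k + m) F j = \big[op/idx]_(0 <= j < m) F (k + j)%N.
Proof.
by rewrite -{1}[k]add0n big_addn addKn; apply: eq_bigr => j _; rewrite addnC.
Qed.

(** * Independence of functions of successive blocks *)

Section StateMachine.
Context {d d1 d2} {Omega : measurableType d} {T : measurableType d1} {S : measurableType d2}.
Context {R : realType} (P : probability Omega R) (Q : {measure set Omega -> \bar R}).
Variables (xi : nat -> Omega -> T) (phi : nat -> S * T -> S) (s0 : S) (Z : nat -> Omega -> S).
Hypothesis mxi : forall j, measurable_fun setT (xi j).
Hypothesis mphi : forall j, measurable_fun setT (phi j).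
Hypothesis Z0 : forall w, Z 0 w = s0.
Hypothesis ZS : forall N w, Z N.+1 w = phi N (Z N w, xi N w).
Hypothesis Qoo : (Q setT < +oo)%E.

Definition cylinder (N M : nat) (B : nat -> set T) : set Omega :=
  \big[setI/setT]_(N <= j < M) (xi j @^-1` B j).

Lemma cylinder_ltn N M B : (N < M)%N ->
  cylinder N M B = xi N @^-1` B N `&` cylinder N.+1 M B.
Proof. by move=> NM; rewrite /cylinder (big_ltn NM). Qed.

Lemma cylinder_nn N B : cylinder N N B = setT.
Proof. by rewrite /cylinder big_geq. Qed.

Lemma eq_cylinder N M B B' : (forall j, (N <= j < M)%N -> B j = B' j) ->
  cylinder N M B = cylinder N M B'.
Proof.
by move=> e; rewrite /cylinder big_nat [RHS]big_nat; apply: eq_bigr => j /e ->.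
Qed.

Hypothesis Qcyl : forall M B, (forall j, measurable (B j)) ->
  Q (cylinder 0 M B) = (Q setT * \prod_(0 <= j < M) P (xi j @^-1` B j))%E.

Lemma state_measurable N : measurable_fun setT (Z N).
Proof.
elim: N => [|N IH].
  by rewrite (_ : Z 0 = cst s0) //; apply/funext.
rewrite (_ : Z N.+1 = phi N \o (fun w => (Z N w, xi N w))); last by apply/funext.
by apply: measurableT_comp => //; exact: measurable_fun_pair.
Qed.

Let m_pre d' (T' : measurableType d') (f : Omega -> T') A :
  measurable_fun setT f -> measurable A -> measurable (f @^-1` A).
Proof. by move=> mf mA; rewrite -[X in measurable X]setTI; exact: mf. Qed.

Lemma cylinder_measurable N M B : (forall j, measurable (B j)) -> measurable (cylinder N M B).
Proof. by move=> mB; apply: bigsetI_measurable => j _; exact: m_pre. Qed.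

(** Induction on [N]: both sides are measures in the pair [(Z N, xi N)], and on rectangles they
    agree by the induction hypothesis, the event on [xi N] joining the cylinder. The recursion for
    [Z] replaces the sigma-algebras generated by blocks. *)
Lemma state_independent N A M B : (N <= M)%N -> measurable A -> (forall j, measurable (B j)) ->
  Q (Z N @^-1` A `&` cylinder N M B) =
    (Q (Z N @^-1` A) * \prod_(N <= j < M) P (xi j @^-1` B j))%E.
Proof.
elim: N A M B => [|N IH] A M B NM mA mB.
  have [As0|As0] := pselect (A s0).
    rewrite (_ : Z 0 @^-1` A = setT) ?setTI ?Qcyl //.
    by rewrite -subTset => w _ /=; rewrite Z0.
  rewrite (_ : Z 0 @^-1` A = set0) ?set0I ?measure0 ?mul0e //.
  by rewrite -subset0 => w /=; rewrite Z0.
pose D := cylinder N.+1 M B.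
have mD : measurable D by exact: cylinder_measurable.
pose p := fine (\prod_(N.+1 <= j < M) P (xi j @^-1` B j))%E.
have pfin : (\prod_(N.+1 <= j < M) P (xi j @^-1` B j))%E = p%:E.
  rewrite fineK // prode_fin_num // => j _; apply: fin_num_measure; exact: m_pre.
have p0 : 0 <= p by apply: fine_ge0; apply: prode_ge0.
pose f w := (Z N w, xi N w).
have mf : measurable_fun setT f by apply: measurable_fun_pair => //; exact: state_measurable.
pose m1 := pushforward (mrestr Q mD) f.
pose m2 := mscale (NngNum p0) (pushforward Q f).
have Zpre : Z N.+1 @^-1` A = f @^-1` (phi N @^-1` A).
  by apply/seteqP; split => w /=; rewrite ZS.
have mX : measurable (phi N @^-1` A) by rewrite -[X in measurable X]setTI; exact: mphi.
rewrite Zpre pfin muleC.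
change (m1 (phi N @^-1` A) = m2 mf (phi N @^-1` A)).
apply: rect_measure_unique => //.
  by rewrite /= /pushforward /mrestr preimage_setT setTI; apply: le_lt_trans Qoo; rewrite le_measure ?inE.
move=> A' C mA' mC.
pose B' j := if j == N then C else B j.
have mB' j : measurable (B' j) by rewrite /B'; case: ifP.
have BN j : (N < j)%N -> B' j = B j by rewrite /B' => Nj; rewrite gtn_eqF.
have h M' : (N < M')%N -> Q (Z N @^-1` A' `&` (xi N @^-1` C `&` cylinder N.+1 M' B)) =
    (Q (Z N @^-1` A') * (P (xi N @^-1` C) * \prod_(N.+1 <= j < M') P (xi j @^-1` B j)))%E.
  move=> NM'; have := IH A' M' B' (ltnW NM') mA' mB'.
  rewrite (cylinder_ltn B' NM') (big_ltn NM') {1 3}/B' eqxx.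
  rewrite (@eq_cylinder N.+1 M' B' B) => [->|j /andP[Nj _]]; last exact: BN.
  congr (_ * (_ * _))%E; rewrite big_nat [RHS]big_nat; apply: eq_bigr => j /andP[Nj _].
  by rewrite BN.
have h1 := h N.+1 (ltnSn N).
rewrite cylinder_nn setIT big_geq // mule1 in h1.
change (Q (Z N @^-1` A' `&` xi N @^-1` C `&` D) = p%:E * Q (Z N @^-1` A' `&` xi N @^-1` C))%E.
by rewrite -pfin -setIA h // h1 [RHS]muleC muleA.
Qed.

End StateMachine.

Lemma state_law {d d1 d2} {Omega : measurableType d} {T : measurableType d1}
    {S : measurableType d2} {R : realType} (P : probability Omega R)
    (Q : {measure set Omega -> \bar R}) (xi : nat -> Omega -> T) (phi : nat -> S * T -> S)
    (s0 : S) (Z : nat -> Omega -> S) N A :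
  (forall j, measurable_fun setT (xi j)) -> (forall j, measurable_fun setT (phi j)) ->
  (forall w, Z 0 w = s0) -> (forall N w, Z N.+1 w = phi N (Z N w, xi N w)) ->
  (Q setT < +oo)%E ->
  (forall M B, (forall j, measurable (B j)) ->
    P (cylinder xi 0 M B) = \prod_(0 <= j < M) P (xi j @^-1` B j))%E ->
  (forall M B, (forall j, measurable (B j)) ->
    Q (cylinder xi 0 M B) = Q setT * P (cylinder xi 0 M B))%E ->
  measurable A -> Q (Z N @^-1` A) = (Q setT * P (Z N @^-1` A))%E.
Proof.
move=> mxi mphi Z0 ZS Qoo Pc Qc.
have Poo : (P setT < +oo)%E by rewrite probability_setT ltry.
have Pc' M B : (forall j, measurable (B j)) ->
    P (cylinder xi 0 M B) = (P setT * \prod_(0 <= j < M) P (xi j @^-1` B j))%E.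
  by move=> mB; rewrite Pc // probability_setT mul1e.
have Qc' M B : (forall j, measurable (B j)) ->
    Q (cylinder xi 0 M B) = (Q setT * \prod_(0 <= j < M) P (xi j @^-1` B j))%E.
  by move=> mB; rewrite Qc // Pc.
elim: N A => [|N IH] A mA.
  have [As0|As0] := pselect (A s0).
    rewrite (_ : Z 0 @^-1` A = setT) ?probability_setT ?mule1 //.
    by rewrite -subTset => w _ /=; rewrite Z0.
  rewrite (_ : Z 0 @^-1` A = set0) ?measure0 ?mule0 //.
  by rewrite -subset0 => w /=; rewrite Z0.
pose f w := (Z N w, xi N w).
have mf : measurable_fun setT f.
  by apply: measurable_fun_pair => //; exact: (state_measurable mxi mphi Z0 ZS).
pose c := fine (Q setT).
have c0 : 0 <= c by exact: fine_ge0.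
have cE : Q setT = c%:E by rewrite fineK // ge0_fin_numE.
pose m1 := pushforward Q f.
pose m2 := mscale (NngNum c0) (pushforward P f).
have Zpre : Z N.+1 @^-1` A = f @^-1` (phi N @^-1` A).
  by apply/seteqP; split => w /=; rewrite ZS.
have mX : measurable (phi N @^-1` A) by rewrite -[X in measurable X]setTI; exact: mphi.
rewrite Zpre cE; change (m1 (phi N @^-1` A) = m2 mf (phi N @^-1` A)).
apply: rect_measure_unique => // A' C mA' mC.
change (Q (Z N @^-1` A' `&` xi N @^-1` C) = c%:E * P (Z N @^-1` A' `&` xi N @^-1` C))%E.
have := state_independent mxi mphi Z0 ZS Qoo Qc' (leqnSn N) mA' (fun _ : nat => mC).
have := state_independent mxi mphi Z0 ZS Poo Pc' (leqnSn N) mA' (fun _ : nat => mC).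
rewrite cylinder_ltn // cylinder_nn setIT big_nat1 => -> ->.
by rewrite IH // cE muleA.
Qed.

Section MutualIndependence.
Context {d d1 d2 d3 : measure_display} {Omega : measurableType d} {T : measurableType d1} {S : measurableType d2}.
Context {S' : measurableType d3} {R : realType} (P : probability Omega R).
Variable xi : nat -> {RV P >-> T}.
Hypothesis xi_indep : mutually_independent xi.
Variables (phi : nat -> S * T -> S) (s0 : S) (Z : nat -> Omega -> S).
Hypothesis mphi : forall j, measurable_fun setT (phi j).
Hypothesis Z0 : forall w, Z 0 w = s0.
Hypothesis ZS : forall N w, Z N.+1 w = phi N (Z N w, xi N w).

Lemma mutual_cylinder N M B : (forall j, measurable (B j)) ->
  P (cylinder (fun j => xi j) N M B) = (\prod_(N <= j < M) P (xi j @^-1` B j))%E.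
Proof.
move=> mB; rewrite -(xi_indep (s := index_iota N M)) ?iota_uniq //.
by rewrite /cylinder bigcap_seq.
Qed.

Let mxi j : measurable_fun setT (xi j). Proof. exact: measurable_funP. Qed.

Lemma partial_state_measurable N : measurable_fun setT (Z N).
Proof. exact: (state_measurable mxi mphi Z0 ZS). Qed.

Lemma state_mutual N A M B : (N <= M)%N -> measurable A -> (forall j, measurable (B j)) ->
  P (Z N @^-1` A `&` cylinder (fun j => xi j) N M B) =
    (P (Z N @^-1` A) * \prod_(N <= j < M) P (xi j @^-1` B j))%E.
Proof.
move=> NM mA mB; have PT := @probability_setT _ _ _ P.
have Poo : (P setT < +oo)%E by rewrite PT ltry.
apply: (state_independent mxi mphi Z0 ZS Poo _ NM mA mB) => M' B' mB'.
by apply: etrans (mutual_cylinder 0 M' mB') _; rewrite -[LHS]mul1e -PT.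
Qed.

Lemma state_independent_next N : independent2 P (Z N) (xi N).
Proof.
move=> A B mA mB; have := @state_mutual N A N.+1 (fun=> B) (leqnSn N) mA (fun=> mB).
by rewrite cylinder_ltn // cylinder_nn setIT big_nat1.
Qed.

Variables (phi' : nat -> S' * T -> S') (s0' : S') (N0 : nat) (Z' : nat -> Omega -> S').
Hypothesis mphi' : forall j, measurable_fun setT (phi' j).
Hypothesis Z'0 : forall w, Z' 0 w = s0'.
Hypothesis Z'S : forall N w, Z' N.+1 w = phi' N (Z' N w, xi (N0 + N)%N w).

(** Restricted to an event of the first block, [P] is proportional to itself on the cylinders of the
    second, hence on the states of the second, which is independence. *)
Lemma blocks_independent N : independent2 P (Z N0) (Z' N).
Proof.
move=> A B mA mB.
pose xi' j := xi (N0 + j)%N.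
have mZ : measurable (Z N0 @^-1` A).
  by have := partial_state_measurable N0 measurableT mA; rewrite setTI.
pose Q := mrestr P mZ.
have QT : Q setT = P (Z N0 @^-1` A) by rewrite /Q /mrestr setTI.
have mxi' j : measurable_fun setT (xi' j) by exact: mxi.
have shift M C : cylinder (fun j => xi' j) 0 M C =
    cylinder (fun j => xi j) N0 (N0 + M) (fun j => C (j - N0)%N).
  by rewrite /cylinder big_nat_shift; apply: eq_bigr => j _; rewrite addKn.
have shiftP M C : (\prod_(N0 <= j < N0 + M) P (xi j @^-1` C (j - N0)%N) =
    \prod_(0 <= j < M) P (xi' j @^-1` C j))%E.
  by rewrite big_nat_shift; apply: eq_bigr => j _; rewrite addKn.
have PC M C : (forall j, measurable (C j)) ->
    P (cylinder (fun j => xi' j) 0 M C) = (\prod_(0 <= j < M) P (xi' j @^-1` C j))%E.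
  by move=> mC; rewrite shift mutual_cylinder // shiftP.
have Qoo : (Q setT < +oo)%E by rewrite QT -ge0_fin_numE // fin_num_measure.
have := state_law (xi := fun j => xi' j) (Q := Q) N mxi' mphi' Z'0 Z'S Qoo PC _ mB.
have QE X : Q X = P (Z N0 @^-1` A `&` X) by rewrite /Q /mrestr setIC.
move=> h; have {h} : Q (Z' N @^-1` B) = (Q setT * P (Z' N @^-1` B))%E.
  apply: h => M C mC; rewrite [LHS]QE shift state_mutual ?leq_addr //.
  by rewrite shiftP -PC // shift; congr (_ * _)%E; exact: esym QT.
by move=> h; rewrite -QE h; congr (_ * _)%E; exact: QT.
Qed.

End MutualIndependence.

Lemma Rintegral_probability_cst {d} {T : measurableType d} {R : realType}
  (P : probability T R) (c : R) : \int[P]_x c = c.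
Proof.
have PT : fine (P setT) = 1 by rewrite probability_setT.
by rewrite Rintegral_cst // -[RHS]mulr1 -PT.
Qed.

Section CoherenceProduct.
Context {d d1 : measure_display} {Omega : measurableType d} {T : measurableType d1}.
Context {R : realType} (P : probability Omega R).

(** [wcos] and [wsin] are the real and imaginary parts of a characteristic function; under
    independence these multiply as complex numbers, and the squared modulus is multiplicative. *)
Lemma coherenceM (w p w' p' : Omega -> R) :
  weight P w -> measurable_fun setT p -> weight P w' -> measurable_fun setT p' ->
  independent2 P (fun x => (w x, p x)) (fun x => (w' x, p' x)) ->
  [/\ weight P (fun x => w x * w' x),
      \int[P]_x (w x * w' x) = (\int[P]_x w x) * \int[P]_x w' x &
  coherence P (fun x => w x * w' x) (fun x => p x + p' x) = coherence P w p * coherence P w' p'].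
Proof.
move=> ww mp ww' mp' ind.
have ms (f : R -> R) : measurable_fun setT f -> measurable_fun setT (fun z : R * R => z.1 * f z.2).
  by move=> mf; apply: measurable_funM => //; exact: measurableT_comp.
have mc : measurable_fun setT (@cos R) by apply: continuous_measurable_fun; exact: continuous_cos.
have msi : measurable_fun setT (@sin R) by apply: continuous_measurable_fun; exact: continuous_sin.
have I f g (mf : measurable_fun setT f) (mg : measurable_fun setT g) :=
  independent2_comp (ms f mf) (ms g mg) ind.
have [im em] : Rintegrable P (fun x => w x * w' x) /\
    \int[P]_x (w x * w' x) = (\int[P]_x w x) * \int[P]_x w' x.
  apply: independent2_Rintegral; [|exact: weight_int|exact: weight_int].
  have m1 : measurable_fun setT (fst : R * R -> R) by [].
  exact: (independent2_comp m1 m1 ind).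
have [icc ecc] := independent2_Rintegral (I _ _ mc mc) (weighted_integrable_cos ww mp) (weighted_integrable_cos ww' mp').
have [ics ecs] := independent2_Rintegral (I _ _ mc msi) (weighted_integrable_cos ww mp) (weighted_integrable_sin ww' mp').
have [isc esc] := independent2_Rintegral (I _ _ msi mc) (weighted_integrable_sin ww mp) (weighted_integrable_cos ww' mp').
have [iss ess] := independent2_Rintegral (I _ _ msi msi) (weighted_integrable_sin ww mp) (weighted_integrable_sin ww' mp').
have W : weight P (fun x => w x * w' x).
  split => //; first by move=> x; rewrite mulr_ge0 ?(weight_ge0 ww) ?(weight_ge0 ww').
  by rewrite em mulr_gt0 ?(weight_mass ww) ?(weight_mass ww').
split => //.
have eC : wcos P (fun x => w x * w' x) (fun x => p x + p' x) =
    wcos P w p * wcos P w' p' - wsin P w p * wsin P w' p'.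
  rewrite /wcos /wsin -ecc -ess -RintegralB //.
  by apply: eq_Rintegral => x _; rewrite cosD /=; ring.
have eS : wsin P (fun x => w x * w' x) (fun x => p x + p' x) =
    wsin P w p * wcos P w' p' + wcos P w p * wsin P w' p'.
  rewrite /wcos /wsin -esc -ecs -RintegralD //.
  by apply: eq_Rintegral => x _; rewrite sinD /=; ring.
rewrite /coherence eC eS em mulrACA -invfM -exprMn; congr (_ / _); ring.
Qed.

Variable xi : nat -> {RV P >-> T}.
Hypothesis xi_indep : mutually_independent xi.
Variables w p : nat -> T -> R.
Hypothesis mw : forall j, measurable_fun setT (w j).
Hypothesis mp : forall j, measurable_fun setT (p j).
Hypothesis ww : forall j, weight P (fun x => w j (xi j x)).

Lemma coherence_prod N :
  [/\ weight P (fun x => \prod_(0 <= j < N) w j (xi j x)),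
      \int[P]_x (\prod_(0 <= j < N) w j (xi j x)) = \prod_(0 <= j < N) \int[P]_x w j (xi j x) &
  coherence P (fun x => \prod_(0 <= j < N) w j (xi j x)) (fun x => \sum_(0 <= j < N) p j (xi j x)) =
  \prod_(0 <= j < N) coherence P (fun x => w j (xi j x)) (fun x => p j (xi j x))].
Proof.
elim: N => [|N [IHw IHm IHc]].
  have W1 : weight P (fun x => 1).
    split => //; first exact: finite_measure_integrable_cst.
    by rewrite Rintegral_probability_cst.
  rewrite big_nil; under eq_fun do rewrite big_nil; under [X in coherence _ _ X]eq_fun do rewrite big_nil.
  by rewrite coherence_cst // Rintegral_probability_cst !big_nil.
pose Z M x := (\prod_(0 <= j < M) w j (xi j x), \sum_(0 <= j < M) p j (xi j x)).
pose phi j (z : (R * R) * T) := (z.1.1 * w j z.2, z.1.2 + p j z.2).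
have mphi j : measurable_fun setT (phi j).
  apply: measurable_fun_pair.
    by apply: measurable_funM; [apply: (measurableT_comp (f := fst))|exact: measurableT_comp].
  by apply: measurable_funD; [apply: (measurableT_comp (f := snd))|exact: measurableT_comp].
have Z0 x : Z 0 x = (1, 0) by rewrite /Z !big_nil.
have ZS M x : Z M.+1 x = phi M (Z M x, xi M x) by rewrite /Z /phi !big_nat_recr.
have ind := state_independent_next xi_indep mphi Z0 ZS N.
have mwp : measurable_fun setT (fun t => (w N t, p N t)) by exact: measurable_fun_pair.
have mid : measurable_fun setT (fun z : R * R => z) by [].
have ind' := independent2_comp mid mwp ind.
have mpN : measurable_fun setT (fun x => \sum_(0 <= j < N) p j (xi j x)).
  by apply: measurable_sum => j; exact: measurableT_comp.
have [W Mm C] := coherenceM IHw mpN (ww N) (measurableT_comp (mp N) (measurable_funP (xi N))) ind'.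
rewrite !big_nat_recr //= -IHc -C -IHm -Mm.
under eq_fun do rewrite big_nat_recr //=; under [X in coherence _ _ X]eq_fun do rewrite big_nat_recr //=.
done.
Qed.

End CoherenceProduct.

(** * Tilted limits of the linear forms *)

Definition countable_base (T : topologicalType) : Prop :=
  exists (U : Type) (V : U -> set T), [/\ countable [set: U], forall u, open (V u)
    & forall (W : set T) x, open W -> W x -> exists u, V u x /\ V u `<=` W].

Lemma continuous_borel (T U : ptopologicalType) (f : T -> U) :
  continuous f -> measurable_fun setT (f : borel T -> borel U).
Proof.
move=> /continuousP cf; apply: (@measurability _ _ (borel T) (borel U) _ _ (@open U) erefl) => _ [A oA <-].
by rewrite setTI; apply: sub_sigma_algebra; exact: cf.
Qed.

Lemma continuous_borel_real {R : realType} (T : ptopologicalType) (f : T -> R) :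
  continuous f -> measurable_fun setT (f : borel T -> R).
Proof.
move=> /continuousP cf; apply: (measurability _ (RGenOpens.measurableE R)).
move=> _ [_ [a [b ->] <-]]; rewrite setTI; apply: sub_sigma_algebra.
by apply: cf; exact: interval_open.
Qed.

(** With a countable base, an open set of the product is a countable union of open rectangles. *)
Lemma countable_base_pair {d} {Omega : measurableType d} (T : ptopologicalType)
    (f g : Omega -> T) : countable_base T ->
  measurable_fun setT (f : Omega -> borel T) -> measurable_fun setT (g : Omega -> borel T) ->
  measurable_fun setT ((fun w => (f w, g w)) : Omega -> borel (T * T)%type).
Proof.
move=> [U [V [cU oV bV]]] mf mg.
apply: (@measurability _ _ Omega (borel (T * T)%type) _ _ (@open (T * T)%type) erefl).
move=> _ [W oW <-]; rewrite setTI.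
pose F (u : U * U) : set Omega :=
  if pselect (V u.1 `*` V u.2 `<=` W) is left _ then f @^-1` V u.1 `&` g @^-1` V u.2 else set0.
have -> : (fun w => (f w, g w)) @^-1` W = \bigcup_u F u.
  apply/seteqP; split => w /=.
    move=> Ow; have [[A B] [/= nA nB] AB] : nbhs (f w, g w) W by exact: open_nbhs_nbhs.
    move: nA nB; rewrite !nbhsE => -[A' [oA' A'w] A'A] [B' [oB' B'w] B'B].
    have [u [uw uA]] := bV _ _ oA' A'w; have [v [vw vB]] := bV _ _ oB' B'w.
    exists (u, v) => //; rewrite /F /=; case: pselect => // -[] [x y] /= [ux vy].
    by apply: AB; split => /=; [exact/A'A/uA|exact/B'B/vB].
  by move=> [u _]; rewrite /F; case: pselect => // uO [fu gu]; apply: uO.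
apply: countable_bigcupT_measurable.
  by rewrite -setXTT; exact: countableX.
move=> u; rewrite /F; case: pselect => // _; apply: measurableI.
  by have := mf measurableT (V u.1); rewrite setTI; apply; exact: sub_sigma_algebra.
by have := mg measurableT (V u.2); rewrite setTI; apply; exact: sub_sigma_algebra.
Qed.

Lemma countable_base_RnG {R : realType} (n : nat) (G : zmodType) :
  countable [set: G] -> countable_base (RnG R n G).
Proof.
move=> cG.
exists ('cV[rat]_n * nat * discrete_group G)%type,
  (fun u => ball (map_mx (ratr : rat -> R) u.1.1) (u.1.2.+1%:R^-1) `*` [set u.2]); split.
- by rewrite -setXTT; apply: countableX => //; exact: countableP.
- move=> [[q k] g] /=; rewrite -[X in open X]/(fst @^-1` _ `&` snd @^-1` _).
  apply: openI.
    by apply: open_comp => [[x y] _|]; [exact: cvg_fst|exact: ball_open].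
  by apply: open_comp => [[x y] _|]; [exact: cvg_snd|exact: discrete_open].
- move=> W [x g] oW Oxg.
  have [[A B] [/= nA nB] AB] : nbhs (x, g) W by exact: open_nbhs_nbhs.
  have [e e0 eA] := (nbhs_ballP _ _).1 nA.
  have e20 : 0 < e / 2 by rewrite divr_gt0.
  have [k _ /(_ k (leqnn k)) /= ke] := near_infty_natSinv_lt (PosNum e20).
  have k0 : 0 < k.+1%:R^-1 :> R by rewrite invr_gt0.
  have qx i : exists q : rat, `|ratr q - x i 0| < k.+1%:R^-1.
    have [q] := rat_in_itvoo (ltr_pwDr k0 (lexx (x i 0))).
    rewrite in_itv /= => /andP[q1 q2]; exists q.
    by rewrite gtr0_norm ?subr_gt0 // ltrBlDl.
  pose q : 'cV[rat]_n := \col_i sval (cid (qx i)).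
  have bq : ball (map_mx (ratr : rat -> R) q) (k.+1%:R^-1) x.
    split=> // i j; rewrite !mxE ord1 /ball /=; exact: svalP (cid (qx i)).
  exists (q, k, g) => /=; split; first by split.
  move=> [y g'] [/= by' ->]; apply: AB; split => /=; last exact: nbhs_singleton.
  apply: eA; apply: le_ball (ball_triangle (ball_sym bq) by').
  by rewrite (splitr e) lerD // ltW.
Qed.

Definition bounded_fun {T : Type} {R : realType} (f : T -> R) : Prop :=
  exists M : R, forall x, `|f x| <= M.

Lemma bounded_Rintegrable {d} {T : measurableType d} {R : realType} (P : probability T R)
  (f : T -> R) : measurable_fun setT f -> bounded_fun f -> Rintegrable P f.
Proof.
move=> mf [M fM]; apply: (@Rintegrable_le _ _ _ _ _ (fun=> M)) => //.
exact: finite_measure_integrable_cst.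
Qed.

(** Weak convergence of the pairs and independence of the limits, reduced to products of test
    functions; only the two separate limit laws remain. *)
Definition product_limit {d} {Omega : measurableType d} {R : realType} (P : probability Omega R)
    {T : ptopologicalType} (S1 S2 : nat -> Omega -> T) (lam1 lam2 : probability (borel T) R) : Prop :=
  forall a b : T -> R, continuous a -> continuous b -> bounded_fun a -> bounded_fun b ->
  \int[P]_w (a (S1 N w) * b (S2 N w)) @[N --> \oo] -->
    (\int[lam1]_x a x) * \int[lam2]_x b x.

Lemma product_limit_sym {d} {Omega : measurableType d} {R : realType} (P : probability Omega R)
    {T : ptopologicalType} (S1 S2 : nat -> Omega -> T) (lam1 lam2 : probability (borel T) R) :
  product_limit P S1 S2 lam1 lam2 -> product_limit P S2 S1 lam2 lam1.
Proof.
move=> h a b ca cb ba bb; rewrite mulrC.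
rewrite (_ : (fun N => _) = (fun N => \int[P]_w (b (S1 N w) * a (S2 N w)))); first exact: h.
by apply/funext => N; apply: eq_Rintegral => w _; rewrite mulrC.
Qed.

Lemma independent_limits_product {d} {Omega : measurableType d} {R : realType}
    (P : probability Omega R) {T : ptopologicalType} (S1 S2 : nat -> Omega -> T) :
  countable_base T -> (forall N, measurable_fun setT (S1 N : Omega -> borel T)) ->
  (forall N, measurable_fun setT (S2 N : Omega -> borel T)) ->
  independent_limits P S1 S2 ->
  exists lam1 lam2 : probability (borel T) R, product_limit P S1 S2 lam1 lam2.
Proof.
move=> cbT mS1 mS2 [lam [lamw lami]].
have cfst : continuous (fst : T * T -> T) by move=> [x y]; exact: cvg_fst.
have csnd : continuous (snd : T * T -> T) by move=> [x y]; exact: cvg_snd.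
have mfst : measurable_fun setT (fst : borel (T * T)%type -> borel T) by exact: continuous_borel.
have msnd : measurable_fun setT (snd : borel (T * T)%type -> borel T) by exact: continuous_borel.
pose F1 : {mfun borel (T * T)%type >-> borel T} := HB.pack (fst : borel (T * T)%type -> borel T)
  (isMeasurableFun.Build _ _ _ _ _ mfst).
pose F2 : {mfun borel (T * T)%type >-> borel T} := HB.pack (snd : borel (T * T)%type -> borel T)
  (isMeasurableFun.Build _ _ _ _ _ msnd).
exists (distribution lam F1), (distribution lam F2) => a b ca cb ba bb.
have ma := continuous_borel_real ca; have mb := continuous_borel_real cb.
have [Ma hMa] := ba; have [Mb hMb] := bb.
pose h (z : T * T) := a z.1 * b z.2.
have ch : continuous h.
  move=> z; apply: (@cvgM _ _ _ _ (fun z : T * T => a z.1) (fun z : T * T => b z.2)).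
    by apply: (@cvg_comp _ _ _ fst a) (ca _); exact: cfst.
  by apply: (@cvg_comp _ _ _ snd b) (cb _); exact: csnd.
have bh : bounded_fun h.
  by exists (Ma * Mb) => z; rewrite normrM; apply: ler_pM.
have mh := continuous_borel_real ch.
have ind : independent2 lam (fst : borel (T * T)%type -> borel T) (snd : borel (T * T)%type -> borel T).
  by move=> A B mA mB; exact: (lami A B mA mB).
have ia : Rintegrable lam (fun z : borel (T * T)%type => a z.1).
  apply: bounded_Rintegrable; first exact: (measurableT_comp ma mfst).
  by exists Ma => z.
have ib : Rintegrable lam (fun z : borel (T * T)%type => b z.2).
  apply: bounded_Rintegrable; first exact: (measurableT_comp mb msnd).
  by exists Mb => z.
have [ih eh] := independent2_Rintegral (independent2_comp ma mb ind) ia ib.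
have e1 : \int[distribution lam F1]_x a x = \int[lam]_z a z.1.
  by rewrite /Rintegral integral_distribution //; exact/measurable_EFinP.
have e2 : \int[distribution lam F2]_x b x = \int[lam]_z b z.2.
  by rewrite /Rintegral integral_distribution //; exact/measurable_EFinP.
rewrite e1 e2 -eh.
have := lamw h ch bh.
rewrite [X in _ --> X](_ : _ = (\int[lam]_x h x)%:E); last by rewrite /Rintegral fineK // integrable_fin_num.
move/fine_cvg; apply: cvg_trans; apply: near_eq_cvg; near=> N.
rewrite /= /Rintegral; congr fine.
have mSS := countable_base_pair cbT (mS1 N) (mS2 N).
rewrite integral_pushforward //; first exact/measurable_EFinP.
apply: bounded_Rintegrable; first exact: (measurableT_comp mh mSS).
by have [M hM] := bh; exists M => w; exact: hM.
Unshelve. all: by end_near.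
Qed.

Lemma cvgn_approx {R : realType} (u : nat -> R) (l : R) :
  (forall e : R, 0 < e -> exists (v : nat -> R) (l' : R),
     [/\ v N @[N --> \oo] --> l', forall N, `|u N - v N| <= e & `|l' - l| <= e]) ->
  u N @[N --> \oo] --> l.
Proof.
move=> h; apply/cvgrPdist_le => e e0.
have e30 : 0 < e / 3 by rewrite divr_gt0.
have [v [l' [vl' uv l'l]]] := h _ e30.
move/cvgrPdist_le : vl' => /(_ _ e30); apply: filterS => N vN.
rewrite (_ : l - u N = - (l' - l) + (l' - v N) - (u N - v N)); last by ring.
apply: (le_trans (ler_normB _ _)); rewrite (_ : e = e / 3 + e / 3 + e / 3); last by field.
by apply: lerD => //; apply: (le_trans (ler_normD _ _)); rewrite normrN lerD.
Qed.

Lemma le_normr_Rintegral_bound {d} {T : measurableType d} {R : realType}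
    (mu : {measure set T -> \bar R}) (f g : T -> R) : measurable_fun setT f ->
  (forall x, `|f x| <= g x) -> Rintegrable mu g -> `|\int[mu]_x f x| <= \int[mu]_x g x.
Proof.
move=> mf fg ig; have if_ : Rintegrable mu f := Rintegrable_le mf fg ig.
apply: (le_trans (le_normr_Rintegral _ _)) => //.
apply: le_Rintegral => //; apply: (Rintegrable_le _ _ ig).
  exact: measurableT_comp.
by move=> x; rewrite normr_id.
Qed.

Lemma positive_weight {d} {T : measurableType d} {R : realType} (P : probability T R)
  (w : T -> R) : Rintegrable P w -> (forall x, 0 < w x) -> weight P w.
Proof.
move=> iw w0; split => //; first by move=> x; exact: ltW.
rewrite lt0r Rintegral_ge0 => [|x _]; last exact: ltW.
rewrite andbT; apply/eqP => h.
have mw := Rintegrable_measurable iw.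
have : (\int[P]_x `|(w x)%:E| = 0)%E.
  rewrite (eq_integral (fun x => (w x)%:E)); last by move=> x _; rewrite gee0_abs // lee_fin ltW.
  by rewrite -[LHS]fineK ?integrable_fin_num // -[fine _]/(\int[P]_x w x) h.
move/(ae_eq_integral_abs P measurableT (_ : measurable_fun setT (EFin \o w))).
move=> /(_ _); case; first exact/measurable_EFinP.
move=> N [mN PN0 hN].
have : P setT = 0%E.
  apply/eqP; rewrite eq_le measure_ge0 andbT -PN0 le_measure ?inE //.
  by move=> x _; apply: hN => /= /(_ I) [] /eqP; rewrite gt_eqF.
by rewrite probability_setT => /eqP; rewrite onee_eq0.
Qed.

Lemma truncation_bound {d} {T : measurableType d} {R : realType}
    (mu : {measure set T -> \bar R}) (f : T -> R) (C : R) :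
  measurable_fun setT f -> (forall x, 0 <= f x) ->
  (forall k : nat, (\int[mu]_x (Num.min (f x) k%:R)%:E <= C%:E)%E) ->
  (\int[mu]_x (f x)%:E <= C%:E)%E.
Proof.
move=> mf f0 h.
have fk x : (Num.min (f x) k%:R)%:E @[k --> \oo] --> (f x)%:E.
  apply: cvg_near_cst; near=> k; rewrite min_l //; near: k.
  exact: nbhs_infty_ger.
have -> : (\int[mu]_x (f x)%:E = \int[mu]_x limn (fun k => (Num.min (f x) k%:R)%:E))%E.
  by apply: eq_integral => x _; apply/esym/cvg_lim.
have mk (k : nat) : measurable_fun setT (fun x => (Num.min (f x) k%:R)%:E).
  by apply/measurable_EFinP; exact: measurable_minr.
have k0 (k : nat) x : (0 <= (Num.min (f x) k%:R)%:E)%E by rewrite lee_fin le_min f0 ler0n.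
have kl (k l : nat) x : (k <= l)%N -> ((Num.min (f x) k%:R)%:E <= (Num.min (f x) l%:R)%:E)%E.
  by move=> kl; rewrite lee_fin le_min !ge_min lexx /= ler_nat kl orbT.
rewrite monotone_convergence //; last by move=> x _ k l; exact: kl.
apply: lime_le; last by near=> k; exact: h.
by apply: ereal_nondecreasing_is_cvgn => k l lk; apply: ge0_le_integral => // x _; exact: kl.
Unshelve. all: by end_near.
Qed.

Lemma ge0_bounded_Rintegrable {d} {T : measurableType d} {R : realType}
    (mu : {measure set T -> \bar R}) (f : T -> R) (C : R) :
  measurable_fun setT f -> (forall x, 0 <= f x) -> (\int[mu]_x (f x)%:E <= C%:E)%E ->
  Rintegrable mu f /\ \int[mu]_x f x <= C.
Proof.
move=> mf f0 h; have fi : Rintegrable mu f.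
  apply/integrableP; split; first exact/measurable_EFinP.
  rewrite (eq_integral (fun x => (f x)%:E)); first by rewrite (le_lt_trans h) // ltry.
  by move=> x _; rewrite gee0_abs // lee_fin.
split => //; rewrite -lee_fin; apply: le_trans h.
by rewrite /Rintegral fineK // integrable_fin_num.
Qed.

Section TiltedLimit.
Context {d} {Omega : measurableType d} {R : realType} (P : probability Omega R).
Context {T : ptopologicalType} (S1 S2 : nat -> Omega -> T) (lam1 lam2 : probability (borel T) R).
Hypothesis mS1 : forall N, measurable_fun setT (S1 N : Omega -> borel T).
Hypothesis mS2 : forall N, measurable_fun setT (S2 N : Omega -> borel T).
Hypothesis S12 : product_limit P S1 S2 lam1 lam2.
Variables (W V : T -> R) (C : R).
Hypothesis cW : continuous W.
Hypothesis cV : continuous V.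
Hypothesis W0 : forall x, 0 < W x.
Hypothesis V0 : forall x, 0 <= V x.
Hypothesis VC : forall N, (\int[P]_w (V (S2 N w))%:E <= C%:E)%E.
Hypothesis WV : forall e : R, 0 < e -> exists2 B : R, 0 <= B & forall x, W x <= Num.min (W x) B + e * V x.

Let mW := continuous_borel_real cW.
Let mV := continuous_borel_real cV.

Let one_bounded : bounded_fun (fun _ : T => 1 : R).
Proof. by exists 1 => x; rewrite normr1. Qed.

Lemma product_limit_right (b : T -> R) : continuous b -> bounded_fun b ->
  \int[P]_w (b (S2 N w)) @[N --> \oo] --> \int[lam2]_x b x.
Proof.
move=> cb bb; have := S12 (fun x => @cst_continuous _ _ (1 : R) x) cb one_bounded bb.
rewrite Rintegral_probability_cst mul1r.
rewrite (_ : (fun N => _) = (fun N => \int[P]_w b (S2 N w))) //.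
by apply/funext => N; apply: eq_Rintegral => w _; rewrite mul1r.
Qed.

Let min_continuous (f : T -> R) (B : R) : continuous f -> continuous (fun x => Num.min (f x) B).
Proof. by move=> cf x; apply: continuous_min => //; [exact: cf|exact: cvg_cst]. Qed.

Let min_bounded (f : T -> R) (B : R) : 0 <= B -> (forall x, 0 <= f x) ->
  forall x, `|Num.min (f x) B| <= B.
Proof. by move=> B0 f0 x; rewrite ger0_norm ?ge_min ?lexx ?orbT // le_min f0. Qed.

Lemma majorant_integrable N : Rintegrable P (fun w => V (S2 N w)) /\ \int[P]_w V (S2 N w) <= C.
Proof.
by apply: ge0_bounded_Rintegrable => //; exact: (measurableT_comp mV (mS2 N)).
Qed.

(** Truncations of [V] are bounded and continuous, so their integrals converge; the bound [C] passes
    to the limit law and then to [V] itself. *)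
Lemma majorant_integrable_lim : Rintegrable lam2 V /\ \int[lam2]_x V x <= C.
Proof.
apply: ge0_bounded_Rintegrable => //; apply: truncation_bound => // k.
have cm := min_continuous (B := k%:R) cV; have bm := min_bounded (ler0n R k) V0.
have bm' : bounded_fun (fun x => Num.min (V x) k%:R) by exists k%:R.
have ii : Rintegrable lam2 (fun x => Num.min (V x) k%:R).
  by apply: bounded_Rintegrable => //; exact: continuous_borel_real.
rewrite -[leLHS]fineK ?integrable_fin_num // lee_fin.
apply: (@cvgn_le _ _ _ _ (product_limit_right cm bm')) => N.
have [iV VN] := majorant_integrable N; apply: le_trans VN.
apply: le_Rintegral => //; last by move=> w _; rewrite ge_min lexx.
apply: bounded_Rintegrable; last by exists k%:R => w.
exact: (measurableT_comp (continuous_borel_real cm) (mS2 N)).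
Qed.

Let WB : exists2 B : R, 0 <= B & forall x, W x <= B + V x.
Proof.
have [B B0 h] := WV ltr01; exists B => // x; apply: (le_trans (h x)).
by rewrite mul1r lerD2r ge_min lexx orbT.
Qed.

Lemma tilt_integrable N : Rintegrable P (fun w => W (S2 N w)).
Proof.
have [B B0 h] := WB.
apply: (@Rintegrable_le _ _ _ _ _ (fun w => B + V (S2 N w))).
- exact: (measurableT_comp mW (mS2 N)).
- by move=> w; rewrite gtr0_norm.
- apply: RintegrableD; first exact: finite_measure_integrable_cst.
  by have [] := majorant_integrable N.
Qed.

Lemma tilt_integrable_lim : Rintegrable lam2 W.
Proof.
have [B B0 h] := WB.
apply: (@Rintegrable_le _ _ _ lam2 W (fun w : borel T => B + V w)) => //.
- by move=> w; rewrite gtr0_norm.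
- apply: RintegrableD; first exact: finite_measure_integrable_cst.
  by have [] := majorant_integrable_lim.
Qed.

Lemma tilt_weight N : weight P (fun w => W (S2 N w)).
Proof. by apply: positive_weight => //; exact: tilt_integrable. Qed.

Lemma tilt_weight_lim : weight lam2 W.
Proof. by apply: positive_weight => //; exact: tilt_integrable_lim. Qed.

(** [W] may be unbounded, out of reach of weak convergence; [WV], a form of uniform integrability,
    allows it to be replaced by [Num.min (W x) B] up to a small error. The law [lam1] is not tilted,
    as [W] depends on the second form alone. *)
Lemma tilted_product_limit (a b : T -> R) : continuous a -> continuous b ->
  bounded_fun a -> bounded_fun b ->
  \int[P]_w (W (S2 N w) * (a (S1 N w) * b (S2 N w))) @[N --> \oo] -->
    (\int[lam1]_x a x) * \int[lam2]_x (W x * b x).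
Proof.
move=> ca cb [Ma hMa] [Mb hMb].
have Ma0 : 0 <= Ma by apply: le_trans (hMa point).
have Mb0 : 0 <= Mb by apply: le_trans (hMb point).
pose M := Ma * Mb * `|C| + 1.
have M0 : 0 < M by rewrite ltr_pwDr // !mulr_ge0.
have ma := continuous_borel_real ca; have mb := continuous_borel_real cb.
apply: cvgn_approx => e e0; have [B B0 hB] := WV (divr_gt0 e0 M0).
have eM0 : 0 < e / M by rewrite divr_gt0.
have cWB := min_continuous (B := B) cW.
have bWB := min_bounded B0 (fun x => ltW (W0 x)).
pose bB x := Num.min (W x) B * b x.
have cbB : continuous bB by move=> x; apply: cvgM; [exact: cWB|exact: cb].
have bbB : bounded_fun bB by exists (B * Mb) => x; rewrite normrM; apply: ler_pM.
have rest x : `|W x - Num.min (W x) B| <= e / M * V x.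
  by rewrite ger0_norm ?subr_ge0 ?ge_min ?lexx // lerBlDl; exact: hB.
exists (fun N => \int[P]_w (a (S1 N w) * bB (S2 N w))), ((\int[lam1]_x a x) * \int[lam2]_x bB x); split.
- by apply: S12 => //; exists Ma.
- move=> N; have [iV VN] := majorant_integrable N.
  have mw1 : measurable_fun setT (fun w => a (S1 N w)) := measurableT_comp ma (mS1 N).
  have mw2 : measurable_fun setT (fun w => b (S2 N w)) := measurableT_comp mb (mS2 N).
  have mw3 : measurable_fun setT (fun w => bB (S2 N w)) := measurableT_comp (continuous_borel_real cbB) (mS2 N).
  have i1 : Rintegrable P (fun w => W (S2 N w) * (a (S1 N w) * b (S2 N w))).
    apply: (weighted_integrable (M := Ma * Mb) (tilt_weight N)); first exact: measurable_funM.
    by move=> w; rewrite normrM ler_pM.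
  have i2 : Rintegrable P (fun w => a (S1 N w) * bB (S2 N w)).
    apply: bounded_Rintegrable; first exact: measurable_funM.
    have [Mc hMc] := bbB; exists (Ma * Mc) => w; rewrite normrM ler_pM //; exact: hMc.
  rewrite -RintegralB //.
  apply: (@le_trans _ _ (\int[P]_w (Ma * Mb * (e / M) * V (S2 N w)))).
    apply: le_normr_Rintegral_bound; last exact: RintegrableZ.
      by apply: measurable_funB; [exact: Rintegrable_measurable i1|exact: Rintegrable_measurable i2].
    move=> w; rewrite (_ : _ - _ = (a (S1 N w) * b (S2 N w)) * (W (S2 N w) - Num.min (W (S2 N w)) B)).
      rewrite normrM -[leRHS]mulrA; apply: ler_pM => //.
      by rewrite normrM ler_pM.
    by rewrite /bB; ring.
  rewrite RintegralZl //; apply: (@le_trans _ _ (Ma * Mb * (e / M) * `|C|)).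
    apply: ler_wpM2l; first exact: mulr_ge0 (mulr_ge0 Ma0 Mb0) (ltW eM0).
    by apply: (le_trans VN); exact: ler_norm.
  rewrite (_ : _ * `|C| = e * ((Ma * Mb * `|C|) / M)); last by ring.
  by rewrite ler_piMr ?ltW // ltr_pdivrMr // mul1r ltrDl.
- have [iV VN] := majorant_integrable_lim.
  have i1 : Rintegrable lam2 (fun x => W x * b x).
    exact: (weighted_integrable (M := Mb) tilt_weight_lim).
  have i2 : Rintegrable lam2 bB by apply: bounded_Rintegrable => //; exact: continuous_borel_real.
  rewrite -mulrBr normrM -RintegralB //.
  apply: (@le_trans _ _ (Ma * (Mb * (e / M) * C))).
    apply: ler_pM => //.
      have -> : Ma = \int[lam1]_x Ma by rewrite Rintegral_probability_cst.
      by apply: le_normr_Rintegral_bound => //; exact: finite_measure_integrable_cst.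
    apply: (@le_trans _ _ (\int[lam2]_w (Mb * (e / M) * V w))).
      apply: le_normr_Rintegral_bound; last exact: RintegrableZ.
        by apply: measurable_funB; [exact: Rintegrable_measurable i2|exact: Rintegrable_measurable i1].
      move=> w; rewrite (_ : _ - _ = - (b w * (W w - Num.min (W w) B))).
        by rewrite normrN normrM -[leRHS]mulrA; apply: ler_pM.
      by rewrite /bB; ring.
    by rewrite RintegralZl // ler_wpM2l //; exact: mulr_ge0 Mb0 (ltW eM0).
  apply: (@le_trans _ _ (Ma * (Mb * (e / M) * `|C|))).
    by rewrite ler_wpM2l // ler_wpM2l ?ler_norm //; exact: mulr_ge0 Mb0 (ltW eM0).
  rewrite (_ : _ * _ = e * ((Ma * Mb * `|C|) / M)); last by ring.
  by rewrite ler_piMr ?ltW // ltr_pdivrMr // mul1r ltrDl.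
Qed.

Lemma tilted_coherence_limit (chi psi : T -> R) : continuous chi -> continuous psi ->
  coherence P (fun w => W (S2 N w)) (fun w => chi (S1 N w) + psi (S2 N w)) @[N --> \oo] -->
    coherence lam1 (fun=> 1) chi * coherence lam2 W psi.
Proof.
move=> cchi cpsi.
have cc (f : T -> R) : continuous f -> continuous (fun x => cos (f x)).
  by move=> cf x; apply: (continuous_comp (cf x)); exact: continuous_cos.
have cs (f : T -> R) : continuous f -> continuous (fun x => sin (f x)).
  by move=> cf x; apply: (continuous_comp (cf x)); exact: continuous_sin.
have bc (f : T -> R) : bounded_fun (fun x => cos (f x)) by exists 1 => x; exact: cos_max.
have bs (f : T -> R) : bounded_fun (fun x => sin (f x)) by exists 1 => x; exact: sin_max.
have mf (f : T -> R) N : continuous f -> measurable_fun setT (fun w => f (S2 N w)).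
  by move=> cf; exact: (measurableT_comp (continuous_borel_real cf) (mS2 N)).
have mf1 (f : T -> R) N : continuous f -> measurable_fun setT (fun w => f (S1 N w)).
  by move=> cf; exact: (measurableT_comp (continuous_borel_real cf) (mS1 N)).
have ii (f g : T -> R) N : continuous f -> continuous g -> bounded_fun f -> bounded_fun g ->
    Rintegrable P (fun w => W (S2 N w) * (f (S1 N w) * g (S2 N w))).
  move=> cf cg [Mf hf] [Mg hg]; apply: (weighted_integrable (M := Mf * Mg) (tilt_weight N)).
    by apply: measurable_funM; [exact: mf1|exact: mf].
  by move=> w; rewrite normrM ler_pM.
have L := tilted_product_limit.
have Lcc := L _ _ (cc _ cchi) (cc _ cpsi) (bc _) (bc _).
have Lss := L _ _ (cs _ cchi) (cs _ cpsi) (bs _) (bs _).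
have Lsc := L _ _ (cs _ cchi) (cc _ cpsi) (bs _) (bc _).
have Lcs := L _ _ (cc _ cchi) (cs _ cpsi) (bc _) (bs _).
have Lm : \int[P]_w W (S2 N w) @[N --> \oo] --> \int[lam2]_x W x.
  have := L _ _ (fun x => @cst_continuous _ _ (1 : R) x) (fun x => @cst_continuous _ _ (1 : R) x) one_bounded one_bounded.
  rewrite Rintegral_probability_cst.
  rewrite (_ : (fun N => _) = (fun N => \int[P]_w W (S2 N w))).
    by rewrite mul1r; under [X in _ --> X -> _]eq_Rintegral do rewrite mulr1.
  by apply/funext => N; apply: eq_Rintegral => w _; rewrite !mulr1.
have icc N := ii _ _ N (cc _ cchi) (cc _ cpsi) (bc _) (bc _).
have iss N := ii _ _ N (cs _ cchi) (cs _ cpsi) (bs _) (bs _).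
have isc N := ii _ _ N (cs _ cchi) (cc _ cpsi) (bs _) (bc _).
have ics N := ii _ _ N (cc _ cchi) (cs _ cpsi) (bc _) (bs _).
have m0 := weight_mass tilt_weight_lim.
rewrite /coherence Rintegral_probability_cst expr1n divr1 mulrA.
apply: cvgM; last first.
  apply: cvgV; first by rewrite expf_neq0 // gt_eqF.
  by rewrite expr2; apply: cvgM.
have eC : (fun N => wcos P (fun w => W (S2 N w)) (fun w => chi (S1 N w) + psi (S2 N w))) =
  (fun N => \int[P]_w (W (S2 N w) * (cos (chi (S1 N w)) * cos (psi (S2 N w)))) -
            \int[P]_w (W (S2 N w) * (sin (chi (S1 N w)) * sin (psi (S2 N w))))).
  apply/funext => N; rewrite -RintegralB //.
  by apply: eq_Rintegral => w _; rewrite cosD mulrBr.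
have eS : (fun N => wsin P (fun w => W (S2 N w)) (fun w => chi (S1 N w) + psi (S2 N w))) =
  (fun N => \int[P]_w (W (S2 N w) * (sin (chi (S1 N w)) * cos (psi (S2 N w)))) +
            \int[P]_w (W (S2 N w) * (cos (chi (S1 N w)) * sin (psi (S2 N w))))).
  apply/funext => N; rewrite -RintegralD //.
  by apply: eq_Rintegral => w _; rewrite sinD mulrDr.
have one1 (m : {measure set (borel T) -> \bar R}) (f : T -> R) : \int[m]_x (1 * f x) = \int[m]_x f x.
  by apply: eq_Rintegral => x _; rewrite mul1r.
rewrite {2}/wcos {2}/wsin !one1.
set C1 := \int[lam1]_x cos (chi x) in Lcc Lcs *; set Si := \int[lam1]_x sin (chi x) in Lss Lsc *.
rewrite (_ : (C1 ^+ 2 + Si ^+ 2) * (wcos lam2 W psi ^+ 2 + wsin lam2 W psi ^+ 2) =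
  (C1 * wcos lam2 W psi - Si * wsin lam2 W psi) ^+ 2 +
  (Si * wcos lam2 W psi + C1 * wsin lam2 W psi) ^+ 2); last by ring.
have hC : wcos P (fun w => W (S2 N w)) (fun w => chi (S1 N w) + psi (S2 N w)) @[N --> \oo] -->
  C1 * wcos lam2 W psi - Si * wsin lam2 W psi by rewrite eC; exact: cvgB.
have hS : wsin P (fun w => W (S2 N w)) (fun w => chi (S1 N w) + psi (S2 N w)) @[N --> \oo] -->
  Si * wcos lam2 W psi + C1 * wsin lam2 W psi by rewrite eS; exact: cvgD.
by rewrite !expr2; under eq_fun do rewrite !expr2; apply: cvgD; apply: cvgM.
Qed.

End TiltedLimit.

(** * Exponential moments from finite differences *)

Section TrigDifferences.
Context {R : realType}.

(** The binomial coefficients are left implicit: all that matters is that a difference of coherences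
    is a finite linear combination, to which [gram_ge] applies. *)
Lemma fdiffn_linear (l : nat) : exists a : nat -> R, forall f : nat -> R,
  fdiffn l f 0 = \sum_(i < l.+1) a i * f i.
Proof.
suff H : forall i, exists a : nat -> R, forall f : nat -> R,
    fdiffn l f i = \sum_(j < l.+1) a j * f (i + j)%N.
  by have [a ha] := H 0%N; exists a.
elim: l => [|l IH] i.
  by exists (fun=> 1) => f; rewrite big_ord_recl big_ord0 mul1r addr0 addn0.
have [a ha] := IH i; have [b hb] := IH i.+1.
exists (fun j => (if j is j'.+1 then b j' else 0) - (if (j <= l)%N then a j else 0)) => f.
rewrite fdiffnS ha hb.
under [RHS]eq_bigr do rewrite mulrBl; rewrite sumrB; congr (_ - _).
  by rewrite [RHS]big_ord_recl mul0r add0r; apply: eq_bigr => j _; rewrite addSnnS.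
rewrite [RHS]big_ord_recr /= ltnn mul0r addr0.
by apply: eq_bigr => j _; rewrite -ltnS ltn_ord.
Qed.

(** Cosines of an arithmetic progression are eigenvectors of the second central difference, with
    eigenvalue [- (2 sin (th / 2)) ^ 2]; the index [i + m] recentres the forward differences. *)
Lemma fdiffn_cos (m i : nat) (th b : R) :
  fdiffn m.*2 (fun i => cos (i%:R * th + b)) i =
  (- (2 * sin (th / 2)) ^+ 2) ^+ m * cos ((i + m)%:R * th + b).
Proof.
elim: m i => [|m IH] i; first by rewrite expr0 mul1r addn0.
rewrite doubleS !fdiffnS !IH.
set x := (i.+1 + m)%:R * th + b; set q := - (2 * sin (th / 2)) ^+ 2; rewrite [q ^+ m.+1]exprSr.
have -> : (i.+2 + m)%:R * th + b = x + th by rewrite /x !addSn -!natr1; ring.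
have -> : (i + m)%:R * th + b = x - th by rewrite /x !addSn -!natr1; ring.
have -> : (i + m.+1)%:R * th + b = x by rewrite /x addSnnS.
rewrite cosD cosB -!mulrBr -[RHS]mulrA; congr (_ * _); rewrite /q exprMn.
have h := one_minus_cos th.
rewrite (_ : cos th = 1 - 2 * sin (th / 2) ^+ 2); last by rewrite -h; ring.
ring.
Qed.

Lemma sin_le_id (x : R) : 0 <= x -> sin x <= x.
Proof.
move=> x0.
have dS (r : R) : is_derive r (1 : R) (fun r => r - sin r) (1 - cos r) by exact: is_deriveB.
have [c _] := is_derive_mvt 0 x dS; rewrite sin0 !subr0 => e.
by rewrite -subr_ge0 e mulr_ge0 // subr_ge0 cos_le1.
Qed.

Lemma sin_ge_half (x : R) : `|x| <= 1 -> `|x| / 2 <= `|sin x|.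
Proof.
wlog x0 : x / 0 <= x.
  move=> h; case: (leP 0 x) => [/h//|x0] x1.
  by have := h (- x); rewrite sinN !normrN oppr_ge0 ltW //; apply.
rewrite (ger0_norm x0) => x1; apply: le_trans (ler_norm _).
have dS (r : R) : is_derive r (1 : R) (fun r => sin r - r) (cos r - 1) by exact: is_deriveB.
have [c] := is_derive_mvt 0 x dS; rewrite min_l // max_r // sin0 !subr0 => /andP[c0 cx] e.
have c2 : sin (c / 2) ^+ 2 <= (c / 2) ^+ 2.
  apply: lerXn2r; rewrite ?nnegrE ?divr_ge0 //; last by rewrite sin_le_id // divr_ge0.
  apply: sin_ge0_pi; rewrite divr_ge0 //=.
  by have := pi_ge2 R; lra.
have c1 : 1 / 2 <= cos c by have := one_minus_cos c; nra.
have : 0 <= (cos c - 1 / 2) * x by rewrite mulr_ge0 // subr_ge0.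
by nra.
Qed.

Lemma cosh_partial_sum (x : R) (N : nat) :
  \sum_(0 <= l < N.*2) (x ^+ l / l`!%:R + (- x) ^+ l / l`!%:R) =
  2 * \sum_(0 <= m < N) x ^+ m.*2 / (m.*2)`!%:R.
Proof.
elim: N => [|N IH]; first by rewrite !big_geq // mulr0.
rewrite doubleS !big_nat_recr //= IH mulrDr exprNn [(- x) ^+ N.*2.+1]exprNn.
by rewrite -[(-1) ^+ N.*2]signr_odd -[(-1) ^+ N.*2.+1]signr_odd /= odd_double /= expr0 expr1; ring.
Qed.

Lemma cosh_cvg (x : R) :
  2 * \sum_(0 <= m < N) x ^+ m.*2 / (m.*2)`!%:R @[N --> \oo] --> expR x + expR (- x).
Proof.
have cv (y : R) : \sum_(0 <= l < N.*2) y ^+ l / l`!%:R @[N --> \oo] --> expR y.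
  have d : N.*2 @[N --> \oo] --> \oo.
    move=> A [N0 _ h]; exists N0 => // N /= N0N; apply: h => /=.
    by apply: (leq_trans N0N); rewrite -addnn leq_addl.
  have := cvg_comp _ _ d (is_cvg_series_exp_coeff y).
  rewrite (_ : (fun N => _) = (series (exp_coeff y) \o double)) //.
under eq_fun do rewrite -cosh_partial_sum big_split; exact: cvgD.
Qed.

(** Only even powers occur, so the tail of the series at [x] is at most the tail at [X]. *)
Lemma cosh_uniform (X e : R) : 0 <= X -> 0 < e -> exists M : nat, forall x : R, `|x| <= X ->
  expR x + expR (- x) <= 2 * \sum_(0 <= m < M) x ^+ m.*2 / (m.*2)`!%:R + e.
Proof.
move=> X0 e0; have := @cosh_cvg X; move/cvgrPdist_le => /(_ e e0)[M _ /(_ M (leqnn M)) /= hM].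
exists M => x xX; apply: (cvgn_le (@cosh_cvg x)) => N.
have t0 (y : R) m : 0 <= y ^+ m.*2 / (m.*2)`!%:R.
  by rewrite divr_ge0 // -mul2n exprM exprn_ge0 // sqr_ge0.
have [NM|MN] := leqP N M.
  rewrite (big_cat_nat (n := N) _ NM) //= mulrDr -addrA lerDl.
  by apply: addr_ge0; [rewrite mulr_ge0 // sumr_ge0|exact: ltW].
rewrite (big_cat_nat (n := M) _ (ltnW MN)) //= mulrDr lerD2l.
apply: (@le_trans _ _ (2 * \sum_(M <= m < N) X ^+ m.*2 / (m.*2)`!%:R)).
  rewrite ler_pM2l //; apply: ler_sum => m _; rewrite ler_pM2r ?invr_gt0 ?ltr0n ?fact_gt0 //.
  rewrite -mul2n !exprM; apply: lerXn2r; rewrite ?nnegrE ?sqr_ge0 //.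
  by rewrite -real_normK ?num_real //; apply: lerXn2r; rewrite ?nnegrE.
have CN : 2 * \sum_(0 <= m < N) X ^+ m.*2 / (m.*2)`!%:R <= expR X + expR (- X).
  apply: (nondecreasing_cvgn_lim_ge _ (@cosh_cvg X)) => n.
  by rewrite big_nat_recr //= mulrDr lerDl mulr_ge0.
have := ler_norm (expR X + expR (- X) - 2 * \sum_(0 <= m < M) X ^+ m.*2 / (m.*2)`!%:R).
move: CN; rewrite (big_cat_nat (n := M) _ (ltnW MN)) //= mulrDr; lra.
Qed.

End TrigDifferences.

Definition window {T : Type} {R : realType} (p : T -> R) (B : R) (x : T) : R :=
  ((`|p x| <= B)%R : bool)%:R.

Lemma window_measurable {d} {T : measurableType d} {R : realType} (p : T -> R) (B : R) :
  measurable_fun setT p -> measurable_fun setT (window p B).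
Proof.
move=> mp; apply: (measurableT_comp (f := fun b : bool => b%:R : R)) => //.
by apply: measurable_fun_ler => //; exact: measurableT_comp.
Qed.

Lemma window_ge0 {T : Type} {R : realType} (p : T -> R) (B : R) x : 0 <= window p B x.
Proof. exact: ler0n. Qed.

Lemma window_in {T : Type} {R : realType} (p : T -> R) (B : R) x : `|p x| <= B -> window p B x = 1.
Proof. by rewrite /window => ->. Qed.

Lemma window_out {T : Type} {R : realType} (p : T -> R) (B : R) x : B < `|p x| -> window p B x = 0.
Proof. by rewrite /window ltNge => /negbTE ->. Qed.

Lemma window_le {T : Type} {R : realType} (p : T -> R) (B C : R) x : B <= C ->
  window p B x <= window p C x.
Proof.
move=> BC; rewrite /window ler_nat; case: (leP (`|p x|) B) => // pB.
by rewrite (le_trans pB).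
Qed.

Lemma window_bound {d} {T : measurableType d} {R : realType}
    (mu : {measure set T -> \bar R}) (f p : T -> R) (C : R) :
  measurable_fun setT f -> measurable_fun setT p -> (forall x, 0 <= f x) ->
  (forall k : nat, (\int[mu]_x (f x * window p k%:R x)%:E <= C%:E)%E) ->
  (\int[mu]_x (f x)%:E <= C%:E)%E.
Proof.
move=> mf mp f0 h.
have fk x : (f x * window p k%:R x)%:E @[k --> \oo] --> (f x)%:E.
  apply: cvg_near_cst; near=> k; rewrite window_in ?mulr1 //; near: k.
  exact: nbhs_infty_ger.
have -> : (\int[mu]_x (f x)%:E = \int[mu]_x limn (fun k => (f x * window p k%:R x)%:E))%E.
  by apply: eq_integral => x _; apply/esym/cvg_lim.
have mk (k : nat) : measurable_fun setT (fun x => (f x * window p k%:R x)%:E).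
  apply/measurable_EFinP; apply: measurable_funM => //.
  exact: window_measurable.
have k0 (k : nat) x : (0 <= (f x * window p k%:R x)%:E)%E by rewrite lee_fin mulr_ge0 // window_ge0.
have kl (k l : nat) x : (k <= l)%N ->
    ((f x * window p k%:R x)%:E <= (f x * window p l%:R x)%:E)%E.
  by move=> kl; rewrite lee_fin ler_wpM2l // window_le // ler_nat.
rewrite monotone_convergence //; last by move=> x _ k l; exact: kl.
apply: lime_le; last by near=> k; exact: h.
by apply: ereal_nondecreasing_is_cvgn => k l lk; apply: ge0_le_integral => // x _; exact: kl.
Unshelve. all: by end_near.
Qed.

(* On a window of [psi], cosh (eta (psi x - psi y)) is dominated by a series of
   the powers (2 sin (h (psi x - psi y) / 2)) ^ (2 m), whose integrals are central
   differences of the coherence [k]; the bound on these lets the window grow. *)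
Section TwoSidedMoments.
Context {d} {T : measurableType d} {R : realType} (mu : {measure set T -> \bar R}).
Variables (w psi : T -> R).
Hypotheses (ww : weight mu w) (mpsi : measurable_fun setT psi).
Variables (a Cb rho eta : R).
Hypotheses (a0 : 0 < a) (rho0 : 0 < rho) (Cb0 : 0 <= Cb) (eta0 : 0 < eta) (aeta : 4 * a * eta <= 1).
Let k s := coherence mu w (fun x => s * psi x).
Hypothesis kb : forall (h : R) (m : nat), 0 < h -> m%:R * h <= rho ->
  `|fdiffn m.*2 (fun i => k ((i%:R - m%:R) * h)) 0| <= (m.*2)`!%:R * ((a * h) ^+ m.*2 * Cb).

Let W := \int[mu]_x w x.

Lemma window_product (B : nat) :
  (\int[mu]_x (w x * (expR (eta * psi x) * window psi B%:R x))) *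
  (\int[mu]_x (w x * (expR (- (eta * psi x)) * window psi B%:R x))) <= W ^+ 2 * (4 * Cb).
Proof.
have [M hM] := @cosh_uniform R (2 * B.+1%:R * eta) 1
  (mulr_ge0 (mulr_ge0 (ler0n R 2) (ler0n R B.+1)) (ltW eta0)) ltr01.
(* The two bounds on [h] serve to stay where [|sin x| >= |x| / 2] for the phase differences in the
   window, and to use [kb] up to order [M]. *)
pose h := Num.min (B.+1%:R^-1) (rho / M.+1%:R).
have M0 : 0 < M.+1%:R :> R by [].
have h0 : 0 < h by rewrite lt_min invr_gt0 ltr0n /= divr_gt0.
have hB : h * B.+1%:R <= 1 by rewrite -ler_pdivlMr // div1r ge_min lexx.
have hM' (m : nat) : (m <= M)%N -> m%:R * h <= rho.
  move=> mM; apply: (@le_trans _ _ (M.+1%:R * (rho / M.+1%:R))).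
    apply: ler_pM (ler0n _ _) (ltW h0) _ _; first by rewrite ler_nat (leqW mM).
    by rewrite ge_min lexx orbT.
  by rewrite mulrC divfK // gt_eqF.
(* By [|eta z| <= (2 eta / h) * |2 sin (h z / 2)|], these are the coefficients of the series of 2
   cosh in powers of the sine; the extra 1 at [m = 0] pays for the truncation error. *)
pose A (m : nat) : R := 2 * (2 * eta / h) ^+ m.*2 / (m.*2)`!%:R + (m == 0)%:R.
have A0 m : 0 <= A m.
  by rewrite addr_ge0 // divr_ge0 // mulr_ge0 // exprn_ge0 // divr_ge0 ?mulr_ge0 // ltW.
pose c m : nat -> R := sval (cid (@fdiffn_linear R m.*2)).
have cE m f : fdiffn m.*2 f 0 = \sum_(i < m.*2.+1) c m i * f i by exact: (svalP (cid (@fdiffn_linear R m.*2)) f).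
pose r := [seq (m, i) | m <- iota 0 M.+1, i <- iota 0 (m.*2.+1)].
pose q (i : nat * nat) : R := (i.2%:R - i.1%:R) * h.
pose p (i : nat * nat) x := q i * psi x.
(* The sign cancels that of the eigenvalue in [fdiffn_cos]. *)
pose al (i : nat * nat) : R := A i.1 * (-1) ^+ i.1 * c i.1 i.2.
have mp i : measurable_fun setT (p i) by exact: measurable_funM.
have sumE (g : R -> R) : \sum_(i <- r) al i * g (q i) =
    \sum_(0 <= m < M.+1) A m * (-1) ^+ m * fdiffn m.*2 (fun i => g ((i%:R - m%:R) * h)) 0.
  rewrite /r big_allpairs_dep /= /index_iota subn0; apply: eq_bigr => m _.
  rewrite cE mulr_sumr -(big_mkord xpredT (fun i => A m * (-1) ^+ m * (c m i * g ((i%:R - m%:R) * h)))).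
  by rewrite /index_iota subn0; apply: eq_bigr => i _; rewrite /al /q /= !mulrA.
pose f x := expR (eta * psi x) * window psi B%:R x.
pose g x := expR (- (eta * psi x)) * window psi B%:R x.
have mind := window_measurable B%:R mpsi.
have mf : measurable_fun setT f.
  apply: measurable_funM => //; apply: measurableT_comp => //; exact: measurable_funM.
have mg : measurable_fun setT g.
  apply: measurable_funM => //; apply: measurableT_comp => //.
  by apply: measurableT_comp => //; exact: measurable_funM.
have eb x (z : R) : `|z| = eta -> expR (z * psi x) * window psi B%:R x <= expR (eta * B%:R).
  move=> ze; case: (leP (`|psi x|) B%:R) => pB; last by rewrite window_out // mulr0 expR_ge0.
  rewrite window_in // mulr1 ler_expR (le_trans (ler_norm _)) // normrM ze ler_pM2l //.
have fM x : `|f x| <= expR (eta * B%:R).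
  by rewrite ger0_norm ?mulr_ge0 ?expR_ge0 ?window_ge0 // /f eb // gtr0_norm.
have gM x : `|g x| <= expR (eta * B%:R).
  by rewrite ger0_norm ?mulr_ge0 ?expR_ge0 ?window_ge0 // /g -mulNr eb // normrN gtr0_norm.
have key x y : f x * g y <= \sum_(i <- r) al i * cos (p i x - p i y).
  pose z := psi x - psi y.
  have -> : \sum_(i <- r) al i * cos (p i x - p i y) =
      \sum_(0 <= m < M.+1) A m * (2 * sin (h * z / 2)) ^+ m.*2.
    rewrite (eq_bigr (fun i => al i * cos (q i * z))); last by move=> i _; rewrite /p mulrBr.
    rewrite (sumE (fun s => cos (s * z))); apply: eq_bigr => m _.
    rewrite (@eq_fdiffn _ _ _ (fun i => cos (i%:R * (h * z) + - (m%:R * (h * z))))); last first.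
      by move=> i; congr cos; ring.
    rewrite fdiffn_cos add0n subrr cos0 mulr1 -mulrA; congr (_ * _).
    by rewrite -mul2n exprM -exprMn mulN1r opprK.
  have rhs0 : 0 <= \sum_(0 <= m < M.+1) A m * (2 * sin (h * z / 2)) ^+ m.*2.
    by apply: sumr_ge0 => m _; rewrite mulr_ge0 // -mul2n exprM exprn_ge0 // sqr_ge0.
  rewrite /f /g mulrACA; case: (leP (`|psi x|) B%:R) => px; last by rewrite (window_out px) mul0r mulr0.
  case: (leP (`|psi y|) B%:R) => py; last by rewrite (window_out py) !mulr0.
  rewrite !window_in // !mulr1 -expRD -mulrBr -/z.
  have zB : `|z| <= 2 * B.+1%:R.
    apply: (le_trans (ler_normB _ _)); rewrite mulr_natl mulr2n.
    by apply: lerD; [apply: (le_trans px)|apply: (le_trans py)]; rewrite ler_nat.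
  have ezB : `|eta * z| <= 2 * B.+1%:R * eta by rewrite normrM gtr0_norm // mulrC ler_pM2r.
  apply: (@le_trans _ _ (expR (eta * z) + expR (- (eta * z)))); first by rewrite lerDl expR_ge0.
  apply: (le_trans (hM _ ezB)).
  under [leRHS]eq_bigr do rewrite mulrDl.
  rewrite big_split /=; apply: lerD; last first.
    rewrite big_nat_recl //= mul1r expr0 lerDl sumr_ge0 // => m _.
  rewrite big_nat_recr //= mulr_sumr -[leLHS]addr0; apply: lerD; last first.
    rewrite mulr_ge0 //; first by rewrite divr_ge0 // mulr_ge0 // exprn_ge0 // divr_ge0 ?mulr_ge0 // ltW.
    by rewrite -mul2n exprM exprn_ge0 // sqr_ge0.
  apply: ler_sum => m _; set F : R := (m.*2)`!%:R; have F0 : 0 < F by rewrite ltr0n fact_gt0.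
  set Y := (2 * eta / h) ^+ m.*2; set S := (2 * _) ^+ m.*2.
  rewrite (_ : 2 * Y / F * S = 2 * (Y * S / F)); last by ring.
  rewrite ler_pM2l // ler_pM2r ?invr_gt0 // /Y /S -exprMn.
  rewrite -mul2n !exprM; apply: lerXn2r; rewrite ?nnegrE ?sqr_ge0 //.
  rewrite -real_normK ?num_real // -[leRHS]real_normK ?num_real //.
  apply: lerXn2r; rewrite ?nnegrE //.
  have hz : `|h * z / 2| <= 1.
    rewrite !normrM (gtr0_norm h0) (@gtr0_norm _ 2^-1) // ler_pdivrMr // mul1r.
    by apply: (@le_trans _ _ (h * (2 * B.+1%:R))); [rewrite ler_pM2l|move: hB; lra].
  have := sin_ge_half hz; rewrite !normrM (gtr0_norm h0) (gtr0_norm eta0) (@gtr0_norm _ 2^-1) // (@gtr0_norm _ 2) //.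
  rewrite (@gtr0_norm _ (h^-1)) ?invr_gt0 // => sz.
  rewrite (_ : `|_| = 4 * (h * `|z| / 2 / 2) / h); last by field; rewrite gt_eqF.
  set sn := `|sin _| in sz *; rewrite (_ : 2 * eta / h * (2 * sn) = eta * (4 * sn / h)); last by ring.
  rewrite ler_pM2l //  ler_pM2r ?invr_gt0 // ler_pM2l //.
have := gram_ge ww mp mf mg fM gM key; move=> /le_trans; apply.
have W0 : 0 < W := weight_mass ww.
have -> : \sum_(i <- r) al i * (wcos mu w (p i) ^+ 2 + wsin mu w (p i) ^+ 2) =
    W ^+ 2 * \sum_(i <- r) al i * k (q i).
  rewrite mulr_sumr; apply: eq_bigr => i _; rewrite mulrCA; congr (_ * _).
  by rewrite /k /coherence mulrC divfK // expf_neq0 // gt_eqF.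
rewrite ler_pM2l ?exprn_gt0 // sumE.
(* [kb] cancels the factorials and the powers of [h]; with [4 * a * eta <= 1] a geometric series of
   ratio 1/4 remains, and [2 * 4 / 3 + 1 <= 4]. *)
have term (m : nat) : (m < M.+1)%N -> A m * (-1) ^+ m * fdiffn m.*2 (fun i => k ((i%:R - m%:R) * h)) 0 <=
    2 * (1 / 4) ^+ m * Cb + (m == 0)%:R * Cb.
  move=> mM; apply: (@le_trans _ _ (A m * `|fdiffn m.*2 (fun i => k ((i%:R - m%:R) * h)) 0|)).
    rewrite -mulrA ler_wpM2l // (le_trans (ler_norm _)) // normrM normrX normrN1 expr1n mul1r //.
  apply: (@le_trans _ _ (A m * ((m.*2)`!%:R * ((a * h) ^+ m.*2 * Cb)))).
    by rewrite ler_wpM2l // kb // hM'.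
  have f0 : (m.*2)`!%:R != 0 :> R by rewrite pnatr_eq0 -lt0n fact_gt0.
  rewrite mulrDl; apply: lerD; last first.
    by case: m mM f0 => [|m] _ _; rewrite ?mul0r // double0 fact0 expr0 !mul1r.
  rewrite (_ : _ * _ = 2 * ((2 * eta / h) ^+ m.*2 * (a * h) ^+ m.*2) * Cb); last by field.
  rewrite ler_wpM2r // ler_pM2l // -exprMn -mul2n exprM; apply: lerXn2r; rewrite ?nnegrE ?sqr_ge0 //.
  rewrite (_ : 1 / 4 = (1 / 2) ^+ 2); last by field.
  have -> : 2 * eta / h * (a * h) = 4 * a * eta / 2 by field; rewrite gt_eqF.
  have ae0 : 0 <= 4 * a * eta by rewrite !mulr_ge0 ?(ltW a0) ?(ltW eta0).
  by apply: lerXn2r; rewrite ?nnegrE ?divr_ge0 // ler_pM2r.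
apply: (@le_trans _ _ (\sum_(0 <= m < M.+1) (2 * (1 / 4) ^+ m * Cb + (m == 0)%:R * Cb))).
  by rewrite big_nat [leRHS]big_nat; apply: ler_sum => m /andP[_]; exact: term.
rewrite big_split /= -!mulr_suml -mulr_sumr -mulrDl; apply: ler_wpM2r => //.
have -> : \sum_(0 <= i < M.+1) (i == 0)%:R = 1 :> R.
  by rewrite big_nat_recl //= big1 // addr0.
have -> : \sum_(0 <= i < M.+1) (1 / 4) ^+ i = (4 - 4 * (1 / 4) ^+ M.+1) / 3 :> R.
  elim: (M.+1) => [|N IH]; first by rewrite big_geq // expr0; field.
  by rewrite big_nat_recr //= IH exprS; field.
have : 0 <= (1 / 4) ^+ M.+1 :> R by rewrite exprn_ge0 // divr_ge0.
lra.
Qed.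

(** Only products of windowed integrals are bounded. As the window grows each factor is
    nondecreasing and eventually positive, so that fixing one factor bounds the other, and the
    product of the limits is reached one factor at a time. *)
Lemma two_sided_moments :
  [/\ Rintegrable mu (fun x => w x * expR (eta * psi x)),
      Rintegrable mu (fun x => w x * expR (- (eta * psi x))) &
      (\int[mu]_x (w x * expR (eta * psi x))) * (\int[mu]_x (w x * expR (- (eta * psi x)))) <=
        W ^+ 2 * (4 * Cb)].
Proof.
pose D := W ^+ 2 * (4 * Cb).
have W0 : 0 < W := weight_mass ww.
have D0 : 0 <= D by rewrite mulr_ge0 ?exprn_ge0 ?mulr_ge0 ?(ltW W0).
have w0 := weight_ge0 ww; have mw := Rintegrable_measurable (weight_int ww).
pose u (z : R) (B : nat) x := w x * (expR (z * psi x) * window psi B%:R x).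
have mexp (z : R) : measurable_fun setT (fun x => expR (z * psi x)).
  by apply: measurableT_comp => //; exact: measurable_funM.
have iu z B : Rintegrable mu (u z B).
  apply: (weighted_integrable (M := expR (`|z| * B%:R)) ww).
    by apply: measurable_funM => //; exact: window_measurable.
  move=> x; rewrite ger0_norm ?mulr_ge0 ?expR_ge0 ?window_ge0 //.
  case: (leP (`|psi x|) B%:R) => pB; last by rewrite window_out // mulr0 expR_ge0.
  by rewrite window_in // mulr1 ler_expR (le_trans (ler_norm _)) // normrM ler_wpM2l.
pose U z B := \int[mu]_x u z B x.
have U0 z B : 0 <= U z B by apply: Rintegral_ge0 => x _; rewrite !mulr_ge0 ?expR_ge0 ?window_ge0.
have Ule z B B' : (B <= B')%N -> U z B <= U z B'.
  move=> BB; apply: le_Rintegral => // x _; rewrite ler_wpM2l // ler_wpM2l ?expR_ge0 //.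
  by rewrite window_le // ler_nat.
have UD z B : `|z| = eta -> U z B * U (- z) B <= D.
  move=> zE; have := window_product B.
  have E (y : R) : \int[mu]_x (w x * (expR (- (y * psi x)) * window psi B%:R x)) = U (- y) B.
    by apply: eq_Rintegral => x _; rewrite /u mulNr.
  have [ze|ze] : z = eta \/ z = - eta.
    by move: zE; case: (ler0P z) => _ <-; [right; rewrite opprK|left].
  - by rewrite E ze.
  - by rewrite E ze opprK mulrC => H; exact: H.
have bnd z C : (forall B, U z B <= C) ->
    Rintegrable mu (fun x => w x * expR (z * psi x)) /\ \int[mu]_x (w x * expR (z * psi x)) <= C.
  move=> h; apply: ge0_bounded_Rintegrable; first exact: measurable_funM.
    by move=> x; rewrite mulr_ge0 ?expR_ge0.
  apply: (@window_bound _ _ _ _ _ psi); first exact: measurable_funM.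
  - by [].
  - by move=> x; rewrite mulr_ge0 ?expR_ge0.
  move=> B; rewrite (eq_integral (fun x => (u z B x)%:E)); last by move=> x _; rewrite /u mulrA.
  rewrite -[leLHS]fineK; last exact: integrable_fin_num (iu z B).
  by rewrite lee_fin; exact: h.
(* On a window of size [B] the exponential is at least [exp (- |z| B)], so the case [z = 0]
   suffices, where the windowed integrals tend to the mass of [w]. *)
have pos z : exists B, 0 < U z B.
  apply: contrapT => /forallNP h.
  have Uz B : U z B <= 0 by have := h B; move/negP; rewrite -leNgt.
  have [iz z0] := bnd z 0 Uz.
  have ex : exists B, U 0 B > 0.
    apply: contrapT => /forallNP h'.
    have [_] := bnd 0 0 (fun B => ltac:(by rewrite leNgt; apply/negP; exact: h')).
    under eq_Rintegral do rewrite mul0r expR0 mulr1.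
    by rewrite leNgt => /negP; apply.
  have [B UB] := ex.
  have : expR (- (`|z| * B%:R)) * U 0 B <= U z B.
    rewrite -(RintegralZl _ measurableT (iu 0 B)); apply: le_Rintegral; [exact: measurableT|exact: RintegrableZ|exact: iu|].
    move=> x _; rewrite /u mulrCA ler_wpM2l // mul0r expR0 mul1r.
    case: (leP (`|psi x|) B%:R) => pB; last by rewrite window_out // !mulr0.
    rewrite window_in // !mulr1 ler_expR lerNl (le_trans (ler_norm _)) //.
    by rewrite normrN normrM ler_wpM2l.
  have := Uz B; have : 0 < expR (- (`|z| * B%:R)) * U 0 B by rewrite mulr_gt0 ?expR_gt0.
  by move=> p1 p2 p3; have := lt_le_trans p1 (le_trans p3 p2); rewrite ltxx.
have fin z : `|z| = eta -> exists C, forall B, U z B <= C.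
  move=> zE; have [B0 UB0] := pos (- z); exists (D / U (- z) B0) => B.
  rewrite ler_pdivlMr //; apply: le_trans (UD z (maxn B B0) zE).
  by apply: ler_pM => //; [apply: Ule; exact: leq_maxl|apply: Ule; exact: leq_maxr].
have ne : `|eta| = eta by rewrite gtr0_norm.
have nne : `|- eta| = eta by rewrite normrN.
have [C1 hC1] := fin _ ne; have [C2 hC2] := fin _ nne.
have [i1 _] := bnd _ _ hC1; have [i2 _] := bnd _ _ hC2.
have eN : (fun x => w x * expR (- (eta * psi x))) = (fun x => w x * expR (- eta * psi x)).
  by apply/funext => x; rewrite mulNr.
rewrite eN; split => //.
have [B1 UB1] := pos (- eta).
have step B : (B1 <= B)%N -> \int[mu]_x (w x * expR (eta * psi x)) <= D / U (- eta) B.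
  move=> B1B; have UB : 0 < U (- eta) B by apply: lt_le_trans UB1 _; exact: Ule.
  apply: (bnd _ _ _).2 => B'; rewrite ler_pdivlMr //.
  apply: le_trans (UD eta (maxn B B') ne).
  by apply: ler_pM => //; [apply: Ule; exact: leq_maxr|apply: Ule; exact: leq_maxl].
set V := \int[mu]_x (w x * expR (eta * psi x)) in step *.
have V0 : 0 <= V by apply: Rintegral_ge0 => x _; rewrite mulr_ge0 ?expR_ge0.
have [Vz|Vp] := leP V 0.
  by rewrite (_ : V = 0) ?mul0r //; apply/eqP; rewrite eq_le Vz.
rewrite mulrC -ler_pdivlMr //; apply: (bnd _ _ _).2 => B.
rewrite ler_pdivlMr // mulrC.
apply: (@le_trans _ _ (V * U (- eta) (maxn B B1))); first by rewrite ler_pM2l // Ule // leq_maxl.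
have := step (maxn B B1) (leq_maxr _ _); rewrite ler_pdivlMr //.
by apply: lt_le_trans UB1 _; apply: Ule; exact: leq_maxr.
Qed.

End TwoSidedMoments.

Lemma Rintegral_cvg_dominated {d} {T : measurableType d} {R : realType}
    (mu : {measure set T -> \bar R}) (f_ : nat -> T -> R) (f g : T -> R) :
  (forall n, measurable_fun setT (f_ n)) -> measurable_fun setT f -> Rintegrable mu g ->
  (forall n x, `|f_ n x| <= g x) -> (forall x, f_ n x @[n --> \oo] --> f x) ->
  \int[mu]_x f_ n x @[n --> \oo] --> \int[mu]_x f x.
Proof.
move=> mf_ mf ig fg cf.
have fi : Rintegrable mu f.
  apply: (Rintegrable_le mf _ ig) => x.
  by apply: (cvgn_norm_le (cf x)) => n; exact: fg.
have [] := @dominated_convergence _ _ _ mu setT measurableT (fun n => EFin \o f_ n)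
  (EFin \o f) (EFin \o g).
- by move=> n; exact/measurable_EFinP.
- exact/measurable_EFinP.
- by apply: aeW => x _; apply/fine_cvgP; split; [near=> n|exact: cf].
- exact: ig.
- by apply: aeW => x n _; rewrite lee_fin.
move=> _ _ h; rewrite /Rintegral; apply: fine_cvg; rewrite fineK //; exact: integrable_fin_num.
Unshelve. all: by end_near.
Qed.

(** Otherwise some vectors in boxes of size [1 / (k + 1)] would keep the coherence away from 1,
    against dominated convergence. *)
Lemma coherence_box_cont {d} {T : measurableType d} {R : realType} {n : nat}
    (mu : {measure set T -> \bar R}) (w : T -> R) (x : T -> 'cV[R]_n) (e : R) :
  weight mu w -> (forall i, measurable_fun setT (fun t => x t i 0)) -> 0 < e ->
  exists2 d : R, 0 < d & forall u, box d u -> 1 - coherence mu w (fun t => dotmul u (x t)) <= e.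
Proof.
move=> ww mx e0; apply: contrapT => h.
have hk k : exists u : 'cV[R]_n, box (k.+1%:R^-1) u /\ e < 1 - coherence mu w (fun t => dotmul u (x t)).
  apply: contrapT => /forallNP hu; apply: h; exists (k.+1%:R^-1); first by rewrite invr_gt0.
  by move=> u bu; rewrite leNgt; apply/negP => lt; apply: (hu u).
pose u k := sval (cid (hk k)).
have uP k : box (k.+1%:R^-1) (u k) /\ e < 1 - coherence mu w (fun t => dotmul (u k) (x t)) := svalP (cid (hk k)).
have mu_ k : measurable_fun setT (fun t => dotmul (u k) (x t)).
  by apply: measurable_sum => i; apply: measurable_funM.
have cu t : dotmul (u k) (x t) @[k --> \oo] --> (0 : R).
  pose S := \sum_(i < n) `|x t i 0|.
  have hS k : `|dotmul (u k) (x t)| <= k.+1%:R^-1 * S.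
    apply: (le_trans (ler_norm_sum _ _ _)); rewrite mulr_sumr; apply: ler_sum => i _.
    by rewrite normrM ler_wpM2r //; have [+ _] := uP k; exact.
  have hc : k.+1%:R^-1 * S @[k --> \oo] --> (0 : R).
    by rewrite -[X in _ --> X](mul0r S); apply: cvgM; [exact: cvg_harmonic|exact: cvg_cst].
  apply: (@squeeze_cvgr _ _ _ _ (fun k => - (k.+1%:R^-1 * S)) (fun k => k.+1%:R^-1 * S)) => //.
  - by near=> k; rewrite -ler_norml.
  - by rewrite -[X in _ --> X]oppr0; exact: cvgN.
have cc : wcos mu w (fun t => dotmul (u k) (x t)) @[k --> \oo] --> \int[mu]_t w t.
  apply: (Rintegral_cvg_dominated _ _ (weight_int ww)).
  - by move=> k; exact: Rintegrable_measurable (weighted_integrable_cos ww (mu_ k)).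
  - exact: Rintegrable_measurable (weight_int ww).
  - by move=> k t; rewrite normrM ger0_norm ?(weight_ge0 ww) // ler_piMr ?(weight_ge0 ww) // cos_max.
  - move=> t; rewrite -[X in _ --> X]mulr1 -cos0; apply: cvgM; first exact: cvg_cst.
    by apply: continuous_cvg; [exact: continuous_cos|exact: cu].
have cs : wsin mu w (fun t => dotmul (u k) (x t)) @[k --> \oo] --> (0 : R).
  have -> : (0 : R) = \int[mu]_t (w t * 0).
    by under eq_Rintegral do rewrite mulr0; rewrite /Rintegral integral0.
  apply: (Rintegral_cvg_dominated _ _ (weight_int ww)).
  - by move=> k; exact: Rintegrable_measurable (weighted_integrable_sin ww (mu_ k)).
  - by apply: measurable_funM => //; exact: Rintegrable_measurable (weight_int ww).
  - by move=> k t; rewrite normrM ger0_norm ?(weight_ge0 ww) // ler_piMr ?(weight_ge0 ww) // sin_max.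
  - move=> t; rewrite -sin0; apply: cvgM; first exact: cvg_cst.
    by apply: continuous_cvg; [exact: continuous_sin|exact: cu].
have m0 := weight_mass ww; set m := \int[mu]_t w t in m0 cc.
have C : coherence mu w (fun t => dotmul (u k) (x t)) @[k --> \oo] --> (1 : R).
  rewrite (_ : (1 : R) = (m * m + 0 * 0) / m ^+ 2); last by rewrite mulr0 addr0 expr2 divff // mulf_neq0 // gt_eqF.
  apply: cvgM; last exact: cvg_cst.
  by under eq_fun do rewrite !expr2; apply: cvgD; apply: cvgM.
have : e <= 1 - 1.
  apply: (cvgn_ge (cvgB (cvg_cst (1 : R)) C)) => k /=.
  by have [_ /ltW] := uP k.
by rewrite subrr leNgt e0.
Unshelve. all: by end_near.
Qed.

Lemma dotmulDl {R : realType} {n : nat} (u v x : 'cV[R]_n) : dotmul (u + v) x = dotmul u x + dotmul v x.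
Proof. by rewrite /dotmul -big_split /=; apply: eq_bigr => i _; rewrite mxE mulrDl. Qed.

Lemma dotmulNl {R : realType} {n : nat} (u x : 'cV[R]_n) : dotmul (- u) x = - dotmul u x.
Proof. by rewrite /dotmul -sumrN; apply: eq_bigr => i _; rewrite mxE mulNr. Qed.

Lemma dotmul_measurable {d} {T : measurableType d} {R : realType} {n : nat} (u : 'cV[R]_n)
  (x : T -> 'cV[R]_n) : (forall i, measurable_fun setT (fun t => x t i 0)) ->
  measurable_fun setT (fun t => dotmul u (x t)).
Proof. by move=> mx; apply: measurable_sum => i; apply: measurable_funM. Qed.

Lemma coherence_defect {d} {T : measurableType d} {R : realType} {n : nat}
    (mu : {measure set T -> \bar R}) (w : T -> R) (x : T -> 'cV[R]_n) :
  weight mu w -> (forall i, measurable_fun setT (fun t => x t i 0)) ->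
  defect (fun u => 1 - coherence mu w (fun t => dotmul u (x t))).
Proof.
move=> ww mx; have md u := dotmul_measurable u mx.
have eD u v : (fun t => dotmul (u + v) (x t)) = (fun t => dotmul u (x t) + dotmul v (x t)).
  by apply/funext => t; rewrite dotmulDl.
have eN u : (fun t => dotmul (- u) (x t)) = (fun t => - dotmul u (x t)).
  by apply/funext => t; rewrite dotmulNl.
split.
- rewrite (_ : (fun t => _) = (fun=> 0)) ?coherence_cst ?subrr //.
  by apply/funext => t; rewrite /dotmul big1 // => i _; rewrite mxE mul0r.
- by move=> u; rewrite subr_ge0 coherence_le1.
- by move=> u; rewrite gerBl coherence_ge0.
- by move=> u; rewrite eN coherenceN.
- by move=> u v; rewrite eD; exact: incoherenceD.
- move=> u v e e0; rewrite eD.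
  set a := coherence mu w (fun t => dotmul u (x t)); set b := coherence mu w (fun t => _ + _).
  rewrite (_ : 1 - b - (1 - a) = - (b - a)); last by ring.
  rewrite normrN.
  exact: coherence_diff.
- by move=> e e0; exact: coherence_box_cont.
Qed.

(** * Exponential moments of the summands *)

(** The product of the two truncated exponentials is at most the truncated exponential of the sum. A
    lower bound for the increment [D] thus turns a bound for the full sum into one for [U]. *)
Lemma split_exp {d} {Omega : measurableType d} {R : realType} (P : probability Omega R)
    (U D : Omega -> R) (t A : R) : measurable_fun setT U -> measurable_fun setT D ->
  independent2 P U D -> 0 <= A ->
  (\int[P]_w Num.min (expR (t * U w)) A) * (\int[P]_w Num.min (expR (t * D w)) 1) <=
    \int[P]_w Num.min (expR (t * (U w + D w))) A.
Proof.
move=> mU mD UD A0.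
have mm (c : R) : measurable_fun setT (fun y : R => Num.min (expR (t * y)) c).
  by apply: measurable_minr => //; apply: measurableT_comp => //; exact: measurable_funM.
have ii (f : Omega -> R) c : measurable_fun setT f -> 0 <= c -> Rintegrable P (fun w => Num.min (expR (t * f w)) c).
  move=> mf c0; apply: bounded_Rintegrable; first exact: (measurableT_comp (mm c) mf).
  by exists c => w; rewrite ger0_norm ?ge_min ?lexx ?orbT // le_min expR_ge0.
have [i1 <-] := independent2_Rintegral (independent2_comp (mm A) (mm 1) UD) (ii U A mU A0) (ii D 1 mD ler01).
apply: le_Rintegral => //; first by apply: (ii (fun w => U w + D w)) => //; exact: measurable_funD.
move=> w _ /=; rewrite mulrDr expRD le_min; have e0 := expR_ge0 (t * U w); have e0' := expR_ge0 (t * D w).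
apply/andP; split.
  by apply: ler_pM; rewrite ?le_min ?e0 ?e0' ?ler01 //= ge_min lexx.
rewrite -[leRHS]mulr1; apply: ler_pM; rewrite ?le_min ?e0 ?e0' ?ler01 //=.
by rewrite ge_min lexx orbT.
Qed.

Lemma independent2_sym {d d1 d2} {Omega : measurableType d} {T1 : measurableType d1}
    {T2 : measurableType d2} {R : realType} (P : set Omega -> \bar R)
    (X : Omega -> T1) (Y : Omega -> T2) : independent2 P X Y -> independent2 P Y X.
Proof. by move=> XY A B mA mB; rewrite setIC XY // muleC. Qed.

Lemma continuous_compose {T : topologicalType} {R : realType} (psi : T -> R) (f : R -> R) :
  continuous psi -> continuous f -> continuous (fun x => f (psi x)).
Proof. by move=> cp cf x; apply: continuous_comp; [exact: cp|exact: cf]. Qed.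

Lemma continuous_min_cst {T : topologicalType} {R : realType} (f : T -> R) (c : R) :
  continuous f -> continuous (fun x => Num.min (f x) c).
Proof. by move=> cf x; apply: continuous_min => //; [exact: cf|exact: cvg_cst]. Qed.

Lemma continuous_max_cst {T : topologicalType} {R : realType} (f : T -> R) (c : R) :
  continuous f -> continuous (fun x => Num.max (f x) c).
Proof. by move=> cf x; apply: continuous_max => //; [exact: cf|exact: cvg_cst]. Qed.

Lemma continuous_mul_cst {R : realType} (t : R) : continuous (fun z : R => t * z).
Proof. by move=> z; apply: cvgM; [exact: cvg_cst|exact: cvg_id]. Qed.

(* A discrete Gronwall argument: the second differences of [ln \o f] at step
   [eta] are at most [ln M]. *)
Lemma ratio_growth {R : realType} (f : R -> R) (M eta : R) : (forall t, 0 < f t) -> f 0 = 1 ->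
  (forall t, f (t + eta) * f (t - eta) <= M * f t ^+ 2) ->
  exists2 b : R, 1 <= b & forall k : nat, f (k%:R * eta) <= b ^+ (k * k).
Proof.
move=> f0 f1 H; pose b := Num.max 1 (Num.max M (f eta)).
have b1 : 1 <= b by rewrite le_max lexx.
have bM : M <= b by rewrite !le_max lexx orbT.
have bf : f eta <= b by rewrite !le_max lexx !orbT.
have b0 : 0 < b by exact: lt_le_trans b1.
exists b => //.
have step k : f (k.+1%:R * eta) <= b ^+ k.+1 * f (k%:R * eta).
  elim: k => [|k IH]; first by rewrite mul1r mul0r f1 mulr1 expr1.
  rewrite -(ler_pM2r (f0 (k%:R * eta))).
  have := H (k.+1%:R * eta).
  rewrite (_ : k.+1%:R * eta + eta = k.+2%:R * eta); last by rewrite -[k.+2]addn1 natrD mulrDl mul1r.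
  rewrite (_ : k.+1%:R * eta - eta = k%:R * eta); last by rewrite -[k.+1]addn1 natrD mulrDl mul1r addrK.
  move/le_trans; apply.
  have g0 := f0 (k.+1%:R * eta).
  apply: (@le_trans _ _ (b * f (k.+1%:R * eta) ^+ 2)); first by rewrite ler_pM2r ?exprn_gt0.
  by rewrite [b ^+ k.+2]exprS expr2 -!mulrA ler_pM2l // [leRHS]mulrCA ler_pM2l.
elim=> [|k IH]; first by rewrite mul0r f1 expr0.
apply: (le_trans (step k)); apply: (@le_trans _ _ (b ^+ k.+1 * b ^+ (k * k))).
  by rewrite ler_pM2l // exprn_gt0.
by rewrite -exprD ler_weXn2l // mulSn mulnS leq_add2l leq_addl.
Qed.

(** At the multiples of [eta] the bound is that of [ratio_growth]; in between, for [t >= 0],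
    [expR (t * Z w)] is at most 1 plus the exponential at a later multiple. Negative [t] are covered
    by [- Y]. *)
Lemma mgf_growth {d} {Omega : measurableType d} {R : realType} (P : probability Omega R)
    (Y : Omega -> R) (M eta : R) : 0 < eta ->
  (forall t, Rintegrable P (fun w => expR (t * Y w))) ->
  (forall t, (\int[P]_w expR ((t + eta) * Y w)) * (\int[P]_w expR ((t - eta) * Y w)) <=
    M * (\int[P]_w expR (t * Y w)) ^+ 2) ->
  exists C : R, forall t, \int[P]_w expR (t * Y w) <= expR (C * (1 + t ^+ 2)).
Proof.
move=> eta0; have oneside (Z : Omega -> R) : (forall t, Rintegrable P (fun w => expR (t * Z w))) ->
  (forall t, (\int[P]_w expR ((t + eta) * Z w)) * (\int[P]_w expR ((t - eta) * Z w)) <=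
    M * (\int[P]_w expR (t * Z w)) ^+ 2) ->
  exists2 C : R, 0 <= C & forall t, 0 <= t -> \int[P]_w expR (t * Z w) <= expR (C * (1 + t ^+ 2)).
  move=> iZ HZ.
  have K0 t : 0 < \int[P]_w expR (t * Z w).
    by apply: weight_mass; apply: positive_weight => // w; exact: expR_gt0.
  have K1 : \int[P]_w expR (0 * Z w) = 1.
    rewrite (_ : (fun w => _) = cst (1 : R)); first exact: Rintegral_probability_cst.
    by apply/funext => w; rewrite mul0r expR0.
  have [b b1 hb] := ratio_growth (f := fun t => \int[P]_w expR (t * Z w)) K0 K1 HZ.
  have b0 : 0 <= b by exact: le_trans b1.
  have C0 : 0 <= 1 + 2 * b + 2 * b / eta ^+ 2.
    by rewrite !addr_ge0 ?divr_ge0 ?mulr_ge0 // ltW // exprn_gt0.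
  exists (1 + 2 * b + 2 * b / eta ^+ 2) => // t t0.
  have x0 : 0 <= t / eta by rewrite divr_ge0 // ltW.
  have [k /andP[k1 k2]] : exists k : nat, t / eta <= k%:R <= t / eta + 1.
    have /andP[h1 h2] := truncn_itv x0; exists (Num.truncn (t / eta)).+1.
    by rewrite ltW //= -natr1 lerD2r.
  apply: (@le_trans _ _ (1 + \int[P]_w expR (k%:R * eta * Z w))).
    rewrite -[X in X + _](Rintegral_probability_cst P) -RintegralD //; last exact: finite_measure_integrable_cst.
    apply: le_Rintegral => //.
      by apply: RintegrableD => //; exact: finite_measure_integrable_cst.
    move=> w _; have [z0|z0] := leP 0 (Z w).
      apply: (@le_trans _ _ (expR (k%:R * eta * Z w))); last by rewrite lerDr.
      by rewrite ler_expR ler_wpM2r // -ler_pdivrMr.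
    apply: (@le_trans _ _ 1); last by rewrite lerDl expR_ge0.
    by rewrite -expR0 ler_expR mulr_ge0_le0 // ltW.
  have eb : b ^+ (k * k) <= expR (b * (k * k)%:R).
    rewrite mulrC expRM_natl; apply: lerXn2r; rewrite ?nnegrE ?expR_ge0 //.
    by apply: le_trans (expR_ge1Dx _); rewrite lerDr.
  have e1 : 1 <= expR (b * (k * k)%:R) by rewrite -expR0 ler_expR mulr_ge0.
  apply: (@le_trans _ _ (expR 1 * expR (b * (k * k)%:R))).
    have : 2 <= expR (1 : R) by apply: le_trans (expR_ge1Dx _); lra.
    have := hb k; set z := expR (b * _) in eb e1 *; set v := b ^+ _ in eb *; set q := \int[P]_w _.
    move=> qv e2; apply: (@le_trans _ _ (2 * z)); first by lra.
    by rewrite ler_wpM2r //; lra.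
  rewrite -expRD ler_expR.
  have kk : (k * k)%:R <= 2 + 2 * t ^+ 2 / eta ^+ 2.
    rewrite natrM; set x := t / eta in x0 k1 k2.
    rewrite (_ : 2 * t ^+ 2 / eta ^+ 2 = 2 * x ^+ 2); last by rewrite /x; field; rewrite gt_eqF.
    apply: (@le_trans _ _ ((x + 1) * (x + 1))); first by rewrite ler_pM.
    have := sqr_ge0 (x - 1); lra.
  have t2 := sqr_ge0 t.
  apply: (@le_trans _ _ (1 + b * (2 + 2 * t ^+ 2 / eta ^+ 2))); first by rewrite lerD2l ler_wpM2l.
  have q0 : 0 <= 2 * b / eta ^+ 2 by rewrite divr_ge0 ?mulr_ge0 // ltW // exprn_gt0.
  rewrite (_ : (1 + 2 * b + 2 * b / eta ^+ 2) * (1 + t ^+ 2) =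
    (1 + b * (2 + 2 * t ^+ 2 / eta ^+ 2)) + ((1 + 2 * b) * t ^+ 2 + 2 * b / eta ^+ 2)).
    by rewrite lerDl addr_ge0 // mulr_ge0 // addr_ge0 // mulr_ge0.
  by field; rewrite gt_eqF.
move=> iY HY; have [C1 C10 h1] := oneside Y iY HY.
have NY t : (fun w => expR (t * - Y w)) = (fun w => expR (- t * Y w)).
  by apply/funext => w; rewrite mulrN mulNr.
have HN t : \int[P]_w expR (t * - Y w) = \int[P]_w expR (- t * Y w) by rewrite NY.
have [||C2 C20 h2] := oneside (fun w => - Y w).
- by move=> t; rewrite NY.
- move=> t; rewrite (HN (t + eta)) (HN (t - eta)) (HN t).
  have -> : - (t - eta) = - t + eta by rewrite opprB addrC.
  by have -> : - (t + eta) = - t - eta; [rewrite opprD|rewrite [X in X <= _]mulrC; exact: HY].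
exists (C1 + C2) => t; have [t0|t0] := leP 0 t.
  by apply: (le_trans (h1 t t0)); rewrite ler_expR ler_wpM2r ?lerDl // addr_ge0 ?sqr_ge0.
have := h2 (- t); rewrite (HN (- t)) opprK sqrrN oppr_ge0 => /(_ (ltW t0)) h.
by apply: (le_trans h); rewrite ler_expR ler_wpM2r ?lerDr // addr_ge0 ?sqr_ge0.
Qed.

Lemma quarter_bound {R : realFieldType} (m e a b x : R) :
  m - e <= m / 4 -> a - b <= m / 4 -> e <= a + x -> b <= m / 4 -> 4^-1 * m <= x.
Proof. lra. Qed.

(* [T] stands for the group R^n x G, [xv j] and [y j] for the R^n-component of
   alpha_j and for a coordinate of that of beta_j; [lin] expresses that
   [y j (xi j)] is almost surely [dotmul (c j) (xv j (xi j))] up to a constant. *)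
Section Forms.
Context {d} {Omega : measurableType d} {R : realType} (P : probability Omega R).
Context {T : ptopologicalType} {n : nat}.
Variable xi : nat -> {RV P >-> borel T}.
Hypothesis xi_indep : mutually_independent xi.
Variables (xv : nat -> borel T -> 'cV[R]_n) (y : nat -> borel T -> R).
Hypothesis mxv : forall j i, measurable_fun setT (fun t => xv j t i 0).
Hypothesis my : forall j, measurable_fun setT (y j).
Variables (S1 S2 : nat -> Omega -> T) (lam1 lam2 : probability (borel T) R).
Hypothesis mS1 : forall N, measurable_fun setT (S1 N : Omega -> borel T).
Hypothesis mS2 : forall N, measurable_fun setT (S2 N : Omega -> borel T).
Hypothesis S12 : product_limit P S1 S2 lam1 lam2.
Variables (chi : T -> 'cV[R]_n) (psi : T -> R).
Hypothesis cchi : forall i, continuous (fun t => chi t i 0).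
Hypothesis cpsi : continuous psi.
Hypothesis S1sum : forall N w u,
  dotmul u (chi (S1 N w)) = \sum_(0 <= j < N) dotmul u (xv j (xi j w)).
Hypothesis S2sum : forall N w, psi (S2 N w) = \sum_(0 <= j < N) y j (xi j w).
Variables (c : nat -> 'cV[R]_n) (K : R).
Hypotheses (K0 : 0 < K) (c_le : forall j, box K (c j)).
Hypothesis lin : forall j (w : Omega -> R) u s, weight P w ->
  coherence P w (fun t => dotmul u (xv j (xi j t)) + s * y j (xi j t)) =
  coherence P w (fun t => dotmul (u + s *: c j) (xv j (xi j t))).

Local Notation Y j := (fun w => y j (xi j w)).
Let U N w := \sum_(0 <= j < N) y j (xi j w).
Let D N m w := \sum_(0 <= i < m) y (N + i)%N (xi (N + i)%N w).

Let mpsi : measurable_fun setT (psi : borel T -> R) := continuous_borel_real cpsi.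

Let mY j : measurable_fun setT (Y j).
Proof. exact: measurableT_comp. Qed.

Let mU N : measurable_fun setT (U N).
Proof. exact: measurable_sum. Qed.

Let mD N m : measurable_fun setT (D N m).
Proof. exact: measurable_sum. Qed.

Let UD N m w : U (N + m)%N w = U N w + D N m w.
Proof. by rewrite /U /D (big_cat_nat (n := N)) ?leq_addr //= big_nat_shift. Qed.

Let phi j (z : R * borel T) := z.1 + y j z.2.

Let mphi j : measurable_fun setT (phi j).
Proof. by apply: measurable_funD => //; exact: measurableT_comp. Qed.

Let indUD N m : independent2 P (U N) (D N m).
Proof.
have U0 w : U 0 w = 0 by rewrite /U big_geq.
have US M w : U M.+1 w = phi M (U M w, xi M w) by rewrite /U big_nat_recr.
have D0 w : D N 0 w = 0 by rewrite /D big_geq.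
have DS M w : D N M.+1 w = phi (N + M)%N (D N M w, xi (N + M)%N w) by rewrite /D big_nat_recr.
exact: (blocks_independent xi_indep mphi U0 US (phi' := fun j => phi (N + j)%N) (fun j => mphi _) D0 DS m).
Qed.

Let indUY j : independent2 P (Y j) (U j).
Proof.
have U0 w : U 0 w = 0 by rewrite /U big_geq.
have US M w : U M.+1 w = phi M (U M w, xi M w) by rewrite /U big_nat_recr.
have mid : measurable_fun setT (fun z : R => z) by [].
exact: (independent2_comp (my j) mid (independent2_sym (state_independent_next xi_indep mphi U0 US j))).
Qed.

Definition mgf_finite (t : R) := Rintegrable lam2 (fun x => expR (t * psi x)).

Let emin (t : R) (f : Omega -> R) (A : R) := \int[P]_w Num.min (expR (t * f w)) A.

Let continuous_of_psi (f : R -> R) : continuous f -> continuous (fun x => f (psi x)).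
Proof. exact: continuous_compose. Qed.

Let exp_psi_cont (t : R) : continuous (fun x => expR (t * psi x)).
Proof.
apply: (continuous_of_psi (f := fun z : R => expR (t * z))).
by apply: (continuous_compose (f := expR)); [exact: continuous_mul_cst|exact: continuous_expR].
Qed.

Let limit_of_psi (f : R -> R) : continuous f -> bounded_fun f ->
  \int[P]_w f (U N w) @[N --> \oo] --> \int[lam2]_x f (psi x).
Proof.
move=> cf [M fM]; have := product_limit_right S12 (continuous_of_psi cf) _.
rewrite (_ : (fun N => _) = (fun N => \int[P]_w f (U N w))).
  by apply; exists M => x.
by apply/funext => N; apply: eq_Rintegral => w _; rewrite S2sum.
Qed.

Let min_exp_cont (t A : R) : continuous (fun z : R => Num.min (expR (t * z)) A).
Proof.
apply: (continuous_min_cst (f := fun z : R => expR (t * z))).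
by apply: (continuous_compose (f := expR)); [exact: continuous_mul_cst|exact: continuous_expR].
Qed.

Let min_exp_bound (t A z : R) : 0 <= A -> `|Num.min (expR (t * z)) A| <= A.
Proof. by move=> A0; rewrite ger0_norm ?ge_min ?lexx ?orbT // le_min expR_ge0. Qed.

Let min_exp_int (t A : R) (f : Omega -> R) : 0 <= A -> measurable_fun setT f ->
  Rintegrable P (fun w => Num.min (expR (t * f w)) A).
Proof.
move=> A0 mf; apply: bounded_Rintegrable; last by exists A => w; exact: min_exp_bound.
apply: (measurableT_comp (f := fun z : R => Num.min (expR (t * z)) A)) => //.
exact: continuous_measurable_fun.
Qed.

Let emin_lim (t A : R) : 0 <= A -> mgf_finite t ->
  exists2 L, emin t (U N) A @[N --> \oo] --> L & L <= \int[lam2]_x expR (t * psi x).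
Proof.
move=> A0 fin; exists (\int[lam2]_x Num.min (expR (t * psi x)) A).
  apply: (limit_of_psi (f := fun z => Num.min (expR (t * z)) A)) => //.
  by exists A => z; exact: min_exp_bound.
apply: le_Rintegral => //; last by move=> x _; rewrite ge_min lexx.
apply: bounded_Rintegrable; last by exists A => w; exact: min_exp_bound.
by apply: continuous_borel_real; exact: (continuous_of_psi (@min_exp_cont t A)).
Qed.

Let emin_pos (t A : R) (f : Omega -> R) : 0 < A -> measurable_fun setT f -> 0 < emin t f A.
Proof.
move=> A0 mf; apply: weight_mass; apply: positive_weight.
  by apply: min_exp_int => //; exact: ltW.
by move=> w; rewrite lt_min expR_gt0.
Qed.

(** A continuous substitute for the indicator of [z >= k + 1], to which weak convergence applies. *)
Let ramp (k : nat) (z : R) : R := Num.min (Num.max (z - k%:R) 0) 1.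

Let ramp_cont k (t : R) : continuous (fun z => ramp k (t * z)).
Proof.
apply: (continuous_min_cst (f := fun z : R => Num.max (t * z - k%:R) 0)).
apply: (continuous_max_cst (f := fun z : R => t * z - k%:R)) => z.
by apply: cvgB; [exact: continuous_mul_cst|exact: cvg_cst].
Qed.

Let ramp_bound k (z : R) : 0 <= ramp k z <= 1.
Proof. by rewrite /ramp ge_min lexx orbT le_min ler01 le_max lexx orbT. Qed.

Let ramp_int k (t : R) (f : Omega -> R) : measurable_fun setT f -> Rintegrable P (fun w => ramp k (t * f w)).
Proof.
move=> mf; apply: bounded_Rintegrable.
  apply: (measurableT_comp (f := fun z : R => ramp k (t * z))) => //.
  exact: continuous_measurable_fun.
by exists 1 => w; have /andP[? ?] := ramp_bound k (t * f w); rewrite ger0_norm.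
Qed.

(** For the full sums [E min (exp (t U), 1)] is close to a positive limit. By tightness, outside an
    event of small probability where [t U N] is large, this quantity is controlled by a constant
    times the one of the increment [D N m], which is therefore bounded below. *)
Let tail_lower (t : R) : exists N0 (q0 : R), 0 < q0 /\ forall N m, (N0 <= N)%N -> q0 <= emin t (D N m) 1.
Proof.
pose m1 := \int[lam2]_x Num.min (expR (t * psi x)) 1.
have L1 : emin t (U N) 1 @[N --> \oo] --> m1.
  apply: (limit_of_psi (f := fun z => Num.min (expR (t * z)) 1)) => //.
  by exists 1 => z; exact: min_exp_bound.
have m10 : 0 < m1.
  apply: weight_mass; apply: positive_weight.
    apply: bounded_Rintegrable; last by exists 1 => w; exact: min_exp_bound.
    by apply: continuous_borel_real; exact: (continuous_of_psi (@min_exp_cont t 1)).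
  by move=> w; rewrite lt_min expR_gt0 ltr01.
have cr : \int[lam2]_x ramp k (t * psi x) @[k --> \oo] --> (0 : R).
  have -> : (0 : R) = \int[lam2]_x 0 by rewrite Rintegral_probability_cst.
  apply: (@Rintegral_cvg_dominated _ _ _ _ _ _ (fun=> 1)).
  - move=> k; apply: continuous_borel_real.
    exact: (continuous_of_psi (f := fun z => ramp k (t * z)) (@ramp_cont k t)).
  - by [].
  - exact: finite_measure_integrable_cst.
  - by move=> k x; have /andP[? ?] := ramp_bound k (t * psi x); rewrite ger0_norm.
  - move=> x; apply: cvg_near_cst; near=> k.
    rewrite /ramp max_r ?min_l // subr_le0; near: k; exact: nbhs_infty_ger.
have m14 : 0 < m1 / 4 by rewrite divr_gt0.
move/cvgrPdist_le : (cr) => /(_ _ m14)[k _ /(_ k (leqnn k)) /=].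
rewrite sub0r normrN => /(le_trans (ler_norm _)) hk.
have Lr : \int[P]_w ramp k (t * U N w) @[N --> \oo] --> \int[lam2]_x ramp k (t * psi x).
  apply: (limit_of_psi (f := fun z => ramp k (t * z))) => //.
  by exists 1 => z; have /andP[? ?] := ramp_bound k (t * z); rewrite ger0_norm.
move/cvgrPdist_le : (L1) => /(_ _ m14)[N1 _ h1].
move/cvgrPdist_le : (Lr) => /(_ _ m14)[N2 _ h2].
exists (maxn N1 N2), (expR (- k.+1%:R) * (m1 / 4)); split; first by rewrite mulr_gt0 ?expR_gt0.
move=> N m; rewrite geq_max => /andP[N1N N2N].
have := h1 (N + m)%N (leq_trans N1N (leq_addr m N)) => /= /(le_trans (ler_norm _)) H1.
have := h2 N N2N => /=; rewrite distrC => /(le_trans (ler_norm _)) H2.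
have H3 : emin t (U (N + m)%N) 1 <= \int[P]_w ramp k (t * U N w) + expR k.+1%:R * emin t (D N m) 1.
  rewrite -RintegralZl //; last exact: min_exp_int.
  rewrite -RintegralD //; [|exact: ramp_int|by apply: RintegrableZ; exact: min_exp_int].
  apply: le_Rintegral => //; first exact: min_exp_int.
    by apply: RintegrableD; [exact: ramp_int|apply: RintegrableZ; exact: min_exp_int].
  move=> w _; rewrite UD mulrDr expRD.
  set u := t * U N w; set v := t * D N m w.
  have [uk|ku] := leP u k.+1%:R.
    apply: (@le_trans _ _ (expR k.+1%:R * Num.min (expR v) 1)); last first.
      by rewrite lerDr; case/andP: (ramp_bound k u).
    have e1 : 1 <= expR k.+1%:R :> R by rewrite -expR0 ler_expR.
    rewrite minr_pMr ?expR_ge0 // le_min !ge_min mulr1 e1 orbT andbT.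
    by rewrite ler_wpM2r ?expR_ge0 // ler_expR.
  have -> : ramp k u = 1.
    rewrite /ramp min_r // le_max lerBrDr addrC; apply/orP; left.
    by rewrite natr1 ltW.
  by rewrite ge_min lerDl mulr_ge0 ?expR_ge0 ?orbT // le_min expR_ge0 ler01.
have e0 := expR_gt0 (k.+1%:R : R).
rewrite expRN mulrC ler_pdivrMr // mulrC [leRHS]mulrC.
exact: quarter_bound H1 H2 H3 hk.
Unshelve. all: by end_near.
Qed.

(** For large [N], compare with the limit through [split_exp], the increments being bounded below;
    the finitely many other [N] are compared with [N0] in the same way, whence the sum in [C]. *)
Lemma partial_mgf_bounded (t : R) : mgf_finite t -> exists C : R, forall N,
  (\int[P]_w (expR (t * psi (S2 N w)))%:E <= C%:E)%E.
Proof.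
move=> fin; have [N0 [q0 [q00 hq]]] := tail_lower t.
pose Kt := \int[lam2]_x expR (t * psi x).
have Kt0 : 0 <= Kt by apply: Rintegral_ge0 => x _; exact: expR_ge0.
have big N A : (N0 <= N)%N -> 0 <= A -> emin t (U N) A <= Kt / q0.
  move=> NN A0; rewrite ler_pdivlMr //.
  have [L cL LK] := emin_lim A0 fin; apply: le_trans LK.
  have cL' : emin t (U (m + N)%N) A @[m --> \oo] --> L.
    by rewrite (cvg_shiftn N (fun k => emin t (U k) A)).
  apply: (cvgn_ge cL') => m; rewrite addnC.
  rewrite (_ : emin t (U (N + m)%N) A = \int[P]_w Num.min (expR (t * (U N w + D N m w))) A).
    apply: le_trans (split_exp t (mU N) (mD N m) (indUD N m) A0).
    by apply: ler_wpM2l; [apply: Rintegral_ge0 => w _; rewrite le_min expR_ge0|exact: hq].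
  by apply: eq_Rintegral => w _; rewrite UD.
have Kq0 : 0 <= Kt / q0 by apply: divr_ge0 => //; exact: ltW.
have qpos N m : 0 < emin t (D N m) 1 by exact: emin_pos.
pose C := Kt / q0 + \sum_(0 <= N < N0) Kt / q0 / emin t (D N (N0 - N)) 1.
have S0 N : 0 <= Kt / q0 / emin t (D N (N0 - N)) 1.
  by apply: divr_ge0; [exact: Kq0|exact: ltW].
exists C => N; apply: truncation_bound => //.
- rewrite (_ : (fun w => _) = (fun w => expR (t * U N w))); last by apply/funext => w; rewrite S2sum.
  by apply: measurableT_comp => //; exact: measurable_funM.
move=> k; rewrite (eq_integral (fun w => (Num.min (expR (t * U N w)) k%:R)%:E)); last first.
  by move=> w _; rewrite S2sum.
rewrite -[leLHS]fineK; last by apply: integrable_fin_num => //; exact: min_exp_int.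
rewrite lee_fin -[fine _]/(emin t (U N) k%:R).
have [N0N|NN0] := leqP N0 N.
  apply: (le_trans (big N _ N0N (ler0n _ k))); rewrite lerDl.
  by apply: sumr_ge0 => i _.
apply: (@le_trans _ _ (Kt / q0 / emin t (D N (N0 - N)) 1)).
  rewrite ler_pdivlMr //; apply: le_trans (big N0 k%:R (leqnn _) (ler0n _ _)).
  rewrite (_ : emin t (U N0) k%:R = \int[P]_w Num.min (expR (t * (U N w + D N (N0 - N) w))) k%:R).
    exact: split_exp.
  by apply: eq_Rintegral => w _; rewrite -UD subnKC // ltnW.
rewrite /C (bigD1_seq N) ?iota_uniq ?mem_index_iota //= addrCA lerDl addr_ge0 //.
by apply: sumr_ge0 => i _.
Qed.

(** The summand is split off [U j.+1], with [U j] in the part of the increment. *)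
Lemma form_weight (t : R) j : mgf_finite t -> weight P (fun w => expR (t * y j (xi j w))).
Proof.
move=> fin; apply: positive_weight; last by move=> w; exact: expR_gt0.
have [C hC] := partial_mgf_bounded fin.
have mE (f : Omega -> R) : measurable_fun setT f -> measurable_fun setT (fun w => expR (t * f w)).
  by move=> mf; apply: measurableT_comp => //; exact: measurable_funM.
have q0 : 0 < emin t (U j) 1 by exact: emin_pos.
apply: (ge0_bounded_Rintegrable (C := C / emin t (U j) 1) _ _ _).1.
- exact: mE.
- by move=> w; exact: expR_ge0.
apply: truncation_bound; [exact: mE|by move=> w; exact: expR_ge0|].
move=> k; rewrite -[leLHS]fineK; last by apply: integrable_fin_num => //; exact: min_exp_int.
rewrite lee_fin -[fine _]/(emin t (Y j) k%:R) ler_pdivlMr //.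
apply: le_trans (split_exp t (mY j) (mU j) (indUY j) (ler0n _ k)) _.
rewrite (_ : \int[P]_w _ = \int[P]_w Num.min (expR (t * U j.+1 w)) k%:R); last first.
  by apply: eq_Rintegral => w _; rewrite /U big_nat_recr //= addrC.
have hU : (\int[P]_w (expR (t * U j.+1 w))%:E <= C%:E)%E.
  by rewrite (eq_integral (fun w => (expR (t * psi (S2 j.+1 w)))%:E)) // => w _; rewrite S2sum.
have [iE EC] := ge0_bounded_Rintegrable (mE _ (mU j.+1)) (fun w => expR_ge0 (t * U j.+1 w)) hU.
apply: le_trans EC; apply: le_Rintegral => //; first exact: min_exp_int.
by move=> w _; rewrite ge_min lexx.
Qed.

Lemma mgf_finite0 : mgf_finite 0.
Proof.
apply: bounded_Rintegrable; last by exists 1 => x; rewrite mul0r expR0 normr1.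
exact: continuous_borel_real (@exp_psi_cont 0).
Qed.

(** Where [expR (t * z)] exceeds the level, [|z|] is so large that the margin [e0] in the exponent
    gains a factor [1 / e]; the two exponentials handle both signs of [z]. *)
Let exp_window (t e0 e : R) : (t = 0 \/ 0 < e0) -> 0 < e -> exists2 B : R, 0 <= B &
  forall z : R, expR (t * z) <= Num.min (expR (t * z)) B + e * (expR ((t + e0) * z) + expR ((t - e0) * z)).
Proof.
move=> te e_gt0.
have V0 (z : R) : 0 <= e * (expR ((t + e0) * z) + expR ((t - e0) * z)).
  by rewrite mulr_ge0 ?addr_ge0 ?expR_ge0 // ltW.
pose M := `|t| * (e * e0)^-1.
exists (expR M) => [|z]; first exact: expR_ge0.
have [le|gt] := leP (expR (t * z)) (expR M); first by rewrite lerDl.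
rewrite ltr_expR in gt.
have t0 : 0 < `|t|.
  by rewrite normr_gt0; apply: contraTneq gt => t0; rewrite /M t0 normr0 !mul0r ltxx.
have e00 : 0 < e0 by case: te => // tz; rewrite tz normr0 ltxx in t0.
have zM : (e * e0)^-1 < `|z|.
  by rewrite -(ltr_pM2l t0) -normrM; exact: lt_le_trans gt (ler_norm _).
have dz : 1 <= e * expR (e0 * `|z|).
  have ee : 0 < e * e0 by exact: mulr_gt0.
  have h : 1 < e * e0 * `|z| by rewrite mulrC -ltr_pdivrMr // div1r.
  apply: le_trans (ltW h) _; rewrite -mulrA ler_pM2l //.
  by apply: le_trans (expR_ge1Dx _); rewrite lerDr.
have : expR (t * z) * expR (e0 * `|z|) <= expR ((t + e0) * z) + expR ((t - e0) * z).
  rewrite -expRD; have [z0|z0] := leP 0 z.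
    by rewrite ger0_norm // -mulrDl lerDl expR_ge0.
  by rewrite ltr0_norm // mulrN -mulrBl lerDr expR_ge0.
move=> h; have h2 : expR (t * z) <= e * (expR ((t + e0) * z) + expR ((t - e0) * z)).
  apply: (@le_trans _ _ (e * (expR (t * z) * expR (e0 * `|z|)))); last by rewrite ler_pM2l.
  by rewrite mulrCA ler_peMr ?expR_ge0.
by apply: (le_trans h2); rewrite lerDr expR_ge0.
Qed.

(* No margin is needed at [t = 0], where the tilt is bounded. *)
Definition tiltable (t : R) := exists e0 : R,
  [/\ t = 0 \/ 0 < e0, mgf_finite (t + e0) & mgf_finite (t - e0)].

Let tilt_majorant t : tiltable t -> exists (V : T -> R) (C : R),
  [/\ continuous V, forall x, 0 <= V x,
     forall N, (\int[P]_w (V (S2 N w))%:E <= C%:E)%E &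
     forall e : R, 0 < e -> exists2 B : R, 0 <= B &
       forall x, expR (t * psi x) <= Num.min (expR (t * psi x)) B + e * V x].
Proof.
move=> [e0 [te f1 f2]].
have [C1 h1] := partial_mgf_bounded f1; have [C2 h2] := partial_mgf_bounded f2.
exists (fun x => expR ((t + e0) * psi x) + expR ((t - e0) * psi x)), (C1 + C2); split.
- by move=> x; apply: cvgD; exact: exp_psi_cont.
- by move=> x; rewrite addr_ge0 ?expR_ge0.
- move=> N.
  have mS a : measurable_fun setT (fun w => (expR (a * psi (S2 N w)))%:E).
    apply/measurable_EFinP; apply: (measurableT_comp (f := fun x : borel T => expR (a * psi x))) => //.
    exact: continuous_borel_real (@exp_psi_cont a).
  rewrite (eq_integral (fun w => ((expR ((t + e0) * psi (S2 N w)))%:E + (expR ((t - e0) * psi (S2 N w)))%:E)%E)) //.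
  rewrite ge0_integralD //; [|by move=> x _; rewrite lee_fin expR_ge0..].
  by rewrite EFinD; apply: leeD; [exact: h1|exact: h2].
- move=> e e_gt0; have [B B0 hB] := exp_window te e_gt0.
  by exists B.
Qed.

Local Notation KY j t := (\int[P]_w expR (t * y j (xi j w))).
Local Notation K2 t := (\int[lam2]_x expR (t * psi x)).

Let F u := coherence lam1 (fun=> 1) (fun x => dotmul u (chi x)).
Let k t s := coherence lam2 (fun x => expR (t * psi x)) (fun x => s * psi x).
Let phi' t j v :=
  1 - coherence P (fun w => expR (t * y j (xi j w))) (fun w => dotmul v (xv j (xi j w))).

Let chi_cont u : continuous (fun x => dotmul u (chi x)).
Proof.
have all (r : seq 'I_n) : continuous (fun x => \sum_(i <- r) u i 0 * chi x i 0).
  elim: r => [|i r IH] x.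
    rewrite (_ : (fun x => _) = (fun=> 0)); first exact: cvg_cst.
    by apply/funext => z; rewrite big_nil.
  rewrite (_ : (fun x => _) = (fun x => u i 0 * chi x i 0 + \sum_(i <- r) u i 0 * chi x i 0)).
    by apply: cvgD; [apply: cvgM; [exact: cvg_cst|exact: cchi]|exact: IH].
  by apply/funext => z; rewrite big_cons.
exact: all.
Qed.

(** [F] carries no [t]: the tilt depends on the second form only. The convergence of the masses is
    the case of constant test functions. *)
Let form_limit t u s : tiltable t ->
  [/\ weight lam2 (fun x => expR (t * psi x)),
    \prod_(j < N) KY j t @[N --> \oo] --> K2 t &
    \prod_(j < N) (1 - phi' t j (u + s *: c j)) @[N --> \oo] --> F u * k t s].
Proof.
move=> tt; have [V [C [cV V0 VC WV]]] := tilt_majorant tt.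
have W0 x : 0 < expR (t * psi x) by exact: expR_gt0.
have wl : weight lam2 (fun x => expR (t * psi x)).
  exact: (tilt_weight_lim mS2 S12 (@exp_psi_cont t) cV W0 V0 VC WV).
have ww j : weight P (fun w => expR (t * y j (xi j w))) by apply: form_weight; exact: weight_int wl.
have mw j : measurable_fun setT (fun x => expR (t * y j x)).
  by apply: measurableT_comp => //; exact: measurable_funM.
have mp j : measurable_fun setT (fun x => dotmul u (xv j x) + s * y j x).
  by apply: measurable_funD; [exact: dotmul_measurable|exact: measurable_funM].
have EW N : (fun w => expR (t * psi (S2 N w))) = (fun w => \prod_(0 <= j < N) expR (t * y j (xi j w))).
  by apply/funext => w; rewrite S2sum mulr_sumr expR_sum.
have CP N := coherence_prod xi_indep mw mp ww N.
split => //.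
- have one : bounded_fun (fun _ : T => 1 : R) by exists 1 => x; rewrite normr1.
  have c1 : continuous (fun _ : T => 1 : R) by move=> x; exact: cvg_cst.
  have H := tilted_product_limit mS1 mS2 S12 (@exp_psi_cont t) cV W0 V0 VC WV c1 c1 one one.
  have E2 : (\int[lam1]_x 1) * (\int[lam2]_x (expR (t * psi x) * 1)) = K2 t.
    rewrite Rintegral_probability_cst mul1r.
    by apply: eq_Rintegral => x _; rewrite mulr1.
  rewrite E2 in H; apply: cvg_trans H; apply: near_eq_cvg; near=> N.
  have [_ E _] := CP N; rewrite big_mkord in E; rewrite -E -EW.
  by apply: eq_Rintegral => w _; rewrite !mulr1.
- have cp : continuous (fun x => s * psi x).
    by move=> x; apply: cvgM; [exact: cvg_cst|exact: cpsi].
  have H := tilted_coherence_limit mS1 mS2 S12 (@exp_psi_cont t) cV W0 V0 VC WV (@chi_cont u) cp.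
  apply: cvg_trans H; apply: near_eq_cvg; near=> N.
  rewrite EW (_ : (fun w => _ + _) =
    (fun w => \sum_(0 <= j < N) (dotmul u (xv j (xi j w)) + s * y j (xi j w)))); last first.
    by apply/funext => w; rewrite S1sum S2sum mulr_sumr big_split.
  have [_ _ ->] := CP N; rewrite big_mkord; apply: eq_bigr => j _.
  by rewrite /phi' subKr lin.
Unshelve. all: by end_near.
Qed.

Let w1 : weight lam1 (fun=> 1).
Proof. by apply: positive_weight => //; exact: finite_measure_integrable_cst. Qed.

Let mchi i : measurable_fun setT (fun x : borel T => chi x i 0).
Proof. by apply: (@continuous_borel_real R T (fun x => chi x i 0)); exact: cchi. Qed.

Let tilt_finite t : tiltable t -> mgf_finite t.
Proof. by move=> tt; have [wl _ _] := form_limit 0 0 tt; exact: weight_int wl. Qed.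

Let dphi t j : tiltable t -> defect (phi' t j).
Proof.
move=> tt; apply: coherence_defect; first by apply: form_weight; exact: tilt_finite.
by move=> i; apply: (measurableT_comp (f := fun t : borel T => xv j t i 0)).
Qed.

Let k0 t : tiltable t -> k t 0 = 1.
Proof.
move=> tt; have [wl _ _] := form_limit 0 0 tt.
rewrite /k (_ : (fun x => 0 * psi x) = fun=> 0); last by apply/funext => x; rewrite mul0r.
exact: coherence_cst.
Qed.

Let kN t s : tiltable t -> k t (- s) = k t s.
Proof.
move=> tt; have [wl _ _] := form_limit 0 0 tt.
rewrite /k -[RHS]coherenceN //; last exact: measurable_funM.
by congr coherence; apply/funext => x; rewrite mulNr.
Qed.

(** The neighbourhood depends on [lam1] only, not on a tilt. *)
Let F_near : exists2 d0 : R, 0 < d0 & forall u, box d0 u -> 1 / 2 <= F u.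
Proof.
have h2 : 0 < 1 / 2 :> R by lra.
have [d0 d00 hd] := coherence_box_cont w1 mchi h2.
by exists d0 => // u /hd; rewrite /F; lra.
Qed.

(** The differences of the coherences under the tilt [t] are bounded in terms of [n], [K] and [d0],
    so that [M] and [eta] do not depend on [t]. *)
Let two_sided_mgf : exists M eta : R, [/\ 0 < eta, 0 < M & forall t h, tiltable t -> 0 < h <= eta ->
  [/\ mgf_finite (t + h), mgf_finite (t - h) & K2 (t + h) * K2 (t - h) <= M * K2 t ^+ 2]].
Proof.
have [d0 d00 F_ge] := F_near.
(* [a] and [Cb] are the constants of [fdiffn_k_le], and [1 / (4 * a)] is the largest exponent that
   [two_sided_moments] allows. *)
pose a := 8 * n.+1%:R * K * expR 1 / d0.
pose Cb := expR (2 * (2 * (2 ^+ n * (6 * n%:R)) + 1)) : R.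
have a0 : 0 < a by rewrite divr_gt0 // !mulr_gt0 ?expR_gt0 // ltr0n.
have Cb0 : 0 < Cb by exact: expR_gt0.
have a4 : 0 < 4 * a by rewrite mulr_gt0.
exists (4 * Cb), (1 / (4 * a)); split; [by rewrite divr_gt0|by rewrite mulr_gt0|].
move=> t h tt /andP[h0 ha].
have [wl _ _] := form_limit 0 0 tt.
have rho0 : 0 < d0 / (2 * K) by rewrite divr_gt0 // mulr_gt0.
have ah : 4 * a * h <= 1 by rewrite mulrC -ler_pdivlMr // mulr_gt0.
have kb (h' : R) (m : nat) : 0 < h' -> m%:R * h' <= d0 / (2 * K) ->
  `|fdiffn m.*2 (fun i => k t ((i%:R - m%:R) * h')) 0| <= (m.*2)`!%:R * ((a * h') ^+ m.*2 * Cb).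
  move=> h'0 mh.
  have mhK : m%:R * h' * K <= d0 / 2.
    have := mh; rewrite ler_pdivlMr ?mulr_gt0 // => mh2.
    by rewrite ler_pdivlMr //; apply: le_trans mh2; lra.
  have := fdiffn_k_le (fun j => dphi j tt) K0 d00 c_le F_ge (k0 tt)
    (fun u s => let: And3 _ _ H := form_limit u s tt in H) h'0 mhK.
  by rewrite (_ : 2 * (4 * n.+1%:R * K * expR 1 * h' / d0) = a * h') // /a; ring.
have [I1 I2 I3] := two_sided_moments wl mpsi a0 rho0 (ltW Cb0) h0 ah kb.
have E1 : (fun x => expR (t * psi x) * expR (h * psi x)) = (fun x => expR ((t + h) * psi x)).
  by apply/funext => x; rewrite -expRD mulrDl.
have E2 : (fun x => expR (t * psi x) * expR (- (h * psi x))) = (fun x => expR ((t - h) * psi x)).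
  by apply/funext => x; rewrite -expRD mulrBl.
rewrite E1 in I1 I3; rewrite E2 in I2 I3.
by split => //; rewrite [leRHS]mulrC.
Qed.

(** Finiteness spreads from [t = 0] in steps of half of [eta], the other half providing the margin
    around [t]. *)
Let all_tiltable t : tiltable t.
Proof.
have [M [eta [eta0 _ H]]] := two_sided_mgf.
pose h := eta / 2; have h0 : 0 < h by rewrite divr_gt0.
suff all (m : nat) t' : `|t'| <= m%:R * h -> tiltable t'.
  apply: (all (Num.bound (`|t| / h))); rewrite -ler_pdivrMr //.
  by apply/ltW/archi_boundP; rewrite divr_ge0 // ltW.
elim: m t' => [|m IH] t'.
  rewrite mul0r normr_le0 => /eqP ->; exists 0; rewrite addr0 subr0.
  by split; [left|exact: mgf_finite0..].
have fin s : `|s| <= m.+2%:R * h -> mgf_finite s.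
  move=> sm; have m2 : 0 < m.+2%:R :> R by rewrite ltr0n.
  have mm : m.+2%:R = m%:R + 2 :> R by rewrite -natrD addn2.
  (* Shrinking [s] by [m / (m + 2)] brings it within [m * h], at a distance of at most
     [2 * h = eta]. *)
  pose s' := s * (m%:R / m.+2%:R).
  have s'm : `|s'| <= m%:R * h.
    rewrite normrM (ger0_norm (divr_ge0 (ler0n _ m) (ltW m2))).
    apply: (@le_trans _ _ (m.+2%:R * h * (m%:R / m.+2%:R))).
      by rewrite ler_wpM2r // divr_ge0 // ltW.
    by rewrite mulrC mulrA divfK ?gt_eqF.
  have ds : s - s' = s * (2 / m.+2%:R).
    rewrite /s' -{1}[s]mulr1 -mulrBr; congr (_ * _).
    by rewrite -{1}(@divff _ m.+2%:R) ?gt_eqF // -mulrBl mm; congr (_ / _); ring.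
  have dle : `|s - s'| <= eta.
    rewrite ds normrM (ger0_norm (divr_ge0 (ler0n _ 2) (ltW m2))).
    rewrite mulrA ler_pdivrMr //; apply: (@le_trans _ _ (m.+2%:R * h * 2)).
      by rewrite ler_wpM2r.
    by rewrite /h; lra.
  have [s0|s0|s0] := ltgtP s 0; last by rewrite s0; exact: mgf_finite0.
    have d0 : 0 < s' - s by rewrite -opprB oppr_gt0 ds pmulr_llt0 // divr_gt0.
    have de : 0 < s' - s <= eta by rewrite d0 /= -(ger0_norm (ltW d0)) distrC.
    by have [_ + _] := H _ _ (IH _ s'm) de; rewrite subKr.
  have d0 : 0 < s - s' by rewrite ds pmulr_lgt0 // divr_gt0.
  have de : 0 < s - s' <= eta by rewrite d0 /= -(ger0_norm (ltW d0)).
  by have [+ _ _] := H _ _ (IH _ s'm) de; rewrite addrC subrK.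
move=> tm; exists h; split; [by right|apply: fin..].
  by apply: (le_trans (ler_normD _ _)); rewrite (gtr0_norm h0) -[m.+2]addn1 natrD mulrDl mul1r lerD2r.
by apply: (le_trans (ler_normB _ _)); rewrite (gtr0_norm h0) -[m.+2]addn1 natrD mulrDl mul1r lerD2r.
Qed.

Lemma form_mgf_finite j t : Rintegrable P (fun w => expR (t * y j (xi j w))).
Proof. exact: weight_int (form_weight j (tilt_finite (all_tiltable t))). Qed.

Let KY_gt0 j t : 0 < KY j t.
Proof. exact: weight_mass (form_weight j (tilt_finite (all_tiltable t))). Qed.

(** Cauchy-Schwarz, by the discriminant of a quadratic polynomial in [x] that is the expectation of
    a weighted square. *)
Let KY_convex j t h : KY j t ^+ 2 <= KY j (t + h) * KY j (t - h).
Proof.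
have quad (x : R) : 0 <= x ^+ 2 * KY j (t + h) + (- 2 * x * KY j t + KY j (t - h)).
  rewrite -!RintegralZl //; [|exact: form_mgf_finite..].
  rewrite -!RintegralD //; [|by [exact: RintegrableZ (form_mgf_finite _ _)|exact: form_mgf_finite|
    by apply: RintegrableD; [apply: RintegrableZ|]; exact: form_mgf_finite]..].
  apply: Rintegral_ge0 => w _; set z := y j (xi j w).
  have -> : x ^+ 2 * expR ((t + h) * z) + (- 2 * x * expR (t * z) + expR ((t - h) * z)) =
    expR (t * z) * (expR (h * z / 2) * x - expR (- (h * z / 2))) ^+ 2.
    have e1 : expR ((t + h) * z) = expR (t * z) * expR (h * z / 2) ^+ 2.
      by rewrite expr2 -!expRD; congr expR; field.
    have e2 : expR ((t - h) * z) = expR (t * z) * expR (- (h * z / 2)) ^+ 2.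
      by rewrite expr2 -!expRD; congr expR; field.
    have e3 : expR (h * z / 2) * expR (- (h * z / 2)) = 1 by rewrite -expRD subrr expR0.
    rewrite e1 e2 sqrrB.
    rewrite (_ : expR (h * z / 2) * x * expR (- (h * z / 2)) = x); first by ring.
    by rewrite mulrAC e3 mul1r.
  by rewrite mulr_ge0 ?expR_ge0 // sqr_ge0.
have p0 := KY_gt0 j (t + h).
have fact (p q r : R) : p != 0 -> (q / p) ^+ 2 * p + (- 2 * (q / p) * q + r) = r - q ^+ 2 / p.
  by move=> pn; field.
have := quad (KY j t / KY j (t + h)).
rewrite (fact _ _ _ (lt0r_neq0 p0)) subr_ge0 (ler_pdivrMr _ _ p0) => H.
by rewrite [leRHS]mulrC.
Qed.

(* Each ratio [r i] is at least 1, by convexity, so that it is bounded by the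
   limit of their product. *)
Let KY_ratio : exists M eta : R, [/\ 0 < eta, 0 < M & forall j t h, 0 < h <= eta ->
  KY j (t + h) * KY j (t - h) <= M * KY j t ^+ 2].
Proof.
have [M [eta [eta0 M0 H]]] := two_sided_mgf; exists M, eta; split => // j t h hh.
have [_ _ K2M] := H t h (all_tiltable t) hh.
have lim t' : \prod_(j < N) KY j t' @[N --> \oo] --> K2 t'.
  by have [_ L _] := form_limit 0 0 (all_tiltable t').
have K20 t' : 0 < K2 t' by have [wl _ _] := form_limit 0 0 (all_tiltable t'); exact: weight_mass wl.
pose r i := KY i (t + h) * KY i (t - h) / KY i t ^+ 2.
have r1 i : 1 <= r i by rewrite ler_pdivlMr ?exprn_gt0 // mul1r.
have rM : \prod_(i < N) r i @[N --> \oo] --> K2 (t + h) * K2 (t - h) / K2 t ^+ 2.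
  rewrite (_ : (fun N => _) = (fun N => (\prod_(i < N) KY i (t + h)) * (\prod_(i < N) KY i (t - h)) /
    (\prod_(i < N) KY i t) ^+ 2)); last first.
    by apply/funext => N; rewrite expr2 invfM -!prodfV -!big_split /=; apply: eq_bigr => i _; rewrite /r expr2 invfM.
  apply: cvgM; first exact: cvgM.
  by apply: cvgV; [rewrite gt_eqF // exprn_gt0|rewrite expr2; under eq_fun do rewrite expr2; exact: cvgM].
suff : r j <= M by rewrite /r ler_pdivrMr ?exprn_gt0.
have rM' : \prod_(i < m + j.+1) r i @[m --> \oo] --> K2 (t + h) * K2 (t - h) / K2 t ^+ 2.
  by rewrite (cvg_shiftn j.+1 (fun N => \prod_(i < N) r i)).
apply: (@le_trans _ _ (K2 (t + h) * K2 (t - h) / K2 t ^+ 2)); last by rewrite ler_pdivrMr ?exprn_gt0.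
apply: (cvgn_ge rM') => m.
have jm : (j < m + j.+1)%N by rewrite addnS ltnS leq_addl.
rewrite (bigD1 (Ordinal jm)) //= ler_peMr //; first exact: le_trans ler01 (r1 j).
by elim/big_ind: _ => // x z; exact: mulr_ege1.
Qed.

(** If the factor of index [j] vanished, so would all later partial products and their limit at
    [u = 0], which is [k t s] because [F 0 = 1]; this contradicts [k_gt0]. *)
Lemma form_positive j t s :
  0 < coherence P (fun w => expR (t * y j (xi j w))) (fun w => s * y j (xi j w)).
Proof.
have tt := all_tiltable t; have [d0 d00 F_ge] := F_near.
have ks : 0 < k t s.
  exact: (k_gt0 (fun j => dphi j tt) K0 d00 c_le F_ge (k0 tt) (fun s => kN s tt)
    (fun u s => let: And3 _ _ H := form_limit u s tt in H)).
have [_ _ L] := form_limit 0 s tt.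
have F1 : F 0 = 1.
  exact: (F01 (fun j => dphi j tt) (k0 tt) (fun u s => let: And3 _ _ H := form_limit u s tt in H)).
rewrite F1 mul1r in L.
rewrite lt_neqAle coherence_ge0 andbT eq_sym; apply: contraTneq ks => z0.
have ww := form_weight j (tilt_finite tt).
have := lin j 0 s ww.
rewrite (_ : (fun w => _ + _) = (fun w => s * y j (xi j w))); last first.
  by apply/funext => w; rewrite /dotmul big1 ?add0r // => i _; rewrite mxE mul0r.
rewrite z0 => /esym z1.
suff -> : k t s = 0 by rewrite ltxx.
apply: (cvg_unique _ L) => //; apply: cvg_near_cst; near=> N.
have jN : (j < N)%N by near: N; exact: nbhs_infty_gt.
by rewrite (bigD1 (Ordinal jN) isT) /= /phi' subKr z1 mul0r.
Unshelve. all: by end_near.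
Qed.

Lemma form_growth j : exists C : R, forall t, KY j t <= expR (C * (1 + t ^+ 2)).
Proof.
have [M [eta [eta0 M0 H]]] := KY_ratio.
apply: (mgf_growth eta0) => [|t]; first exact: form_mgf_finite.
by apply: H; rewrite eta0 lexx.
Qed.

End Forms.

(** * Zero-free Laplace transforms *)

(** A quadratic remainder, unlike mere differentiability, survives integration: derivatives are
    taken under the integral sign by integrating a bound on the second derivative. *)
Lemma is_derive_quadratic {R : realType} (f : R -> R) (x c M : R) :
  (forall h : R, `|h| <= 1 -> `|f (x + h) - f x - h * c| <= M * h ^+ 2) ->
  is_derive x (1 : R) f c.
Proof.
move=> hf; have M0 : 0 <= M.
  by have := hf 1; rewrite normr1 => /(_ (lexx _)) /(le_trans (normr_ge0 _)); rewrite expr1n mulr1.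
have cv : h^-1 *: (f (h *: (1 : R) + x) - f x) @[h --> (0 : R)^'] --> c.
  apply/cvgrPdist_le => e e0; near=> h.
  have h0 : h != 0 by near: h; exact: nbhs_dnbhs_neq.
  have hn : 0 < `|h| by rewrite normr_gt0.
  have h1 : `|h| <= 1 by near: h; apply: dnbhs0_le.
  have hM : `|h| <= e / (M + 1) by near: h; apply: dnbhs0_le; rewrite divr_gt0 // ltr_wpDl.
  rewrite -(ler_pM2l hn) -normrM mulrBr /GRing.scale /= mulr1 mulVKf // addrC -[h + x]addrC.
  rewrite -normrN opprD opprK addrC; have := hf h h1.
  rewrite [x + h]addrC addrAC => /le_trans; apply.
  rewrite -real_normK ?num_real // expr2 mulrCA ler_pM2l //.
  apply: (@le_trans _ _ ((M + 1) * `|h|)); first by rewrite ler_wpM2r // lerDl.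
  by rewrite mulrC -ler_pdivlMr // ltr_wpDl.
apply: DeriveDef; first by apply/cvg_ex; exists c.
by apply/cvg_lim.
Unshelve. all: by end_near.
Qed.

Lemma quadratic_estimate {R : realType} (f f1 f2 : R -> R) (x h M : R) :
  (forall y : R, is_derive y (1 : R) f (f1 y)) ->
  (forall y : R, is_derive y (1 : R) f1 (f2 y)) ->
  (forall y : R, `|y - x| <= `|h| -> `|f2 y| <= M) ->
  `|f (x + h) - f x - h * f1 x| <= M * h ^+ 2.
Proof.
move=> df df1 f2M; have [c hc e] := is_derive_mvt x (x + h) df.
have cx : `|c - x| <= `|h|.
  move: hc; rewrite minEle maxEle; case: ifP => [xh|/negbT]; last rewrite -ltNge => xh.
    by move=> /andP[? ?]; rewrite !ger0_norm; lra.
  by move=> /andP[? ?]; rewrite !ler0_norm; lra.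
have [c' hc' e'] := is_derive_mvt x c df1.
have cx' : `|c' - x| <= `|h|.
  apply: le_trans cx; move: hc'; rewrite minEle maxEle; case: ifP => [xh|/negbT]; last rewrite -ltNge => xh.
    by move=> /andP[? ?]; rewrite !ger0_norm; lra.
  by move=> /andP[? ?]; rewrite !ler0_norm; lra.
rewrite e (_ : _ - _ = (f1 c - f1 x) * h); last by ring.
rewrite e' !normrM -[h ^+ 2]real_normK ?num_real // expr2 -mulrA.
apply: ler_pM; rewrite ?mulr_ge0 //; first exact: f2M.
by rewrite ler_wpM2r.
Qed.

Section RealDerivatives.
Context {R : realType}.
Implicit Types (f g : R -> R) (x a b : R).

Lemma rderD f g x a b : is_derive x (1 : R) f a -> is_derive x (1 : R) g b ->
  is_derive x (1 : R) (fun y => f y + g y) (a + b).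
Proof. by move=> df dg; exact: (is_deriveD df dg). Qed.

Lemma rderN f x a : is_derive x (1 : R) f a -> is_derive x (1 : R) (fun y => - f y) (- a).
Proof. by move=> df; exact: (is_deriveN df). Qed.

Lemma rderB f g x a b : is_derive x (1 : R) f a -> is_derive x (1 : R) g b ->
  is_derive x (1 : R) (fun y => f y - g y) (a - b).
Proof. by move=> df dg; exact: (is_deriveB df dg). Qed.

Lemma rderM f g x a b : is_derive x (1 : R) f a -> is_derive x (1 : R) g b ->
  is_derive x (1 : R) (fun y => f y * g y) (a * g x + f x * b).
Proof.
move=> df dg; apply: (is_derive_eq (is_deriveM df dg)).
by rewrite /GRing.scale /=; ring.
Qed.

Lemma rderV f x a : f x != 0 -> is_derive x (1 : R) f a ->
  is_derive x (1 : R) (fun y => (f y)^-1) (- a / f x ^+ 2).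
Proof.
move=> f0 df; have h : is_derive x (1 : R) (fun y => (f y)^-1) _ := is_deriveV f0 df.
apply: (is_derive_eq h).
by rewrite /GRing.scale /=; field.
Qed.

Lemma rder_comp g f x a b : is_derive (f x) (1 : R) g b -> is_derive x (1 : R) f a ->
  is_derive x (1 : R) (fun y => g (f y)) (b * a).
Proof. by move=> dg df; exact: (is_derive1_comp dg df). Qed.

Lemma rder_eq f x a b : is_derive x (1 : R) f a -> a = b -> is_derive x (1 : R) f b.
Proof. by move=> df <-. Qed.

End RealDerivatives.

(** * Complex-valued functions of a real variable *)

Section ComplexCalculus.
Context {R : realType}.
Local Open Scope complex_scope.
Local Notation Re := complex.Re.
Local Notation Im := complex.Im.
Implicit Types f g : R -> R[i].

Definition cderive f f' : Prop := forall x : R,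
  is_derive x (1 : R) (fun x => Re (f x)) (Re (f' x)) /\
  is_derive x (1 : R) (fun x => Im (f x)) (Im (f' x)).

Definition ccont f : Prop := continuous (fun x => Re (f x)) /\ continuous (fun x => Im (f x)).

Lemma is_derive_continuous (f f' : R -> R) :
  (forall x : R, is_derive x (1 : R) f (f' x)) -> continuous f.
Proof. by move=> df x; apply: differentiable_continuous; apply/derivable1_diffP; case: (df x). Qed.

Lemma cderive_cont f f' : cderive f f' -> ccont f.
Proof. by move=> df; split; apply: is_derive_continuous => x; case: (df x). Qed.

Lemma eq_cderive f f' g' : cderive f f' -> f' =1 g' -> cderive f g'.
Proof. by move=> df e x; rewrite -e. Qed.

Lemma cderive_cst (c : R[i]) : cderive (fun=> c) (fun=> 0).
Proof. by move=> x; split => /=; exact: is_derive_cst. Qed.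

Lemma cderiveD f f' g g' : cderive f f' -> cderive g g' ->
  cderive (fun x => f x + g x) (fun x => f' x + g' x).
Proof.
move=> df dg x; have [df1 df2] := df x; have [dg1 dg2] := dg x.
have e1 : (fun x => Re (f x + g x)) = (fun x => Re (f x) + Re (g x)) by apply/funext => y; rewrite raddfD.
have e2 : (fun x => Im (f x + g x)) = (fun x => Im (f x) + Im (g x)) by apply/funext => y; rewrite raddfD.
by rewrite e1 e2 !raddfD; split; exact: rderD.
Qed.

Lemma ReM (z w : R[i]) : Re (z * w) = Re z * Re w - Im z * Im w.
Proof. by case: z w => [a b] [c d]. Qed.

Lemma ImM (z w : R[i]) : Im (z * w) = Re z * Im w + Im z * Re w.
Proof. by case: z w => [a b] [c d]. Qed.

Lemma cderiveM f f' g g' : cderive f f' -> cderive g g' ->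
  cderive (fun x => f x * g x) (fun x => f' x * g x + f x * g' x).
Proof.
move=> df dg x; have [df1 df2] := df x; have [dg1 dg2] := dg x.
have e1 : (fun x => Re (f x * g x)) = (fun x => Re (f x) * Re (g x) - Im (f x) * Im (g x)).
  by apply/funext => y; rewrite ReM.
have e2 : (fun x => Im (f x * g x)) = (fun x => Re (f x) * Im (g x) + Im (f x) * Re (g x)).
  by apply/funext => y; rewrite ImM.
rewrite e1 e2 !raddfD /= !ReM !ImM; split.
  by apply: (rder_eq (rderB (rderM df1 dg1) (rderM df2 dg2))); ring.
by apply: (rder_eq (rderD (rderM df1 dg2) (rderM df2 dg1))); ring.
Qed.

Lemma complex_normsq_neq0 (z : R[i]) : z != 0 -> Re z ^+ 2 + Im z ^+ 2 != 0.
Proof.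
case: z => a b; apply: contra; rewrite paddr_eq0 ?sqr_ge0 // !sqrf_eq0 /=.
by case/andP => /eqP -> /eqP ->.
Qed.

Lemma ReV (z : R[i]) : Re z^-1 = Re z / (Re z ^+ 2 + Im z ^+ 2).
Proof. by case: z. Qed.

Lemma ImV (z : R[i]) : Im z^-1 = - (Im z / (Re z ^+ 2 + Im z ^+ 2)).
Proof. by case: z. Qed.

Lemma cderiveV f f' : (forall x, f x != 0) -> cderive f f' ->
  cderive (fun x => (f x)^-1) (fun x => - (f' x * ((f x)^-1 * (f x)^-1))).
Proof.
move=> f0 df x; have [df1 df2] := df x; have := f0 x.
have n0 y := complex_normsq_neq0 (f0 y).
pose N (y : R) := Re (f y) ^+ 2 + Im (f y) ^+ 2.
have dN : is_derive x (1 : R) N (2 * Re (f x) * Re (f' x) + 2 * Im (f x) * Im (f' x)).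
  have -> : N = (fun x => Re (f x) * Re (f x) + Im (f x) * Im (f x)) by apply/funext => y; rewrite /N !expr2.
  by apply: (rder_eq (rderD (rderM df1 df1) (rderM df2 df2))); ring.
have dNV := rderV (n0 x : N x != 0) dN.
have e1 : (fun x => Re ((f x)^-1)) = (fun x => Re (f x) * (N x)^-1).
  by apply/funext => y; rewrite /N; case: (f y).
have e2 : (fun x => Im ((f x)^-1)) = (fun x => - (Im (f x) * (N x)^-1)).
  by apply/funext => y; rewrite /N; case: (f y).
rewrite e1 e2; split.
  apply: (rder_eq (rderM df1 dNV)); rewrite /N raddfN /= !(ReM, ImM) ReV ImV.
  by move: (n0 x); set u := Re (f x); set v := Im (f x) => h; field.
apply: (rder_eq (rderN (rderM df2 dNV))); rewrite /N raddfN /= !(ReM, ImM) ReV ImV.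
by move: (n0 x); set u := Re (f x); set v := Im (f x) => h; field.
Qed.

Lemma cderive_cexp f f' : cderive f f' -> cderive (fun x => cexp (f x)) (fun x => f' x * cexp (f x)).
Proof.
move=> df x; have [df1 df2] := df x.
have cE z : cexp z = (expR (Re z) * cos (Im z)) +i* (expR (Re z) * sin (Im z)) :> R[i].
  by rewrite /cexp; apply/eqP; rewrite eq_complex /= !mul0r subr0 addr0 !eqxx.
have e1 : (fun x => Re (cexp (f x))) = (fun x => expR (Re (f x)) * cos (Im (f x))).
  by apply/funext => y; rewrite cE.
have e2 : (fun x => Im (cexp (f x))) = (fun x => expR (Re (f x)) * sin (Im (f x))).
  by apply/funext => y; rewrite cE.
have dE : is_derive x (1 : R) (fun x => expR (Re (f x))) (expR (Re (f x)) * Re (f' x)).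
  exact: (rder_comp (is_derive_expR _) df1).
have dC : is_derive x (1 : R) (fun x => cos (Im (f x))) (- sin (Im (f x)) * Im (f' x)).
  exact: (rder_comp (is_derive_cos _) df2).
have dS : is_derive x (1 : R) (fun x => sin (Im (f x))) (cos (Im (f x)) * Im (f' x)).
  exact: (rder_comp (is_derive_sin _) df2).
rewrite e1 e2 cE !(ReM, ImM) /=; split.
  by apply: (rder_eq (rderM dE dC)); ring.
by apply: (rder_eq (rderM dE dS)); ring.
Qed.

(** The l1 norm of the plane, submultiplicative and free of square roots. *)
Definition cnorm (z : R[i]) : R := `|Re z| + `|Im z|.

Lemma cnorm_ge0 z : 0 <= cnorm z.
Proof. by rewrite addr_ge0. Qed.

Lemma cnormD z w : cnorm (z + w) <= cnorm z + cnorm w.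
Proof. by rewrite /cnorm !raddfD /= addrACA lerD // ler_normD. Qed.

Lemma cnormM z w : cnorm (z * w) <= cnorm z * cnorm w.
Proof.
rewrite /cnorm ReM ImM; apply: (le_trans (lerD (ler_normB _ _) (ler_normD _ _))).
by rewrite !normrM le_eqVlt; apply/orP; left; apply/eqP; ring.
Qed.

Lemma cnormN z : cnorm (- z) = cnorm z.
Proof. by rewrite /cnorm !raddfN /= !normrN. Qed.

End ComplexCalculus.

(** * Integrals over a period *)

Section CircleIntegral.
Context {R : realType}.
Local Open Scope complex_scope.
Local Notation Re := complex.Re.
Local Notation Im := complex.Im.
Local Notation tau := (pi *+ 2 : R).
Implicit Types (f g : R -> R).

Definition rint f : R := primitive f tau - primitive f 0.

Let tau0 : 0 < tau. Proof. by rewrite mulrn_wgt0 // pi_gt0. Qed.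

Lemma rint_ftc F f : (forall x : R, is_derive x (1 : R) F (f x)) -> continuous f ->
  rint f = F tau - F 0.
Proof.
move=> dF cf.
by rewrite /rint; exact: (@is_derive_cst0 R _ _ f 0 tau (primitiveP cf) dF).
Qed.

Lemma rintD f g : continuous f -> continuous g -> rint (fun x => f x + g x) = rint f + rint g.
Proof.
move=> cf cg.
have dF (x : R) : is_derive x (1 : R) (fun x => primitive f x + primitive g x) (f x + g x).
  exact: (rderD (primitiveP cf x) (primitiveP cg x)).
have cfg : continuous (fun x => f x + g x) by move=> x; exact: (cvgD (cf x) (cg x)).
by rewrite (rint_ftc dF cfg) /rint; ring.
Qed.

Lemma rintZ (c : R) f : continuous f -> rint (fun x => c * f x) = c * rint f.
Proof.
move=> cf.
have dF (x : R) : is_derive x (1 : R) (fun x => c * primitive f x) (c * f x).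
  by apply: (rder_eq (rderM (is_derive_cst c x 1) (primitiveP cf x))); rewrite mul0r add0r.
have cc : continuous (fun x => c * f x).
  by move=> x; apply: cvgM; [exact: cvg_cst|exact: cf].
by rewrite (rint_ftc dF cc) /rint; ring.
Qed.

Lemma rint_cst (c : R) : rint (fun=> c) = tau * c.
Proof.
have dF (x : R) : is_derive x (1 : R) (fun x => c * x) c.
  by apply: (rder_eq (rderM (is_derive_cst c x 1) (is_derive_id x 1))); rewrite mul0r add0r mulr1.
have cc : continuous (fun _ : R => c) by move=> x; exact: cvg_cst.
by rewrite (rint_ftc dF cc); ring.
Qed.

Lemma rint_bound f (M : R) : continuous f -> (forall x, `|f x| <= M) -> `|rint f| <= tau * M.
Proof.
move=> cf fM; have [x _] := is_derive_mvt 0 tau (primitiveP cf).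
by rewrite /rint subr0 => ->; rewrite normrM (gtr0_norm tau0) mulrC ler_pM2l.
Qed.

Lemma rint_le f g : continuous f -> continuous g -> (forall x, f x <= g x) -> rint f <= rint g.
Proof.
move=> cf cg fg; rewrite -subr_ge0.
have -> : rint g - rint f = rint (fun x => g x + -1 * f x).
  rewrite rintD ?rintZ //; first by ring.
  by move=> x; apply: cvgM; [exact: cvg_cst|exact: cf].
have cgf : continuous (fun x => g x + -1 * f x).
  by move=> x; apply: cvgD; [exact: cg|apply: cvgM; [exact: cvg_cst|exact: cf]].
have [x _] := is_derive_mvt 0 tau (primitiveP cgf).
rewrite /rint => ->; rewrite subr0 mulr_ge0 ?(ltW tau0) //.
by rewrite mulN1r subr_ge0.
Qed.

Lemma rint_norm_le f g : continuous f -> continuous g -> (forall x, `|f x| <= g x) -> `|rint f| <= rint g.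
Proof.
move=> cf cg fg; rewrite ler_norml; apply/andP; split.
  rewrite lerNl -mulN1r -rintZ //; apply: rint_le => // [x|x].
    by apply: cvgM; [exact: cvg_cst|exact: cf].
  by rewrite mulN1r; apply: le_trans (fg x); rewrite -normrN ler_norm.
by apply: rint_le => // x; apply: le_trans (fg x); rewrite ler_norm.
Qed.

Lemma rint_derive (F F1 F2 : R -> R -> R) :
  (forall x, continuous (F x)) -> (forall x, continuous (F1 x)) ->
  (forall th x, is_derive x (1 : R) (fun x => F x th) (F1 x th)) ->
  (forall th x, is_derive x (1 : R) (fun x => F1 x th) (F2 x th)) ->
  (forall B : R, exists M : R, forall x th, `|x| <= B -> `|F2 x th| <= M) ->
  forall x, is_derive x (1 : R) (fun x => rint (F x)) (rint (F1 x)).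
Proof.
move=> cF cF1 dF dF1 bF2 x; have [M hM] := bF2 (`|x| + 1).
apply: (@is_derive_quadratic _ _ _ _ (tau * M)) => h h1.
have -> : rint (F (x + h)) - rint (F x) - h * rint (F1 x) =
    rint (fun th => F (x + h) th + (-1 * F x th + - h * F1 x th)).
  rewrite rintD; [|exact: cF|].
    rewrite rintD; [|by move=> th; apply: cvgM; [exact: cvg_cst|exact: cF]|by move=> th; apply: cvgM; [exact: cvg_cst|exact: cF1]].
    by rewrite !rintZ //; ring.
  by move=> th; apply: cvgD; (apply: cvgM; [exact: cvg_cst|]); [exact: cF|exact: cF1].
rewrite -mulrA; apply: rint_bound.
  move=> th; apply: cvgD; first exact: cF.
  by apply: cvgD; (apply: cvgM; [exact: cvg_cst|]); [exact: cF|exact: cF1].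
move=> th; rewrite (_ : _ + _ = F (x + h) th - F x th - h * F1 x th); last by ring.
apply: (quadratic_estimate (dF th) (dF1 th)) => y yx; apply: hM.
rewrite -(subrK x y); apply: (le_trans (ler_normD _ _)); rewrite addrC lerD2l.
exact: le_trans yx h1.
Qed.

Implicit Types F G : R -> R[i].

Definition cint F : R[i] := rint (fun x => Re (F x)) +i* rint (fun x => Im (F x)).

Lemma cint_ftc F F' : cderive F F' -> ccont F' -> cint F' = F tau - F 0.
Proof.
move=> dF [c1 c2].
have d1 (x : R) : is_derive x (1 : R) (fun x => Re (F x)) (Re (F' x)) by case: (dF x).
have d2 (x : R) : is_derive x (1 : R) (fun x => Im (F x)) (Im (F' x)) by case: (dF x).
rewrite /cint (rint_ftc d1 c1) (rint_ftc d2 c2).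
by case: (F tau) (F 0) => [a b] [a' b'].
Qed.

Lemma ccontD F G : ccont F -> ccont G -> ccont (fun x => F x + G x).
Proof.
move=> [f1 f2] [g1 g2]; rewrite /ccont.
have -> : (fun x => Re (F x + G x)) = (fun x => Re (F x) + Re (G x)) by apply/funext => x; rewrite raddfD.
have -> : (fun x => Im (F x + G x)) = (fun x => Im (F x) + Im (G x)) by apply/funext => x; rewrite raddfD.
by split => x; apply: cvgD; [exact: f1|exact: g1|exact: f2|exact: g2].
Qed.

Lemma ccontM F G : ccont F -> ccont G -> ccont (fun x => F x * G x).
Proof.
move=> [f1 f2] [g1 g2]; rewrite /ccont.
have -> : (fun x => Re (F x * G x)) = (fun x => Re (F x) * Re (G x) - Im (F x) * Im (G x)).
  by apply/funext => x; rewrite ReM.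
have -> : (fun x => Im (F x * G x)) = (fun x => Re (F x) * Im (G x) + Im (F x) * Re (G x)).
  by apply/funext => x; rewrite ImM.
split => x; first by apply: cvgB; apply: cvgM; [exact: f1|exact: g1|exact: f2|exact: g2].
by apply: cvgD; apply: cvgM; [exact: f1|exact: g2|exact: f2|exact: g1].
Qed.

Lemma ccont_cst (c : R[i]) : ccont (fun=> c).
Proof. by split => x; exact: cvg_cst. Qed.

Lemma cintD F G : ccont F -> ccont G -> cint (fun x => F x + G x) = cint F + cint G.
Proof.
move=> [f1 f2] [g1 g2]; rewrite /cint.
rewrite (_ : (fun x => Re (F x + G x)) = (fun x => Re (F x) + Re (G x))); last by apply/funext => x; rewrite raddfD.
rewrite (_ : (fun x => Im (F x + G x)) = (fun x => Im (F x) + Im (G x))); last by apply/funext => x; rewrite raddfD.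
by rewrite !rintD.
Qed.

Lemma cintZ (c : R[i]) F : ccont F -> cint (fun x => c * F x) = c * cint F.
Proof.
move=> [f1 f2]; rewrite /cint.
rewrite (_ : (fun x => Re (c * F x)) = (fun x => Re c * Re (F x) + - Im c * Im (F x))); last first.
  by apply/funext => x; rewrite ReM mulNr.
rewrite (_ : (fun x => Im (c * F x)) = (fun x => Re c * Im (F x) + Im c * Re (F x))); last first.
  by apply/funext => x; rewrite ImM.
have cz (a : R) (f : R -> R) : continuous f -> continuous (fun x => a * f x).
  by move=> cf x; apply: cvgM; [exact: cvg_cst|exact: cf].
rewrite !rintD ?rintZ //; try exact: cz.
by case: c => a b; rewrite mulNr.
Qed.

Lemma cint_derive (F F1 F2 : R -> R -> R[i]) :
  (forall x, ccont (F x)) -> (forall x, ccont (F1 x)) ->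
  (forall th, cderive (fun x => F x th) (fun x => F1 x th)) ->
  (forall th, cderive (fun x => F1 x th) (fun x => F2 x th)) ->
  (forall B : R, exists M : R, forall x th, `|x| <= B -> cnorm (F2 x th) <= M) ->
  cderive (fun x => cint (F x)) (fun x => cint (F1 x)).
Proof.
move=> cF cF1 dF dF1 bF2 x; rewrite /cint /=; split.
  apply: (@rint_derive (fun x th => Re (F x th)) (fun x th => Re (F1 x th)) (fun x th => Re (F2 x th))).
  - by move=> z; case: (cF z).
  - by move=> z; case: (cF1 z).
  - by move=> th z; case: (dF th z).
  - by move=> th z; case: (dF1 th z).
  - move=> B; have [M hM] := bF2 B; exists M => z th zB; apply: le_trans (hM z th zB).
    by rewrite lerDl.
apply: (@rint_derive (fun x th => Im (F x th)) (fun x th => Im (F1 x th)) (fun x th => Im (F2 x th))).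
- by move=> z; case: (cF z).
- by move=> z; case: (cF1 z).
- by move=> th z; case: (dF th z).
- by move=> th z; case: (dF1 th z).
- move=> B; have [M hM] := bF2 B; exists M => z th zB; apply: le_trans (hM z th zB).
  by rewrite lerDr.
Qed.

End CircleIntegral.

(** * Laplace transforms along paths *)

Section LaplaceTransform.
Context {d} {Omega : measurableType d} {R : realType} (P : probability Omega R).
Local Open Scope complex_scope.
Local Notation Re := complex.Re.
Local Notation Im := complex.Im.
Variable Y : Omega -> R.
Hypothesis mY : measurable_fun setT Y.
Hypothesis mgfY : forall t, Rintegrable P (fun w => expR (t * Y w)).

Let maj (M : R) w : R := expR (M * Y w) + expR (- M * Y w).

Let maj_int M : Rintegrable P (maj M).
Proof. exact: RintegrableD. Qed.

Let pow_le_maj (p : nat) (M a : R) w : 0 <= M -> `|a| <= M ->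
  `|Y w| ^+ p * expR (a * Y w) <= p`!%:R * maj (M + 1) w.
Proof.
move=> M0 aM.
have e1 : `|Y w| ^+ p <= p`!%:R * expR `|Y w|.
  rewrite mulrC -ler_pdivrMr ?ltr0n ?fact_gt0 //.
  apply: le_trans (exp_partial_sum_le p.+1 (normr_ge0 (Y w))).
  by rewrite big_nat_recr //= lerDr sumr_ge0 // => l _; rewrite divr_ge0 // exprn_ge0.
have e2 : expR (a * Y w) <= expR (M * `|Y w|).
  by rewrite ler_expR (le_trans (ler_norm _)) // normrM ler_wpM2r.
apply: (le_trans (ler_pM (exprn_ge0 _ (normr_ge0 _)) (expR_ge0 _) e1 e2)).
rewrite -mulrA -expRD; apply: ler_wpM2l => //.
rewrite -[X in X + _]mul1r -mulrDl addrC /maj mulNr.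
case: (ger0P (Y w)) => _; first by rewrite lerDl expR_ge0.
by rewrite mulrN lerDr expR_ge0.
Qed.

Definition lt_kernel (k : nat) (z : R[i]) w : R[i] := ((Y w) ^+ k)%:C * cexp (z * (Y w)%:C).

Lemma cexpE (z : R[i]) : cexp z = (expR (Re z) * cos (Im z)) +i* (expR (Re z) * sin (Im z)).
Proof. by rewrite /cexp; apply/eqP; rewrite eq_complex /= !mul0r subr0 addr0 !eqxx. Qed.

Lemma Re_real_mul (a : R) (z : R[i]) : Re (a%:C * z) = a * Re z.
Proof. by rewrite ReM /= mul0r subr0. Qed.

Lemma Im_real_mul (a : R) (z : R[i]) : Im (a%:C * z) = a * Im z.
Proof. by rewrite ImM /= mul0r addr0. Qed.

Lemma Re_lt_kernel k z w : Re (lt_kernel k z w) = Y w ^+ k * (expR (Re z * Y w) * cos (Im z * Y w)).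
Proof. by rewrite /lt_kernel Re_real_mul cexpE /= ReM ImM /= !mulr0 subr0 add0r. Qed.

Lemma Im_lt_kernel k z w : Im (lt_kernel k z w) = Y w ^+ k * (expR (Re z * Y w) * sin (Im z * Y w)).
Proof. by rewrite /lt_kernel Im_real_mul cexpE /= ReM ImM /= !mulr0 subr0 add0r. Qed.

Let lt_kernel_le k z w M : 0 <= M -> `|Re z| <= M ->
  cnorm (lt_kernel k z w) <= 2 * (k`!%:R * maj (M + 1) w).
Proof.
move=> M0 zM; rewrite /cnorm Re_lt_kernel Im_lt_kernel !normrM normrX.
have h := pow_le_maj k w M0 zM; rewrite [`|expR _|]ger0_norm ?expR_ge0 //.
rewrite mulr_natl mulr2n; apply: lerD; apply: le_trans h; rewrite mulrA ler_piMr ?mulr_ge0 ?exprn_ge0 ?expR_ge0 //.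
  exact: cos_max.
exact: sin_max.
Qed.

Let mre k z : measurable_fun setT (fun w => Re (lt_kernel k z w)).
Proof.
under eq_fun do rewrite Re_lt_kernel.
apply: measurable_funM; first exact: measurable_funX.
apply: measurable_funM.
  by apply: measurableT_comp => //; exact: measurable_funM.
apply: (measurableT_comp (f := @cos R)); last exact: measurable_funM.
by apply: continuous_measurable_fun; exact: continuous_cos.
Qed.

Let mim k z : measurable_fun setT (fun w => Im (lt_kernel k z w)).
Proof.
under eq_fun do rewrite Im_lt_kernel.
apply: measurable_funM; first exact: measurable_funX.
apply: measurable_funM.
  by apply: measurableT_comp => //; exact: measurable_funM.
apply: (measurableT_comp (f := @sin R)); last exact: measurable_funM.
by apply: continuous_measurable_fun; exact: continuous_sin.
Qed.

Let majB k M : Rintegrable P (fun w => 2 * (k`!%:R * maj (M + 1) w)).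
Proof. by apply: RintegrableZ; apply: RintegrableZ. Qed.

Let ire k z : Rintegrable P (fun w => Re (lt_kernel k z w)).
Proof.
apply: (Rintegrable_le (mre k z) _ (majB k `|Re z|)) => w.
by apply: le_trans (lt_kernel_le k w (normr_ge0 _) (lexx _)); rewrite lerDl.
Qed.

Let iim k z : Rintegrable P (fun w => Im (lt_kernel k z w)).
Proof.
apply: (Rintegrable_le (mim k z) _ (majB k `|Re z|)) => w.
by apply: le_trans (lt_kernel_le k w (normr_ge0 _) (lexx _)); rewrite lerDr.
Qed.

(* k-th derivative of z |-> E exp (z Y). *)
Definition laplace (k : nat) (z : R[i]) : R[i] :=
  (\int[P]_w Re (lt_kernel k z w)) +i* (\int[P]_w Im (lt_kernel k z w)).

Lemma Re_laplace k z : Re (laplace k z) = \int[P]_w Re (lt_kernel k z w).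
Proof. by []. Qed.

Lemma Im_laplace k z : Im (laplace k z) = \int[P]_w Im (lt_kernel k z w).
Proof. by []. Qed.

Lemma laplace_bound k (M : R) : exists B, forall z, `|Re z| <= M -> cnorm (laplace k z) <= B.
Proof.
exists (2 * \int[P]_w (2 * (k`!%:R * maj (M + 1) w))) => z zM.
have M0 : 0 <= M by apply: le_trans zM.
rewrite /cnorm Re_laplace Im_laplace mulr_natl mulr2n; apply: lerD; apply: le_normr_Rintegral_bound => //.
- by move=> w; apply: le_trans (lt_kernel_le k w M0 zM); rewrite lerDl.
- by move=> w; apply: le_trans (lt_kernel_le k w M0 zM); rewrite lerDr.
Qed.

Definition locally_bounded (f : R -> R[i]) : Prop :=
  forall B : R, exists M : R, forall x, `|x| <= B -> cnorm (f x) <= M.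

(** [G] dominates the second derivative of the kernel along the path, which leaves a quadratic
    remainder after integration. *)
Lemma laplace_derive k (ze ze1 ze2 : R -> R[i]) :
  cderive ze ze1 -> cderive ze1 ze2 ->
  locally_bounded ze -> locally_bounded ze1 -> locally_bounded ze2 ->
  cderive (fun x => laplace k (ze x)) (fun x => ze1 x * laplace k.+1 (ze x)).
Proof.
move=> dz dz1 bz bz1 bz2 x.
have [M0 hM0] := bz (`|x| + 1); have [M1 hM1] := bz1 (`|x| + 1); have [M2 hM2] := bz2 (`|x| + 1).
have x1 : `|x| <= `|x| + 1 by rewrite lerDl.
have M00 : 0 <= M0 by apply: le_trans (hM0 x x1); exact: cnorm_ge0.
have M10 : 0 <= M1 by apply: le_trans (hM1 x x1); exact: cnorm_ge0.
have M20 : 0 <= M2 by apply: le_trans (hM2 x x1); exact: cnorm_ge0.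
pose F y w := lt_kernel k (ze y) w.
pose F1 y w := ze1 y * lt_kernel k.+1 (ze y) w.
pose F2 y w := ze2 y * lt_kernel k.+1 (ze y) w + ze1 y * (ze1 y * lt_kernel k.+2 (ze y) w).
have dker j w : cderive (fun y => lt_kernel j (ze y) w) (fun y => ze1 y * lt_kernel j.+1 (ze y) w).
  have h := cderiveM dz (cderive_cst (Y w)%:C).
  apply: (eq_cderive (cderiveM (cderive_cst (Y w ^+ j)%:C) (cderive_cexp h))) => y.
  by rewrite /lt_kernel exprS rmorphM /=; ring.
have dF w : cderive (fun y => F y w) (fun y => F1 y w) by exact: dker.
have dF1 w : cderive (fun y => F1 y w) (fun y => F2 y w).
  by apply: (eq_cderive (cderiveM dz1 (dker k.+1 w))) => y.
pose G w := M2 * (2 * (k.+1`!%:R * maj (M0 + 1) w)) + M1 * (M1 * (2 * (k.+2`!%:R * maj (M0 + 1) w))).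
have iG : Rintegrable P G.
  by apply: RintegrableD; [apply: RintegrableZ|apply: RintegrableZ; apply: RintegrableZ].
have hG w y : `|y| <= `|x| + 1 -> cnorm (F2 y w) <= G w.
  move=> yx; have zM : `|Re (ze y)| <= M0 by apply: le_trans (hM0 y yx); rewrite lerDl.
  apply: (le_trans (cnormD _ _)); apply: lerD; apply: (le_trans (cnormM _ _)).
    by apply: ler_pM; rewrite ?cnorm_ge0 ?hM2 // lt_kernel_le.
  apply: ler_pM; rewrite ?cnorm_ge0 ?hM1 //; apply: (le_trans (cnormM _ _)).
  by apply: ler_pM; rewrite ?cnorm_ge0 ?hM1 // lt_kernel_le.
have yx (w : Omega) (h y : R) : `|h| <= 1 -> `|y - x| <= `|h| -> `|y| <= `|x| + 1.
  move=> h1 yh; rewrite -(subrK x y); apply: (le_trans (ler_normD _ _)).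
  by rewrite addrC lerD2l; exact: le_trans yh h1.
have i1 : Rintegrable P (fun w => Re (F1 x w)).
  under eq_fun do rewrite ReM; apply: RintegrableB; exact: RintegrableZ.
have i2 : Rintegrable P (fun w => Im (F1 x w)).
  under eq_fun do rewrite ImM; apply: RintegrableD; exact: RintegrableZ.
have e1 : Re (ze1 x * laplace k.+1 (ze x)) = \int[P]_w Re (F1 x w).
  rewrite ReM Re_laplace Im_laplace -!RintegralZl // -RintegralB //; try exact: RintegrableZ.
  by apply: eq_Rintegral => w _; rewrite /F1 ReM.
have e2 : Im (ze1 x * laplace k.+1 (ze x)) = \int[P]_w Im (F1 x w).
  rewrite ImM Re_laplace Im_laplace -!RintegralZl // -RintegralD //; try exact: RintegrableZ.
  by apply: eq_Rintegral => w _; rewrite /F1 ImM.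
rewrite e1 e2; split.
  apply: (@is_derive_quadratic _ _ _ _ (\int[P]_w G w)) => h h1.
  rewrite !Re_laplace -RintegralZl // -!RintegralB //; try exact: RintegrableZ; last exact: RintegrableB.
  apply: (@le_trans _ _ (\int[P]_w (h ^+ 2 * G w))); last by rewrite RintegralZl // mulrC.
  apply: le_normr_Rintegral_bound; last exact: RintegrableZ.
    by apply: Rintegrable_measurable; apply: RintegrableB; [exact: RintegrableB|exact: RintegrableZ].
  move=> w; rewrite [h ^+ 2 * _]mulrC.
  apply: (@quadratic_estimate _ (fun y => Re (F y w)) (fun y => Re (F1 y w)) (fun y => Re (F2 y w))).
  - by move=> y; case: (dF w y).
  - by move=> y; case: (dF1 w y).
  - by move=> y /(yx w h y h1) /(hG w); apply: le_trans; rewrite lerDl.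
apply: (@is_derive_quadratic _ _ _ _ (\int[P]_w G w)) => h h1.
rewrite !Im_laplace -RintegralZl // -!RintegralB //; try exact: RintegrableZ; last exact: RintegrableB.
apply: (@le_trans _ _ (\int[P]_w (h ^+ 2 * G w))); last by rewrite RintegralZl // mulrC.
apply: le_normr_Rintegral_bound; last exact: RintegrableZ.
  by apply: Rintegrable_measurable; apply: RintegrableB; [exact: RintegrableB|exact: RintegrableZ].
move=> w; rewrite [h ^+ 2 * _]mulrC.
apply: (@quadratic_estimate _ (fun y => Im (F y w)) (fun y => Im (F1 y w)) (fun y => Im (F2 y w))).
- by move=> y; case: (dF w y).
- by move=> y; case: (dF1 w y).
- by move=> y /(yx w h y h1) /(hG w); apply: le_trans; rewrite lerDr.
Qed.

End LaplaceTransform.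

(** * The third derivative of the logarithm of the transform *)

Section ZeroFreeLaplace.
Context {d} {Omega : measurableType d} {R : realType} (P : probability Omega R).
Local Open Scope complex_scope.
Local Notation Re := complex.Re.
Local Notation Im := complex.Im.
Local Notation tau := (pi *+ 2 : R).
Variable Y : Omega -> R.
Hypothesis mY : measurable_fun setT Y.
Hypothesis mgfY : forall t, Rintegrable P (fun w => expR (t * Y w)).
Variable C : R.
Hypothesis growth : forall t, \int[P]_w expR (t * Y w) <= expR (C * (1 + t ^+ 2)).
Hypothesis positive : forall t s, 0 < coherence P (fun w => expR (t * Y w)) (fun w => s * Y w).
Local Notation h k := (laplace P Y k%N).

Let normsq (z : R[i]) : R := Re z ^+ 2 + Im z ^+ 2.

Let mgf_gt0 t : 0 < \int[P]_w expR (t * Y w).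
Proof. by apply: weight_mass; apply: positive_weight => // w; exact: expR_gt0. Qed.

(** The coherence under the tilt [Re z] is the squared modulus of the transform at [z], normalised
    by that at [Re z]: positivity of all coherences means absence of zeros. *)
Let normsq_laplace z : normsq (h 0 z) =
  coherence P (fun w => expR (Re z * Y w)) (fun w => Im z * Y w) * (\int[P]_w expR (Re z * Y w)) ^+ 2.
Proof.
rewrite /coherence divfK; last by rewrite gt_eqF // exprn_gt0.
rewrite /normsq.
rewrite Re_laplace.
rewrite Im_laplace /wcos /wsin.
by congr (_ ^+ 2 + _ ^+ 2); apply: eq_Rintegral => w _; rewrite ?Re_lt_kernel ?Im_lt_kernel expr0 mul1r.
Qed.

Let normsq_gt0 z : 0 < normsq (h 0 z).
Proof. by rewrite normsq_laplace; apply: mulr_gt0; [exact: positive|apply: exprn_gt0; exact: mgf_gt0]. Qed.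

Let normsq_le z : normsq (h 0 z) <= expR (C * (1 + Re z ^+ 2)) ^+ 2.
Proof.
rewrite normsq_laplace; have w0 : weight P (fun w => expR (Re z * Y w)).
  by apply: positive_weight => // w; exact: expR_gt0.
apply: (@le_trans _ _ ((\int[P]_w expR (Re z * Y w)) ^+ 2)).
  rewrite ler_piMl ?sqr_ge0 //; apply: coherence_le1 => //; exact: measurable_funM.
by apply: lerXn2r; rewrite ?nnegrE ?expR_ge0 ?growth //; exact: ltW (mgf_gt0 _).
Qed.

Let laplace_neq0 z : h 0 z != 0.
Proof.
apply: contraTneq (normsq_gt0 z) => ->.
by rewrite /normsq /= expr0n /= addr0 ltxx.
Qed.

Definition tame_path (ze ze1 ze2 : R -> R[i]) :=
  [/\ cderive ze ze1, cderive ze1 ze2, locally_bounded ze, locally_bounded ze1 & locally_bounded ze2].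

(** Complex differentiability tested along paths; segments and circles are the only paths to which
    it is applied. *)
Definition holo (f f' : R[i] -> R[i]) := forall ze ze1 ze2, tame_path ze ze1 ze2 ->
  cderive (fun x => f (ze x)) (fun x => ze1 x * f' (ze x)).

Let holo_laplace k : holo (h k) (h k.+1).
Proof. by move=> ze ze1 ze2 [a1 a2 a3 a4 a5]; exact: (laplace_derive mY mgfY k a1 a2). Qed.

Let holoM f f' g g' : holo f f' -> holo g g' ->
  holo (fun z => f z * g z) (fun z => f' z * g z + f z * g' z).
Proof.
move=> hf hg ze ze1 ze2 t; apply: (eq_cderive (cderiveM (hf _ _ _ t) (hg _ _ _ t))) => x; ring.
Qed.

Let holoD f f' g g' : holo f f' -> holo g g' -> holo (fun z => f z + g z) (fun z => f' z + g' z).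
Proof.
move=> hf hg ze ze1 ze2 t; apply: (eq_cderive (cderiveD (hf _ _ _ t) (hg _ _ _ t))) => x; ring.
Qed.

Let holoN f f' : holo f f' -> holo (fun z => - f z) (fun z => - f' z).
Proof.
move=> hf ze ze1 ze2 t x; have [a b] := hf _ _ _ t x; split.
  have := rderN a; rewrite (_ : (fun y => _) = (fun y => Re (- f (ze y)))); last first.
    by apply/funext => y; case: (f _).
  by move/rder_eq; apply; rewrite mulrN; case: (_ * _).
have := rderN b; rewrite (_ : (fun y => _) = (fun y => Im (- f (ze y)))); last first.
  by apply/funext => y; case: (f _).
by move/rder_eq; apply; rewrite mulrN; case: (_ * _).
Qed.

Let holoV : holo (fun z => (h 0 z)^-1) (fun z => - (h 1 z * ((h 0 z)^-1 * (h 0 z)^-1))).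
Proof.
move=> ze ze1 ze2 t; have H := holo_laplace 0 t.
by apply: (eq_cderive (cderiveV (fun x => laplace_neq0 (ze x)) H)) => x; ring.
Qed.

(** The functions in play. The class is closed under derivation and its members are bounded on
    disks, both by induction, so that derivatives of every order are available. *)
Inductive laplace_alg : (R[i] -> R[i]) -> Prop :=
| alg_laplace k : laplace_alg (h k)
| alg_inv : laplace_alg (fun z => (h 0 z)^-1)
| alg_mul f g : laplace_alg f -> laplace_alg g -> laplace_alg (fun z => f z * g z)
| alg_add f g : laplace_alg f -> laplace_alg g -> laplace_alg (fun z => f z + g z)
| alg_opp f : laplace_alg f -> laplace_alg (fun z => - f z).

Let alg_derive f : laplace_alg f -> exists2 f', laplace_alg f' & holo f f'.
Proof.
elim=> [k||f' g af [f1 a1 h1] ag [g1 b1 h2]|f' g af [f1 a1 h1] ag [g1 b1 h2]|f' af [f1 a1 h1]].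
- by exists (h k.+1); [exact: alg_laplace|exact: holo_laplace].
- exists (fun z => - (h 1 z * ((h 0 z)^-1 * (h 0 z)^-1))); last exact: holoV.
  apply/alg_opp/alg_mul; first exact: alg_laplace.
  by apply: alg_mul; exact: alg_inv.
- exists (fun z => f1 z * g z + f' z * g1 z); last exact: holoM.
  by apply: alg_add; exact: alg_mul.
- by exists (fun z => f1 z + g1 z); [exact: alg_add|exact: holoD].
- by exists (fun z => - f1 z); [exact: alg_opp|exact: holoN].
Qed.

Let abs_Re (z : R[i]) : `|Re z| <= cnorm z.
Proof. by rewrite /cnorm lerDl. Qed.

Let abs_Im (z : R[i]) : `|Im z| <= cnorm z.
Proof. by rewrite /cnorm lerDr. Qed.

Let segment_path (w v : R[i]) : tame_path (fun x => w + x%:C * v) (fun=> v) (fun=> 0).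
Proof.
have cx : cderive (fun x : R => x%:C) (fun=> 1).
  by move=> x; split; [exact: is_derive_id|exact: is_derive_cst].
split.
- apply: (eq_cderive (cderiveD (cderive_cst w) (cderiveM cx (cderive_cst v)))) => x.
  by rewrite add0r mul1r mulr0 addr0.
- exact: cderive_cst.
- move=> B; exists (cnorm w + B * cnorm v) => x xB.
  apply: (le_trans (cnormD _ _)); rewrite lerD2l; apply: (le_trans (cnormM _ _)).
  by rewrite ler_wpM2r ?cnorm_ge0 // /cnorm /= normr0 addr0.
- by move=> B; exists (cnorm v).
- by move=> B; exists 0 => x _; rewrite /cnorm /= normr0 addr0.
Qed.

(** Continuity in both real variables, for the compactness argument of [square_bound]; derivatives
    along single paths do not provide it without a bound uniform in the direction [v]. *)
Let laplace_lipschitz (w : R[i]) : exists2 L : R, 0 <= L & forall v, cnorm v <= 1 ->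
  cnorm (h 0 (w + v) - h 0 w) <= L * cnorm v.
Proof.
have [B1 hB1] := laplace_bound mY mgfY 1 (`|Re w| + 1).
have [B2 hB2] := laplace_bound mY mgfY 2 (`|Re w| + 1).
have B10 : 0 <= B1.
  by apply: le_trans (cnorm_ge0 _) (hB1 w _); rewrite lerDl.
have B20 : 0 <= B2.
  by apply: le_trans (cnorm_ge0 _) (hB2 w _); rewrite lerDl.
exists (2 * (B1 + B2)) => [|v v1]; first by rewrite mulr_ge0 ?addr_ge0.
have tp := segment_path w v.
have D1 := holo_laplace 0 tp.
have D2 : cderive (fun x => v * h 1 (w + x%:C * v)) (fun x => v * (v * h 2 (w + x%:C * v))).
  by apply: (eq_cderive (cderiveM (cderive_cst v) (holo_laplace 1 tp))) => x; rewrite mul0r add0r.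
have path_in (x : R) : `|x| <= 1 -> `|Re (w + x%:C * v)| <= `|Re w| + 1.
  move=> x1; have -> : Re (w + x%:C * v) = Re w + x * Re v.
    by rewrite -Re_real_mul; case: (w) => ? ?; case: (_ * _).
  apply: (le_trans (ler_normD _ _)); rewrite lerD2l normrM.
  by apply: mulr_ile1 => //; exact: le_trans (abs_Re v) v1.
have vv : cnorm v * (cnorm v * B2) <= cnorm v * B2.
  by rewrite ler_wpM2l ?cnorm_ge0 // ler_piMl.
have bnd (x : R) : `|x - 0| <= `|1 : R| -> cnorm (v * (v * h 2 (w + x%:C * v))) <= cnorm v * B2.
  rewrite subr0 normr1 => x1; apply: le_trans vv.
  apply: (le_trans (cnormM _ _)); rewrite ler_wpM2l ?cnorm_ge0 //.
  apply: (le_trans (cnormM _ _)); rewrite ler_wpM2l ?cnorm_ge0 //.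
  by apply: hB2; exact: path_in.
have q1 := quadratic_estimate (fun x => (D1 x).1) (fun x => (D2 x).1)
  (fun x xx => le_trans (abs_Re _) (bnd x xx)).
have q2 := quadratic_estimate (fun x => (D1 x).2) (fun x => (D2 x).2)
  (fun x xx => le_trans (abs_Im _) (bnd x xx)).
move: q1 q2; rewrite !add0r !mul1r !mul0r !addr0 expr1n mulr1 => q1 q2.
have d1 : cnorm (v * h 1 w) <= cnorm v * B1.
  apply: (le_trans (cnormM _ _)); rewrite ler_wpM2l ?cnorm_ge0 //; apply: hB1; by rewrite lerDl.
have d2 := le_trans (abs_Re _) d1; have d3 := le_trans (abs_Im _) d1.
have -> : cnorm (h 0 (w + v) - h 0 w) = `|Re (h 0 (w + v)) - Re (h 0 w)| + `|Im (h 0 (w + v)) - Im (h 0 w)|.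
  by rewrite /cnorm; case: (h 0 (w + v)) => ? ?; case: (h 0 w).
have tri (a b : R) (M1 M2 : R) : `|a - b| <= M1 -> `|b| <= M2 -> `|a| <= M1 + M2.
  by move=> ab bM; rewrite -(subrK b a); apply: (le_trans (ler_normD _ _)); exact: lerD.
have := tri _ _ _ _ q1 d2; have := tri _ _ _ _ q2 d3.
lra.
Qed.

Let square_bound (B : R) : exists2 m : R, 0 < m & forall z, cnorm z <= B -> m <= normsq (h 0 z).
Proof.
pose N (p : R * R) : R := Re (h 0 (p.1 +i* p.2)) * Re (h 0 (p.1 +i* p.2)) +
  Im (h 0 (p.1 +i* p.2)) * Im (h 0 (p.1 +i* p.2)).
have NE p : N p = normsq (h 0 (p.1 +i* p.2)) by rewrite /normsq !expr2.
have cN : continuous N.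
  have ch (f : R[i] -> R) : (forall a b, `|f a - f b| <= cnorm (a - b)) ->
      continuous (fun p : R * R => f (h 0 (p.1 +i* p.2))).
    move=> fl p; have [L L0 hL] := laplace_lipschitz (p.1 +i* p.2).
    apply/cvgrPdist_le => e e0.
    pose dl := Num.min (1 / 2) (e / (2 * (L + 1))).
    have dl0 : 0 < dl by rewrite lt_min !divr_gt0 // mulr_gt0 // ltr_wpDl.
    have dl1 : dl <= 1 / 2 by rewrite ge_min lexx.
    have dl2 : dl <= e / (2 * (L + 1)) by rewrite ge_min lexx orbT.
    near=> q; rewrite distrC; apply: (le_trans (fl _ _)).
    have -> : q.1 +i* q.2 = (p.1 +i* p.2) + ((q.1 - p.1) +i* (q.2 - p.2)).
      by rewrite /GRing.add /= /addc /= !subrKC.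
    have n1 : `|p.1 - q.1| <= dl.
      near: q; have c1 : (fun q : R * R => q.1) @ nbhs p --> p.1 by exact: cvg_fst.
      by move/cvgrPdist_le : c1; apply.
    have n2 : `|p.2 - q.2| <= dl.
      near: q; have c2 : (fun q : R * R => q.2) @ nbhs p --> p.2 by exact: cvg_snd.
      by move/cvgrPdist_le : c2; apply.
    have cv : cnorm ((q.1 - p.1) +i* (q.2 - p.2)) <= Num.min 1 (e / (L + 1)).
      rewrite /cnorm /= [`|q.1 - p.1|]distrC [`|q.2 - p.2|]distrC le_min; apply/andP; split; first by lra.
      have -> : e / (L + 1) = e / (2 * (L + 1)) + e / (2 * (L + 1)).
        by field; rewrite gt_eqF // ltr_wpDl.
      by apply: lerD; [exact: le_trans n1 dl2|exact: le_trans n2 dl2].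
    move: cv; rewrite le_min => /andP[cv1 cv2].
    apply: (le_trans (hL _ cv1)); apply: (@le_trans _ _ (L * (e / (L + 1)))); first exact: ler_wpM2l.
    by rewrite mulrA ler_pdivrMr ?ltr_wpDl // mulrC ler_pM2l // lerDl.
  have cR : continuous (fun p : R * R => Re (h 0 (p.1 +i* p.2))).
    by apply: (ch (fun z => Re z)) => a b; apply: le_trans (abs_Re _); case: a => ? ?; case: b.
  have cI : continuous (fun p : R * R => Im (h 0 (p.1 +i* p.2))).
    by apply: (ch (fun z => Im z)) => a b; apply: le_trans (abs_Im _); case: a => ? ?; case: b.
  by move=> p; apply: cvgD; [apply: cvgM; exact: cR|apply: cvgM; exact: cI].
have cV : continuous (fun p => (N p)^-1).
  by move=> p; apply: cvgV; [rewrite gt_eqF // NE normsq_gt0|exact: cN].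
have cB : compact (`[- B, B] `*` `[- B, B] : set (R * R)).
  by apply: compact_setX; exact: segment_compact.
have := continuous_compact (continuous_subspaceT cV) cB => /compact_bounded [M [_ /(_ (M + 1))]].
rewrite ltrDl ltr01 => /(_ isT) hM.
exists (`|M| + 1)^-1; first by rewrite invr_gt0 ltr_wpDl.
move=> z zB; rewrite -[normsq _]invrK lef_pV2 ?posrE ?invr_gt0 ?normsq_gt0 ?ltr_wpDl //.
apply: (@le_trans _ _ (M + 1)); last by rewrite lerD2r ler_norm.
apply: le_trans (ler_norm _) _; apply: (hM ((normsq (h 0 z))^-1)); exists (Re z, Im z) => /=.
  have a1 := le_trans (abs_Re z) zB; have a2 := le_trans (abs_Im z) zB.
  by split; rewrite /= in_itv /=; [move: a1|move: a2]; rewrite ler_norml.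
by rewrite NE; case: (z).
Unshelve. all: by end_near.
Qed.

Definition disk_bounded (f : R[i] -> R[i]) := forall B : R, exists M : R, forall z, cnorm z <= B -> cnorm (f z) <= M.

Let alg_bounded f : laplace_alg f -> disk_bounded f.
Proof.
elim=> [k||f' g af IHf ag IHg|f' g af IHf ag IHg|f' af IHf] B.
- have [M hM] := laplace_bound mY mgfY k B; exists M => z zB.
  by apply: hM; exact: le_trans (abs_Re z) zB.
- have [m m0 hm] := square_bound B; have [M hM] := laplace_bound mY mgfY 0 B.
  exists (M / m) => z zB; have M1 := hM z (le_trans (abs_Re z) zB).
  have m1 := hm z zB; have n0 := normsq_gt0 z.
  rewrite /cnorm ReV ImV -/(normsq _) normrN !normrM normfV (gtr0_norm n0) -mulrDl -/(cnorm _).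
  by apply: ler_pM => //; rewrite ?cnorm_ge0 ?invr_ge0 ?(ltW n0) // lef_pV2.
- have [M1 h1] := IHf B; have [M2 h2] := IHg B; exists (M1 * M2) => z zB.
  by apply: (le_trans (cnormM _ _)); apply: ler_pM; rewrite ?cnorm_ge0 ?h1 ?h2.
- have [M1 h1] := IHf B; have [M2 h2] := IHg B; exists (M1 + M2) => z zB.
  by apply: (le_trans (cnormD _ _)); rewrite lerD ?h1 ?h2.
- by have [M1 h1] := IHf B; exists M1 => z zB; rewrite cnormN h1.
Qed.

(** [k] is real, so that negative frequencies need no separate treatment; integrality enters as
    [rot_periodic]. *)
Definition rot (k th : R) : R[i] := cos (k * th) +i* sin (k * th).

Let rotD k l th : rot k th * rot l th = rot (k + l) th.
Proof.
rewrite /rot mulrDl cosD sinD; apply/eqP; rewrite eq_complex ReM ImM /= eqxx /=.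
by apply/eqP; ring.
Qed.

Let rot_derive k : cderive (rot k) (fun th => 'i * k%:C * rot k th).
Proof.
have dm x : is_derive x (1 : R) (fun th : R => k * th) k.
  by apply: (rder_eq (rderM (is_derive_cst k x 1) (is_derive_id x 1))); rewrite mul0r mulr1 add0r.
move=> x; split.
  apply: (rder_eq (rder_comp (is_derive_cos (k * x)) (dm x))).
  by rewrite !ReM !ImM /=; ring.
apply: (rder_eq (rder_comp (is_derive_sin (k * x)) (dm x))).
by rewrite ImM !ReM !ImM /=; ring.
Qed.

Let rot_bound k th : cnorm (rot k th) <= 2.
Proof.
rewrite /cnorm /=; have : `|cos (k * th)| <= 1 by rewrite ler_norml cos_geN1 cos_le1.
have : `|sin (k * th)| <= 1 by rewrite ler_norml sin_geN1 sin_le1.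
lra.
Qed.

Let Re_rot k th : Re (rot k th) = cos (k * th). Proof. by []. Qed.
Let Im_rot k th : Im (rot k th) = sin (k * th). Proof. by []. Qed.

Let rot_periodic k := rot k tau = 1.

Let per1 : rot_periodic 1.
Proof. by rewrite /rot_periodic /rot mul1r cos2pi sin2pi. Qed.

Let perD k l : rot_periodic k -> rot_periodic l -> rot_periodic (k + l).
Proof. by rewrite /rot_periodic => a b; rewrite -rotD a b mulr1. Qed.

Let perN k : rot_periodic k -> rot_periodic (- k).
Proof.
rewrite /rot_periodic /rot mulNr cosN sinN => /eqP; rewrite eq_complex /= => /andP[/eqP -> /eqP ->].
by rewrite oppr0.
Qed.

Let ii : 'i * 'i = -1 :> R[i].
Proof. by apply/eqP; rewrite eq_complex ReM ImM /=; apply/andP; split; apply/eqP; ring. Qed.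

Let i_neq0 : 'i != 0 :> R[i].
Proof. by rewrite eq_complex /= negb_and oner_neq0 orbT. Qed.

Let ReN (z : R[i]) : Re (- z) = - Re z. Proof. by case: z. Qed.
Let ImN (z : R[i]) : Im (- z) = - Im z. Proof. by case: z. Qed.
Let ReD (z w : R[i]) : Re (z + w) = Re z + Re w. Proof. by case: z; case: w. Qed.
Let ImD (z w : R[i]) : Im (z + w) = Im z + Im w. Proof. by case: z; case: w. Qed.

Let Re_i (w : R[i]) : Re ('i * w) = - Im w.
Proof. by case: w => a b; rewrite ReM /= mul0r mul1r sub0r. Qed.

Section Circle.
Variable s0 : R.
Definition circ (r th : R) : R[i] := 'i * s0%:C + r%:C * rot 1 th.

Let radial_path th : tame_path (fun r => circ r th) (fun=> rot 1 th) (fun=> 0).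
Proof. exact: segment_path. Qed.

Let circ_bound r th : cnorm (circ r th) <= cnorm ('i * s0%:C) + `|r| * 2.
Proof.
apply: (le_trans (cnormD _ _)); rewrite lerD2l; apply: (le_trans (cnormM _ _)).
by rewrite {1}/cnorm /= normr0 addr0 ler_wpM2l.
Qed.

Let angular_path r : tame_path (circ r) (fun th => r%:C * ('i * rot 1 th)) (fun th => - (r%:C * rot 1 th)).
Proof.
have c1 : (1%:C : R[i]) = 1 by [].
have bnd th : cnorm (r%:C * rot 1 th) <= `|r| * 2.
  by apply: (le_trans (cnormM _ _)); rewrite {1}/cnorm /= normr0 addr0 ler_wpM2l.
split.
- apply: (eq_cderive (cderiveD (cderive_cst _) (cderiveM (cderive_cst r%:C) (rot_derive 1)))) => th.
  by rewrite c1; ring.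
- apply: (eq_cderive (cderiveM (cderive_cst r%:C) (cderiveM (cderive_cst _) (rot_derive 1)))) => th.
  by rewrite c1 mulr1 !mul0r !add0r (mulrA 'i 'i) ii mulN1r mulrN.
- by move=> B; exists (cnorm ('i * s0%:C) + `|r| * 2) => th _; exact: circ_bound.
- move=> B; exists (cnorm ('i : R[i]) * (`|r| * 2)) => th _.
  by rewrite mulrCA; apply: (le_trans (cnormM _ _)); rewrite ler_wpM2l ?cnorm_ge0.
- by move=> B; exists (`|r| * 2) => th _; rewrite cnormN.
Qed.

Let rot_cont k : ccont (rot k). Proof. exact: cderive_cont (rot_derive k). Qed.

Let alg_cont f r : laplace_alg f -> ccont (fun th => f (circ r th)).
Proof. by move=> /alg_derive [f' _ hf]; exact: cderive_cont (hf _ _ _ (angular_path r)). Qed.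

Definition fourier (f : R[i] -> R[i]) (k r : R) : R[i] := cint (fun th => f (circ r th) * rot k th).

Let Re_fourier f k r : Re (fourier f k r) = rint (fun th => Re (f (circ r th) * rot k th)).
Proof. by []. Qed.

Let Im_fourier f k r : Im (fourier f k r) = rint (fun th => Im (f (circ r th) * rot k th)).
Proof. by []. Qed.

Let fourier_derive f f' k : laplace_alg f -> laplace_alg f' -> holo f f' ->
  cderive (fourier f k) (fourier f' (k + 1)).
Proof.
move=> af af' hf; have [f'' af'' hf'] := alg_derive af'.
apply: (@cint_derive _ (fun r th => f (circ r th) * rot k th) (fun r th => f' (circ r th) * rot (k + 1) th)
  (fun r th => f'' (circ r th) * rot (k + 1 + 1) th)).
- by move=> r; apply: ccontM; [exact: alg_cont|exact: rot_cont].
- by move=> r; apply: ccontM; [exact: alg_cont|exact: rot_cont].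
- move=> th; apply: (eq_cderive (cderiveM (hf _ _ _ (radial_path th)) (cderive_cst (rot k th)))) => r.
  by rewrite -rotD; ring.
- move=> th; apply: (eq_cderive (cderiveM (hf' _ _ _ (radial_path th)) (cderive_cst (rot (k + 1) th)))) => r.
  by rewrite -[rot (k + 1 + 1) th]rotD; ring.
- move=> B; have [M hM] := alg_bounded af'' (cnorm ('i * s0%:C) + B * 2).
  exists (M * 2) => r th rB; apply: (le_trans (cnormM _ _)); apply: ler_pM; rewrite ?cnorm_ge0 //.
  by apply: hM; apply: (le_trans (circ_bound r th)); rewrite lerD2l ler_wpM2r.
Qed.

Let rot0 k : rot k 0 = 1.
Proof. by rewrite /rot mulr0 cos0 sin0. Qed.

(** Integrate over the circle the angular derivative of the periodic function [f * rot k]. Together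
    with [fourier_derive] this gives the equation [r V' = - k V], which takes the place of Cauchy's
    theorem. *)
Let fourier_parts f f' k r : laplace_alg f -> laplace_alg f' -> holo f f' -> rot_periodic k ->
  r%:C * fourier f' (k + 1) r = - (k%:C * fourier f k r).
Proof.
move=> af af' hf pk.
pose F' th := 'i * (r%:C * (f' (circ r th) * rot (k + 1) th) + k%:C * (f (circ r th) * rot k th)).
have D : cderive (fun th => f (circ r th) * rot k th) F'.
  apply: (eq_cderive (cderiveM (hf _ _ _ (angular_path r)) (rot_derive k))) => th.
  by rewrite /F' -rotD; ring.
have c1 : ccont (fun th => f' (circ r th) * rot (k + 1) th).
  by apply: ccontM; [exact: alg_cont|exact: rot_cont].
have c2 : ccont (fun th => f (circ r th) * rot k th).
  by apply: ccontM; [exact: alg_cont|exact: rot_cont].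
have c1' : ccont (fun th => r%:C * (f' (circ r th) * rot (k + 1) th)).
  by apply: ccontM => //; exact: ccont_cst.
have c2' : ccont (fun th => k%:C * (f (circ r th) * rot k th)).
  by apply: ccontM => //; exact: ccont_cst.
have c3 : ccont (fun th => r%:C * (f' (circ r th) * rot (k + 1) th) + k%:C * (f (circ r th) * rot k th)).
  exact: ccontD.
have c4 : ccont F' by apply: ccontM => //; exact: ccont_cst.
have := cint_ftc D c4.
rewrite /circ per1 pk !rot0 subrr /F' (cintZ _ c3) (cintD c1' c2') (cintZ _ c1) (cintZ _ c2) => /eqP.
by rewrite mulf_eq0 (negbTE i_neq0) /= addr_eq0 => /eqP.
Qed.

Let rderX (m : nat) (x : R) : is_derive x (1 : R) (fun y : R => y ^+ m) (m%:R * x ^+ m.-1).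
Proof.
elim: m => [|m IH].
  by apply: (rder_eq (is_derive_cst (1 : R) x 1)); rewrite mul0r.
rewrite (_ : (fun y => _) = (fun y => y * y ^+ m)); last by apply/funext => y; rewrite exprS.
apply: (rder_eq (rderM (is_derive_id x 1) IH)).
by rewrite mul1r /= -natr1 mulrDl mul1r addrC mulrCA; case: m {IH} => [|m]; rewrite ?mul0r // -exprS.
Qed.

(** [r ^ m.+1 * f r] is constant, hence 0 by its value at 0; at [r = 0] the equation itself gives
    the claim. *)
Let ode_pos (f f1 : R -> R) (m : nat) : (forall r : R, is_derive r (1 : R) f (f1 r)) ->
  (forall r, r * f1 r = - (m.+1%:R * f r)) -> forall r, f r = 0.
Proof.
move=> df H r.
have D (x : R) : is_derive x (1 : R) (fun y => y ^+ m.+1 * f y) 0.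
  apply: (rder_eq (rderM (rderX m.+1 x) (df x))).
  rewrite /= exprS; have hx := H x; move: (x ^+ m) => z.
  rewrite (_ : _ + _ = z * (m.+1%:R * f x + x * f1 x)); last by ring.
  by rewrite hx addrN mulr0.
have [->|r0] := eqVneq r 0.
  have := H 0; rewrite mul0r => /esym/eqP; rewrite oppr_eq0 mulf_eq0 pnatr_eq0 /=.
  by move/eqP.
have := is_derive_0_is_cst r 0 D; rewrite expr0n /= mul0r => /eqP.
by rewrite mulf_eq0 expf_eq0 (negbTE r0) andbF /= => /eqP.
Qed.

(** With [r = exp y] the singularity of the equation at 0 disappears, and [f (exp y) * exp (-2 y)]
    is constant. *)
Let ode_neg (f f1 : R -> R) : (forall r : R, is_derive r (1 : R) f (f1 r)) ->
  (forall r, r * f1 r = 2 * f r) -> forall r, 0 < r -> f r = f 1 * r ^+ 2.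
Proof.
move=> df H r r0.
have dl (x : R) : is_derive x (1 : R) (fun y : R => -2 * y) (-2).
  by apply: (rder_eq (rderM (is_derive_cst (-2 : R) x 1) (is_derive_id x 1))); rewrite mul0r mulr1 add0r.
have D (x : R) : is_derive x (1 : R) (fun y => f (expR y) * expR (-2 * y)) 0.
  have d1 := rder_comp (df (expR x)) (is_derive_expR x).
  have d2 := rder_comp (is_derive_expR (-2 * x)) (dl x).
  apply: (rder_eq (rderM d1 d2)); rewrite [f1 _ * _]mulrC H; ring.
have := is_derive_0_is_cst (ln r) 0 D.
rewrite lnK ?posrE // mulr0 expR0 mulr1 => <-.
rewrite -mulrA (_ : expR (-2 * ln r) * r ^+ 2 = 1) ?mulr1 //.
have -> : r ^+ 2 = expR (2 * ln r) by rewrite expRM_natl lnK ?posrE.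
by rewrite -expRD -mulrDl addNr mul0r expR0.
Qed.

Let fourier_Re f f' k r : laplace_alg f -> laplace_alg f' -> holo f f' -> rot_periodic k ->
  r * Re (fourier f' (k + 1) r) = - (k * Re (fourier f k r)) /\
  r * Im (fourier f' (k + 1) r) = - (k * Im (fourier f k r)).
Proof.
move=> af af' hf pk; have E := fourier_parts r af af' hf pk.
by rewrite -!Re_real_mul -!Im_real_mul -ReN -ImN E.
Qed.

Let fourier_zero f (m : nat) r : laplace_alg f -> rot_periodic m.+1%:R -> fourier f m.+1%:R r = 0.
Proof.
move=> af pk; have [f' af' hf] := alg_derive af.
have D := fourier_derive m.+1%:R af af' hf.
apply/eqP; rewrite eq_complex /=; apply/andP; split; apply/eqP.
  by apply: (ode_pos (fun r => (D r).1) (m := m)) => x; exact: (fourier_Re x af af' hf pk).1.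
by apply: (ode_pos (fun r => (D r).2) (m := m)) => x; exact: (fourier_Re x af af' hf pk).2.
Qed.

Definition logder (z : R[i]) : R[i] := h 1 z * (h 0 z)^-1.
Definition logder2 (z : R[i]) : R[i] :=
  h 2 z * (h 0 z)^-1 + h 1 z * - (h 1 z * ((h 0 z)^-1 * (h 0 z)^-1)).

Lemma alg_logder : laplace_alg logder.
Proof. by apply: alg_mul; [exact: alg_laplace|exact: alg_inv]. Qed.

Lemma alg_logder2 : laplace_alg logder2.
Proof.
apply: alg_add; apply: alg_mul; [exact: alg_laplace|exact: alg_inv|exact: alg_laplace|apply: alg_opp].
by apply: alg_mul; [exact: alg_laplace|apply: alg_mul; exact: alg_inv].
Qed.

Lemma holo_logder : holo logder logder2.
Proof. exact: holoM (holo_laplace 1) holoV. Qed.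

(** Working with [ln |f|] avoids the choice of a complex logarithm. *)
Let lognorm_derive (f f' : R -> R[i]) : (forall x, 0 < normsq (f x)) -> cderive f f' -> forall x : R,
  is_derive x (1 : R) (fun x => ln (normsq (f x)) / 2) (Re (f' x * (f x)^-1)).
Proof.
move=> f0 df x; have [d1 d2] := df x.
have dN : is_derive x (1 : R) (fun x => normsq (f x))
    (2 * (Re (f' x) * Re (f x) + Im (f' x) * Im (f x))).
  rewrite (_ : (fun x => _) = (fun x => Re (f x) * Re (f x) + Im (f x) * Im (f x))).
    by apply: (rder_eq (rderD (rderM d1 d1) (rderM d2 d2))); ring.
  by apply/funext => z; rewrite /normsq !expr2.
have dl := rder_comp (f := fun x => normsq (f x)) (is_derive1_ln (f0 x)) dN.
apply: (rder_eq (rderM dl (is_derive_cst (2^-1 : R) x 1))).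
have := f0 x; rewrite ReM ReV ImV /normsq.
move: (Re (f x)) (Im (f x)) (Re (f' x)) (Im (f' x)) => a b c e ab.
by rewrite /cst; field; rewrite gt_eqF.
Qed.

(** [U] is harmonic; [p] and [- r q] are its radial and angular derivatives. *)
Let U r th : R := ln (normsq (h 0 (circ r th))) / 2.
Let p r th : R := Re (logder (circ r th) * rot 1 th).
Let q r th : R := Im (logder (circ r th) * rot 1 th).

Let U_radial th (r : R) : is_derive r (1 : R) (fun r => U r th) (p r th).
Proof.
have := lognorm_derive (fun x => normsq_gt0 (circ x th)) (holo_laplace 0 (radial_path th)) r.
by move/rder_eq; apply; rewrite /p /logder; congr Re; ring.
Qed.

Let U_angular r (th : R) : is_derive th (1 : R) (U r) (- (r * q r th)).
Proof.
have := lognorm_derive (fun x => normsq_gt0 (circ r x)) (holo_laplace 0 (angular_path r)) th.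
move/rder_eq; apply; rewrite /q /logder.
rewrite (_ : _ * _ = r%:C * ('i * (h 1 (circ r th) * (h 0 (circ r th))^-1 * rot 1 th))); last by ring.
by rewrite Re_real_mul Re_i mulrN.
Qed.

Let U_cont r : continuous (U r).
Proof. exact: is_derive_continuous (U_angular r). Qed.

Let lr_cont r k : ccont (fun th => logder (circ r th) * rot k th).
Proof. by apply: ccontM; [apply: alg_cont; exact: alg_logder|exact: rot_cont]. Qed.

(** The mean value property: the radial derivative of the integral is the real part of the
    coefficient of index 1, which vanishes. *)
Let U_mean r : rint (U r) = tau * U 0 0.
Proof.
have D : forall x : R, is_derive x (1 : R) (fun x => rint (U x)) (rint (p x)).
  apply: (@rint_derive _ U p (fun r th => Re (rot 1 th * logder2 (circ r th) * rot 1 th))).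
  - exact: U_cont.
  - by move=> x; exact: (lr_cont x 1).1.
  - by move=> th x; exact: U_radial.
  - move=> th x; have [d1 _] := cderiveM (holo_logder (radial_path th)) (cderive_cst (rot 1 th)) x.
    by move/rder_eq : d1; apply; rewrite mulr0 addr0.
  - move=> B; have [M hM] := alg_bounded alg_logder2 (cnorm ('i * s0%:C) + B * 2).
    exists (2 * M * 2) => r' th rB; apply: (le_trans (abs_Re _)); apply: (le_trans (cnormM _ _)).
    apply: ler_pM; rewrite ?cnorm_ge0 //; apply: (le_trans (cnormM _ _)).
    apply: ler_pM; rewrite ?cnorm_ge0 //; apply: hM; apply: (le_trans (circ_bound r' th)).
    by rewrite lerD2l ler_wpM2r.
have p0 x : rint (p x) = 0.
  have E : fourier logder 1 x = 0 := fourier_zero (m := 0%N) x alg_logder per1.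
  by rewrite -[RHS]/(Re (0 : R[i])) -E.
have := is_derive_0_is_cst r 0 (fun x => rder_eq (D x) (p0 x)) => ->.
transitivity (rint (fun=> U 0 0)); last exact: rint_cst.
by congr rint; apply/funext => th; rewrite /U /circ !mul0r.
Qed.

Let per3 : rot_periodic 3.
Proof. by have := perD per1 (perD per1 per1); rewrite (_ : 1 + (1 + 1) = 3 :> R) //; ring. Qed.

Let trig3 r : r * rint (fun th => q r th * cos (3 * th)) = - (3 * rint (fun th => U r th * sin (3 * th))) /\
  r * rint (fun th => q r th * sin (3 * th)) = 3 * rint (fun th => U r th * cos (3 * th)).
Proof.
have cq : continuous (q r) by exact: (lr_cont r 1).2.
have [cc cs] := rot_cont 3.
have cqc : continuous (fun th => q r th * cos (3 * th)) by move=> x; apply: cvgM; [exact: cq|exact: cc].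
have cqs : continuous (fun th => q r th * sin (3 * th)) by move=> x; apply: cvgM; [exact: cq|exact: cs].
have cUc : continuous (fun th => U r th * cos (3 * th)) by move=> x; apply: cvgM; [exact: U_cont|exact: cc].
have cUs : continuous (fun th => U r th * sin (3 * th)) by move=> x; apply: cvgM; [exact: U_cont|exact: cs].
have cZ (c : R) (f : R -> R) : continuous f -> continuous (fun th => c * f th).
  by move=> cf x; apply: cvgM; [exact: cvg_cst|exact: cf].
have cAdd (f g : R -> R) : continuous f -> continuous g -> continuous (fun th => f th + g th).
  by move=> cf cg x; apply: cvgD; [exact: cf|exact: cg].
have U2 : U r tau = U r 0 by rewrite /U /circ per1 rot0.
have [c2 s2] : cos (3 * tau) = 1 /\ sin (3 * tau) = 0.
  by have := per3; rewrite /rot_periodic /rot => -[].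
split.
- have D (x : R) : is_derive x (1 : R) (fun th => U r th * cos (3 * th))
      (- r * (q r x * cos (3 * x)) + -3 * (U r x * sin (3 * x))).
    apply: (rder_eq (rderM (U_angular r x) (rot_derive 3 x).1)).
    by rewrite !ReM !ImM /=; ring.
  have := rint_ftc D (cAdd _ _ (cZ _ _ cqc) (cZ _ _ cUs)).
  rewrite (rintD (cZ _ _ cqc) (cZ _ _ cUs)) (rintZ _ cqc) (rintZ _ cUs) U2 c2 mulr0 cos0 subrr.
  by move=> E; lra.
- have D (x : R) : is_derive x (1 : R) (fun th => U r th * sin (3 * th))
      (- r * (q r x * sin (3 * x)) + 3 * (U r x * cos (3 * x))).
    apply: (rder_eq (rderM (U_angular r x) (rot_derive 3 x).2)).
    by rewrite ImM !ReM !ImM /=; ring.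
  have := rint_ftc D (cAdd _ _ (cZ _ _ cqs) (cZ _ _ cUc)).
  rewrite (rintD (cZ _ _ cqs) (cZ _ _ cUc)) (rintZ _ cqs) (rintZ _ cUc) U2 s2 (mulr0 3) sin0 mulr0 subrr.
  by move=> E; lra.
Qed.

(** The coefficients of [logder] of indices 4 and -2 are those of [p + i q] of indices 3 and -3. The
    vanishing of the former eliminates [p], and [trig3] passes from [q] to [U] by integration by
    parts. *)
Let fourier_m2 r : r * Re (fourier logder (-2) r) = 6 * rint (fun th => U r th * cos (3 * th)) /\
  r * Im (fourier logder (-2) r) = - (6 * rint (fun th => U r th * sin (3 * th))).
Proof.
have per4 : rot_periodic 3.+1%:R.
  by have := perD per1 per3; rewrite (_ : 1 + 3 = 3.+1%:R :> R) //; ring.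
have z4 := fourier_zero (m := 3%N) r alg_logder per4.
have zr : Re (fourier logder 3.+1%:R r) = 0 by rewrite z4.
have zi : Im (fourier logder 3.+1%:R r) = 0 by rewrite z4.
have cq : continuous (q r) by exact: (lr_cont r 1).2.
have cp : continuous (p r) by exact: (lr_cont r 1).1.
have [cc cs] := rot_cont 3.
have cqc : continuous (fun th => q r th * cos (3 * th)) by move=> x; apply: cvgM; [exact: cq|exact: cc].
have cqs : continuous (fun th => q r th * sin (3 * th)) by move=> x; apply: cvgM; [exact: cq|exact: cs].
have cpc : continuous (fun th => p r th * cos (3 * th)) by move=> x; apply: cvgM; [exact: cp|exact: cc].
have cps : continuous (fun th => p r th * sin (3 * th)) by move=> x; apply: cvgM; [exact: cp|exact: cs].
have cN (f : R -> R) : continuous f -> continuous (fun th => -1 * f th).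
  by move=> cf x; apply: cvgM; [exact: cvg_cst|exact: cf].
have e4 th : logder (circ r th) * rot 3.+1%:R th = logder (circ r th) * rot 1 th * rot 3 th.
  by rewrite -mulrA rotD; congr (_ * rot _ _); ring.
have e2 th : logder (circ r th) * rot (-2) th = logder (circ r th) * rot 1 th * rot (- 3) th.
  by rewrite -mulrA rotD; congr (_ * rot _ _); ring.
have R4 : rint (fun th => p r th * cos (3 * th)) - rint (fun th => q r th * sin (3 * th)) = 0.
  rewrite -[RHS]zr Re_fourier -[- rint _]mulN1r -(rintZ _ cqs) -(rintD cpc (cN _ cqs)).
  by congr rint; apply/funext => th; rewrite e4 ReM mulN1r.
have I4 : rint (fun th => p r th * sin (3 * th)) + rint (fun th => q r th * cos (3 * th)) = 0.
  rewrite -[RHS]zi Im_fourier -(rintD cps cqc).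
  by congr rint; apply/funext => th; rewrite e4 ImM.
have R2 : Re (fourier logder (-2) r) = rint (fun th => p r th * cos (3 * th)) + rint (fun th => q r th * sin (3 * th)).
  rewrite -(rintD cpc cqs) Re_fourier.
  by congr rint; apply/funext => th; rewrite e2 ReM Re_rot Im_rot !(mulNr 3) cosN sinN mulrN opprK.
have I2 : Im (fourier logder (-2) r) = rint (fun th => q r th * cos (3 * th)) - rint (fun th => p r th * sin (3 * th)).
  rewrite -[- rint _]mulN1r -(rintZ _ cps) -(rintD cqc (cN _ cps)) Im_fourier.
  by congr rint; apply/funext => th; rewrite e2 ImM Re_rot Im_rot !(mulNr 3) cosN sinN mulrN mulN1r addrC.
have [t1 t2] := trig3 r.
by rewrite R2 I2; split; move: R4 I4 t1 t2;
  move: (rint _) (rint _) (rint _) (rint _) (rint _) (rint _) => a1 a2 a3 a4 a5 a6; nra.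
Qed.

(** The circle is centred on the imaginary axis, so that its real parts are at most [r] in modulus
    and the bound does not depend on [s0]. *)
Let U_le r th : U r th <= `|C| * (1 + r ^+ 2).
Proof.
have Rc : Re (circ r th) = r * cos th by rewrite /circ ReD ReM Re_real_mul /= mul1r; ring.
have c2 : Re (circ r th) ^+ 2 <= r ^+ 2.
  have c1 : cos th ^+ 2 <= 1 by rewrite -(cos2Dsin2 th) lerDl sqr_ge0.
  by rewrite Rc exprMn ler_piMr ?sqr_ge0.
have H : ln (normsq (h 0 (circ r th))) <= 2 * (C * (1 + Re (circ r th) ^+ 2)).
  rewrite -ler_expR lnK ?posrE ?normsq_gt0 // expRM_natl; exact: normsq_le.
rewrite /U ler_pdivrMr // mulrC; apply: (le_trans H); rewrite ler_pM2l //.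
apply: (@le_trans _ _ (`|C| * (1 + Re (circ r th) ^+ 2))).
  by rewrite ler_wpM2r ?ler_norm // addr_ge0 ?sqr_ge0.
by rewrite ler_wpM2l // lerD2l.
Qed.

(** Growth bounds [U] from above only, say by [B]. As in the Borel-Caratheodory theorem, the mean of
    [U] is known, so that [|U| <= 2 B - U] controls the mean of [|U|]. *)
Let U_trig_le r (g : R -> R) : continuous g -> (forall x, `|g x| <= 1) ->
  `|rint (fun th => U r th * g th)| <= tau * (2 * `|C| * (1 + r ^+ 2)) - tau * U 0 0.
Proof.
move=> cg g1.
have c1 : continuous (fun _ : R => 2 * `|C| * (1 + r ^+ 2)) by move=> x; exact: cvg_cst.
have c2 : continuous (fun th => -1 * U r th).
  by move=> x; apply: cvgM; [exact: cvg_cst|exact: U_cont].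
have -> : tau * (2 * `|C| * (1 + r ^+ 2)) - tau * U 0 0 =
    rint (fun th => 2 * `|C| * (1 + r ^+ 2) + -1 * U r th).
  by rewrite (rintD c1 c2) rint_cst (rintZ _ (@U_cont r)) U_mean mulN1r.
apply: rint_norm_le.
- by move=> x; apply: cvgM; [exact: U_cont|exact: cg].
- by move=> x; apply: cvgD; [exact: c1|exact: c2].
- move=> x; rewrite normrM; apply: (@le_trans _ _ `|U r x|); first by rewrite ler_piMr.
  have := U_le r x; have : 0 <= `|C| * (1 + r ^+ 2) by rewrite mulr_ge0 // addr_ge0 ?sqr_ge0.
  set B := `|C| * _ => B0 UB; rewrite -mulrA -/B mulN1r.
  by rewrite ler_norml; apply/andP; split; lra.
Qed.

Let cubic_zero (g a b : R) : (forall r : R, 0 < r -> `|g| * r ^+ 3 <= a + b * r ^+ 2) -> g = 0.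
Proof.
move=> H; apply/eqP; rewrite -normr_eq0; apply: contraT => g0'.
have g0 : 0 < `|g| by rewrite lt_neqAle eq_sym g0' normr_ge0.
pose r := 1 + (`|a| + `|b|) / `|g|.
have d0 : 0 <= (`|a| + `|b|) / `|g| by rewrite divr_ge0 ?addr_ge0.
have r1 : 1 <= r by rewrite lerDl.
have r0 : 0 < r by exact: lt_le_trans r1.
have gr : `|g| * r = `|g| + (`|a| + `|b|) by rewrite /r mulrDr mulr1 mulrC divfK ?gt_eqF.
have r2 : 1 <= r ^+ 2 by rewrite exprn_ege1.
have := H r r0; rewrite exprS mulrA gr.
have a1 : a <= `|a| * r ^+ 2 by apply: (le_trans (ler_norm a)); rewrite ler_peMr.
have b1 : b * r ^+ 2 <= `|b| * r ^+ 2 by rewrite ler_wpM2r ?ler_norm // ltW // exprn_gt0.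
have g1 : 0 < `|g| * r ^+ 2 by rewrite mulr_gt0 // exprn_gt0.
rewrite !mulrDl; lra.
Qed.

Let fourier_m2_zero r : 0 < r -> fourier logder (-2) r = 0.
Proof.
have per2 : rot_periodic (-2).
  by have := perN (perD per1 per1); rewrite (_ : - (1 + 1) = -2 :> R) //; ring.
have D := fourier_derive (-2) alg_logder alg_logder2 holo_logder.
have E x := fourier_Re x alg_logder alg_logder2 holo_logder per2.
have ReJ x : 0 < x -> Re (fourier logder (-2) x) = Re (fourier logder (-2) 1) * x ^+ 2.
  apply: (ode_neg (f := fun x => Re (fourier logder (-2) x)) (fun x => (D x).1)) => y.
  by rewrite (E y).1 mulNr opprK.
have ImJ x : 0 < x -> Im (fourier logder (-2) x) = Im (fourier logder (-2) 1) * x ^+ 2.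
  apply: (ode_neg (f := fun x => Im (fourier logder (-2) x)) (fun x => (D x).2)) => y.
  by rewrite (E y).2 mulNr opprK.
have [cc cs] := rot_cont 3.
have cb (x : R) : `|cos (3 * x)| <= 1 by rewrite ler_norml cos_geN1 cos_le1.
have sb (x : R) : `|sin (3 * x)| <= 1 by rewrite ler_norml sin_geN1 sin_le1.
have bnd (g x z : R) : 0 < x -> x * (g * x ^+ 2) = z ->
    `|z| <= 6 * (tau * (2 * `|C| * (1 + x ^+ 2)) - tau * U 0 0) ->
    `|g| * x ^+ 3 <= 6 * (tau * (2 * `|C|) - tau * U 0 0) + 6 * (tau * (2 * `|C|)) * x ^+ 2.
  move=> x0 <-; rewrite mulrCA -exprS normrM (gtr0_norm (exprn_gt0 3 x0)) => /le_trans; apply.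
  lra.
have g1 : Re (fourier logder (-2) 1) = 0.
  apply: cubic_zero => x x0; apply: (bnd _ _ (6 * rint (fun th => U x th * cos (3 * th)))) => //.
    by rewrite -(fourier_m2 x).1 -ReJ.
  by rewrite normrM ger0_norm // ler_pM2l //; exact: (U_trig_le x cc cb).
have g2 : Im (fourier logder (-2) 1) = 0.
  apply: cubic_zero => x x0; apply: (bnd _ _ (- (6 * rint (fun th => U x th * sin (3 * th))))) => //.
    by rewrite -(fourier_m2 x).2 -ImJ.
  by rewrite normrN normrM ger0_norm // ler_pM2l //; exact: (U_trig_le x cs sb).
move=> r0; apply/eqP; rewrite eq_complex ReJ // ImJ // g1 g2 !mul0r /=.
by rewrite eqxx.
Qed.

(* With V k the Fourier coefficients of the logarithmic derivative on the circles
   of centre i s0 and radius r, one has r V'(k) = - k V(k). Hence V(k) = 0 for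
   k = 1, 4 and V(-2) is a multiple of r ^ 2, which the growth of ln |h 0| forces
   to vanish, by an integration by parts. So the third derivative of ln (h 0)
   vanishes on the imaginary axis. *)
Lemma logder_third f : laplace_alg f -> holo logder2 f -> f ('i * s0%:C) = 0.
Proof.
move=> af hf.
have per2 : rot_periodic (-2).
  by have := perN (perD per1 per1); rewrite (_ : - (1 + 1) = -2 :> R) //; ring.
have real_neq0 (r : R) : 0 < r -> r%:C != 0 by move=> r0; rewrite eq_complex /= negb_and gt_eqF.
(* From index -2, two applications of [fourier_parts] lead to index 0 of the third derivative. They
   divide by [r], so that [r = 0] is reached by continuity; there the coefficient is 2 pi times the
   value at the centre. *)
have W r : 0 < r -> fourier logder2 (-1) r = 0.
  move=> r0; have := fourier_parts r alg_logder alg_logder2 holo_logder per2.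
  rewrite fourier_m2_zero // mulr0 oppr0 (_ : -2 + 1 = -1 :> R); last by ring.
  by move/eqP; rewrite mulf_eq0 (negbTE (real_neq0 _ r0)) => /eqP.
have Z r : 0 < r -> fourier f 0 r = 0.
  move=> r0; have := fourier_parts r alg_logder2 af hf (perN per1).
  rewrite W // mulr0 oppr0 addNr.
  by move/eqP; rewrite mulf_eq0 (negbTE (real_neq0 _ r0)) => /eqP.
have [f' af' hf'] := alg_derive af.
have [c1 c2] := cderive_cont (fourier_derive 0 af af' hf').
have right0 (g : R -> R) : continuous g -> (forall r, 0 < r -> g r = 0) -> g 0 = 0.
  move=> cg g0; apply/eqP; rewrite -normr_le0; apply/ler_addgt0Pr => e e0; rewrite add0r.
  have /cvgrPdist_le /(_ e e0) [dl /= dl0 hd] := cg 0.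
  have := hd (dl / 2); rewrite /ball_ /= (g0 (dl / 2)) ?divr_gt0 // subr0; apply.
  by rewrite sub0r normrN gtr0_norm ?divr_gt0 //; lra.
have E0 : fourier f 0 0 = 0.
  apply/eqP; rewrite eq_complex /=; apply/andP; split; apply/eqP.
    by apply: (right0 _ c1) => r /Z ->.
  by apply: (right0 _ c2) => r /Z ->.
have t0 : tau != 0 :> R by rewrite mulrn_eq0 /= gt_eqF // pi_gt0.
have Ec : fourier f 0 0 = tau%:C * f ('i * s0%:C).
  rewrite /fourier (_ : (fun th => _) = fun=> f ('i * s0%:C)); last first.
    by apply/funext => th; rewrite /circ mul0r addr0 /rot !mul0r cos0 sin0 mulr1.
  by rewrite /cint !rint_cst; apply/eqP; rewrite eq_complex /= Re_real_mul Im_real_mul !eqxx.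
move/eqP : E0; rewrite Ec mulf_eq0 => /orP[|/eqP //].
by rewrite eq_complex /= (negbTE t0).
Qed.

End Circle.

Let cder_zero (f f' : R -> R[i]) : cderive f f' -> (forall x, f' x = 0) -> forall x y, f x = f y.
Proof.
move=> df f'0 x y; have d1 (r : R) := (df r).1; have d2 (r : R) := (df r).2.
apply/eqP; rewrite eq_complex; apply/andP; split; apply/eqP.
  by apply: (is_derive_0_is_cst x y (f := fun x => Re (f x))) => r; apply: (rder_eq (d1 r)); rewrite f'0.
by apply: (is_derive_0_is_cst x y (f := fun x => Im (f x))) => r; apply: (rder_eq (d2 r)); rewrite f'0.
Qed.

Lemma cexpD (z w : R[i]) : cexp (z + w) = cexp z * cexp w.
Proof.
rewrite !cexpE ReD ImD expRD cosD sinD; apply/eqP; rewrite eq_complex ReM ImM /=.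
by apply/andP; split; apply/eqP; ring.
Qed.

Let laplace0 k : h k 0 = (\int[P]_w (Y w ^+ k))%:C.
Proof.
apply/eqP; rewrite eq_complex Re_laplace Im_laplace; apply/andP; split; apply/eqP.
  apply: eq_Rintegral => w _.
  by rewrite Re_lt_kernel -[Re 0]/(0 : R) -[Im 0]/(0 : R) mul0r expR0 cos0 !mulr1.
transitivity (\int[P]_w (0 : R)); last exact: Rintegral_probability_cst.
apply: eq_Rintegral => w _.
by rewrite Im_lt_kernel -[Re 0]/(0 : R) -[Im 0]/(0 : R) mul0r expR0 sin0 !mulr0.
Qed.

(** As the third derivative of the logarithm vanishes on the imaginary axis, integration from 0,
    where the values are moments, determines the first two derivatives and then the transform. *)
Lemma gaussian_moments (m v s : R) : m = \int[P]_w Y w -> v = \int[P]_w (Y w ^+ 2) - m ^+ 2 ->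
  (\int[P]_w cos (s * Y w)) +i* (\int[P]_w sin (s * Y w)) =
  cexp ('i * (s * m)%:C - (2^-1 * (s ^+ 2 * v))%:C).
Proof.
move=> mE vE; pose pt (x : R) : R[i] := 0 + x%:C * 'i.
have ptE x : pt x = 'i * x%:C by rewrite /pt add0r mulrC.
have pt0 : pt 0 = 0 by rewrite /pt mul0r addr0.
have tp : tame_path pt (fun=> 'i) (fun=> 0) by exact: segment_path.
have [f3 af3 hf3] := alg_derive alg_logder2.
have z3 x : f3 (pt x) = 0 by rewrite ptE (logder_third x af3 hf3).
have h00 : h 0 0 = 1.
  rewrite laplace0 (_ : \int[P]_w _ = 1) //.
  by rewrite -[RHS](Rintegral_probability_cst P); apply: eq_Rintegral => w _; rewrite expr0.
have L1 : logder 0 = m%:C.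
  rewrite /logder h00 invr1 mulr1 laplace0 mE; congr (_%:C).
have L2 : logder2 0 = v%:C.
  have E1 : h 1 0 = m%:C by rewrite -L1 /logder h00 invr1 mulr1.
  rewrite /logder2 h00 invr1 !mulr1 E1 laplace0 vE.
  by apply/eqP; rewrite eq_complex /=; apply/andP; split; apply/eqP; ring.
have D2 : forall x, logder2 (pt x) = v%:C.
  move=> x; rewrite -L2 -pt0; apply: (cder_zero (hf3 _ _ _ tp)) => r.
  by rewrite z3 mulr0.
have cx : cderive (fun x : R => x%:C) (fun=> 1).
  by move=> x; split; [exact: is_derive_id|exact: is_derive_cst].
have D1 : forall x, logder (pt x) = m%:C + 'i * v%:C * x%:C.
  move=> x; have D : cderive (fun x => logder (pt x) + - ('i * v%:C) * x%:C) (fun=> 0).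
    apply: (eq_cderive (cderiveD (holo_logder tp) (cderiveM (cderive_cst (- ('i * v%:C))) cx))) => r.
    by rewrite D2 mul0r add0r mulr1; exact: subrr.
  have := cder_zero D (fun=> erefl) x 0; rewrite pt0 L1 mulr0 addr0 => <-; ring.
(* Minus the expected exponent: instead of taking a logarithm, [h 0 * cexp e] is shown to be
   constant. *)
pose e (x : R) : R[i] := - ('i * m%:C) * x%:C + (2^-1 * v)%:C * (x%:C * x%:C).
have D0 : cderive (fun x => h 0 (pt x) * cexp (e x)) (fun=> 0).
  have de : cderive e (fun x => - ('i * m%:C) + v%:C * x%:C).
    apply: (eq_cderive (cderiveD (cderiveM (cderive_cst (- ('i * m%:C))) cx)
      (cderiveM (cderive_cst (2^-1 * v)%:C) (cderiveM cx cx)))) => r.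
    by apply/eqP; rewrite eq_complex /=; apply/andP; split; apply/eqP; field.
  apply: (eq_cderive (cderiveM (holo_laplace 0 tp) (cderive_cexp de))) => r.
  have -> : h 1 (pt r) = logder (pt r) * h 0 (pt r) by rewrite /logder divfK.
  rewrite D1.
  have -> : 'i * ((m%:C + 'i * v%:C * r%:C) * h 0 (pt r)) * cexp (e r) +
    h 0 (pt r) * ((- ('i * m%:C) + v%:C * r%:C) * cexp (e r)) =
    ('i * 'i + 1) * (v%:C * r%:C * h 0 (pt r) * cexp (e r)) by ring.
  by rewrite ii addNr mul0r.
have E0 : cexp (0 : R[i]) = 1.
  by rewrite cexpE -[Re 0]/(0 : R) -[Im 0]/(0 : R) expR0 cos0 sin0 mulr1 mulr0.
have G := cder_zero D0 (fun=> erefl) s 0.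
have e0 : e 0 = 0 by rewrite /e !mulr0 addr0.
rewrite pt0 h00 e0 E0 mulr1 in G.
have -> : (\int[P]_w cos (s * Y w)) +i* (\int[P]_w sin (s * Y w)) = h 0 (pt s).
  have Rp : Re (pt s) = 0 by rewrite ptE Re_i oppr0.
  have Ip : Im (pt s) = s by rewrite ptE ImM /= mul0r mul1r add0r.
  apply/eqP; rewrite eq_complex Re_laplace Im_laplace; apply/andP; split; apply/eqP.
    by apply: eq_Rintegral => w _; rewrite Re_lt_kernel Rp Ip mul0r expR0 expr0 !mul1r.
  by apply: eq_Rintegral => w _; rewrite Im_lt_kernel Rp Ip mul0r expR0 expr0 !mul1r.
have -> : 'i * (s * m)%:C - (2^-1 * (s ^+ 2 * v))%:C = - e s.
  by rewrite /e; apply/eqP; rewrite eq_complex /=; apply/andP; split; apply/eqP; ring.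
have N : cexp (e s) * cexp (- e s) = 1 by rewrite -cexpD subrr.
by rewrite -[LHS]mulr1 -N mulrA G mul1r.
Qed.

Lemma square_integrable : Rintegrable P Y /\ Rintegrable P (fun w => Y w ^+ 2).
Proof.
have iM : Rintegrable P (fun w => 4 * (expR (1 * Y w) + expR (-1 * Y w))).
  by apply: RintegrableZ; apply: RintegrableD.
have key (x : R) : 0 <= x -> x ^+ 2 <= 4 * expR x /\ x <= 4 * expR x.
  move=> x0; have h1 : 1 + x / 2 <= expR (x / 2) by exact: expR_ge1Dx.
  have E : expR x = expR (x / 2) ^+ 2 by rewrite expr2 -expRD; congr expR; field.
  have h2 : (1 + x / 2) ^+ 2 <= expR x.
    by rewrite E; apply: lerXn2r; rewrite ?nnegrE ?expR_ge0 //; lra.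
  have x2 := sqr_ge0 x; have E2 : (1 + x / 2) ^+ 2 = 1 + x + x ^+ 2 / 4 by field.
  by split; lra.
have bnd w : Y w ^+ 2 <= 4 * (expR (1 * Y w) + expR (-1 * Y w)) /\
    `|Y w| <= 4 * (expR (1 * Y w) + expR (-1 * Y w)).
  rewrite mul1r mulN1r; have e1 := expR_ge0 (Y w); have e2 := expR_ge0 (- Y w).
  have [y0|y0] := leP 0 (Y w).
    by have [a b] := key _ y0; rewrite ger0_norm //; split; lra.
  have := key (- Y w); rewrite sqrrN oppr_ge0 => /(_ (ltW y0))[a b].
  by rewrite ltr0_norm //; split; lra.
split; first exact: (Rintegrable_le mY (fun w => (bnd w).2) iM).
apply: (Rintegrable_le _ _ iM) => [|w].
  rewrite (_ : (fun w => _) = (fun w => Y w * Y w)); last by apply/funext => w; rewrite expr2.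
  exact: measurable_funM.
by rewrite ger0_norm ?sqr_ge0 //; exact: (bnd w).1.
Qed.

End ZeroFreeLaplace.

(** * Additive functionals on a torsion-free group *)

(** The reals are divisible, so an additive map on a subgroup extends; Zorn's lemma is applied to
    graphs. Torsion-freeness allows the value 1 at [g] on the subgroup that [g] generates. *)
Lemma separating_additive (R : realType) (G : zmodType) (g : G) : torsion_free G -> g <> 0 ->
  exists u : G -> R, (forall x y, u (x + y) = u x + u y) /\ u g <> 0.
Proof.
move=> tf g0.
(* The last condition admits the empty set, the union of the empty chain, while forcing [(g, 1)]
   into every other graph. *)
pose good (f : set (G * R)) := [/\ forall p q, f p -> f q -> f (p - q),
  forall y, f (0, y) -> y = 0 & forall p, f p -> f (g, 1)].
have pairMz (x : G) (y : R) (z : int) : (x, y) *~ z = (x *~ z, y *~ z).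
  have pn k : (x, y) *+ k = (x *+ k, y *+ k).
    by elim: k => [|k IH]; rewrite ?mulr0n // !mulrS IH.
  by case: z => k; [exact: pn|rewrite !NegzE !mulrNz; exact: (congr1 -%R (pn k.+1))].
have fz f p (z : int) : good f -> f p -> f (p *~ z).
  move=> [sub _ _] fp; have f0 : f 0 by rewrite -(subrr p); exact: sub.
  have fn k : f (p *+ k).
    elim: k => [|k IH]; first by rewrite mulr0n.
    rewrite mulrS (_ : p + p *+ k = p *+ k - (0 - p)); last by rewrite sub0r opprK addrC.
    by apply: (sub _ _) => //; exact: sub.
  case: z => k; first exact: fn.
  by rewrite NegzE mulrNz -sub0r; apply: (sub _ _) => //; exact: (fn k.+1).
have [F FG Ftot|f [gf fmax]] := @Zorn_bigcup _ good _.
  split.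
  - move=> p q [X FX Xp] [Y FY Yq]; have [XY|YX] := Ftot X Y FX FY.
      by exists Y => //; have [s _ _] := FG Y FY; exact: s (XY _ Xp) Yq.
    by exists X => //; have [s _ _] := FG X FX; exact: s Xp (YX _ Yq).
  - by move=> y [X FX Xy]; have [_ v _] := FG X FX; exact: v.
  - by move=> p [X FX Xp]; exists X => //; have [_ _ w] := FG X FX; exact: w Xp.
have [sub vert _] := gf.
have fg : f (g, 1).
  apply: contrapT => nfg.
  have fe p : ~ f p by move=> fp; apply: nfg; case: gf => _ _; apply; exact: fp.
  pose f0 : set (G * R) := [set p | exists z : int, p = (g *~ z, 1 *~ z)].
  have f01 : f0 (g, 1) by exists 1; rewrite !mulr1z.
  apply: (fmax f0); first by split=> [p /fe//|H]; apply: (fe (g, 1)); exact: H.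
  split=> [p q [z ->] [z' ->]|y [z [E ->]]|//].
    by exists (z - z'); rewrite !mulrzBr.
  suff -> : z = 0 by rewrite mulr0z.
  case: z E => [[|k]|k] // E; exfalso; apply: g0; apply: (tf g k.+1) => //.
  by move: E; rewrite NegzE mulrNz => /esym/eqP; rewrite oppr_eq0 => /eqP.
have f0 : f 0 by rewrite -(subrr (g, 1 : R)); exact: sub.
have tot h : exists r, f (h, r).
  (* If a nonzero multiple of [h] is already in the domain, it dictates the value at [h]; otherwise
     any value would do, and 0 is taken. *)
  have [r hr] : exists r : R, forall (z : int) y, f (h *~ z, y) -> y = r *~ z.
    have [[m [y0 [m0 fm]]]|nm] := pselect (exists (m : int) (y0 : R), m != 0 /\ f (h *~ m, y0)).
      exists (y0 / m%:~R) => z y fzy.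
      have := fz _ _ m gf fzy; have := fz _ _ z gf fm; rewrite !pairMz => a1 a2.
      have := sub _ _ a1 a2; rewrite -!mulrzA [(z * m)%R]mulrC => a3.
      have {}a3 : f (0, y0 *~ z - y *~ m) by rewrite -(subrr (h *~ (m * z))); exact: a3.
      move/vert: a3 => /eqP; rewrite subr_eq0 => /eqP; rewrite -[y0 *~ z]mulrzr -[y *~ m]mulrzr => E.
      by rewrite -[RHS]mulrzr mulrAC E mulfK // intr_eq0.
    exists 0 => z y fzy; rewrite mul0rz; have z0 : z = 0.
      by apply: contrapT => /eqP z0; apply: nm; exists z, y.
    by rewrite z0 mulr0z in fzy; exact: vert.
  exists r; apply: contrapT => nf.
  pose f' : set (G * R) := [set p | exists q (z : int), f q /\ p = (q.1 + h *~ z, q.2 + r *~ z)].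
  apply: (fmax f').
    split=> [p fp|H]; first by exists p, 0; rewrite !mulr0z !addr0 -surjective_pairing.
    by apply: nf; apply: H; exists 0, 1; rewrite !mulr1z !add0r.
  split=> [p q [a [z [fa ->]]] [b [z' [fb ->]]]|y [a [z [fa [E ->]]]]|p _].
  - exists (a - b), (z - z'); split; first exact: sub.
    by apply: injective_projections => /=; rewrite mulrzBr opprD addrACA.
  - have a1 : a.1 = h *~ (- z) by apply/eqP; rewrite mulrNz -addr_eq0 -E.
    have /hr -> : f (h *~ (- z), a.2) by rewrite -a1 -surjective_pairing.
    by rewrite mulrNz addNr.
  - by exists (g, 1), 0; rewrite !mulr0z !addr0.
have uniq h r r' : f (h, r) -> f (h, r') -> r = r'.
  move=> a b; have : f (0, r - r') by rewrite -(subrr h); exact: sub a b.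
  by move/vert/eqP; rewrite subr_eq0 => /eqP.
pose u h := projT1 (cid (tot h)); have fu h : f (h, u h) by exact: projT2 (cid (tot h)).
exists u; split=> [x y|].
  apply: (uniq (x + y)) => //.
  rewrite (_ : (x + y, u x + u y) = (x, u x) - (0 - (y, u y))); last by rewrite sub0r opprK.
  by apply: (sub _ _) => //; exact: sub.
by rewrite (uniq _ _ _ (fu g) fg); apply/eqP; rewrite oner_eq0.
Qed.

(* Induction on J: averaging the identity over [v + ws J *+ k], k < M, telescopes
   the J-th increment to a term of size O(1/M). *)
Lemma telescoping_average (R : realType) (W : zmodType) (V : W -> Prop) (J : nat)
    (g : nat -> W -> R) (ws : nat -> W) (b c e : R) :
  (forall v j, V v -> V (v + ws j)) -> V 0 ->
  (forall j v, V v -> `|g j v| <= b) ->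
  (forall v, V v -> `|c - \sum_(0 <= j < J) (g j (v + ws j) - g j v)| <= e) -> `|c| <= e.
Proof.
move=> Vw V0; elim: J g e => [|J IH] g e gb H.
  by have := H 0 V0; rewrite big_geq // subr0.
have Vn v k : V v -> V (v + ws J *+ k).
  by move=> Vv; elim: k => [|k IHk]; rewrite ?mulr0n ?addr0 // mulrSr addrA; exact: Vw.
have step (M : nat) : (0 < M)%N -> `|c| <= e + 2 * b / M%:R.
  move=> M0; have M0' : 0 < M%:R :> R by rewrite ltr0n.
  pose g' j v := M%:R^-1 * \sum_(k < M) g j (v + ws J *+ k).
  apply: (IH g') => [j v Vv|v Vv].
    rewrite /g' normrM gtr0_norm ?invr_gt0 // mulrC ler_pdivrMr //.
    apply: (le_trans (ler_norm_sum _ _ _)).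
    apply: (@le_trans _ _ (\sum_(k < M) b)); first by apply: ler_sum => k _; exact: gb (Vn _ _ Vv).
    by rewrite sumr_const card_ord mulr_natr.
  pose h k := c - \sum_(0 <= j < J.+1) (g j (v + ws J *+ k + ws j) - g j (v + ws J *+ k)).
  have tel : \sum_(k < M) (g J (v + ws J *+ k + ws J) - g J (v + ws J *+ k)) =
      g J (v + ws J *+ M) - g J v.
    rewrite -(big_mkord xpredT (fun k => g J (v + ws J *+ k + ws J) - g J (v + ws J *+ k))).
    under eq_bigr do rewrite -addrA -mulrSr.
    by rewrite (telescope_sumr (fun k => g J (v + ws J *+ k))) // mulr0n addr0.
  have E : c - \sum_(0 <= j < J) (g' j (v + ws j) - g' j v) =
      M%:R^-1 * (\sum_(k < M) h k + (g J (v + ws J *+ M) - g J v)).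
    rewrite -tel -big_split /=.
    rewrite (eq_bigr (fun k : 'I_M => c - \sum_(0 <= j < J) (g j (v + ws J *+ k + ws j) - g j (v + ws J *+ k)))); last first.
      by move=> k _; rewrite /h big_nat_recr //=; lra.
    have aux (s : nat -> R) : M%:R^-1 * \sum_(k < M) (c - s k) = c - M%:R^-1 * \sum_(k < M) s k.
      by rewrite sumrB sumr_const card_ord mulrBr -[c *+ M]mulr_natl mulKf ?gt_eqF.
    rewrite (aux (fun k => \sum_(0 <= j < J) (g j (v + ws J *+ k + ws j) - g j (v + ws J *+ k)))); congr (_ - _).
    rewrite exchange_big /= mulr_sumr; apply: eq_bigr => j _.
    rewrite /g' -mulrBr -sumrB; congr (_ * _); apply: eq_bigr => k _.
    by rewrite addrAC.
  rewrite E normrM gtr0_norm ?invr_gt0 // mulrC ler_pdivrMr // mulrDl divfK ?gt_eqF //.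
  apply: (le_trans (ler_normD _ _)); apply: lerD.
    apply: (le_trans (ler_norm_sum _ _ _)).
    apply: (@le_trans _ _ (\sum_(k < M) e)); first by apply: ler_sum => k _; exact: H (Vn _ _ Vv).
    by rewrite sumr_const card_ord mulr_natr.
  apply: (le_trans (ler_normB _ _)); have := gb J _ (Vn v M Vv); have := gb J _ Vv; lra.
have b0 : 0 <= b by apply: le_trans (gb 0%N 0 V0).
apply/ler_addgt0Pr => d d0.
pose M := (Num.bound (2 * b / d)).+1; have M0 : 0 < M%:R :> R by rewrite ltr0n.
apply: (le_trans (step M isT)); rewrite lerD2l ler_pdivrMr // [d * _]mulrC -ler_pdivrMr //.
have := archi_boundP (divr_ge0 (mulr_ge0 (ler0n R 2) b0) (ltW d0)).
by move=> /ltW/le_trans; apply; rewrite ler_nat.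
Qed.

(* Modulo 2 pi the values of [u] on [E] range over a finite-dimensional torus, in
   which the image of [V] is totally bounded. *)
Lemma cos_net (R : realType) (G : eqType) (V : (G -> R) -> Prop) (E : seq G) (e : R) :
  V (fun=> 0) -> 0 < e ->
  exists (N : nat) (ws : nat -> G -> R), (forall i, V (ws i)) /\
    forall u, V u -> exists2 i, (i < N)%N & forall g, g \in E -> 1 - e <= cos (u g - ws i g).
Proof.
move=> V0 e0.
pose m := (Num.bound (e^-1)).+1; have m0 : 0 < m%:R :> R by rewrite ltr0n.
have em : m%:R^-1 <= e.
  rewrite -[e]invrK lef_pV2 ?posrE ?invr_gt0 //.
  have ei : 0 <= e^-1 by rewrite invr_ge0 ltW.
  by apply: (le_trans (ltW (archi_boundP ei))); rewrite ler_nat.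
have m1 : 1 <= m%:R :> R by rewrite ler1n.
(* Cells of width [1 / m] in [-1, 1]. Functionals whose cosines and sines fall in the same cells are
   close, by [(cos x - cos y) ^ 2 + (sin x - sin y) ^ 2 = 2 - 2 cos (x - y)]. *)
pose cell (x : R) : 'I_(2 * m).+1 := inord (Num.truncn ((x + 1) * m%:R)).
have cellP x y : -1 <= x <= 1 -> -1 <= y <= 1 -> cell x = cell y -> (x - y) ^+ 2 <= m%:R^-1.
  move=> /andP[x1 x2] /andP[y1 y2] E1.
  have px : 0 <= (x + 1) * m%:R by rewrite mulr_ge0 //; lra.
  have py : 0 <= (y + 1) * m%:R by rewrite mulr_ge0 //; lra.
  have /andP[a1 a2] := truncn_itv px; have /andP[b1 b2] := truncn_itv py.
  have tr (z : R) : 0 <= z * m%:R -> z <= 2 -> (Num.truncn (z * m%:R) < (2 * m).+1)%N.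
    move=> z0 z2; have /andP[c1 _] := truncn_itv z0.
    rewrite ltnS -(ler_nat R); apply: (le_trans c1); rewrite natrM.
    by rewrite ler_pM2r.
  have t1 : (Num.truncn ((x + 1) * m%:R) < (2 * m).+1)%N by apply: tr => //; lra.
  have t2 : (Num.truncn ((y + 1) * m%:R) < (2 * m).+1)%N by apply: tr => //; lra.
  have E2 : Num.truncn ((x + 1) * m%:R) = Num.truncn ((y + 1) * m%:R).
    by have := congr1 val E1; rewrite /= !inordK.
  rewrite E2 -natr1 in a1 a2; rewrite -natr1 in b2.
  have xy : `|(x - y) * m%:R| <= 1.
    rewrite ler_norml; set p := (Num.truncn _)%:R in a1 a2 b1 b2.
    have -> : (x - y) * m%:R = (x + 1) * m%:R - (y + 1) * m%:R by ring.
    by apply/andP; split; lra.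
  have {}xy : `|x - y| <= m%:R^-1 by move: xy; rewrite normrM [`|m%:R|]gtr0_norm // -ler_pdivlMr // div1r.
  rewrite -real_normK ?num_real // expr2.
  apply: (@le_trans _ _ (m%:R^-1 * 1)); last by rewrite mulr1.
  by apply: ler_pM => //; apply: (le_trans xy); rewrite invf_le1.
pose col (u : G -> R) : (size E).-tuple ('I_(2 * m).+1 * 'I_(2 * m).+1) :=
  map_tuple (fun g => (cell (cos (u g)), cell (sin (u g)))) (in_tuple E).
have pick t : exists w, V w /\ ((exists2 u, V u & col u = t) -> col w = t).
  have [[u Vu cu]|no] := pselect (exists2 u, V u & col u = t); first by exists u.
  by exists (fun=> 0).
pose ch t := projT1 (cid (pick t)).
have chP t : V (ch t) /\ ((exists2 u, V u & col u = t) -> col (ch t) = t) by exact: projT2 (cid (pick t)).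
pose T := (size E).-tuple ('I_(2 * m).+1 * 'I_(2 * m).+1).
pose t0 : T := col (fun=> 0).
exists #|{: T}|, (fun i => ch (nth t0 (enum {: T}) i)); split=> [i|u Vu]; first exact: (chP _).1.
exists (index (col u) (enum {: T})); first by rewrite cardE index_mem mem_enum.
move=> g gE; rewrite nth_index ?mem_enum //.
have := (chP (col u)).2 (ex_intro2 _ _ u Vu erefl).
set w := ch _ => /(congr1 val) /= /eq_in_map /(_ g gE) [c1 c2].
have hc (z : R) : -1 <= cos z <= 1 by rewrite cos_geN1 cos_le1.
have hs (z : R) : -1 <= sin z <= 1 by rewrite sin_geN1 sin_le1.
have d1 := cellP _ _ (hc _) (hc _) c1; have d2 := cellP _ _ (hs _) (hs _) c2.
rewrite cosB; have := cos2Dsin2 (u g); have := cos2Dsin2 (w g).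
move: d1 d2; rewrite !sqrrB; lra.
Qed.

(** * Discrete random variables *)

Section DiscreteValues.
Context {d} {Omega : measurableType d} {R : realType} (P : probability Omega R) {G : zmodType}.
Local Notation DG := (borel (discrete_group G)).
Implicit Types Z D : Omega -> G.

Lemma discrete_measurable (A : set DG) : measurable A.
Proof.
apply: sub_sigma_algebra; rewrite /= openE => x Ax.
exact/principal_filterP.
Qed.

Lemma discrete_fun_measurable d' (T : measurableType d') (f : DG -> T) : measurable_fun setT f.
Proof. by move=> _ Y mY; exact: discrete_measurable. Qed.

Lemma discrete_compose (f : G -> R) Z : measurable_fun setT (Z : Omega -> DG) ->
  measurable_fun setT (fun w => f (Z w)).
Proof.
move=> mZ; apply: (measurableT_comp (f := f : DG -> R)) => //.
exact: discrete_fun_measurable.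
Qed.

Lemma discrete_integrable (f : G -> R) Z : measurable_fun setT (Z : Omega -> DG) -> bounded_fun f ->
  Rintegrable P (fun w => f (Z w)).
Proof.
move=> mZ [M hM]; apply: bounded_Rintegrable; first exact: discrete_compose.
by exists M.
Qed.

Lemma bool_bounded (T : Type) (b : T -> bool) : bounded_fun (fun g => (b g)%:R : R).
Proof. by exists 1 => g; case: (b g); rewrite ?normr1 ?normr0. Qed.

Lemma finite_mass Z (e : R) : countable [set: G] -> measurable_fun setT (Z : Omega -> DG) -> 0 < e ->
  exists2 E : seq G, uniq E & \int[P]_w (Z w \notin E)%:R <= e.
Proof.
move=> /countable_injP [f fi] mZ e0.
have [c cf] : exists c : nat -> G, forall g, c (f g) = g.
  have H i : exists g, (exists g', f g' = i) -> f g = i.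
    by have [[g' <-]|no] := pselect (exists g', f g' = i); [exists g'|exists 0].
  exists (fun i => projT1 (cid (H i))) => g.
  by have := projT2 (cid (H (f g))) (ex_intro _ g erefl); apply: fi; rewrite inE.
pose E k := undup [seq c i | i <- iota 0 k].
have cv : \int[P]_w (Z w \notin E k)%:R @[k --> \oo] --> (0 : R).
  have -> : (0 : R) = \int[P]_w 0 by rewrite Rintegral_probability_cst.
  apply: (@Rintegral_cvg_dominated _ _ _ _ _ _ (fun=> 1)).
  - by move=> k; exact: (discrete_compose (fun g => (g \notin E k)%:R)).
  - by [].
  - exact: finite_measure_integrable_cst.
  - by move=> k w; case: (_ \notin _); rewrite ?normr1 ?normr0.
  - move=> w; apply: cvg_near_cst; near=> k.
    rewrite mem_undup (_ : Z w \in _) //; apply/mapP; exists (f (Z w)) => //.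
    by rewrite mem_iota /=; near: k; exact: nbhs_infty_gt.
move/cvgrPdist_le : cv => /(_ e e0)[k _ /(_ k (leqnn k)) /=].
rewrite sub0r normrN => /(le_trans (ler_norm _)) hk.
by exists (E k) => //; exact: undup_uniq.
Unshelve. all: by end_near.
Qed.

Lemma mem_sum (s : seq G) (x : G) : uniq s -> \sum_(g <- s) ((x == g)%:R : R) = (x \in s)%:R.
Proof.
elim: s => [_|g s IH /= /andP[gs us]]; first by rewrite big_nil.
rewrite big_cons IH // in_cons; case: eqP => [->|_]; last by rewrite add0r.
by rewrite (negbTE gs) addr0.
Qed.

Definition atom Z (g : G) : R := \int[P]_w (Z w == g)%:R.

Lemma atom_ge0 Z g : 0 <= atom Z g.
Proof. by apply: Rintegral_ge0 => w _. Qed.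

Lemma atom_sum Z (s : seq G) : measurable_fun setT (Z : Omega -> DG) -> uniq s ->
  \sum_(g <- s) atom Z g = \int[P]_w (Z w \in s)%:R.
Proof.
move=> mZ us; rewrite -Rintegral_sum.
  by apply: eq_Rintegral => w _; rewrite mem_sum.
by move=> g; apply: (discrete_integrable (f := fun x => (x == g)%:R)) => //; exact: bool_bounded.
Qed.

Lemma prob_le1 Z (b : G -> bool) : measurable_fun setT (Z : Omega -> DG) -> \int[P]_w (b (Z w))%:R <= 1.
Proof.
move=> mZ; rewrite -[leRHS](Rintegral_probability_cst P); apply: le_Rintegral => //.
- by apply: (discrete_integrable (f := fun x => (b x)%:R)) => //; exact: bool_bounded.
- exact: finite_measure_integrable_cst.
- by move=> w _; case: (b _).
Qed.

End DiscreteValues.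

(** At most [1 / c] points have mass [c] or more, so that the maximum is attained, only finitely
    often, and is isolated from the other masses. *)
Lemma largest_atoms {R : realType} {G : eqType} (f : G -> R) (g0 : G) :
  (forall g, 0 <= f g) -> (forall s, uniq s -> \sum_(g <- s) f g <= 1) -> 0 < f g0 ->
  exists (A : seq G) (p p' : R), [/\ uniq A, A != [::], 0 <= p' < p,
    forall a, a \in A -> f a = p & forall g, g \notin A -> f g <= p'] /\ forall g, f g <= p.
Proof.
move=> f0 fs fg0; pose c := f g0 / 2; have c0 : 0 < c by rewrite divr_gt0.
pose Q k := `[< exists s : seq G, [/\ uniq s, size s = k & forall g, g \in s -> c <= f g] >].
have Q0 : Q 0%N by apply/asboolP; exists [::].
have Qb k : Q k -> (k <= Num.bound (c^-1))%N.
  move=> /asboolP[s [us <- sc]].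
  have h : (size s)%:R * c <= 1.
    apply: le_trans (fs s us); have -> : (size s)%:R * c = \sum_(g <- s) c.
      by rewrite big_const_seq count_predT iter_addr_0 mulr_natl.
    by rewrite big_seq [leRHS]big_seq; apply: ler_sum => g /sc.
  have ci : 0 <= c^-1 by rewrite invr_ge0 ltW.
  rewrite -(ler_nat R); apply: le_trans (ltW (archi_boundP ci)).
  by rewrite -[leRHS]div1r ler_pdivlMr.
case: (ex_maxnP (ex_intro (fun k => Q k) 0%N Q0) Qb) => k /asboolP[s [us sk sc]] kmax.
have out g : g \notin s -> f g < c.
  move=> gs; rewrite ltNge; apply/negP => cg.
  have : Q k.+1.
    apply/asboolP; exists (g :: s); rewrite /= gs us sk; split => // h.
    by rewrite in_cons => /orP[/eqP -> //|/sc].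
  by move/kmax; rewrite ltnn.
have cg0 : c < f g0 by rewrite /c; lra.
have g0s : g0 \in s by apply: contraT => /out; rewrite ltNge ltW.
have [m ms mmax] : exists2 m, m \in s & forall h, h \in s -> f h <= f m.
  move: g0s; clear -f0; elim: s g0 => // g s IH g0 _.
  case: s IH => [_|h s IH]; first by exists g; rewrite ?inE // => x; rewrite inE => /eqP ->.
  have [m ms mm] := IH h (mem_head h s).
  have [gm|mg] := leP (f g) (f m).
    by exists m => [|x]; rewrite in_cons ?ms ?orbT // => /orP[/eqP -> //|/mm].
  exists g => [|x]; first exact: mem_head.
  by rewrite in_cons => /orP[/eqP -> //|/mm /le_trans]; apply; exact: ltW.
have fm0 : c < f m by apply: lt_le_trans cg0 (mmax _ g0s).
have [p' [cp' p'm p'P]] : exists p', [/\ c <= p', p' < f m & forall h, h \in s -> f h < f m -> f h <= p'].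
  clear -fm0; elim: s => [|g s [p' [h1 h2 h3]]]; first by exists c.
  have [gm|mg] := ltP (f g) (f m); last first.
    by exists p'; split => // h; rewrite in_cons => /orP[/eqP ->|/h3 //]; rewrite ltNge mg.
  exists (Num.max p' (f g)); split; [by rewrite le_max h1|by rewrite gt_max h2|].
  move=> h; rewrite in_cons le_max => /orP[/eqP ->|hs hm]; first by rewrite lexx orbT.
  by rewrite h3.
exists [seq g <- s | f g == f m], (f m), p'; split; first split.
- exact: filter_uniq.
- by apply/negP => /eqP E; have := mem_filter (fun g => f g == f m) m s; rewrite E ms eqxx.
- by rewrite p'm andbT; apply: le_trans cp'; exact: ltW.
- by move=> a; rewrite mem_filter => /andP[/eqP].
- move=> g; rewrite mem_filter negb_and => /orP[gm|/out/ltW/le_trans]; last exact.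
  have [gs|/out/ltW/le_trans] := boolP (g \in s); last exact.
  by apply: p'P => //; rewrite lt_neqAle gm mmax.
- move=> g; have [/mmax //|/out gc] := boolP (g \in s).
  exact: ltW (lt_trans gc fm0).
Qed.

(** Otherwise [A] would contain the infinitely many distinct points [a0 - x *+ k]. *)
Lemma finite_no_translate {G : zmodType} (A : seq G) (x : G) : torsion_free G -> A != [::] -> x != 0 ->
  exists2 a, a \in A & a - x \notin A.
Proof.
move=> tf; case: A => [//|a0 A'] _; set A := a0 :: A' => x0.
apply: contrapT => no.
have st a : a \in A -> a - x \in A by move=> aA; apply: contrapT => /negP h; apply: no; exists a.
have all k : a0 - x *+ k \in A.
  elim: k => [|k IH]; first by rewrite mulr0n subr0 mem_head.
  by rewrite mulrSr opprD addrA st.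
have us : uniq [seq a0 - x *+ k | k <- iota 0 (size A).+1].
  rewrite map_inj_uniq ?iota_uniq //.
  have inj k l : (k <= l)%N -> a0 - x *+ k = a0 - x *+ l -> k = l.
    move=> kl /addrI /oppr_inj E; apply/eqP; rewrite eqn_leq kl /= leqNgt; apply/negP => lt.
    have h0 : x *+ (l - k) = 0 by rewrite mulrnBr // E subrr.
    by move/eqP: x0; apply; apply: (tf x (l - k)%N) => //; rewrite subn_gt0.
  move=> k l E; have [kl|lk] := leqP k l; first exact: inj.
  by apply/esym/inj => //; exact: ltnW.
have sub : {subset [seq a0 - x *+ k | k <- iota 0 (size A).+1] <= A} by move=> y /mapP[k _ ->].
by have := uniq_leq_size us sub; rewrite size_map size_iota ltnn.
Qed.

(** * Uniform tails of sums in the group *)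

Section UniformTail.
Context {d d'} {Omega : measurableType d} {Omega' : measurableType d'} {R : realType}.
Context (P : probability Omega R) (lam : probability Omega' R) {G : zmodType}.
Local Notation DG := (borel (discrete_group G)).
Hypothesis G_countable : countable [set: G].
Hypothesis G_torsion_free : torsion_free G.
Variables (S : nat -> Omega -> G) (z : Omega' -> G) (D : nat -> nat -> Omega -> G).
Hypothesis mS : forall N, measurable_fun setT (S N : Omega -> DG).
Hypothesis mz : measurable_fun setT (z : Omega' -> DG).
Hypothesis mD : forall N m, measurable_fun setT (D N m : Omega -> DG).
Hypothesis SD : forall N m w, S (N + m)%N w = S N w + D N m w.
Hypothesis indSD : forall N m, independent2 P (S N : Omega -> DG) (D N m : Omega -> DG).
Hypothesis S_cvg : forall f : G -> R, bounded_fun f ->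
  \int[P]_w f (S N w) @[N --> \oo] --> \int[lam]_x f (z x).

(** Outside a finite set carrying almost all the mass, atoms are uniformly small; inside it there
    are finitely many convergences. *)
Let atoms_near (e : R) : 0 < e ->
  exists N0, forall N g, (N0 <= N)%N -> atom P (S N) g <= atom lam z g + e.
Proof.
move=> e0; have e2 : 0 < e / 2 by rewrite divr_gt0.
have [E uE hE] := finite_mass lam G_countable mz e2.
have near b : exists N0, forall N, (N0 <= N)%N ->
    \int[P]_w (b (S N w) : bool)%:R <= \int[lam]_x (b (z x))%:R + e / 2.
  have := S_cvg (bool_bounded b) => /cvgrPdist_le /(_ _ e2)[N0 _ h]; exists N0 => N NN.
  have := h N NN => /=; rewrite distrC => /(le_trans (ler_norm _)); lra.
have [N1 h1] := near (fun g => g \notin E).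
have [N2 h2] : exists N2, forall N g, (N2 <= N)%N -> g \in E -> atom P (S N) g <= atom lam z g + e / 2.
  clear -near; elim: E => [|g E [N2 h2]]; first by exists 0%N.
  have [N3 h3] := near (fun x => x == g); exists (maxn N2 N3) => N h; rewrite geq_max => /andP[a1 a2].
  by rewrite in_cons => /orP[/eqP ->|hE]; [exact: h3|exact: h2].
exists (maxn N1 N2) => N g; rewrite geq_max => /andP[a1 a2].
have [gE|gE] := boolP (g \in E); first by have := h2 N g a2 gE; lra.
have : atom P (S N) g <= \int[P]_w (S N w \notin E)%:R.
  apply: le_Rintegral => //.
  - by apply: (discrete_integrable _ (f := fun x => (x == g)%:R)) => //; exact: bool_bounded.
  - by apply: (discrete_integrable _ (f := fun x => (x \notin E)%:R)) => //; exact: bool_bounded.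
  - by move=> w _; case: eqP => [->|_]; rewrite ?gE.
have := h1 N a1; have := atom_ge0 lam z g; lra.
Qed.

(* The mass of the largest atoms of the limit is nearly preserved by the
   increment, whose other values would move some of these atoms out of their
   set: a finite set is not a translate of itself in a torsion-free group. *)
Lemma uniform_tail (e : R) : 0 < e ->
  exists J, forall N m, (J <= N)%N -> \int[P]_w (D N m w != 0)%:R <= e.
Proof.
move=> e0.
have [g0 fg0] : exists g0, 0 < atom lam z g0.
  have h2 : 0 < 1 / 2 :> R by lra.
  have [E uE hE] := finite_mass lam G_countable mz h2.
  apply: contrapT => no.
  have a0 g : atom lam z g = 0.
    apply/eqP; rewrite eq_le atom_ge0 andbT leNgt; apply/negP => h; apply: no; by exists g.
  have := atom_sum lam mz uE; rewrite big1 // => E0.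
  have : \int[lam]_x (z x \in E)%:R + \int[lam]_x (z x \notin E)%:R = 1.
    rewrite -RintegralD //.
    + rewrite -[RHS](Rintegral_probability_cst lam); apply: eq_Rintegral => x _.
      by case: (_ \in _); rewrite ?addr0 ?add0r.
    + by apply: (discrete_integrable _ (f := fun x => (x \in E)%:R)) => //; exact: bool_bounded.
    + by apply: (discrete_integrable _ (f := fun x => (x \notin E)%:R)) => //; exact: bool_bounded.
  rewrite -E0; lra.
have at1 s : uniq s -> \sum_(g <- s) atom lam z g <= 1.
  by move=> us; rewrite atom_sum //; apply: (prob_le1 lam (fun x => x \in s)).
have [A [p [p' [[uA A0 /andP[p'0 p'p] Ap Ap'] pmax]]]] := largest_atoms (atom_ge0 lam z) at1 fg0.
have pp : 0 < p - p' by rewrite subr_gt0.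
pose a : R := (size A)%:R.
have a1 : 1 <= a by rewrite /a ler1n; case: (A) A0.
pose del := e * (p - p') / (2 + a).
have a2 : 0 < 2 + a by lra.
have del0 : 0 < del by rewrite divr_gt0 // mulr_gt0.
have [N1 h1] := atoms_near del0.
have := S_cvg (bool_bounded (fun g => g \in A)) => /cvgrPdist_le /(_ _ del0)[N2 _ h2].
exists (maxn N1 N2) => N m; rewrite geq_max => /andP[NN1 NN2].
have low : a * p - del <= \int[P]_w (S (N + m)%N w \in A)%:R.
  have := h2 _ (leq_trans NN2 (leq_addr m N)) => /= /(le_trans (ler_norm _)).
  rewrite -(atom_sum lam mz uA) (eq_big_seq (fun=> p)) // big_const_seq count_predT iter_addr_0 -mulr_natl -/a.
  lra.
have [E uE hE] := finite_mass P G_countable (mD N m) del0.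
(* A bound for the probability that [S N + x] lies in [A]: a nonzero [x] replaces at least one of
   the largest atoms by one of mass at most [p']. *)
pose hh (x : G) : R := a * (p + del) - (p - p') * (x != 0)%:R.
have hh0 x : 0 <= hh x.
  rewrite /hh; have : p - p' <= a * (p + del).
    apply: (@le_trans _ _ (1 * (p + del))); first by lra.
    by rewrite ler_wpM2r //; lra.
  by case: (x != 0); rewrite ?mulr1 ?mulr0; lra.
have shift x : \int[P]_w (S N w + x \in A)%:R <= hh x.
  have -> : \int[P]_w (S N w + x \in A)%:R = \sum_(g <- A) atom P (S N) (g - x).
    rewrite -Rintegral_sum; last first.
      by move=> g; apply: (discrete_integrable _ (f := fun y => (y == g - x)%:R)) => //; exact: bool_bounded.
    apply: eq_Rintegral => w _; rewrite -mem_sum //; apply: eq_bigr => g _.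
    by rewrite [in RHS]eq_sym subr_eq eq_sym.
  apply: (@le_trans _ _ (\sum_(g <- A) (atom lam z (g - x) + del))).
    by apply: ler_sum => g _; exact: h1.
  rewrite big_split /= big_const_seq count_predT iter_addr_0 -[del *+ _]mulr_natl -/a.
  have sp (B : seq G) : \sum_(g <- B) atom lam z (g - x) <= (size B)%:R * p.
    elim: B => [|g B IH]; first by rewrite big_nil mul0r.
    by rewrite big_cons /= -natr1 mulrDl mul1r addrC lerD.
  rewrite /hh mulrDr; have [x0|x0] := eqVneq x 0.
    by have := sp A; rewrite /= mulr0 subr0 lerD2r.
  have [g gA gx] := finite_no_translate G_torsion_free A0 x0.
  have := Ap' _ gx; rewrite mulr1 (big_rem g) //=.
  have := sp (rem g A); rewrite size_rem //.
  have -> : (size A).-1%:R = a - 1 :> R.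
    by rewrite /a; case: (A) gA => //= ? ? _; rewrite -natr1 addrK.
  lra.
have iD (f : G -> R) : bounded_fun f -> Rintegrable P (fun w => f (D N m w)) by exact: discrete_integrable.
have iS (f : G -> R) : bounded_fun f -> Rintegrable P (fun w => f (S N w)) by exact: discrete_integrable.
have prodE x : Rintegrable P (fun w => (D N m w == x)%:R * (S N w + x \in A)%:R) /\
    \int[P]_w ((D N m w == x)%:R * (S N w + x \in A)%:R) <= \int[P]_w ((D N m w == x)%:R * hh x).
  have ind : independent2 P (fun w => (S N w + x \in A)%:R : R) (fun w => (D N m w == x)%:R : R).
    exact: (independent2_comp (discrete_fun_measurable (fun y : DG => (y + x \in A)%:R : R))
      (discrete_fun_measurable (fun y : DG => (y == x)%:R : R)) (indSD N m)).
  have [i1 i2] := independent2_Rintegral ind (iS (fun y => (y + x \in A)%:R) (bool_bounded _))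
    (iD (fun y => (y == x)%:R) (bool_bounded _)).
  have C w : (D N m w == x)%:R * (S N w + x \in A)%:R = (S N w + x \in A)%:R * (D N m w == x)%:R :> R.
    by rewrite mulrC.
  under eq_fun do rewrite C; split => //.
  rewrite i2 RintegralZr //; last by apply: (iD (fun y => (y == x)%:R)); exact: bool_bounded.
  by rewrite mulrC ler_wpM2l // Rintegral_ge0.
have up : \int[P]_w (S (N + m)%N w \in A)%:R <= del + (a * (p + del) - (p - p') * \int[P]_w (D N m w != 0)%:R).
  have step1 : \int[P]_w (S (N + m)%N w \in A)%:R <=
      \int[P]_w ((D N m w \notin E)%:R + \sum_(x <- E) (D N m w == x)%:R * (S N w + x \in A)%:R).
    apply: le_Rintegral => //.
    - by apply: (discrete_integrable _ (f := fun x => (x \in A)%:R)) => //; exact: bool_bounded.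
    - apply: RintegrableD; first by apply: (iD (fun x => (x \notin E)%:R)); exact: bool_bounded.
      by apply: Rintegrable_sum => x; exact: (prodE x).1.
    - move=> w _; rewrite SD; have [DE|DE] /= := boolP (D N m w \in E); last first.
        have : 0 <= \sum_(x <- E) (D N m w == x)%:R * (S N w + x \in A)%:R :> R.
          by apply: sumr_ge0 => x _; rewrite mulr_ge0.
        by case: (_ \in A) => /=; lra.
      rewrite add0r (big_rem _ DE) /= eqxx mul1r lerDl.
      by apply: sumr_ge0 => x _; rewrite mulr_ge0.
  apply: (le_trans step1); rewrite RintegralD //; last 2 first.
    by apply: (iD (fun x => (x \notin E)%:R)); exact: bool_bounded.
    by apply: Rintegrable_sum => x; exact: (prodE x).1.
  apply: lerD => //; rewrite Rintegral_sum; last by move=> x; exact: (prodE x).1.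
  have ihh : Rintegrable P (fun w => hh (D N m w)).
    apply: RintegrableB; first exact: finite_measure_integrable_cst.
    by apply: RintegrableZ; apply: (iD (fun x => (x != 0)%:R)); exact: bool_bounded.
  have iEh x : Rintegrable P (fun w => (D N m w == x)%:R * hh x).
    under eq_fun do rewrite mulrC.
    by apply: RintegrableZ; apply: (iD (fun y => (y == x)%:R)); exact: bool_bounded.
  apply: (@le_trans _ _ (\int[P]_w hh (D N m w))).
    apply: (@le_trans _ _ (\sum_(x <- E) \int[P]_w ((D N m w == x)%:R * hh x))).
      by apply: ler_sum => x _; exact: (prodE x).2.
    rewrite -Rintegral_sum //; apply: le_Rintegral => //; first exact: Rintegrable_sum.
    move=> w _; have [DE|DE] := boolP (D N m w \in E).
      rewrite (big_rem _ DE) /= eqxx mul1r big_seq big1 ?addr0 // => x.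
      by rewrite mem_rem_uniq // inE eq_sym => /andP[/negbTE -> _]; rewrite mul0r.
    rewrite big_seq big1 // => x xE; case: eqP => [Dx|_]; last by rewrite mul0r.
    by rewrite Dx xE in DE.
  rewrite /hh RintegralB //; last 2 first.
    exact: finite_measure_integrable_cst.
    by apply: RintegrableZ; apply: (iD (fun x => (x != 0)%:R)); exact: bool_bounded.
  rewrite Rintegral_probability_cst RintegralZl //.
  by apply: (iD (fun x => (x != 0)%:R)); exact: bool_bounded.
have fin : (p - p') * \int[P]_w (D N m w != 0)%:R <= del * (2 + a).
  move: low up; set I1 := \int[P]_w (_ \in A)%:R; set I2 := \int[P]_w (_ != 0)%:R.
  move=> l1 l2; have := le_trans l1 l2; rewrite mulrDr; lra.
have dE : del * (2 + a) = e * (p - p') by rewrite /del divfK // gt_eqF.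
by move: fin; rewrite dE mulrC ler_pM2r.
Qed.

End UniformTail.

Lemma countable_enum {T : Type} (t0 : T) : countable [set: T] -> exists c : nat -> T, forall t, exists n, c n = t.
Proof.
move=> /countable_injP [f fi].
have H i : exists t, (exists t', f t' = i) -> f t = i.
  by have [[t' <-]|no] := pselect (exists t', f t' = i); [exists t'|exists t0].
exists (fun i => projT1 (cid (H i))) => t; exists (f t).
by have := projT2 (cid (H (f t))) (ex_intro _ t erefl); apply: fi; rewrite inE.
Qed.

(** As [G] is countable, preimages are countable unions of rectangles. *)
Lemma discrete_step_measurable {d} {T : measurableType d} {G : zmodType} (f : G -> T -> G) :
  countable [set: G] -> (forall g, measurable_fun setT (f g : T -> borel (discrete_group G))) ->
  measurable_fun setT ((fun p => f p.1 p.2) : borel (discrete_group G) * T -> borel (discrete_group G)).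
Proof.
move=> /(countable_enum 0) [c cs] mf _ A mA; rewrite setTI.
rewrite (_ : _ @^-1` _ = \bigcup_n ([set c n] `*` (f (c n) @^-1` A))); last first.
  apply/seteqP; split=> [[g t] /= fA|[g t] [n _ [/= -> fA]] //].
  by have [n cn] := cs g; exists n => //; split => //=; rewrite cn.
apply: bigcup_measurable => n _; apply: measurableX; first exact: discrete_measurable.
by rewrite -[X in measurable X]setTI; exact: mf.
Qed.

(** * Coherence of functions of group-valued variables *)

Section DiscreteCoherence.
Context {d} {Omega : measurableType d} {R : realType} (P : probability Omega R) {G : zmodType}.
Local Notation DG := (borel (discrete_group G)).

Lemma weight_one : weight P (fun=> 1).
Proof. by apply: positive_weight => //; exact: finite_measure_integrable_cst. Qed.

Lemma coherence_ge_wcos (p : Omega -> R) (c : R) : 0 <= c -> measurable_fun setT p ->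
  c <= \int[P]_w cos (p w) -> c ^+ 2 <= coherence P (fun=> 1) p.
Proof.
move=> c0 mp cp; rewrite /coherence Rintegral_probability_cst expr1n divr1.
have -> : wcos P (fun=> 1) p = \int[P]_w cos (p w).
  by apply: eq_Rintegral => w _; rewrite mul1r.
apply: (@le_trans _ _ ((\int[P]_w cos (p w)) ^+ 2)); last by rewrite lerDl sqr_ge0.
by apply: lerXn2r; rewrite ?nnegrE // (le_trans c0).
Qed.

Let cos_int (p : Omega -> R) : measurable_fun setT p -> Rintegrable P (fun w => cos (p w)).
Proof.
move=> mp; apply: bounded_Rintegrable.
  by apply: measurableT_comp => //; apply: continuous_measurable_fun; exact: continuous_cos.
by exists 1 => w; rewrite ler_norml cos_geN1 cos_le1.
Qed.

(** Off [E] the cosine falls short by at most 2, so its mean is at least 31/32 - 2/64 = 15/16, whose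
    square exceeds 7/8. *)
Lemma near_one_coherence (z : Omega -> G) (E : seq G) (u : G -> R) :
  measurable_fun setT (z : Omega -> DG) -> \int[P]_w (z w \notin E)%:R <= 1 / 64 ->
  (forall g, g \in E -> 31 / 32 <= cos (u g)) ->
  7 / 8 <= coherence P (fun=> 1) (fun w => u (z w)).
Proof.
move=> mz EP cu.
have iE : Rintegrable P (fun w => 2 * (z w \notin E)%:R).
  apply: RintegrableZ; apply: (discrete_integrable _ (f := fun x => (x \notin E)%:R)) => //.
  exact: bool_bounded.
have mu : measurable_fun setT (fun w => u (z w)) by exact: discrete_compose.
apply: (@le_trans _ _ ((15 / 16) ^+ 2)); first by lra.
apply: coherence_ge_wcos => //.
apply: (@le_trans _ _ (\int[P]_w (31 / 32 - 2 * (z w \notin E)%:R))).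
  rewrite RintegralB //; last exact: finite_measure_integrable_cst.
  rewrite Rintegral_probability_cst RintegralZl //; first by lra.
  by apply: (discrete_integrable _ (f := fun x => (x \notin E)%:R)) => //; exact: bool_bounded.
apply: le_Rintegral => //.
- by apply: RintegrableB => //; exact: finite_measure_integrable_cst.
- exact: cos_int.
- move=> w _; have [zE|zE] /= := boolP (z w \in E).
    by rewrite mulr0 subr0 cu.
  by rewrite mulr1; have := cos_geN1 (u (z w)); lra.
Qed.

(** The events [D1 = 0] and [D2 = 0] do not depend on the form [p], so that the bound holds for all
    forms at once. *)
Lemma tail_coherence (p : Omega -> R) (D1 D2 : Omega -> G) (e : R) : measurable_fun setT p ->
  measurable_fun setT (D1 : Omega -> DG) -> measurable_fun setT (D2 : Omega -> DG) ->
  (forall w, D1 w = 0 -> D2 w = 0 -> p w = 0) -> 0 <= e -> e <= 1 / 4 ->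
  \int[P]_w (D1 w != 0)%:R <= e -> \int[P]_w (D2 w != 0)%:R <= e ->
  1 - 8 * e <= coherence P (fun=> 1) p.
Proof.
move=> mp m1 m2 p0 e0 e4 h1 h2.
have iD (D : Omega -> G) : measurable_fun setT (D : Omega -> DG) -> Rintegrable P (fun w => (D w != 0)%:R : R).
  by move=> mD; apply: (discrete_integrable _ (f := fun x => (x != 0)%:R)) => //; exact: bool_bounded.
apply: (@le_trans _ _ ((1 - 4 * e) ^+ 2)).
  by have := sqr_ge0 e; rewrite sqrrB; lra.
apply: coherence_ge_wcos => //; first by lra.
have i12 : Rintegrable P (fun w => (D1 w != 0)%:R + (D2 w != 0)%:R : R).
  by apply: RintegrableD; exact: iD.
apply: (@le_trans _ _ (\int[P]_w (1 - 2 * ((D1 w != 0)%:R + (D2 w != 0)%:R)))).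
  rewrite RintegralB //; [|exact: finite_measure_integrable_cst|exact: RintegrableZ].
  rewrite Rintegral_probability_cst RintegralZl // RintegralD //; [|exact: iD..].
  lra.
apply: le_Rintegral => //.
- by apply: RintegrableB; [exact: finite_measure_integrable_cst|exact: RintegrableZ].
- exact: cos_int.
- move=> w _; have := cos_geN1 (p w).
  case: (eqVneq (D1 w) 0) => /= [d1|_]; last by case: (D2 w != 0) => /=; lra.
  case: (eqVneq (D2 w) 0) => /= [d2|_]; last by lra.
  by rewrite p0 // cos0; lra.
Qed.

End DiscreteCoherence.

Lemma cos_small {R : realType} (x : R) : `|x| <= 1 / 4 -> 31 / 32 <= cos x.
Proof.
move=> x4; have := one_minus_cos x.
have [y0 yE] : 0 <= `|x| / 2 /\ `|x| / 2 <= 1 / 8 by split; [rewrite divr_ge0|lra].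
have s1 := sin_le_id y0.
have s0 : 0 <= sin (`|x| / 2).
  by apply: sin_ge0_pi; rewrite y0 /=; have := pi_ge2 R; lra.
have -> : sin (x / 2) ^+ 2 = sin (`|x| / 2) ^+ 2.
  by case: (leP 0 x) => h; [rewrite ger0_norm|rewrite ltr0_norm // mulNr sinN sqrrN].
have : sin (`|x| / 2) ^+ 2 <= (1 / 8) ^+ 2.
  by apply: lerXn2r; rewrite ?nnegrE //; lra.
lra.
Qed.

(** Coherence 1 makes the mean of [exp (i p)] a unit vector; the mean squared distance to it is then
    0, so that every atom attains it. *)
Lemma sub_periodic_coherence {d} {Omega : measurableType d} {R : realType} (P : probability Omega R)
    {G : zmodType} (z : Omega -> G) (p : G -> R) (g : G) :
  measurable_fun setT (z : Omega -> borel (discrete_group G)) ->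
  coherence P (fun=> 1) (fun w => p (z w)) = 1 -> 0 < atom P z g ->
  cos (p g) = \int[P]_w cos (p (z w)) /\ sin (p g) = \int[P]_w sin (p (z w)).
Proof.
move=> mz; rewrite /coherence Rintegral_probability_cst expr1n divr1.
have -> : wcos P (fun=> 1) (fun w => p (z w)) = \int[P]_w cos (p (z w)).
  by apply: eq_Rintegral => w _; rewrite mul1r.
have -> : wsin P (fun=> 1) (fun w => p (z w)) = \int[P]_w sin (p (z w)).
  by apply: eq_Rintegral => w _; rewrite mul1r.
set a := \int[P]_w cos _; set b := \int[P]_w sin _ => ab ag.
have bc : bounded_fun (fun x => cos (p x)) by exists 1 => x; rewrite ler_norml cos_geN1 cos_le1.
have bs : bounded_fun (fun x => sin (p x)) by exists 1 => x; rewrite ler_norml sin_geN1 sin_le1.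
have ic := discrete_integrable P mz bc; have is' := discrete_integrable P mz bs.
have i1 : Rintegrable P (fun=> 2 : R) by exact: finite_measure_integrable_cst.
have iV : Rintegrable P (fun w => 2 - 2 * (a * cos (p (z w)) + b * sin (p (z w)))).
  by apply: RintegrableB => //; apply: RintegrableZ; apply: RintegrableD; exact: RintegrableZ.
have V0 : \int[P]_w (2 - 2 * (a * cos (p (z w)) + b * sin (p (z w)))) = 0.
  rewrite RintegralB //; last by apply: RintegrableZ; apply: RintegrableD; exact: RintegrableZ.
  rewrite Rintegral_probability_cst RintegralZl; [|by []|by apply: RintegrableD; exact: RintegrableZ].
  rewrite RintegralD //; [|exact: RintegrableZ..].
  by rewrite !RintegralZl // -/a -/b -!expr2 ab; ring.
pose c := (cos (p g) - a) ^+ 2 + (sin (p g) - b) ^+ 2.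
have E x : 2 - 2 * (a * cos (p x) + b * sin (p x)) = (cos (p x) - a) ^+ 2 + (sin (p x) - b) ^+ 2.
  by have := cos2Dsin2 (p x); have := ab; rewrite !sqrrB; lra.
have : c * atom P z g <= 0.
  rewrite -V0 /atom -RintegralZl //; last first.
    by apply: (discrete_integrable _ (f := fun x => (x == g)%:R)) => //; exact: bool_bounded.
  apply: le_Rintegral => //.
    by apply: RintegrableZ; apply: (discrete_integrable _ (f := fun x => (x == g)%:R)) => //; exact: bool_bounded.
  move=> w _; rewrite E; case: eqP => [->|_]; first by rewrite mulr1.
  by rewrite mulr0 addr_ge0 ?sqr_ge0.
rewrite pmulr_lle0 // => c0.
have := sqr_ge0 (cos (p g) - a); have := sqr_ge0 (sin (p g) - b) => s1 s2.
have e1 : (cos (p g) - a) ^+ 2 = 0 by move: c0; rewrite /c; lra.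
have e2 : (sin (p g) - b) ^+ 2 = 0 by move: c0; rewrite /c; lra.
by move/eqP: e1; rewrite sqrf_eq0 subr_eq0 => /eqP ->; move/eqP: e2; rewrite sqrf_eq0 subr_eq0 => /eqP ->.
Qed.

Lemma coherent_constant {d} {Omega : measurableType d} {R : realType} (P : probability Omega R)
    {G : zmodType} (z : Omega -> G) : countable [set: G] -> torsion_free G ->
  measurable_fun setT (z : Omega -> borel (discrete_group G)) ->
  (forall u : G -> R, (forall x y, u (x + y) = u x + u y) ->
    coherence P (fun=> 1) (fun w => u (z w)) = 1) ->
  exists g, \int[P]_w (z w != g)%:R = 0 :> R.
Proof.
move=> Gc tf mz H.
have [g ag] : exists g, 0 < atom P z g.
  apply: contrapT => no.
  have a0 g : atom P z g = 0.
    by apply/eqP; rewrite eq_le atom_ge0 andbT leNgt; apply/negP => h; apply: no; exists g.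
  have h2 : 0 < 1 / 2 :> R by lra.
  have [E uE hE] := finite_mass P Gc mz h2.
  have := atom_sum P mz uE; rewrite big1 // => E0.
  have : \int[P]_x (z x \in E)%:R + \int[P]_x (z x \notin E)%:R = 1 :> R.
    rewrite -RintegralD //.
    + rewrite -[RHS](Rintegral_probability_cst P); apply: eq_Rintegral => x _.
      by case: (_ \in _); rewrite ?addr0 ?add0r.
    + by apply: (discrete_integrable _ (f := fun x => (x \in E)%:R)) => //; exact: bool_bounded.
    + by apply: (discrete_integrable _ (f := fun x => (x \notin E)%:R)) => //; exact: bool_bounded.
  rewrite -E0; lra.
exists g.
have other h : h != g -> atom P z h = 0.
  move=> hg; apply/eqP; rewrite eq_le atom_ge0 andbT leNgt; apply/negP => ah.
  have hg' : h - g <> 0 by move/eqP; rewrite subr_eq0 (negbTE hg).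
  have [u [uD u0]] := @separating_additive R G (h - g) tf hg'.
  (* Scaled so that the phases at [h] and [g] differ by pi, although both must be the mean phase. *)
  pose s := pi / u (h - g); pose p x := s * u x.
  have pD x y : p (x + y) = p x + p y by rewrite /p uD mulrDr.
  have [c1 s1] := sub_periodic_coherence mz (H p pD) ah.
  have [c2 s2] := sub_periodic_coherence mz (H p pD) ag.
  have pi' : p h - p g = pi.
    have -> : p h = p (h - g) + p g by rewrite -pD subrK.
    by rewrite addrK /p /s divfK //; apply/eqP.
  have : cos (p h - p g) = -1 by rewrite pi' cospi.
  rewrite cosB c1 c2 s1 s2 -!expr2 => E1.
  by have := sqr_ge0 (\int[P]_w cos (p (z w))); have := sqr_ge0 (\int[P]_w sin (p (z w))); lra.
apply/eqP; rewrite eq_le Rintegral_ge0 // andbT; apply/ler_addgt0Pr => e e0; rewrite add0r.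
have [E uE hE] := finite_mass P Gc mz e0; apply: le_trans hE.
have ib (b : G -> bool) : Rintegrable P (fun w => (b (z w))%:R : R).
  by apply: (discrete_integrable _ (f := fun x => (b x)%:R)) => //; exact: bool_bounded.
have -> : \int[P]_w (z w \notin E)%:R = \int[P]_w (z w \notin E)%:R + \sum_(h <- rem g E) atom P z h :> R.
  rewrite big_seq big1 ?addr0 // => h; rewrite mem_rem_uniq // inE => /andP[hg _]; exact: other.
rewrite atom_sum ?rem_uniq // -RintegralD //; [|exact: (ib (fun x => x \notin E))|exact: (ib (fun x => x \in rem g E))].
apply: le_Rintegral => //; first exact: (ib (fun x => x != g)).
  by apply: RintegrableD; [exact: (ib (fun x => x \notin E))|exact: (ib (fun x => x \in rem g E))].
move=> w _; rewrite mem_rem_uniq // inE.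
by case: (z w == g); case: (z w \in E) => /=; lra.
Qed.

(** * The components in the discrete group *)

(** The lower bounds produced by iterating [K_step]. *)
Lemma halved_powers {R : realType} (J : nat) (r : nat -> R) :
  r 0%N = 1 / 2 -> (forall n, r n.+1 = 1 / 2 * (r n / 2) ^+ (2 ^ J)) ->
  (forall n, 0 < r n <= 1 / 2) /\ (forall n m, r (n + m)%N <= r n).
Proof.
move=> r0E rS; have r01 n : 0 < r n <= 1 / 2.
  elim: n => [|n /andP[r0 r1]]; first by rewrite r0E lexx andbT; lra.
  rewrite rS; have p1 : (r n / 2) ^+ (2 ^ J) <= 1 by rewrite exprn_ile1 //; lra.
  have p0 : 0 < (r n / 2) ^+ (2 ^ J) by rewrite exprn_gt0 // divr_gt0.
  by apply/andP; split; lra.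
split => // n m; elim: m => [|m IH]; rewrite ?addn0 // addnS rS; apply: le_trans IH.
have /andP[r0 r1] := r01 (n + m)%N.
have : (r (n + m)%N / 2) ^+ (2 ^ J) <= r (n + m)%N / 2.
  by rewrite -[leRHS]expr1 ler_wiXn2l ?expn_gt0 //; lra.
lra.
Qed.

Lemma increment_bounds {R : realFieldType} (f k g h l e : R) :
  f + k <= g -> l + g <= f + k -> k <= h -> l + h <= k -> - l <= 2 * e ->
  - (4 * e) <= f - (g - h) /\ f - (g - h) <= 4 * e.
Proof. by move=> h1 h2 h3 h4 h5; split; lra. Qed.

Section GroupForms.
Context {d} {Omega : measurableType d} {R : realType} (P : probability Omega R).
Context {T : ptopologicalType} {G : zmodType}.
Local Notation DG := (borel (discrete_group G)).
Hypothesis G_countable : countable [set: G].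
Hypothesis G_torsion_free : torsion_free G.
Variable xi : nat -> {RV P >-> borel T}.
Hypothesis xi_indep : mutually_independent xi.
Variable z : T -> discrete_group G.
Hypothesis cz : continuous z.
Variables a a' b b' : nat -> G -> G.
Hypotheses (aD : forall j x y, a j (x + y) = a j x + a j y)
  (bD : forall j x y, b j (x + y) = b j x + b j y).
Hypotheses (aK : forall j, cancel (a j) (a' j)) (aK' : forall j, cancel (a' j) (a j)).
Hypotheses (bK : forall j, cancel (b j) (b' j)) (bK' : forall j, cancel (b' j) (b j)).
Variables (S1 S2 : nat -> Omega -> T) (lam1 lam2 : probability (borel T) R).
Hypothesis mS1 : forall N, measurable_fun setT (S1 N : Omega -> borel T).
Hypothesis mS2 : forall N, measurable_fun setT (S2 N : Omega -> borel T).
Hypothesis S12 : product_limit P S1 S2 lam1 lam2.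
Hypothesis S1z : forall N w, z (S1 N w) = \sum_(0 <= j < N) a j (z (xi j w)) :> G.
Hypothesis S2z : forall N w, z (S2 N w) = \sum_(0 <= j < N) b j (z (xi j w)) :> G.

Let V (u : G -> R) := forall x y, u (x + y) = u x + u y.
Let fj j (p : G -> R) := coherence P (fun=> 1) (fun w => p (z (xi j w))).
Let F (u : G -> R) := coherence lam1 (fun=> 1) (fun x => u (z x)).
Let K (v : G -> R) := coherence lam2 (fun=> 1) (fun x => v (z x)).
Let E N (u v : G -> R) := \prod_(0 <= j < N) fj j (fun g => u (a j g) + v (b j g)).

Let a'D j x y : a' j (x + y) = a' j x + a' j y.
Proof. by apply: (can_inj (aK j)); rewrite aD !aK'. Qed.

Let b'D j x y : b' j (x + y) = b' j x + b' j y.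
Proof. by apply: (can_inj (bK j)); rewrite bD !bK'. Qed.

Let V0 u : V u -> u 0 = 0.
Proof. by move=> Vu; apply: (addrI (u 0)); rewrite -Vu !addr0. Qed.

Let V_sum u (I : Type) (r : seq I) (f : I -> G) : V u -> u (\sum_(i <- r) f i) = \sum_(i <- r) u (f i).
Proof. by move=> Vu; elim: r => [|i r IH]; rewrite ?big_nil ?V0 // !big_cons Vu IH. Qed.

Let V_zero : V (fun=> 0). Proof. by move=> x y; rewrite addr0. Qed.

Let VD u v : V u -> V v -> V (u + v).
Proof.
move=> Vu Vv x y; rewrite -[LHS]/(u (x + y) + v (x + y)) Vu Vv.
by rewrite -[(u + v) x]/(u x + v x) -[(u + v) y]/(u y + v y); ring.
Qed.

Let mz : measurable_fun setT (z : borel T -> DG) := continuous_borel cz.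

Let mzx j : measurable_fun setT (fun w => z (xi j w) : DG).
Proof. exact: (measurableT_comp mz). Qed.

Let mfz (f : G -> R) : measurable_fun setT (fun x : borel T => f (z x)).
Proof. exact: (discrete_compose f mz). Qed.

Let zc (u : G -> R) : continuous (fun x => u (z x)).
Proof.
move=> x; apply: cvg_near_cst.
have H : nbhs (z x) [set z x] by exact/principal_filterP.
have Hn : nbhs x (z @^-1` [set z x]) := @cz x _ H.
near=> y; have -> : z y = z x by near: y; exact: Hn.
by [].
Unshelve. all: by end_near.
Qed.

Let E_state N u v : E N u v =
  coherence P (fun=> 1) (fun w => \sum_(0 <= j < N) (u (a j (z (xi j w))) + v (b j (z (xi j w))))).
Proof.
have mw (j : nat) : measurable_fun setT (fun _ : borel T => 1 : R) by [].
have mp j : measurable_fun setT (fun x : borel T => u (a j (z x)) + v (b j (z x))).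
  exact: (mfz (fun g => u (a j g) + v (b j g))).
have ww (j : nat) : weight P (fun w => (fun _ : borel T => 1 : R) (xi j w)) by exact: weight_one.
have [_ _] := coherence_prod xi_indep mw mp ww N.
by rewrite (_ : (fun w => \prod_(0 <= j < N) 1) = (fun=> 1)) // funeqE => w; rewrite big1.
Qed.

Let E_lim u v : V u -> V v -> E N u v @[N --> \oo] --> F u * K v.
Proof.
move=> Vu Vv.
have c1 : continuous (fun _ : T => 1 : R) by move=> x; exact: cvg_cst.
have p1 (x : T) : 0 < 1 :> R by [].
have p2 (x : T) : 0 <= 1 :> R by [].
have VC (N : nat) : (\int[P]_w (1 : R)%:E <= (1 : R)%:E)%E.
  by rewrite integral_cst //= probability_setT mule1.
have WV (e : R) : 0 < e -> exists2 B : R, 0 <= B & forall x : T, (1 : R) <= Num.min 1 B + e * 1.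
  by move=> e0; exists 1 => // x; rewrite minxx lerDl mulr1 ltW.
have H := tilted_coherence_limit mS1 mS2 S12 c1 c1 p1 p2 VC WV (@zc u) (@zc v).
apply: cvg_trans H; apply: near_eq_cvg; near=> N.
rewrite E_state; congr coherence; apply/funext => w.
by rewrite S1z S2z !V_sum // big_split.
Unshelve. all: by end_near.
Qed.

Let fj01 j p : 0 <= fj j p <= 1.
Proof.
rewrite coherence_ge0 /=; apply: coherence_le1; first exact: weight_one.
exact: (discrete_compose p (mzx j)).
Qed.

Let E01 N u v : 0 <= E N u v <= 1.
Proof.
rewrite /E; elim/big_ind: _ => [|x y /andP[x0 x1] /andP[y0 y1]|j _]; last exact: fj01.
  by rewrite ler01 lexx.
by rewrite mulr_ge0 // mulr_ile1.
Qed.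

Let E_split N m u v : E (N + m)%N u v = E N u v * coherence P (fun=> 1)
  (fun w => \sum_(0 <= i < m) (u (a (N + i)%N (z (xi (N + i)%N w))) + v (b (N + i)%N (z (xi (N + i)%N w))))).
Proof.
pose p j (x : borel T) := u (a j (z x)) + v (b j (z x)).
have mp j : measurable_fun setT (p j) by exact: (mfz (fun g => u (a j g) + v (b j g))).
pose phi j (q : R * borel T) := q.1 + p j q.2.
have mphi j : measurable_fun setT (phi j).
  by apply: measurable_funD => //; exact: measurableT_comp.
pose U n w := \sum_(0 <= j < n) p j (xi j w).
pose D n w := \sum_(0 <= i < n) p (N + i)%N (xi (N + i)%N w).
have U0 w : U 0%N w = 0 by rewrite /U big_geq.
have US M w : U M.+1 w = phi M (U M w, xi M w) by rewrite /U big_nat_recr.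
have D0 w : D 0%N w = 0 by rewrite /D big_geq.
have DS M w : D M.+1 w = phi (N + M)%N (D M w, xi (N + M)%N w) by rewrite /D big_nat_recr.
have ind : independent2 P (U N) (D m).
  exact: (blocks_independent xi_indep mphi U0 US (phi' := fun j => phi (N + j)%N) (fun j => mphi _) D0 DS m).
have mpx j : measurable_fun setT (fun w => p j (xi j w)) by exact: measurableT_comp.
have mU : measurable_fun setT (U N) by exact: measurable_sum.
have mD : measurable_fun setT (D m) by apply: measurable_sum => i; exact: mpx.
have pairm : measurable_fun setT (fun r : R => (1 : R, r)) by exact: measurable_fun_pair.
have ind' : independent2 P (fun x => (1 : R, U N x)) (fun x => (1 : R, D m x)).
  exact: (independent2_comp pairm pairm ind).
have [_ _ H] := coherenceM (weight_one P) mU (weight_one P) mD ind'.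
rewrite (E_state N) -[RHS]H E_state (_ : (fun x => 1 * 1) = (fun=> 1)); last by apply/funext => x; rewrite mulr1.
congr coherence; apply/funext => w.
by rewrite /U /D (big_cat_nat (n := N)) ?leq_addr //= big_nat_shift.
Qed.

Let mp_sum N m u v : measurable_fun setT
  (fun w => (\sum_(0 <= i < m) (u (a (N + i)%N (z (xi (N + i)%N w))) + v (b (N + i)%N (z (xi (N + i)%N w)))) : R)).
Proof.
by apply: measurable_sum => i; exact: (discrete_compose (fun g => u (a (N + i)%N g) + v (b (N + i)%N g)) (mzx _)).
Qed.

Let E_dec N m u v : E (N + m)%N u v <= E N u v.
Proof.
rewrite E_split ler_piMr //; first by case/andP: (E01 N u v).
by apply: coherence_le1; [exact: weight_one|exact: mp_sum].
Qed.

Let FK_le N u v : V u -> V v -> F u * K v <= E N u v.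
Proof.
move=> Vu Vv; have L := E_lim Vu Vv.
have L' : E (m + N)%N u v @[m --> \oo] --> F u * K v.
  by rewrite (cvg_shiftn N (fun n => E n u v)).
apply: (cvgn_le L') => m; rewrite addnC; exact: E_dec.
Qed.

Let step (c : nat -> G -> G) j (g : G) (t : borel T) : G := g + c j (z t).

Let step_measurable c j : measurable_fun setT ((fun p => step c j p.1 p.2) : DG * borel T -> DG).
Proof.
apply: (discrete_step_measurable (f := step c j) G_countable) => g.
exact: (measurableT_comp (f := (fun x : G => g + c j x) : DG -> DG) (discrete_fun_measurable _) mz).
Qed.

Let partial_measurable (c : nat -> G -> G) (k : nat -> nat) m :
  measurable_fun setT (fun w => \sum_(0 <= i < m) c (k i) (z (xi (k i) w)) : DG).
Proof.
elim: m => [|m IH].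
  rewrite (_ : (fun w => _) = cst (0 : DG)); first exact: measurable_cst.
  by apply/funext => w; rewrite big_geq.
have stp := step_measurable c (k m).
rewrite (_ : (fun w => _) = (fun w => (fun p : DG * borel T => step c (k m) p.1 p.2 : DG)
    ((\sum_(0 <= i < m) c (k i) (z (xi (k i) w)) : DG), (xi (k m) w : borel T)))); last first.
  by apply/funext => w; rewrite big_nat_recr.
by apply: (measurableT_comp stp); exact: measurable_fun_pair.
Qed.

Let tail_of (c : nat -> G -> G) (S : nat -> Omega -> T) (lam : probability (borel T) R) (e : R) :
  (forall N w, z (S N w) = \sum_(0 <= j < N) c j (z (xi j w)) :> G) ->
  (forall f : G -> R, bounded_fun f -> \int[P]_w f (z (S N w)) @[N --> \oo] --> \int[lam]_x f (z x)) ->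
  0 < e -> exists J, forall N m, (J <= N)%N ->
    \int[P]_w ((\sum_(0 <= i < m) c (N + i)%N (z (xi (N + i)%N w)) : G) != 0)%:R <= e.
Proof.
move=> Sz Scv e0.
pose U n w : G := \sum_(0 <= j < n) c j (z (xi j w)).
pose D N n w : G := \sum_(0 <= i < n) c (N + i)%N (z (xi (N + i)%N w)).
have mU N : measurable_fun setT (U N : Omega -> DG) by exact: (partial_measurable c (fun i => i) N).
have mD N m : measurable_fun setT (D N m : Omega -> DG) by exact: (partial_measurable c (fun i => N + i)%N m).
have UD N m w : U (N + m)%N w = U N w + D N m w.
  by rewrite /U /D (big_cat_nat (n := N)) ?leq_addr //= big_nat_shift.
pose phi j (q : DG * borel T) : DG := step c j q.1 q.2.
have mphi j : measurable_fun setT (phi j) by exact: step_measurable.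
have ind N m : independent2 P (U N : Omega -> DG) (D N m : Omega -> DG).
  have U0 w : U 0%N w = 0 by rewrite /U big_geq.
  have US M w : U M.+1 w = phi M (U M w, xi M w) by rewrite /U big_nat_recr.
  have D0 w : D N 0%N w = 0 by rewrite /D big_geq.
  have DS M w : D N M.+1 w = phi (N + M)%N (D N M w, xi (N + M)%N w) by rewrite /D big_nat_recr.
  exact: (blocks_independent (Z := fun n => U n : Omega -> DG) (Z' := fun n => D N n : Omega -> DG)
    xi_indep mphi U0 US (phi' := fun j => phi (N + j)%N) (fun j => mphi _) D0 DS m).
have cv f : bounded_fun f -> \int[P]_w f (U N w) @[N --> \oo] --> \int[lam]_x f (z x).
  move=> bf; apply: cvg_trans (Scv f bf); apply: near_eq_cvg; near=> N.
  by apply: eq_Rintegral => w _; rewrite Sz.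
exact: (uniform_tail (z := z : borel T -> G) G_countable G_torsion_free mU mz mD UD ind cv e0).
Unshelve. all: by end_near.
Qed.

(** [J] serves all [u] and [v]: the tails of both sums vanish in [G] with probability close to 1,
    and all functionals of them with them. *)
Let two_sided (e : R) : 0 < e -> exists J, forall u v, V u -> V v -> (1 - e) * E J u v <= F u * K v.
Proof.
move=> e0; pose e' := Num.min (1 / 4) (e / 8).
have e'0 : 0 < e' by rewrite lt_min !divr_gt0.
have e'4 : e' <= 1 / 4 by rewrite ge_min lexx.
have e'8 : e' <= e / 8 by rewrite ge_min lexx orbT.
have cv1 f : bounded_fun f -> \int[P]_w f (z (S1 N w)) @[N --> \oo] --> \int[lam1]_x f (z x).
  by move=> [M fM]; apply: (product_limit_right (product_limit_sym S12) (@zc f)); exists M => x.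
have cv2 f : bounded_fun f -> \int[P]_w f (z (S2 N w)) @[N --> \oo] --> \int[lam2]_x f (z x).
  by move=> [M fM]; apply: (product_limit_right S12 (@zc f)); exists M => x.
have [J1 h1] := tail_of S1z cv1 e'0; have [J2 h2] := tail_of S2z cv2 e'0.
exists (maxn J1 J2) => u v Vu Vv; set J := maxn J1 J2.
have L' : E (m + J)%N u v @[m --> \oo] --> F u * K v.
  by rewrite (cvg_shiftn J (fun n => E n u v)); exact: E_lim.
apply: (cvgn_ge L') => m; rewrite addnC E_split mulrC ler_wpM2l //; first by case/andP: (E01 J u v).
apply: (@le_trans _ _ (1 - 8 * e')); first by lra.
apply: (tail_coherence (D1 := fun w => \sum_(0 <= i < m) a (J + i)%N (z (xi (J + i)%N w)))
  (D2 := fun w => \sum_(0 <= i < m) b (J + i)%N (z (xi (J + i)%N w)))).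
- exact: mp_sum.
- exact: (partial_measurable a (fun i => J + i)%N m).
- exact: (partial_measurable b (fun i => J + i)%N m).
- by move=> w d1 d2; rewrite big_split /= -!V_sum // d1 d2 !V0 // addr0.
- exact: ltW.
- exact: e'4.
- by apply: h1; rewrite /J leq_maxl.
- by apply: h2; rewrite /J leq_maxr.
Qed.

Let F0 : F (fun=> 0) = 1. Proof. by apply: coherence_cst; exact: weight_one. Qed.
Let K0 : K (fun=> 0) = 1. Proof. by apply: coherence_cst; exact: weight_one. Qed.

Let KD u v : 7 / 8 <= K u -> 7 / 8 <= K v -> 1 / 2 <= K (u + v).
Proof.
move=> hu hv.
have := incoherenceD (weight_one lam2) (mfz u) (mfz v).
by rewrite -/(K u) -/(K v) -[coherence _ _ _]/(K (u + v)); lra.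
Qed.

(* Elimination: K is bounded below at v as soon as it is at the J preceding
   points of an arithmetic progression whose step is small enough for F and K
   to be close to 1 along the shifts involved. *)
Let K_step J (k v : G -> R) (r : R) : V k -> V v -> 0 <= r <= 1 ->
  (forall u v, V u -> V v -> (1 / 2) * E J u v <= F u * K v) ->
  (forall l u, (l <= J)%N -> subset_sum [seq (fun g => - k (b j (a' j g))) | j <- iota 0 J] l u -> 1 / 2 <= F u) ->
  (forall l, (0 < l <= J)%N -> r <= K (v + k *+ l)) ->
  1 / 2 * (r / 2) ^+ (2 ^ J) <= K v.
Proof.
move=> Vk Vv /andP[r0 r1] EFK Fs Kr.
pose W : zmodType := ((G -> R) * (G -> R))%type.
pose e j (w : W) := fj j (fun g => w.1 (a j g) + w.2 (b j g)).
pose dd j : W := ((fun g => - k (b j (a' j g))), k).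
have eper j (w : W) : e j (w + dd j) = e j w.
  rewrite /e; congr (fj j); apply/funext => g.
  rewrite -[(w + dd j).1 (a j g)]/(w.1 (a j g) - k (b j (a' j (a j g)))) aK.
  by rewrite -[(w + dd j).2 (b j g)]/(w.2 (b j g) + k (b j g)); ring.
have e01 j (w : W) : 0 <= e j w <= 1 by exact: fj01.
have a01 : 0 <= r / 2 <= 1 by apply/andP; split; lra.
have stepH l (u : W) : subset_sum [seq dd j | j <- iota 0 J] l.+1 u ->
    r / 2 <= \prod_(0 <= j < J) e j ((fun=> 0, v) + u).
  move=> su.
  have proj (s : seq nat) l' (u' : W) : subset_sum [seq dd j | j <- s] l' u' ->
      [/\ (l' <= size s)%N, V u'.1, u'.2 = k *+ l' &
        subset_sum [seq (fun g => - k (b j (a' j g))) | j <- s] l' u'.1].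
    elim: s l' u' => [|j s IH] l' u' /=; first by move=> [-> ->]; split => // x y; rewrite addr0.
    move=> [/IH [h1 h2 h3 h4]|[l1 [u1 [-> -> /IH [h1 h2 h3 h4]]]]].
      by split => //; [exact: leqW|left].
    split => //; last by right; exists l1, u1.1.
      apply: VD => // x y.
      by rewrite -[LHS]/(- k (b j (a' j (x + y)))) a'D bD Vk opprD.
    by rewrite mulrS -h3.
  have [lJ Vu u2 su1] := proj _ _ _ su; rewrite size_iota in lJ.
  have V2 : V (v + k *+ l.+1).
    have Vn i : V (k *+ i) by elim: i => [|i IH]; [rewrite mulr0n; exact: V_zero|rewrite mulrS; exact: VD].
    exact: VD.
  have -> : (fun=> 0, v) + u = (u.1, v + k *+ l.+1) :> W.
    by rewrite [LHS]surjective_pairing /= u2; congr (_, _); apply/funext => g; rewrite -[LHS]/(0 + u.1 g) add0r.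
  apply: le_trans (FK_le J Vu V2).
  have h1 := Fs _ _ lJ su1; have h2 := Kr l.+1 lJ.
  by rewrite (_ : r / 2 = 1 / 2 * r); [apply: ler_pM => //; lra|rewrite mul1r mulrC].
have H := prod_lower_bound e01 eper a01 stepH.
have := EFK (fun=> 0) v V_zero Vv; rewrite F0 (mul1r (K v)) => EK; apply: le_trans EK.
rewrite ler_pM2l; last by lra.
apply: (le_trans H); rewrite le_eqVlt; apply/orP; left; apply/eqP.
by apply: eq_bigr => j _; rewrite /e /=.
Qed.

(** Divided by a large [m], the functional [w] moves so slowly that [J] steps keep its values small
    on the finite sets [E1] and, after transport by [b j] and the inverse of [a j], [E2]. *)
Let net_point (w : G -> R) J (E1 E2 : seq G) : V w -> exists2 m : nat, (0 < m)%N &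
  (forall l g, (l <= J)%N -> g \in E1 -> `|l%:R * (w g / m%:R)| <= 1 / 4) /\
  (forall (l : nat) (u : G -> R), (l <= J)%N ->
    subset_sum [seq (fun g => - (fun g => - (w g / m%:R)) (b j (a' j g))) | j <- iota 0 J] l u ->
    forall g, g \in E2 -> `|u g| <= 1 / 4).
Proof.
move=> Vw.
pose c : R := \sum_(g <- E1) `|w g| + \sum_(g <- E2) \sum_(j <- iota 0 J) `|w (b j (a' j g))|.
have c1 g : g \in E1 -> `|w g| <= c.
  move=> gE; rewrite /c (big_rem g) //= -addrA lerDl addr_ge0 //; first exact: sumr_ge0.
  by apply: sumr_ge0 => h _; exact: sumr_ge0.
have c2 g j : g \in E2 -> j \in iota 0 J -> `|w (b j (a' j g))| <= c.
  move=> gE jJ; apply: (@le_trans _ _ (\sum_(j <- iota 0 J) `|w (b j (a' j g))|)).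
    by rewrite (big_rem j jJ) /= lerDl sumr_ge0.
  apply: (@le_trans _ _ (\sum_(g <- E2) \sum_(j <- iota 0 J) `|w (b j (a' j g))|)).
    by rewrite (big_rem g gE) /= lerDl; apply: sumr_ge0 => h _; exact: sumr_ge0.
  by rewrite /c lerDr sumr_ge0.
have c0 : 0 <= c.
  by rewrite addr_ge0 //; [exact: sumr_ge0|apply: sumr_ge0 => h _; exact: sumr_ge0].
pose m := (Num.bound (4 * (J%:R * c))).+1; have m0 : 0 < m%:R :> R by rewrite ltr0n.
have Jc : J%:R * (c / m%:R) <= 1 / 4.
  have h0 : 0 <= 4 * (J%:R * c) by rewrite !mulr_ge0.
  have h1 : 4 * (J%:R * c) <= m%:R by apply: (le_trans (ltW (archi_boundP h0))); rewrite ler_nat.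
  by rewrite mulrA ler_pdivrMr //; lra.
have small l (x : R) : (l <= J)%N -> `|x| <= l%:R * (c / m%:R) -> `|x| <= 1 / 4.
  move=> lJ xl; apply: (le_trans xl); apply: le_trans Jc.
  by rewrite ler_wpM2r ?ler_nat // divr_ge0 // ltW.
exists m => //; split=> [l g lJ gE|l u lJ su g gE].
  apply: (small l) => //; rewrite normrM normr_nat ler_wpM2l // normrM normfV [`|m%:R|]gtr0_norm //.
  by rewrite ler_pM2r ?invr_gt0 // c1.
apply: (small l) => //.
have := @subset_sum_ind _ _ (fun l (u : G -> R) => `|u g| <= l%:R * (c / m%:R)) _ _ _ _ su.
case=> //; first by rewrite -[(0 : G -> R) g]/(0 : R) normr0 mul0r.
move=> h i u' /mapP[j jJ ->] hu.
rewrite -[X in `|X|]/(- (- (w (b j (a' j g)) / m%:R)) + u' g) opprK.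
apply: (le_trans (ler_normD _ _)); rewrite -natr1 mulrDl mul1r addrC; apply: lerD => //.
by rewrite normrM normfV [`|m%:R|]gtr0_norm // ler_pM2r ?invr_gt0 // c2.
Qed.

(** Each [v] is close, on a finite set and modulo 2 pi, to one of finitely many [w], so that
    [K (v - w)] is near 1. From there [v] is reached along [w / m], each point being bounded below
    through the [J] preceding ones. The number [m] of steps depends on [w] only, hence is bounded by
    [B] over the net. *)
Lemma right_coherence_bounded_below : exists2 rho : R, 0 < rho & forall v, V v -> rho <= K v.
Proof.
have h64 : 0 < 1 / 64 :> R by lra.
have h2 : 0 < 1 / 2 :> R by lra.
have h32 : 0 < 1 / 32 :> R by lra.
have h31 : 31 / 32 <= 1 - 1 / 32 :> R by lra.
have h78 : 1 / 2 <= 7 / 8 :> R by lra.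
have [J HJ0] := two_sided h2.
have HJ u v : V u -> V v -> (1 / 2) * E J u v <= F u * K v.
  by move=> Vu Vv; have := HJ0 u v Vu Vv; rewrite (_ : 1 - 1 / 2 = 1 / 2 :> R) //; lra.
have [E1 _ hE1] := finite_mass lam2 G_countable mz h64.
have [E2 _ hE2] := finite_mass lam1 G_countable mz h64.
have [M [ws [Vws net]]] := cos_net E1 V_zero h32.
have pick i := net_point J E1 E2 (Vws i).
pose mm i := projT1 (cid2 (pick i)).
have mmP i : (0 < mm i)%N /\ _ := conj (projT2 (cid2 (pick i))).1 (projT2 (cid2 (pick i))).2.
pose r := fix r n : R := if n is n'.+1 then 1 / 2 * (r n' / 2) ^+ (2 ^ J) else 1 / 2.
have [r01 rdec] := halved_powers (r := r) erefl (fun=> erefl).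
pose B := \sum_(0 <= i < M) mm i.
exists (r B) => [|v Vv]; first by case/andP: (r01 B).
have [i iM close] := net v Vv; set w := ws i in close.
have [m0 [near1 near2]] : (0 < mm i)%N /\ _ := mmP i.
set m := mm i in m0 near1 near2; have Vw : V w := Vws i.
have mB : (m <= B)%N by rewrite /B (bigD1_seq i) ?iota_uniq ?mem_index_iota //= leq_addr.
have mR : m%:R != 0 :> R by rewrite pnatr_eq0 -lt0n.
apply: (@le_trans _ _ (r m)); first by rewrite -(subnKC mB).
(* Minus the step, as [K_step] bounds a point by those obtained from it by adding [k]. *)
pose k : G -> R := fun g => - (w g / m%:R).
have Vk : V k by move=> x y; rewrite /k Vw; ring.
(* The points with [n <= J] lie close to [v - w] and start the induction; the point of index [J + m]
   is [v]. *)
pose y (n : nat) : G -> R := fun g => v g - w g + (n%:R - J%:R) * (w g / m%:R).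
have Vy n : V (y n) by move=> g h; rewrite /y Vv Vw; ring.
have K1 : 7 / 8 <= K (fun g => v g - w g).
  apply: (near_one_coherence (E := E1)) => // g gE; exact: le_trans h31 (close g gE).
have base n : (n <= J)%N -> 1 / 2 <= K (y n).
  move=> nJ; apply: (KD (v := fun g => (n%:R - J%:R) * (w g / m%:R)) K1).
  apply: (near_one_coherence (E := E1)) => // g gE; apply: cos_small.
  rewrite -opprB mulNr normrN -natrB //; apply: near1 => //; exact: leq_subr.
have main n : forall i', (i' <= J + n)%N -> r n <= K (y i').
  elim: n => [|n IH] i'; first by rewrite addn0; exact: base.
  rewrite addnS leq_eqVlt => /orP[/eqP ->|]; last first.
    rewrite ltnS => /IH; apply: le_trans; rewrite -[n.+1]addn1; exact: rdec.
  have /andP[r0 r1] := r01 n.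
  apply: (K_step Vk (Vy _) (r := r n)) => //.
  - by rewrite (ltW r0) /=; apply: (le_trans r1); rewrite ler_pdivrMr // mul1r ler1n.
  - move=> l u lJ su; apply: (le_trans h78).
    apply: (near_one_coherence (E := E2)) => // g gE; apply: cos_small.
    exact: near2 su _ gE.
  - move=> l /andP[l0 lJ].
    have -> : y (J + n).+1 + k *+ l = y ((J + n).+1 - l)%N.
      have kn g : (k *+ l) g = l%:R * k g.
        have knl i0 : (k *+ i0) g = i0%:R * k g.
          elim: i0 => [|i0 IHi]; first by rewrite mul0r.
          by rewrite mulrS -[LHS]/(k g + (k *+ i0) g) IHi -natr1; ring.
        exact: knl.
      apply/funext => g; rewrite -[LHS]/(y (J + n).+1 g + (k *+ l) g) kn /y /k.
      rewrite natrB; first by ring.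
      by apply: (leq_trans lJ); rewrite -addnS leq_addr.
    by apply: IH; rewrite leq_subLR -add1n leq_add2r.
have -> : v = y (J + m)%N.
  apply/funext => g; rewrite /y natrD (_ : J%:R + m%:R - J%:R = m%:R); last by ring.
  by rewrite [m%:R * _]mulrC divfK // subrK.
exact: main.
Qed.

(** Up to a small error, [ln (F u)] is, for every [v], the sum over [j < J] of the increments of
    [g j] from [v] to [v + ws j]. The lower bound on [K] makes the [g j] bounded, so that
    [telescoping_average] applies. *)
Lemma left_coherence_eq1 (u : G -> R) : V u -> F u = 1.
Proof.
move=> Vu; have [rho rho0 Krho] := right_coherence_bounded_below.
have fjK j v : V v -> K v <= fj j (fun g => v (b j g)).
  move=> Vv; have := FK_le j.+1 V_zero Vv; rewrite F0 mul1r /E big_nat_recr //= => /le_trans; apply.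
  have /andP[e0 e1] := E01 j (fun=> 0) v.
  rewrite (_ : (fun g => 0 + v (b j g)) = (fun g => v (b j g))); last by apply/funext => g; rewrite add0r.
  by rewrite ler_piMl //; case/andP: (fj01 j (fun g => v (b j g))).
have fjpos j v : V v -> 0 < fj j (fun g => v (b j g)).
  by move=> Vv; apply: lt_le_trans (fjK j v Vv); exact: lt_le_trans rho0 (Krho v Vv).
pose g j v := ln (fj j (fun x => v (b j x))).
have gb j v : V v -> `|g j v| <= - ln rho.
  move=> Vv; rewrite /g ler0_norm; last by apply: ln_le0; case/andP: (fj01 j (fun x => v (b j x))).
  by rewrite lerN2 ler_ln ?posrE ?fjpos //; exact: le_trans (Krho v Vv) (fjK j v Vv).
(* Seen through [b j], adding [u] composed with [a j] amounts to shifting [v] by [ws j]. *)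
pose ws j : G -> R := fun x => u (a j (b' j x)).
have Vws j : V (ws j) by move=> x y; rewrite /ws b'D aD Vu.
have EE J v : V v -> E J u v = \prod_(0 <= j < J) fj j (fun x => (v + ws j) (b j x)).
  move=> Vv; apply: eq_bigr => j _; congr (fj j); apply/funext => x.
  by rewrite -[RHS]/(v (b j x) + ws j (b j x)) /ws bK addrC.
have EE0 J v : E J (fun=> 0) v = \prod_(0 <= j < J) fj j (fun x => v (b j x)).
  by apply: eq_bigr => j _; congr (fj j); apply/funext => x; rewrite add0r.
have lnprod J (h : nat -> R) : (forall j, 0 < h j) ->
    0 < \prod_(0 <= j < J) h j /\ ln (\prod_(0 <= j < J) h j) = \sum_(0 <= j < J) ln (h j).
  move=> h0; elim: J => [|J [p IH]]; first by rewrite !big_geq // ln1.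
  by rewrite !big_nat_recr //= lnM ?posrE // IH mulr_gt0.
have Fpos : 0 < F u.
  have h2 : 0 < 1 / 2 :> R by lra.
  have [J HJ] := two_sided h2; have := HJ u _ Vu V_zero.
  have [p _] := lnprod J (fun j => fj j (fun x => ((fun=> 0) + ws j) (b j x))) (fun j => fjpos j _ (VD V_zero (Vws j))).
  rewrite EE // K0 mulr1; apply: lt_le_trans; rewrite mulr_gt0 //; lra.
have ln_le (x y : R) : 0 < x -> x <= y -> ln x <= ln y.
  by move=> x0 xy; rewrite ler_ln ?posrE // (lt_le_trans x0 xy).
have lnD (x y : R) : 0 < x -> 0 < y -> ln (x * y) = ln x + ln y by move=> x0 y0; rewrite lnM ?posrE.
have close (e : R) : 0 < e <= 1 / 2 -> `|ln (F u)| <= 4 * e.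
  move=> /andP[e0 e2]; have [J HJ] := two_sided e0.
  have lne : - ln (1 - e) <= 2 * e.
    have p1 : 0 < 1 - e by lra.
    have := le_ln1Dx (x := (1 - e)^-1 - 1).
    rewrite (_ : 1 + ((1 - e)^-1 - 1) = (1 - e)^-1); last by lra.
    rewrite lnV ?posrE // => h; apply: (le_trans (h _)).
      by rewrite ltrBrDl subrr invr_gt0.
    rewrite lerBlDr -div1r ler_pdivrMr //.
    have : e * e <= e * (1 / 2) by rewrite ler_pM2l.
    lra.
  apply: (telescoping_average (V := V) (J := J) (g := g) (ws := ws) (b := - ln rho)) => //.
  - by move=> v j Vv; exact: VD.
  - move=> v Vv.
    have Kp : 0 < K v by exact: lt_le_trans rho0 (Krho v Vv).
    have [p1 l1] := lnprod J (fun j => fj j (fun x => (v + ws j) (b j x))) (fun j => fjpos j _ (VD Vv (Vws j))).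
    have [p0 l0] := lnprod J (fun j => fj j (fun x => v (b j x))) (fun j => fjpos j v Vv).
    rewrite -EE // in p1 l1; rewrite -EE0 in p0 l0.
    have pe : 0 < 1 - e by lra.
    have b1 : ln (F u) + ln (K v) <= ln (E J u v).
      have h : F u * K v <= E J u v := FK_le J Vu Vv.
      by rewrite -lnD //; apply: ln_le => //; exact: mulr_gt0.
    have b2 : ln (1 - e) + ln (E J u v) <= ln (F u) + ln (K v).
      have h : (1 - e) * E J u v <= F u * K v := HJ u v Vu Vv.
      by rewrite -!lnD //; apply: ln_le => //; exact: mulr_gt0.
    have b3 : ln (K v) <= ln (E J (fun=> 0) v).
      by rewrite ler_ln ?posrE //; have := FK_le J V_zero Vv; rewrite F0 mul1r.
    have b4 : ln (1 - e) + ln (E J (fun=> 0) v) <= ln (K v).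
      have h : (1 - e) * E J (fun=> 0) v <= K v by have := HJ _ _ V_zero Vv; rewrite F0 mul1r.
      by rewrite -lnD //; apply: ln_le => //; exact: mulr_gt0.
    rewrite sumrB -l1 -l0 ler_norml; apply/andP; split; [exact: (increment_bounds b1 b2 b3 b4 lne).1|exact: (increment_bounds b1 b2 b3 b4 lne).2].
have ln0 : ln (F u) = 0.
  apply/eqP; rewrite -normr_le0; apply/ler_addgt0Pr => e e0; rewrite add0r.
  pose e' := Num.min (1 / 2) (e / 4).
  have h : 0 < e' <= 1 / 2 by rewrite lt_min !divr_gt0 //= ge_min lexx.
  apply: (le_trans (close e' h)); rewrite mulrC -ler_pdivlMr //.
  by rewrite ge_min lexx orbT.
by rewrite -[LHS]lnK ?posrE // ln0 expR0.
Qed.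

(** With [u] the transport of [v] by the inverse of [a j], the factor of index [j] is the coherence
    of [v]; the other factors are at most 1 and [F u = 1], so it is 1. *)
Theorem group_components_constant j : exists g, \int[P]_w ((z (xi j w) : G) != g)%:R = 0 :> R.
Proof.
apply: (coherent_constant (z := fun w => z (xi j w))) => // v Vv.
pose u x := v (a' j x); have Vu : V u by move=> x y; rewrite /u a'D Vv.
have := FK_le j.+1 Vu V_zero; rewrite left_coherence_eq1 // K0 mul1r /E big_nat_recr //=.
rewrite (_ : (fun g => u (a j g) + 0) = v); last by apply/funext => g; rewrite /u aK addr0.
have /andP[e0 e1] := E01 j u (fun=> 0).
have /andP[f0 f1] := fj01 j v.
move=> h; apply/eqP; rewrite eq_le f1 /=; apply: (le_trans h).
by rewrite ler_piMl.
Qed.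

End GroupForms.

(** * Topological automorphisms *)

(** Vanishing on the integers, [g] is bounded on the whole line by its values on [0, 1], and a
    bounded additive function is 0. *)
Lemma additive_bounded_zero {R : realType} (g : R -> R) (d B : R) :
  (forall x y, g (x + y) = g x + g y) -> g 1 = 0 -> 0 < d ->
  (forall c, `|c| <= d -> `|g c| <= B) -> forall c, g c = 0.
Proof.
move=> gD g1 d0 gB.
have g0 : g 0 = 0 by apply: (addrI (g 0)); rewrite -gD !addr0.
have gN x : g (- x) = - g x by apply/eqP; rewrite -addr_eq0 -gD addNr g0.
have gMn x k : g (x *+ k) = g x *+ k.
  by elim: k => [|k IH]; rewrite ?mulr0n // !mulrS gD IH.
have gz (z : int) : g z%:~R = 0.
  case: z => k; first by rewrite -pmulrn gMn g1 mul0rn.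
  by rewrite NegzE mulrNz gN -pmulrn gMn g1 mul0rn oppr0.
have B0 : 0 <= B by apply: le_trans (gB 0 _); rewrite ?normr_ge0 // normr0 ltW.
pose k := (Num.bound (d^-1)).+1; have k0 : 0 < k%:R :> R by rewrite ltr0n.
have kd : k%:R^-1 <= d.
  rewrite -[d]invrK lef_pV2 ?posrE ?invr_gt0 //.
  have di : 0 <= d^-1 by rewrite invr_ge0 ltW.
  by apply: (le_trans (ltW (archi_boundP di))); rewrite ler_nat.
have unit c : 0 <= c <= 1 -> `|g c| <= k%:R * B.
  move=> /andP[c0 c1].
  have -> : c = (c / k%:R) *+ k by rewrite -mulr_natr divfK ?gt_eqF.
  rewrite gMn normrMn -[`|g _| *+ k]mulr_natl ler_pM2l //; apply: gB.
  rewrite ger0_norm; last by rewrite divr_ge0 // ltW.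
  rewrite ler_pdivrMr //.
  by apply: (le_trans c1); rewrite -ler_pdivrMr // mul1r.
move=> c; have key m : m%:R * `|g c| <= k%:R * B.
  rewrite mulr_natl -normrMn -gMn.
  have /andP[f1 f2] := floor_itv (c *+ m).
  rewrite -(subrK (Num.floor (c *+ m))%:~R (c *+ m)) gD gz addr0; apply: unit.
  by rewrite subr_ge0 f1 /= lerBlDr addrC -[X in _ + X]/(1%:~R) -intrD ltW.
apply/eqP; rewrite -normr_eq0; apply: contraT => gc.
have gc0 : 0 < `|g c| by rewrite lt_neqAle eq_sym gc normr_ge0.
have kB : 0 <= k%:R * B / `|g c| by rewrite divr_ge0 // mulr_ge0.
have lt := archi_boundP kB; rewrite ltr_pdivrMr // in lt.
by have := le_lt_trans (key (Num.bound (k%:R * B / `|g c|))) lt; rewrite ltxx.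
Qed.

Section Endomorphisms.
Context {R : realType} {n : nat} {G : zmodType}.
Local Notation X := (RnG R n G).
Variable a : X -> X.
Hypothesis aD : {morph a : x y / x + y}.
Hypothesis ca : continuous a.

Let a0 : a 0 = 0.
Proof. by apply: (addrI (a 0)); rewrite -aD !addr0. Qed.

Let aMn x k : a (x *+ k) = a x *+ k.
Proof. by elim: k => [|k IH]; rewrite ?mulr0n // !mulrS aD IH. Qed.

Let fstMn (x : X) k : (x *+ k).1 = x.1 *+ k.
Proof. by elim: k => [|k IH]; rewrite ?mulr0n // !mulrS /= IH. Qed.

Let sndMn (x : X) k : (x *+ k).2 = x.2 *+ k.
Proof. by elim: k => [|k IH]; rewrite ?mulr0n // !mulrS /= IH. Qed.

Let nbhs0_box (S : set X) : nbhs (0 : X) S -> exists2 e : R, 0 < e & forall x : 'cV[R]_n, box e x -> S (x, 0).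
Proof.
move=> [[A B] /= [nA nB] sub].
have /nbhs_ballP [e /= e0 eA] := nA.
exists (e / 2) => [|x xe]; first by rewrite divr_gt0.
apply: sub; split=> /=; last exact: nbhs_singleton nB.
apply: eA; split=> // i j; rewrite /ball /= ord1 !mxE sub0r normrN.
by apply: (le_lt_trans (xe i)); lra.
Qed.

Let near0 (S : set X) : nbhs (0 : X) S -> exists2 e : R, 0 < e & forall x : 'cV[R]_n, box e x -> S (a (x, 0)).
Proof.
move=> nS; have nS' : nbhs (0 : X) (a @^-1` S) by apply: ca; rewrite a0.
by have [e e0 he] := nbhs0_box nS'; exists e.
Qed.

Let box_shrink (x : 'cV[R]_n) (e : R) : 0 < e -> exists k : nat, (0 < k)%N /\ box e (k%:R^-1 *: x).
Proof.
move=> e0; have [d d0 hd] := boxZ_small x e0.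
pose k := (Num.bound (d^-1)).+1; have k0 : 0 < k%:R :> R by rewrite ltr0n.
exists k; split => //; apply: hd; rewrite gtr0_norm ?invr_gt0 //.
rewrite -[d]invrK lef_pV2 ?posrE ?invr_gt0 //.
have di : 0 <= d^-1 by rewrite invr_ge0 ltW.
by apply: (le_trans (ltW (archi_boundP di))); rewrite ler_nat.
Qed.

(** Near 0 the discrete component vanishes by continuity, and every [x] is a multiple of some
    [x / k] near 0. *)
Lemma endo_snd0 (x : 'cV[R]_n) : (a (x, 0)).2 = 0.
Proof.
have n0 : nbhs (0 : X) [set y : X | y.2 = 0].
  exists (setT, [set (0 : discrete_group G)]) => /=; last by move=> [y1 y2] [_ /= ->].
  by split; [exact: filterT|exact/principal_filterP].
have [e e0 he] := near0 n0; have [k [k0 hk]] := box_shrink x e0.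
have kR : k%:R != 0 :> R by rewrite pnatr_eq0 -lt0n.
have -> : (x, 0) = ((k%:R^-1 *: x, 0) : X) *+ k.
  apply: (@eq_trans _ _ ((k%:R^-1 *: x) *+ k, (0 : discrete_group G) *+ k)).
    by rewrite mul0rn -scaler_nat scalerA divff // scale1r.
  by rewrite [RHS]surjective_pairing fstMn sndMn.
by rewrite aMn sndMn he ?mul0rn.
Qed.

Let fstD (x y : 'cV[R]_n) : (a (x + y, 0)).1 = (a (x, 0)).1 + (a (y, 0)).1.
Proof.
have -> : (x + y, 0) = (x, 0) + (y, 0) :> X by rewrite /GRing.add /= /add_pair /= addr0.
by rewrite aD.
Qed.

(** The defect of homogeneity is additive in [c], vanishes at 1 and is bounded near 0 by
    continuity. *)
Let fstZ (c : R) (x : 'cV[R]_n) : (a (c *: x, 0)).1 = c *: (a (x, 0)).1.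
Proof.
apply/matrixP => i j; rewrite ord1 mxE.
pose g (c : R) := (a (c *: x, 0)).1 i 0 - c * (a (x, 0)).1 i 0.
suff : g c = 0 by rewrite /g => /eqP; rewrite subr_eq0 => /eqP.
have n1 : nbhs (0 : X) [set y : X | box 1 y.1].
  exists ([set v : 'cV[R]_n | box 1 v], setT) => /=; last by move=> [y1 y2] [? _].
  split; last exact: filterT.
  apply/nbhs_ballP; exists 1 => //= v [_ bv] k; have := bv k 0.
  by rewrite /ball /= mxE sub0r normrN => /ltW.
have [e e0 he] := near0 n1; have [d d0 hd] := boxZ_small x e0.
apply: (@additive_bounded_zero _ g d (1 + d * `|(a (x, 0)).1 i 0|)) => //.
- by move=> c1 c2; rewrite /g scalerDl fstD mxE mulrDl opprD addrACA.
- by rewrite /g scale1r mul1r subrr.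
- move=> c' c'd; rewrite /g; apply: (le_trans (ler_normB _ _)); apply: lerD.
    by have := he _ (hd _ c'd); apply.
  by rewrite normrM ler_wpM2r.
Qed.

Lemma endo_fst0 (x : 'cV[R]_n) : (a (x, 0)).1 = restr_mx a *m x.
Proof.
have fs (r : seq 'I_n) (F : 'I_n -> 'cV[R]_n) :
    (a (\sum_(i <- r) F i, 0)).1 = \sum_(i <- r) (a (F i, 0)).1.
  by elim: r => [|i r IH]; [rewrite !big_nil a0|rewrite !big_cons fstD IH].
rewrite {1}(matrix_sum_delta x).
under eq_bigr do rewrite big_ord1.
rewrite fs; apply/matrixP => i j; rewrite ord1 summxE mxE.
by apply: eq_bigr => k _; rewrite (ord1 j) fstZ !mxE mulrC.
Qed.

(** Block triangular form: the component in [G] may contribute to the one in R^n, but not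
    conversely. *)
Lemma endoE x g : a (x, g) = (restr_mx a *m x + (a (0, g)).1, (a (0, g)).2).
Proof.
have -> : (x, g) = (x, 0) + (0, g) :> X by rewrite /GRing.add /= /add_pair /= addr0 add0r.
by rewrite aD [LHS]surjective_pairing /= endo_fst0 endo_snd0 add0r.
Qed.

Lemma endo_sndD g g' : (a (0, g + g')).2 = (a (0, g)).2 + (a (0, g')).2.
Proof.
have -> : (0, g + g') = (0, g) + (0, g') :> X by rewrite /GRing.add /= /add_pair /= addr0.
by rewrite aD.
Qed.

End Endomorphisms.

Section Automorphisms.
Context {R : realType} {n : nat} {G : zmodType}.
Local Notation X := (RnG R n G).

Lemma automorphism_parts (a : X -> X) : top_automorphism a ->
  restr_mx a \in unitmx /\ exists k' : G -> G, [/\ forall g, k' (a (0, g)).2 = g,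
    forall g, (a (0, k' g)).2 = g & {morph k' : g g' / g + g'}].
Proof.
move=> [aD ca [b [ab ba cb]]].
have bD : {morph b : x y / x + y} by move=> x y; apply: (can_inj ab); rewrite aD !ba.
have E (x : 'cV[R]_n) : restr_mx b *m (restr_mx a *m x) = x.
  rewrite -(endo_fst0 bD cb) -(endo_fst0 aD ca).
  by rewrite -{2}(endo_snd0 aD ca x) -surjective_pairing ab.
have E1 : restr_mx b *m restr_mx a = 1%:M.
  apply/matrixP => i j; have := congr1 (fun M : 'cV[R]_n => M i 0) (E (delta_mx j 0)).
  by rewrite mulmxA -colE !mxE eqxx andbT.
split; first by have [_] := mulmx1_unit E1.
exists (fun g => (b (0, g)).2); split=> [g|g|g g'].
- have := congr1 snd (ab (0, g)); rewrite [a (0, g)]surjective_pairing (endoE bD cb).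
  by [].
- have := congr1 snd (ba (0, g)); rewrite [b (0, g)]surjective_pairing (endoE aD ca).
  by [].
- exact: (endo_sndD bD).
Qed.

End Automorphisms.

Lemma continuous_sum_norm {R : realType} {T : topologicalType} (I : Type) (r : seq I) (g : I -> T -> R) :
  (forall i, continuous (g i)) -> continuous (fun x => \sum_(i <- r) `|g i x|).
Proof.
move=> cg; elim: r => [|i r IH] x.
  rewrite (_ : (fun x => _) = (fun=> 0)); first exact: cvg_cst.
  by apply/funext => z; rewrite big_nil.
rewrite (_ : (fun x => _) = (fun x => `|g i x| + \sum_(i <- r) `|g i x|)).
  by apply: cvgD; [apply: cvg_norm; exact: cg|exact: IH].
by apply/funext => z; rewrite big_cons.
Qed.

Lemma continuous_inv_gap {R : realType} {T : topologicalType} (f s : T -> R) :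
  continuous f -> continuous s -> (forall x, 0 < f x + `|1 - s x|) ->
  continuous (fun x => (f x + `|1 - s x|)^-1).
Proof.
move=> cf cs h0 x; apply: cvgV; first by rewrite gt_eqF.
by apply: cvgD; [exact: cf|apply: cvg_norm; apply: cvgB; [exact: cvg_cst|exact: cs]].
Qed.

(** Compactness is used on the whole cube rather than on a unit sphere: [f v + |1 - s v|] is
    positive everywhere, so its inverse is bounded there, and it equals [f v] where the l1 norm
    [s v] is 1. *)
Lemma norm_dominates_entries {R : realType} (p : nat) (f : 'rV[R]_p.+1 -> R) :
  (forall u v : 'rV[R]_p.+1, f (u + v) <= f u + f v) ->
  (forall (c : R) (v : 'rV[R]_p.+1), f (c *: v) = `|c| * f v) ->
  (forall v : 'rV[R]_p.+1, f v = 0 -> v = 0) -> exists c : R, forall (v : 'rV[R]_p.+1) i, `|v 0 i| <= c * f v.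
Proof.
move=> fD fZ f0.
have fz : f 0 = 0 by rewrite -(scale0r 0) fZ normr0 mul0r.
have fN v : f (- v) = f v by rewrite -scaleN1r fZ normrN1 mul1r.
have fge0 v : 0 <= f v by have := fD v (- v); rewrite subrr fz fN; lra.
have fsum (I : Type) (r : seq I) (F : I -> 'rV[R]_p.+1) : f (\sum_(i <- r) F i) <= \sum_(i <- r) f (F i).
  elim: r => [|i r IH]; first by rewrite !big_nil fz.
  by rewrite !big_cons; apply: (le_trans (fD _ _)); rewrite lerD2l.
pose s (v : 'rV[R]_p.+1) := \sum_i `|v 0 i|.
pose L := \sum_(i < p.+1) f (delta_mx 0 i).
have L0 : 0 <= L by apply: sumr_ge0 => i _.
have fs (v : 'rV[R]_p.+1) (e : R) : (forall i, `|v 0 i| <= e) -> f v <= e * L.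
  move=> ve; rewrite {1}(row_sum_delta v); apply: (le_trans (fsum _ _ _)).
  by rewrite /L mulr_sumr; apply: ler_sum => i _; rewrite fZ ler_wpM2r.
have cf : continuous f.
  move=> v S /nbhs_ballP [e /= e0 eS]; change (nbhs v (f @^-1` S)).
  pose dl := e / 2 / (L + 1); have L1 : 0 < L + 1 by rewrite ltr_wpDl.
  have dl0 : 0 < dl by rewrite !divr_gt0.
  apply/nbhs_ballP; exists dl => //= u [_ uv]; apply: eS.
  have h1 : f (v - u) <= dl * L by apply: fs => i; have := uv 0 i; rewrite /ball /= !mxE => /ltW.
  have h2 : dl * L <= e / 2 by rewrite /dl mulrAC ler_pdivrMr // ler_pM2l ?divr_gt0 // lerDl.
  have h3 := fD (v - u) u; rewrite subrK in h3.
  have h4 := fD (u - v) v; rewrite subrK -opprB fN in h4.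
  by rewrite -ball_normE /= ltr_norml; apply/andP; split; lra.
have cs : continuous s by apply: continuous_sum_norm => i; exact: coord_continuous.
pose h v := f v + `|1 - s v|.
have h0 v : 0 < h v.
  have [v0|v0] := eqVneq (f v) 0.
    by rewrite /h (f0 _ v0) fz add0r /s big1 ?subr0 ?normr1 // => i _; rewrite mxE normr0.
  by rewrite /h ltr_wpDr // lt_neqAle eq_sym v0 fge0.
have cV : continuous (fun v => (h v)^-1) by exact: continuous_inv_gap.
have cB : compact [set v : 'rV[R]_p.+1 | forall i, `[-1, 1]%classic (v ord0 i)].
  by apply: (@rV_compact R p.+1 (fun=> `[-1, 1]%classic)) => i; exact: segment_compact.
have := continuous_compact (continuous_subspaceT cV) cB => /compact_bounded [M [_ /(_ (M + 1))]].
rewrite ltrDl ltr01 => /(_ isT) hM.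
exists (`|M| + 1) => v i.
have vs : `|v 0 i| <= s v by rewrite /s (bigD1 i) //= lerDl sumr_ge0.
apply: (le_trans vs).
have s0 : 0 <= s v by exact: sumr_ge0.
have [sv|sv] := eqVneq (s v) 0; first by rewrite sv mulr_ge0 // addr_ge0.
have sv0 : 0 < s v by rewrite lt_neqAle eq_sym sv s0.
pose w := (s v)^-1 *: v.
have sw : s w = 1.
  rewrite /s /w; under eq_bigr do rewrite mxE normrM.
  by rewrite -mulr_sumr -/(s v) gtr0_norm ?invr_gt0 // mulVf.
have hw : h w = (s v)^-1 * f v.
  by rewrite /h sw subrr normr0 addr0 /w fZ gtr0_norm // invr_gt0.
have : (h w)^-1 <= M + 1.
  apply: le_trans (ler_norm _) _; apply: (hM ((h w)^-1)); exists w => // k /=.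
  rewrite in_itv /= -ler_norml -sw /s (bigD1 k) //= lerDl; exact: sumr_ge0.
have MM : M + 1 <= `|M| + 1 by rewrite lerD2r ler_norm.
move=> /le_trans /(_ MM); rewrite -[X in X <= _]div1r ler_pdivrMr // hw mulrCA ler_pdivlMl // mulr1.
by [].
Qed.

Lemma mx_norm_bounds_entries {R : realType} (n : nat) (N : 'M[R]_n -> R) (M : nat -> 'M[R]_n) :
  is_mx_norm N -> bounded_seq (fun j => N (M j)) ->
  exists c : R, forall j i k, `|M j i k| <= c.
Proof.
move=> [ND NZ N0] [b hb]; case: n N M ND NZ N0 hb => [|m] N M ND NZ N0 hb.
  by exists 0 => j [].
have [|||c hc] := @norm_dominates_entries R _ (fun v : 'rV[R]_(m + m * m.+1).+1 => N (vec_mx (v : 'rV_(m.+1 * m.+1)))).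
- by move=> u v; rewrite linearD; exact: ND.
- by move=> a v; rewrite linearZ; exact: NZ.
- move=> v /N0 v0; apply: (can_inj (@vec_mxK _ m.+1 m.+1)); by rewrite v0 linear0.
exists (`|c| * `|b|) => j i k.
rewrite -(mxvecE (M j) i k); apply: (le_trans (hc (mxvec (M j)) (mxvec_index i k))); rewrite mxvecK.
apply: (le_trans (ler_norm _)); rewrite normrM ler_wpM2l //; exact: le_trans (hb j) (ler_norm b).
Qed.

Section AdditionMeasurable.
Context {R : realType} {n : nat} {G : zmodType}.
Local Notation X := (RnG R n G).

Lemma RnG_add_continuous : continuous (fun p : X * X => p.1 + p.2).
Proof.
move=> [[x g] [y h]] /= S [[A B] /= [nA nB] sub].
have /nbhs_ballP [e /= e0 eA] := nA; have Bgh := nbhs_singleton nB.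
have e2 : 0 < e / 2 by rewrite divr_gt0.
have near (v : 'cV[R]_n) (k : discrete_group G) : nbhs ((v, k) : X) [set q : X | ball v (e / 2) q.1 /\ q.2 = k].
  exists (ball v (e / 2), [set k]) => /=; last by move=> [q1 q2] [/= ? ->].
  by split; [exact: nbhsx_ballx|exact/principal_filterP].
exists ([set q : X | ball x (e / 2) q.1 /\ q.2 = g], [set q : X | ball y (e / 2) q.1 /\ q.2 = h]) => /=.
  by split; exact: near.
move=> [[x' g'] [y' h']] /= [[[_ bx] /= ->] [[_ by'] /= ->]].
apply: sub; split => //=; apply: eA; split => // i j.
have := bx i j; have := by' i j; rewrite /ball /= !mxE => h1 h2.
rewrite (_ : x i j + y i j - (x' i j + y' i j) = (x i j - x' i j) + (y i j - y' i j)); last by ring.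
by apply: (le_lt_trans (ler_normD _ _)); lra.
Qed.

Lemma RnG_sum_measurable {d} {Omega : measurableType d} (f : nat -> Omega -> X) N :
  countable [set: G] -> (forall j, measurable_fun setT (f j : Omega -> borel X)) ->
  measurable_fun setT ((fun w => \sum_(j < N) f j w) : Omega -> borel X).
Proof.
move=> Gc mf; elim: N => [|N IH].
  rewrite (_ : (fun w => _) = cst (0 : borel X)); first exact: measurable_cst.
  by apply/funext => w; rewrite big_ord0.
have mp := countable_base_pair (countable_base_RnG n Gc) IH (mf N).
rewrite (_ : (fun w => _) = (fun p : borel (X * X)%type => (p.1 + p.2 : X) : borel X) \o
    (fun w => (\sum_(j < N) f j w, f N w) : borel (X * X)%type)).
  by apply: measurableT_comp => //; exact: continuous_borel RnG_add_continuous.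
by apply/funext => w; rewrite big_ord_recr.
Qed.

End AdditionMeasurable.

Section NullSets.
Context {d} {Omega : measurableType d} {R : realType} (P : probability Omega R).

Lemma null_set_ae (b : Omega -> bool) (F H : Omega -> \bar R) :
  measurable_fun setT (fun w => (b w)%:R : R) -> \int[P]_w (b w)%:R = 0 :> R ->
  (forall w, ~~ b w -> F w = H w) -> ae_eq P setT F H.
Proof.
move=> mb b0 FH; pose N := [set w | b w].
have mN : measurable N.
  have -> : N = (fun w => (b w)%:R : R) @^-1` [set 1].
    apply/seteqP; split=> w /=; rewrite /N /=; first by move=> ->.
    by case: (b w) => //= /eqP; rewrite eq_sym oner_eq0.
  by rewrite -[X in measurable X]setTI; exact: mb.
have PN : P N = 0%E.
  have E : (\int[P]_w ((b w)%:R)%:E = P N)%E.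
    rewrite (eq_integral (fun w => (\1_N w)%:E)); first by rewrite integral_indic // setIT.
    move=> w _; rewrite indicE; have -> // : (w \in N) = b w.
    by apply/idP/idP => [/set_mem //|bw]; exact: mem_set.
  have := b0; rewrite /Rintegral E => fP.
  by rewrite -[LHS]fineK ?fP //; exact: fin_num_measure.
exists N; split => // w /= K; rewrite /N /=; apply: contrapT => /negP nb.
by apply: K => _; rewrite FH.
Qed.

Lemma Rintegral_null (f g : Omega -> R) (b : Omega -> bool) : measurable_fun setT f ->
  measurable_fun setT g -> measurable_fun setT (fun w => (b w)%:R : R) ->
  \int[P]_w (b w)%:R = 0 :> R -> (forall w, ~~ b w -> f w = g w) -> \int[P]_w f w = \int[P]_w g w.
Proof.
move=> mf mg mb b0 fg; rewrite /Rintegral; congr fine.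
apply: ae_eq_integral => //; [exact/measurable_EFinP|exact/measurable_EFinP|].
by apply: (null_set_ae mb b0) => w /fg ->.
Qed.

Lemma Rintegrable_null (f g : Omega -> R) (b : Omega -> bool) : Rintegrable P f ->
  measurable_fun setT g -> measurable_fun setT (fun w => (b w)%:R : R) ->
  \int[P]_w (b w)%:R = 0 :> R -> (forall w, ~~ b w -> f w = g w) -> Rintegrable P g.
Proof.
move=> iF mg mb b0 fg; have mf := Rintegrable_measurable iF.
apply/integrableP; split; first exact/measurable_EFinP.
have /integrableP [_] := iF; rewrite (ae_eq_integral (fun w => `|(g w)%:E|)%E) //.
- by apply: measurableT_comp => //; exact/measurable_EFinP.
- by apply: measurableT_comp => //; exact/measurable_EFinP.
- by apply: (null_set_ae mb b0) => w /fg /= ->.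
Qed.

Lemma coherence_null (w p q : Omega -> R) (b : Omega -> bool) : weight P w -> measurable_fun setT p ->
  measurable_fun setT q -> measurable_fun setT (fun x => (b x)%:R : R) ->
  \int[P]_x (b x)%:R = 0 :> R -> (forall x, ~~ b x -> p x = q x) -> coherence P w p = coherence P w q.
Proof.
move=> ww mp mq mb b0 pq; rewrite /coherence.
have -> : wcos P w p = wcos P w q.
  apply: (Rintegral_null _ _ mb b0) => [||x /pq -> //].
    exact: Rintegrable_measurable (weighted_integrable_cos ww mp).
  exact: Rintegrable_measurable (weighted_integrable_cos ww mq).
have -> // : wsin P w p = wsin P w q.
apply: (Rintegral_null _ _ mb b0) => [||x /pq -> //].
  exact: Rintegrable_measurable (weighted_integrable_sin ww mp).
exact: Rintegrable_measurable (weighted_integrable_sin ww mq).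
Qed.

End NullSets.

(** * The components in the Euclidean space *)

Section LinearForms.
Context {d} {Omega : measurableType d} {R : realType} (P : probability Omega R) {n : nat} {G : zmodType}.
Local Notation X := (RnG R n G).

Lemma dotmulE (x y : 'cV[R]_n) : dotmul x y = (x^T *m y) 0 0.
Proof. by rewrite mxE; apply: eq_bigr => i _; rewrite mxE. Qed.

Lemma dotmulDr (x y y' : 'cV[R]_n) : dotmul x (y + y') = dotmul x y + dotmul x y'.
Proof. by rewrite !dotmulE mulmxDr mxE. Qed.

Lemma dotmul_trmx (M : 'M[R]_n) (x y : 'cV[R]_n) : dotmul (M^T *m x) y = dotmul x (M *m y).
Proof. by rewrite !dotmulE trmx_mul trmxK mulmxA. Qed.

Lemma dotmulZl (c : R) (x y : 'cV[R]_n) : dotmul (c *: x) y = c * dotmul x y.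
Proof. by rewrite !dotmulE linearZ /= -scalemxAl mxE. Qed.

Lemma dotmulBr (x y y' : 'cV[R]_n) : dotmul x (y - y') = dotmul x y - dotmul x y'.
Proof. by rewrite !dotmulE mulmxBr !mxE. Qed.

Lemma dotmul_continuous (T : topologicalType) (u : 'cV[R]_n) (f : T -> 'cV[R]_n) :
  (forall i, continuous (fun t => f t i 0)) -> continuous (fun t => dotmul u (f t)).
Proof.
move=> cf.
have all (r : seq 'I_n) : continuous (fun t => \sum_(i <- r) u i 0 * f t i 0).
  elim: r => [|i r IH] t.
    rewrite (_ : (fun t => _) = (fun=> 0)); first exact: cvg_cst.
    by apply/funext => z; rewrite big_nil.
  rewrite (_ : (fun t => _) = (fun t => u i 0 * f t i 0 + \sum_(i <- r) u i 0 * f t i 0)).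
    by apply: cvgD; [apply: cvgM; [exact: cvg_cst|exact: cf]|exact: IH].
  by apply/funext => z; rewrite big_cons.
exact: all.
Qed.

Lemma RnG_coord_continuous i : continuous (fun t : X => t.1 i 0).
Proof.
move=> t; apply: (continuous_comp (f := fst) (g := fun v : 'cV[R]_n => v i 0)); first exact: cvg_fst.
exact: coord_continuous.
Qed.

Lemma image_coord_continuous (a : X -> X) i : continuous a -> continuous (fun t : X => (a t).1 i 0).
Proof.
move=> ca t; apply: (continuous_comp (f := a) (g := fun t : X => t.1 i 0)); first exact: ca.
exact: RnG_coord_continuous.
Qed.

Lemma snd_neq_measurable (xi : Omega -> X) (g : G) : measurable_fun setT (xi : Omega -> borel X) ->
  measurable_fun setT (fun w => ((xi w).2 != g :> G)%:R : R).
Proof.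
move=> mxi.
have ms : measurable_fun setT (snd : borel X -> borel (discrete_group G)).
  by apply: continuous_borel => t; exact: cvg_snd.
exact: (discrete_compose (fun x : G => (x != g)%:R) (measurableT_comp ms mxi)).
Qed.

(** The hypotheses of the study of zero-free transforms: all exponential moments, their growth, and
    the absence of zeros. *)
Definition tame (Y : Omega -> R) : Prop :=
  [/\ forall t, Rintegrable P (fun w => expR (t * Y w)),
    exists K, forall t, \int[P]_w expR (t * Y w) <= expR (K * (1 + t ^+ 2)) &
    forall t s, 0 < coherence P (fun w => expR (t * Y w)) (fun w => s * Y w)].

(** As the component of [xi j] in [G] is almost surely [g j], block triangularity gives
    [(beta j x).1 = M j *m (alpha j x).1] up to a constant, which coherences ignore. The bound on
    the entries of [M j] becomes one on the vectors [c j]. *)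
Lemma linear_form_tame (alpha beta : nat -> X -> X) (xi : nat -> {RV P >-> borel X})
    (lam1 lam2 : probability (borel X) R) (g : nat -> G) (C : R) (v : 'cV[R]_n) j :
  countable [set: G] -> (forall j, top_automorphism (alpha j)) -> (forall j, top_automorphism (beta j)) ->
  mutually_independent xi ->
  product_limit P (fun N w => \sum_(j < N) alpha j (xi j w)) (fun N w => \sum_(j < N) beta j (xi j w)) lam1 lam2 ->
  (forall j, \int[P]_w ((xi j w).2 != g j :> G)%:R = 0 :> R) ->
  (forall j i k, `|(restr_mx (beta j) *m invmx (restr_mx (alpha j))) i k| <= C) ->
  tame (fun w => dotmul v (beta j (xi j w)).1).
Proof.
move=> Gc aA bA xi_indep S12 gP CP.
have ca i : continuous (alpha i) by have [_ + _] := aA i.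
have cb i : continuous (beta i) by have [_ + _] := bA i.
have aD i : {morph alpha i : x y / x + y} by have [+ _ _] := aA i.
have bD i : {morph beta i : x y / x + y} by have [+ _ _] := bA i.
pose xv i (t : borel X) := (alpha i t).1.
pose y i (t : borel X) := dotmul v (beta i t).1.
pose S1 N w := \sum_(j < N) alpha j (xi j w); pose S2 N w := \sum_(j < N) beta j (xi j w).
have mxv i k : measurable_fun setT (fun t => xv i t k 0).
  exact: (@continuous_borel_real R X (fun t => (alpha i t).1 k 0) (image_coord_continuous (ca i))).
have my i : measurable_fun setT (y i).
  apply: (@continuous_borel_real R X (fun t => dotmul v (beta i t).1)).
  by apply: dotmul_continuous => k; exact: image_coord_continuous.
have mS1 N : measurable_fun setT (S1 N : Omega -> borel X).
  apply: (RnG_sum_measurable (f := fun j w => alpha j (xi j w))) => // i.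
  by apply: (measurableT_comp (f := alpha i : borel X -> borel X)) => //; exact: continuous_borel.
have mS2 N : measurable_fun setT (S2 N : Omega -> borel X).
  apply: (RnG_sum_measurable (f := fun j w => beta j (xi j w))) => // i.
  by apply: (measurableT_comp (f := beta i : borel X -> borel X)) => //; exact: continuous_borel.
have fst_sum (f : nat -> Omega -> X) u N w :
    dotmul u (\sum_(j < N) f j w).1 = \sum_(0 <= j < N) dotmul u (f j w).1.
  elim: N => [|N IH]; last by rewrite big_ord_recr big_nat_recr //= -IH -dotmulDr.
  by rewrite big_ord0 big_geq // /dotmul big1 // => i _; rewrite mxE mulr0.
have S1sum N w u : dotmul u (S1 N w).1 = \sum_(0 <= j < N) dotmul u (xv j (xi j w)).
  exact: (fst_sum (fun j w => alpha j (xi j w))).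
have S2sum N w : dotmul v (S2 N w).1 = \sum_(0 <= j < N) y j (xi j w).
  exact: (fst_sum (fun j w => beta j (xi j w))).
have cchi i : continuous (fun t : X => t.1 i 0) by exact: RnG_coord_continuous.
have cpsi : continuous (fun t : X => dotmul v t.1) by exact: dotmul_continuous.
pose M i := restr_mx (beta i) *m invmx (restr_mx (alpha i)).
pose c i : 'cV[R]_n := (M i)^T *m v.
pose K := `|C| * (\sum_i `|v i 0|) + 1.
have K0 : 0 < K by rewrite ltr_wpDl // mulr_ge0 // sumr_ge0.
have c_le i : box K (c i).
  move=> k; rewrite /c mxE; apply: (le_trans (ler_norm_sum _ _ _)).
  apply: (@le_trans _ _ (`|C| * (\sum_i `|v i 0|))); last by rewrite lerDl.
  rewrite mulr_sumr; apply: ler_sum => l _; rewrite mxE normrM ler_wpM2r //.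
  exact: le_trans (CP i l k) (ler_norm C).
have lin i (w : Omega -> R) u s : weight P w ->
    coherence P w (fun t => dotmul u (xv i (xi i t)) + s * y i (xi i t)) =
    coherence P w (fun t => dotmul (u + s *: c i) (xv i (xi i t))).
  move=> ww; have [Au _] := automorphism_parts (aA i).
  pose k0 := dotmul v ((beta i (0, g i)).1 - M i *m (alpha i (0, g i)).1).
  have mX u' : measurable_fun setT (fun t => dotmul u' (xv i (xi i t))).
    by apply: dotmul_measurable => l; apply: (measurableT_comp (f := fun t : borel X => xv i t l 0)).
  have mYi : measurable_fun setT (fun t => y i (xi i t)) by exact: measurableT_comp.
  transitivity (coherence P w (fun t => dotmul (u + s *: c i) (xv i (xi i t)) + s * k0)); last first.
    by rewrite coherence_shift.
  apply: (coherence_null ww _ _ (snd_neq_measurable (g i) _) (gP i)) => [||//|t].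
  - by apply: measurable_funD => //; exact: measurable_funM.
  - exact: measurable_funD.
  - rewrite negbK => /eqP gt.
    have E : y i (xi i t) = dotmul (c i) (xv i (xi i t)) + k0.
      rewrite /y /xv /c /k0 [xi i t]surjective_pairing gt (endoE (bD i) (cb i)) (endoE (aD i) (ca i)) /=.
      by rewrite dotmul_trmx mulmxDr /M mulmxA mulmxKV // dotmulBr !dotmulDr; ring.
    by rewrite E dotmulDl dotmulZl mulrDr addrA.
split.
- by move=> t; exact: (form_mgf_finite xi_indep mxv my mS1 mS2 S12 cchi cpsi S1sum S2sum K0 c_le lin j t).
- exact: (form_growth xi_indep mxv my mS1 mS2 S12 cchi cpsi S1sum S2sum K0 c_le lin j).
- by move=> t s; exact: (form_positive xi_indep mxv my mS1 mS2 S12 cchi cpsi S1sum S2sum K0 c_le lin j t s).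
Qed.

End LinearForms.

(** * From linear forms to Gaussian laws *)

Section GaussianLaws.
Context {d} {Omega : measurableType d} {R : realType} (P : probability Omega R).
Local Open Scope complex_scope.

(** Only the value of the characteristic function at 1 is recorded, as [Z] will range over all
    linear forms. *)
Definition gaussian_transform (Z : Omega -> R) : Prop :=
  let m := \int[P]_w Z w in let v := \int[P]_w (Z w ^+ 2) - m ^+ 2 in
  [/\ Rintegrable P Z, Rintegrable P (fun w => Z w ^+ 2), 0 <= v &
   (\int[P]_w cos (Z w)) +i* (\int[P]_w sin (Z w)) = cexp ('i * m%:C - (2^-1 * v)%:C)].

Lemma tame_gaussian (Y : Omega -> R) : measurable_fun setT Y -> tame P Y -> gaussian_transform Y.
Proof.
move=> mY [mgfY [C growth] pos].
have [i1 i2] := square_integrable mY mgfY.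
rewrite /gaussian_transform; set m := \int[P]_w Y w; split => //.
- have : 0 <= \int[P]_w ((Y w - m) ^+ 2) by apply: Rintegral_ge0 => w _; exact: sqr_ge0.
  have i3 : Rintegrable P (fun w => 2 * m * Y w) by exact: RintegrableZ.
  have i4 : Rintegrable P (fun=> m ^+ 2) by exact: finite_measure_integrable_cst.
  have -> : \int[P]_w ((Y w - m) ^+ 2) = \int[P]_w (Y w ^+ 2 - (2 * m * Y w - m ^+ 2)).
    by apply: eq_Rintegral => w _; ring.
  rewrite RintegralB //; last exact: RintegrableB.
  rewrite RintegralB // RintegralZl // Rintegral_probability_cst -/m.
  by rewrite (_ : 2 * m * m - m ^+ 2 = m ^+ 2) //; ring.
- have := gaussian_moments mY mgfY growth pos 1 (erefl m) erefl.
  have -> : \int[P]_w cos (1 * Y w) = \int[P]_w cos (Y w).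
    by apply: eq_Rintegral => w _; rewrite mul1r.
  have -> : \int[P]_w sin (1 * Y w) = \int[P]_w sin (Y w).
    by apply: eq_Rintegral => w _; rewrite mul1r.
  by rewrite expr1n !mul1r.
Qed.

Lemma gaussian_shift (Y Z : Omega -> R) (k : R) (b : Omega -> bool) :
  measurable_fun setT Y -> measurable_fun setT Z -> measurable_fun setT (fun w => (b w)%:R : R) ->
  \int[P]_w (b w)%:R = 0 :> R -> (forall w, ~~ b w -> Y w = Z w + k) ->
  gaussian_transform Y -> gaussian_transform Z.
Proof.
move=> mY mZ mb b0 YZ [i1 i2 v0 E].
have ZY w : ~~ b w -> Y w - k = Z w by move=> /YZ ->; rewrite addrK.
have ik : Rintegrable P (fun=> k) by exact: finite_measure_integrable_cst.
have ik2 : Rintegrable P (fun=> k ^+ 2) by exact: finite_measure_integrable_cst.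
have mYk : measurable_fun setT (fun w => Y w - k) by exact: measurable_funB.
have mX (f : R -> R) : continuous f -> forall U : Omega -> R, measurable_fun setT U ->
    measurable_fun setT (fun w => f (U w)).
  by move=> cf U mU; apply: measurableT_comp => //; exact: continuous_measurable_fun.
have csq : continuous (fun x : R => x ^+ 2) by exact: exprn_continuous.
have null (f : R -> R) : continuous f -> \int[P]_w f (Z w) = \int[P]_w f (Y w - k).
  move=> cf; apply/esym/(Rintegral_null _ _ mb b0) => [||w /ZY -> //]; exact: mX.
have iY2 : Rintegrable P (fun w => (Y w - k) ^+ 2).
  rewrite (_ : (fun w => _) = (fun w => Y w ^+ 2 - (2 * k * Y w - k ^+ 2))); last first.
    by apply/funext => w; ring.
  by apply: RintegrableB => //; apply: RintegrableB => //; exact: RintegrableZ.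
have jZ : Rintegrable P Z by apply: (Rintegrable_null (RintegrableB i1 ik) mZ mb b0).
have jZ2 : Rintegrable P (fun w => Z w ^+ 2).
  by apply: (Rintegrable_null iY2 _ mb b0) => [|w /ZY -> //]; exact: (mX (fun x => x ^+ 2)).
have EZ : \int[P]_w Z w = \int[P]_w Y w - k.
  rewrite -[X in _ - X](Rintegral_probability_cst P) -RintegralB //.
  by apply: (null (fun x => x)) => x; exact: cvg_id.
have EZ2 : \int[P]_w (Z w ^+ 2) = \int[P]_w (Y w ^+ 2) - (2 * k * (\int[P]_w Y w) - k ^+ 2).
  rewrite (null (fun x => x ^+ 2)) // -(Rintegral_probability_cst P (k ^+ 2)) -RintegralZl //.
  rewrite -RintegralB //; last exact: RintegrableZ.
  rewrite -RintegralB //; last by apply: RintegrableB => //; exact: RintegrableZ.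
  by apply: eq_Rintegral => w _; ring.
have vE : \int[P]_w (Z w ^+ 2) - (\int[P]_w Z w) ^+ 2 = \int[P]_w (Y w ^+ 2) - (\int[P]_w Y w) ^+ 2.
  by rewrite EZ2 EZ; ring.
rewrite /gaussian_transform vE; split => //.
have ic : Rintegrable P (fun w => cos (Y w)).
  apply: bounded_Rintegrable; first by apply: mX => //; exact: continuous_cos.
  by exists 1 => w; rewrite ler_norml cos_geN1 cos_le1.
have is' : Rintegrable P (fun w => sin (Y w)).
  apply: bounded_Rintegrable; first by apply: mX => //; exact: continuous_sin.
  by exists 1 => w; rewrite ler_norml sin_geN1 sin_le1.
have cE : \int[P]_w cos (Z w) = cos k * (\int[P]_w cos (Y w)) + sin k * (\int[P]_w sin (Y w)).
  rewrite (null cos); last exact: continuous_cos.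
  rewrite -!RintegralZl // -RintegralD //; [|exact: RintegrableZ..].
  by apply: eq_Rintegral => w _; rewrite cosB; ring.
have sE : \int[P]_w sin (Z w) = cos k * (\int[P]_w sin (Y w)) - sin k * (\int[P]_w cos (Y w)).
  rewrite (null sin); last exact: continuous_sin.
  rewrite -!RintegralZl // -RintegralB //; [|exact: RintegrableZ..].
  by apply: eq_Rintegral => w _; rewrite sinB; ring.
set v := (2^-1 * _)%:C in E *.
have -> : 'i * (\int[P]_w Z w)%:C - v = 'i * (- k)%:C + ('i * (\int[P]_w Y w)%:C - v).
  rewrite EZ addrA -mulrDr; congr (_ * _ - _).
  by apply/eqP; rewrite eq_complex /=; apply/andP; split; apply/eqP; ring.
have r0 : complex.Re ('i * (- k)%:C) = 0 by rewrite /=; ring.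
have i0 : complex.Im ('i * (- k)%:C) = - k by rewrite /=; ring.
rewrite cexpD -E cE sE cexpE r0 i0 expR0 cosN sinN !mul1r; apply/eqP; rewrite eq_complex ReM ImM /=.
by apply/andP; split; apply/eqP; ring.
Qed.

End GaussianLaws.

Lemma convolution_dirac {R : realType} {n : nat} {G : zmodType} (gamma : probability (borel 'cV[R]_n) R)
    (x : RnG R n G) (E : set (borel (RnG R n G))) : measurable E ->
  convolution (embed_Rn gamma) (\d_(x : borel (RnG R n G))) E =
  gamma [set v | E (((v, 0) : RnG R n G) + x)].
Proof.
move=> mE; pose X := RnG R n G.
have ce : continuous (fun v : 'cV[R]_n => (v, 0) : X).
  by move=> v S [[A B] /= [nA nB] s]; apply: filterS nA => u Au; apply: s; split => //=; exact: nbhs_singleton nB.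
have me : measurable_fun setT ((fun v => (v, 0)) : borel 'cV[R]_n -> borel X) by exact: continuous_borel.
have ct : continuous (fun p : X => p + x).
  move=> p; have cp : continuous (fun p : X => (p, x) : X * X).
    by move=> q S [[A B] /= [nA nB] s]; apply: filterS nA => u Au; apply: s; split => //=; exact: nbhs_singleton nB.
  exact: (continuous_comp (cp p) (@RnG_add_continuous R n G (p, x))).
have mt : measurable_fun setT ((fun p => p + x) : borel X -> borel X) by exact: continuous_borel.
have mEx : measurable ((fun p : borel X => (p : X) + x) @^-1` E : set (borel X)).
  by rewrite -[X in measurable X]setTI; exact: mt.
rewrite /convolution /pushforward /product_measure1.
transitivity (\int[embed_Rn gamma]_p (\1_((fun p : borel X => (p : X) + x) @^-1` E) p)%:E)%E.
  apply: (congr1 (fun f => \int[embed_Rn gamma]_p f p)%E); apply/funext => p; rewrite /= diracE indicE; congr ((nat_of_bool _)%:R%:E).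
  by apply/idP/idP => /set_mem h; apply: mem_set; [exact: (set_mem h)|apply: mem_set; exact: h].
rewrite integral_indic //.
by rewrite setIT.
Qed.

(** Through the inverse transpose of the matrix of [a], every linear form in the R^n-component of
    [xi] is, up to a constant, one in that of [a (xi w)]. Each has a Gaussian transform with its own
    mean and variance, which are those prescribed by the mean vector [m] and the covariance matrix
    [C]. *)
Lemma gaussian_distribution {d} {Omega : measurableType d} {R : realType} (P : probability Omega R)
    {n : nat} {G : zmodType} (a : RnG R n G -> RnG R n G) (xi : {RV P >-> borel (RnG R n G)}) (g : G) :
  top_automorphism a -> \int[P]_w ((xi w).2 != g :> G)%:R = 0 :> R ->
  (forall v, tame P (fun w => dotmul v (a (xi w)).1)) ->
  exists (gamma : probability (borel 'cV[R]_n) R) (x : RnG R n G), is_gaussian gamma /\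
    forall E : set (borel (RnG R n G)), measurable E ->
      distribution P xi E = convolution (embed_Rn gamma) (\d_(x : borel (RnG R n G))) E.
Proof.
move=> aut g0 ta; have [aD ca _] := aut; have [Bu _] := automorphism_parts aut.
pose X := RnG R n G.
have mxi : measurable_fun setT (xi : Omega -> borel X) by [].
have mb := snd_neq_measurable g mxi.
have cf : continuous (fst : X -> 'cV[R]_n) by move=> t; exact: cvg_fst.
have mf : measurable_fun setT ((fun w => (xi w).1) : Omega -> borel 'cV[R]_n).
  by apply: (measurableT_comp (f := fst : borel X -> borel 'cV[R]_n)) => //; exact: continuous_borel.
have mco i : measurable_fun setT (fun w => (xi w).1 i 0).
  apply: (measurableT_comp (f := fun t : borel X => t.1 i 0)) => //.
  exact: (@continuous_borel_real R X (fun t => t.1 i 0) (@RnG_coord_continuous R n G i)).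
have gz t : gaussian_transform P (fun w => dotmul t (xi w).1).
  pose v := (invmx (restr_mx a))^T *m t.
  have mYv : measurable_fun setT (fun w => dotmul v (a (xi w)).1).
    apply: dotmul_measurable => i; apply: (measurableT_comp (f := fun t : borel X => (a t).1 i 0)) => //.
    exact: (@continuous_borel_real R X (fun t => (a t).1 i 0) (image_coord_continuous ca)).
  apply: (gaussian_shift (k := dotmul v (a (0, g)).1) mYv _ mb g0 _ (tame_gaussian mYv (ta v))).
    exact: dotmul_measurable.
  move=> w; rewrite negbK => /eqP gw.
  rewrite {1}[xi w]surjective_pairing gw (endoE aD ca) /= dotmulDr; congr (_ + _).
  by rewrite /v dotmul_trmx mulmxA mulVmx // mul1mx.
pose co i w := (xi w).1 i 0.
have coE i w : dotmul (delta_mx i 0) (xi w).1 = co i w.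
  rewrite /dotmul (bigD1 i) //= mxE !eqxx mul1r big1 ?addr0 // => j ji.
  by rewrite mxE (negbTE ji) mul0r.
have ico i : Rintegrable P (co i) /\ Rintegrable P (fun w => co i w ^+ 2).
  have [h1 h2 _ _] := gz (delta_mx i 0); split.
    by rewrite (_ : co i = (fun w => dotmul (delta_mx i 0) (xi w).1)) //; apply/funext => w; rewrite coE.
  rewrite (_ : (fun w => co i w ^+ 2) = (fun w => dotmul (delta_mx i 0) (xi w).1 ^+ 2)) //.
  by apply/funext => w; rewrite coE.
have ico2 i k : Rintegrable P (fun w => co i w * co k w).
  apply: (@Rintegrable_le _ _ _ _ _ (fun w => co i w ^+ 2 + co k w ^+ 2)).
  - exact: (measurable_funM (mco i) (mco k)).
  - move=> w; rewrite normrM; have := sqr_ge0 (`|co i w| - `|co k w|); rewrite sqrrB !real_normK ?num_real //.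
    have := sqr_ge0 (co i w); have := sqr_ge0 (co k w); lra.
  - by apply: RintegrableD; exact: (ico _).2.
pose m : 'cV[R]_n := \col_i \int[P]_w co i w.
pose C : 'M[R]_n := \matrix_(i, k) (\int[P]_w (co i w * co k w) - m i 0 * m k 0).
have mE t : \int[P]_w dotmul t (xi w).1 = dotmul m t.
  rewrite /dotmul Rintegral_sum; last by move=> i; apply: RintegrableZ; exact: (ico i).1.
  by apply: eq_bigr => i _; rewrite RintegralZl //; [rewrite mxE mulrC|exact: (ico i).1].
have CE t : dotmul (C *m t) t = \int[P]_w (dotmul t (xi w).1 ^+ 2) - (dotmul m t) ^+ 2.
  have -> : \int[P]_w (dotmul t (xi w).1 ^+ 2) = \sum_i \sum_k t i 0 * t k 0 * \int[P]_w (co i w * co k w).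
    transitivity (\int[P]_w (\sum_i \sum_k t i 0 * t k 0 * (co i w * co k w))).
      apply: eq_Rintegral => w _; rewrite expr2 /dotmul mulr_suml; apply: eq_bigr => i _.
      by rewrite mulr_sumr; apply: eq_bigr => k _; rewrite mulrACA.
    rewrite Rintegral_sum; last by move=> i; apply: Rintegrable_sum => k; exact: RintegrableZ.
    apply: eq_bigr => i _; rewrite Rintegral_sum; last by move=> k; exact: RintegrableZ.
    by apply: eq_bigr => k _; rewrite RintegralZl.
  have -> : (dotmul m t) ^+ 2 = \sum_i \sum_k t i 0 * t k 0 * (m i 0 * m k 0).
    rewrite expr2 {1 2}/dotmul mulr_suml; apply: eq_bigr => i _; rewrite mulr_sumr; apply: eq_bigr => k _; ring.
  rewrite -sumrB {1}/dotmul; apply: eq_bigr => i _; rewrite mxE mulr_suml -sumrB; apply: eq_bigr => k _.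
  by rewrite mxE; ring.
pose F : {mfun Omega >-> borel 'cV[R]_n} := HB.pack ((fun w => (xi w).1) : Omega -> borel 'cV[R]_n)
  (isMeasurableFun.Build _ _ _ _ _ mf).
(* The mean stays in [gamma]; the shift carries only the component in [G]. *)
exists (distribution P F), (0, g); split.
- exists m, C; split.
  + by apply/matrixP => i k; rewrite !mxE mulrC; congr (_ - _); apply: eq_Rintegral => w _; rewrite mulrC.
  + by move=> t; rewrite CE -mE; have [_ _ + _] := gz t.
  + move=> t; have [_ _ _ E] := gz t.
    rewrite CE -mE /= -E /char_fun.
    have mdot : measurable_fun setT (fun x : borel 'cV[R]_n => dotmul t x).
      apply: (@continuous_borel_real R 'cV[R]_n (fun x => dotmul t x)).
      by apply: (@dotmul_continuous R n 'cV[R]_n t id) => i; exact: coord_continuous.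
    have tr (f : R -> R) : continuous f -> (forall x, `|f x| <= 1) ->
        \int[distribution P F]_x f (dotmul t x) = \int[P]_w f (dotmul t (xi w).1).
      move=> cff f1.
      have mff : measurable_fun setT (fun x : borel 'cV[R]_n => f (dotmul t x)).
        by apply: measurableT_comp => //; exact: continuous_measurable_fun.
      rewrite /Rintegral integral_distribution //; first exact/measurable_EFinP.
      apply: bounded_Rintegrable; first exact: (measurableT_comp mff mf).
      by exists 1 => w; exact: f1.
    congr (_ +i* _)%C.
      by apply: (tr cos); [exact: continuous_cos|move=> x; rewrite ler_norml cos_geN1 cos_le1].
    by apply: (tr sin); [exact: continuous_sin|move=> x; rewrite ler_norml sin_geN1 sin_le1].
- move=> E mE'; rewrite convolution_dirac //.
  have mE2 : measurable [set w | E (((xi w).1, 0) + (0, g) : X)].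
    have ct : continuous (fun t : X => (t.1, g) : X).
      have ce : continuous (fun v : 'cV[R]_n => (v, g) : X).
        by move=> v S [[A B] /= [nA nB] s]; apply: filterS nA => u Au; apply: s; split => //=; exact: nbhs_singleton nB.
      by move=> t; exact: (continuous_comp (cf t) (ce t.1)).
    have mt : measurable_fun setT ((fun w => ((xi w).1, g) : X) : Omega -> borel X).
      by apply: (measurableT_comp (f := (fun t : X => (t.1, g) : X) : borel X -> borel X)) => //; exact: continuous_borel.
    rewrite (_ : [set w | _] = (fun w => ((xi w).1, g) : X) @^-1` E).
      by rewrite -[X in measurable X]setTI; exact: mt.
    by apply/seteqP; split=> w /=; rewrite /GRing.add /= /add_pair /= addr0 add0r.
  have mE1 : measurable (xi @^-1` E) by rewrite -[X in measurable X]setTI; exact: mxi.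
  transitivity (P [set w | E (((xi w).1, 0) + (0, g) : X)]) => //.
  rewrite /distribution /pushforward /=.
  have i1 := integral_indic P measurableT mE1; have i2 := integral_indic P measurableT mE2.
  rewrite !setIT in i1 i2; rewrite -i1 -i2.
  apply: ae_eq_integral => //; [by apply/measurable_EFinP; exact: measurable_indic..|].
  apply: (null_set_ae mb g0) => w; rewrite negbK => /eqP gw; rewrite !indicE; congr ((nat_of_bool _)%:R%:E).
  suff H : ((xi w).1, 0) + (0, g) = xi w :> X by apply/idP/idP => /set_mem h; apply/mem_set; move: h; rewrite /= H.
  by rewrite [RHS]surjective_pairing gw /GRing.add /= /add_pair /= addr0 add0r.
Qed.

Section Components.
Context {d} {Omega : measurableType d} {R : realType} (P : probability Omega R) {n : nat} {G : zmodType}.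
Local Notation X := (RnG R n G).

Lemma partial_sum_measurable (alpha : nat -> X -> X) (xi : nat -> {RV P >-> borel X}) N :
  countable [set: G] -> (forall j, top_automorphism (alpha j)) ->
  measurable_fun setT ((fun w => \sum_(j < N) alpha j (xi j w)) : Omega -> borel X).
Proof.
move=> Gc aA; apply: (RnG_sum_measurable (f := fun j w => alpha j (xi j w))) => // j.
have [_ ca _] := aA j.
by apply: (measurableT_comp (f := alpha j : borel X -> borel X)) => //; exact: continuous_borel.
Qed.

Lemma partial_sum_snd (alpha : nat -> X -> X) (x : nat -> X) N :
  (forall j, top_automorphism (alpha j)) ->
  (\sum_(j < N) alpha j (x j)).2 = \sum_(0 <= j < N) (alpha j (0, (x j).2)).2 :> G.
Proof.
move=> aA; elim: N => [|N IH]; first by rewrite big_ord0 big_geq.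
rewrite big_ord_recr big_nat_recr //= -IH; have [aD ca _] := aA N.
by rewrite [in alpha N (x N)](surjective_pairing (x N)) (endoE aD ca).
Qed.

Lemma group_component_constant (alpha beta : nat -> X -> X) (xi : nat -> {RV P >-> borel X}) j :
  countable [set: G] -> torsion_free G ->
  (forall j, top_automorphism (alpha j)) -> (forall j, top_automorphism (beta j)) ->
  mutually_independent xi ->
  independent_limits P (fun N w => \sum_(j < N) alpha j (xi j w)) (fun N w => \sum_(j < N) beta j (xi j w)) ->
  exists g : G, \int[P]_w ((xi j w).2 != g :> G)%:R = 0 :> R.
Proof.
move=> Gc Gt aA bA ind lim.
have mS1 N := partial_sum_measurable xi N Gc aA; have mS2 N := partial_sum_measurable xi N Gc bA.
have [lam1 [lam2 S12]] := independent_limits_product (countable_base_RnG n Gc) mS1 mS2 lim.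
pose snd_part (f : nat -> X -> X) i (g : G) : G := (f i (0, g)).2.
have inverses (f : nat -> X -> X) : (forall j, top_automorphism (f j)) ->
    exists f' : nat -> G -> G, forall i, cancel (snd_part f i) (f' i) /\ cancel (f' i) (snd_part f i).
  move=> fA; have H i : exists f' : G -> G, cancel (snd_part f i) f' /\ cancel f' (snd_part f i).
    by have [_ [k [k1 k2 _]]] := automorphism_parts (fA i); exists k.
  by exists (fun i => projT1 (cid (H i))) => i; exact: projT2 (cid (H i)).
have [a' aK] := inverses _ aA; have [b' bK] := inverses _ bA.
have sndD f i x y : top_automorphism (f i) -> snd_part f i (x + y) = snd_part f i x + snd_part f i y.
  by move=> [fD _ _]; exact: endo_sndD.
have cz : continuous (snd : X -> discrete_group G) by move=> x; exact: cvg_snd.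
exact: (group_components_constant Gc Gt ind cz (fun i x y => sndD _ i x y (aA i)) (fun i x y => sndD _ i x y (bA i))
  (fun i => (aK i).1) (fun i => (aK i).2) (fun i => (bK i).1) (fun i => (bK i).2) mS1 mS2 S12
  (fun N w => partial_sum_snd (fun j => xi j w) N aA) (fun N w => partial_sum_snd (fun j => xi j w) N bA) j).
Qed.

End Components.

Theorem theorem3p1 (R : realType) (n : nat) (G : zmodType)
    (G_countable : countable [set: G]) (G_torsion_free : torsion_free G)
    (alpha beta : nat -> RnG R n G -> RnG R n G)
    (alpha_aut : forall j, top_automorphism (alpha j))
    (beta_aut : forall j, top_automorphism (beta j))
    (A B : nat -> 'M[R]_n)
    (A_def : forall j, A j = restr_mx (alpha j))
    (B_def : forall j, B j = restr_mx (beta j))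
    (nrm : 'M[R]_n -> R) (nrm_norm : is_mx_norm nrm)
    (bounded_a : bounded_seq (fun j => nrm (A j *m invmx (B j))) \/
                 bounded_seq (fun j => nrm (B j *m invmx (A j))))
    (bounded_b : bounded_seq (fun j =>
                   nrm (A j *m invmx (B j)) * nrm (B j *m invmx (A j))))
    (d : measure_display) (Omega : measurableType d) (P : probability Omega R)
    (xi : nat -> {RV P >-> borel (RnG R n G)})
    (xi_indep : mutually_independent xi)
    (L1_cvg : cvg_in_law P (fun N w => \sum_(j < N) alpha j (xi j w)))
    (L2_cvg : cvg_in_law P (fun N w => \sum_(j < N) beta j (xi j w)))
    (L1_L2_indep : independent_limits P
                     (fun N w => \sum_(j < N) alpha j (xi j w))
                     (fun N w => \sum_(j < N) beta j (xi j w))) :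
  forall j, exists (gamma : probability (borel 'cV[R]_n) R) (x : RnG R n G),
    is_gaussian gamma /\
    forall E : set (borel (RnG R n G)), measurable E ->
      distribution P (xi j) E = convolution (embed_Rn gamma) (\d_(x : borel (RnG R n G))) E.
Proof.
move=> j.
have mS1 N := partial_sum_measurable xi N G_countable alpha_aut.
have mS2 N := partial_sum_measurable xi N G_countable beta_aut.
have [lam1 [lam2 S12]] := independent_limits_product (countable_base_RnG n G_countable) mS1 mS2 L1_L2_indep.
have gE i := group_component_constant i G_countable G_torsion_free alpha_aut beta_aut xi_indep L1_L2_indep.
pose g i := projT1 (cid (gE i)).
have gP i : \int[P]_w ((xi i w).2 != g i :> G)%:R = 0 :> R := projT2 (cid (gE i)).
case: bounded_a => /(mx_norm_bounds_entries nrm_norm) [C CP].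
(* Here [A j *m invmx (B j)] is bounded, so that the forms in [alpha] are expressed through those in
   [beta]: L1 and L2 exchange roles. *)
- apply: (gaussian_distribution (alpha_aut j) (gP j)) => v.
  apply: (linear_form_tame v j G_countable beta_aut alpha_aut xi_indep (product_limit_sym S12) gP (C := C)).
  by move=> i k l; rewrite -A_def -B_def.
- apply: (gaussian_distribution (beta_aut j) (gP j)) => v.
  apply: (linear_form_tame v j G_countable alpha_aut beta_aut xi_indep S12 gP (C := C)).
  by move=> i k l; rewrite -A_def -B_def.
Qed.
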